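(* Let $1\le i\le n$ and let $\lambda=(\lambda_1,\ldots,\lambda_n)\in\mathbb{Z}^n$ be a $\mathfrak{k}_n$-dominant integral weight. Put $$I_{P_{i,n}}(\lambda)=\mathrm{Ind}_{P_{i,n}(\mathbb{R})}^{\mathrm{Sp}_{2n}(\mathbb{R})}\left(\mathrm{sgn}^{\lambda_n}|\cdot|^{\lambda_n-n+(i-1)/2}\boxtimes L(\lambda_1,\ldots,\lambda_{n-i})\right).$$ If $\lambda_n=\cdots=\lambda_{n-i+1}$, then $I_{P_{i,n}}(\lambda)$ contains a highest weight vector of weight $\lambda$, and moreover such a highest weight vector generates $L(\lambda)$. Conversely, let $\mu$ be a character of $\mathrm{GL}_i(\mathbb{R})$ and $(\omega_1,\ldots,\omega_{n-i})\in\mathbb{Z}^{n-i}$ a $\mathfrak{k}_{n-i}$-dominant integral weight. If the induced representation $$\mathrm{Ind}_{P_{i,n}(\mathbb{R})}^{\mathrm{Sp}_{2n}(\mathbb{R})}\left(\mu\boxtimes L(\omega_1,\ldots,\omega_{n-i})\right)$$ has a highest weight vector of weight $\lambda$, then: (a) $\lambda_n=\cdots=\lambda_{n-i+1}$; (b) $\mu=\mathrm{sgn}^{\lambda_n}|\cdot|^{\lambda_n-n+(i-1)/2}$; (c) $(\omega_1,\ldots,\omega_{n-i})=(\lambda_1,\ldots,\lambda_{n-i})$.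
   Context: $\mathrm{Sp}_{2n}$ is the symplectic group of rank $n$, i.e. $\{g\in \mathrm{GL}_{2n}: {}^tgJg=J\}$ with $J=\begin{pmatrix}0&-\mathbf 1_n\\ \mathbf 1_n&0\end{pmatrix}$, acting on the Siegel upper half space $\mathfrak{H}_n$ by linear fractional transformations; $\mathrm{Sp}_0$ is trivial. $K_{n,\infty}\subset \mathrm{Sp}_{2n}(\mathbb{R})$ is the stabilizer of $\sqrt{-1}\,\mathbf 1_n$, $\mathfrak{g}_n=\mathrm{Lie}(\mathrm{Sp}_{2n}(\mathbb R))\otimes\mathbb{C}$, $\mathfrak{k}_n=\mathrm{Lie}(K_{n,\infty})\otimes\mathbb C$, and $\mathfrak{g}_n=\mathfrak{k}_n+\mathfrak{p}_{n,+}+\mathfrak{p}_{n,-}$, where $\mathfrak{p}_{n,\pm}$ correspond to the holomorphic/anti-holomorphic tangent spaces of $\mathfrak H_n$ at $\sqrt{-1}\,\mathbf 1_n$. A Cartan subalgebra of $\mathfrak{k}_n$ is also one of $\mathfrak g_n$; the roots are $\pm(e_i+e_j)$ $(i\le j)$, $\pm(e_k-e_l)$ $(k<l)$, and the positive system is $\{-(e_i+e_j)\ (i\le j),\ e_k-e_l\ (k<l)\}$, the roots $-(e_i+e_j)$ being those of $\mathfrak p_{n,-}$. A highest weight vector is a nonzero weight vector annihilated by all positive root vectors (in particular by $\mathfrak{p}_{n,-}$). A weight $\lambda$ is $\mathfrak k_n$-dominant if $\lambda_i-\lambda_{i+1}\in\mathbb{Z}_{\ge0}$ for $1\le i\le n-1$,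 and integral if all entries are integers. For $\mathfrak k_n$-dominant integral $\lambda$, $L(\lambda)$ is the unique irreducible highest weight $(\mathfrak g_n,K_{n,\infty})$-module of highest weight $\lambda$ (if $\lambda_n> n$ it is the holomorphic discrete series of weight $\lambda$). $P_{i,n}$ is the standard parabolic subgroup of $\mathrm{Sp}_{2n}$ with Levi subgroup $\mathrm{GL}_i\times \mathrm{Sp}_{2(n-i)}$ (standard: containing the Borel subgroup of matrices $\begin{pmatrix}a&b\\0&{}^ta^{-1}\end{pmatrix}$ with $a$ upper triangular). $\mathrm{Ind}$ is normalized parabolic induction. A character of $\mathbb{R}^\times$ is regarded as a character of $\mathrm{GL}_i(\mathbb{R})$ by composition with $\det$. *)

(* Defs.v *)
From HB Require Import structures.
From mathcomp Require Import all_boot all_order all_algebra.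
From mathcomp Require Import complex.
From mathcomp Require Import all_classical all_reals all_analysis.

Set Implicit Arguments.
Unset Strict Implicit.
Unset Printing Implicit Defensive.

Import Order.TTheory GRing.Theory Num.Theory.
Import numFieldNormedType.Exports.

Local Open Scope classical_set_scope.
Local Open Scope ring_scope.
Local Open Scope complex_scope.

(** * Calculus with complex and vector values *)

(* The notation 'i could resolve to [Num.imaginary], an unspecified root of -1. *)
Definition iC (R : realType) : R[i] := Complex 0 1.

Section Calculus.
Variable R : realType.

(* Continuity and derivatives of R[i]-valued maps are taken on real and
   imaginary parts. *)
Definition ccontinuous_on (T : topologicalType) (A : set T) (c : T -> R[i]) :=
  {within A, continuous (fun x => complex.Re (c x))} /\
  {within A, continuous (fun x => complex.Im (c x))}.

Definition is_cderive0 (c : R -> R[i]) (d : R[i]) :=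
  is_derive (0 : R) (1 : R) (fun t => complex.Re (c t)) (complex.Re d) /\
  is_derive (0 : R) (1 : R) (fun t => complex.Im (c t)) (complex.Im d).

Definition cderive0 (c : R -> R[i]) : R[i] :=
  xget 0 [set d | is_cderive0 c d].

(* V carries no topology.  A curve in V has a derivative when it stays in a
   finite-dimensional subspace and is differentiable there; the value d does
   not depend on the spanning family e. *)
Definition is_vderive0 (V : lmodType R[i]) (g : R -> V) (d : V) :=
  exists (m : nat) (e : 'I_m -> V) (c : 'I_m -> R -> R[i]) (c' : 'I_m -> R[i]),
    [/\ forall t, g t = \sum_j c j t *: e j,
        forall j, is_cderive0 (c j) (c' j)
      & d = \sum_j c' j *: e j].

Definition vderive0 (V : lmodType R[i]) (g : R -> V) : V :=
  xget 0 [set d | is_vderive0 g d].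

Definition expm (n : nat) (A : 'M[R]_n) : 'M[R]_n :=
  \matrix_(r, c) limn (series (fun k => (A ^+ k) r c / (k`!)%:R)).

Definition Lie (n : nat) (G : set 'M[R]_n) : set 'M[R]_n :=
  [set X | forall t : R, G (expm (t *: X))].

Definition LieC (n : nat) (G : set 'M[R]_n) : set 'M[R[i]]_n :=
  [set X | Lie G (map_mx (@complex.Re R) X) /\
           Lie G (map_mx (@complex.Im R) X)].

End Calculus.

(** * The symplectic group, K, and roots *)

Lemma block_bracket (C : comNzRingType) (n : nat) (u c : C) (D S : 'M[C]_n) :
  u * u = -1 -> D *m S + S *m D = c *: S ->
  block_mx 0 (- u *: D) (u *: D) 0 *m block_mx S (- u *: S) (- u *: S) (- S)
  - block_mx S (- u *: S) (- u *: S) (- S) *m block_mx 0 (- u *: D) (u *: D) 0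
  = - c *: block_mx S (- u *: S) (- u *: S) (- S).
Proof.
move=> u2 key; rewrite !mulmx_block opp_block_mx add_block_mx scale_block_mx.
rewrite !mul0mx !mulmx0 !(addr0, add0r) !scaleNr !(mulNmx, mulmxN).
rewrite -!scalemxAl -!scalemxAr !scalerN !opprK !scalerA u2 !scaleN1r !opprK.
by congr block_mx; rewrite -?opprD -?scalerDr 1?[S *m D + _]addrC key
  ?scalerA // mulrC.
Qed.

Section Symplectic.
Variables (R : realType) (n : nat).

Definition Jmx : 'M[R]_(n + n) := block_mx 0 (- 1%:M) 1%:M 0.

Definition Sp : set 'M[R]_(n + n) :=
  [set g | [/\ g \in unitmx & g^T *m Jmx *m g = Jmx]].

Definition moebius (g : 'M[R]_(n + n)) (Z : 'M[R[i]]_n) : 'M[R[i]]_n :=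
  let gC := map_mx (real_complex R) g in
  (ulsubmx gC *m Z + ursubmx gC) *m invmx (dlsubmx gC *m Z + drsubmx gC).

Definition Kinf : set 'M[R]_(n + n) :=
  [set g | Sp g /\ moebius g ((iC R)%:M) = (iC R)%:M].

(* The coordinates e_j on the diagonal Cartan subalgebra of k_n are dual to the
   elements below.  The sign is the one for which the roots of p_{n,-} are the
   -(e_a + e_b); see [cartan_pminus]. *)
Definition cartan (j : 'I_n) : 'M[R[i]]_(n + n) :=
  block_mx 0 (- iC R *: delta_mx j j) (iC R *: delta_mx j j) 0.

Definition bracket (m : nat) (X Y : 'M[R[i]]_m) : 'M[R[i]]_m :=
  X *m Y - Y *m X.

Definition e_ (j : 'I_n) : {ffun 'I_n -> int} := [ffun k => (k == j)%:Z].

Definition positive_root (alpha : {ffun 'I_n -> int}) : Prop :=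
  (exists a b : 'I_n, (a <= b)%N /\ alpha = - (e_ a + e_ b)) \/
  (exists a b : 'I_n, (a < b)%N /\ alpha = e_ a - e_ b).

Definition root_space (alpha : {ffun 'I_n -> int}) : set 'M[R[i]]_(n + n) :=
  [set X | LieC Sp X /\
           forall j, bracket (cartan j) X = (alpha j)%:~R *: X].

(* For g = (A, B; C, -A^T) in the complexified Lie algebra, the C-linear
   extension of X |-> d/dt (exp(tX).i) at 0 is B + C + i(A + A^T).  Its kernel
   on the complement of k_n, which is the antiholomorphic part p_{n,-}, consists
   of the matrices below with S symmetric. *)
Definition pminus (S : 'M[R[i]]_n) : 'M[R[i]]_(n + n) :=
  block_mx S (- iC R *: S) (- iC R *: S) (- S).

Lemma cartan_pminus (j a b : 'I_n) :
  bracket (cartan j) (pminus (delta_mx a b + delta_mx b a)) =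
  ((- (e_ a + e_ b)) j)%:~R *: pminus (delta_mx a b + delta_mx b a).
Proof.
set S := delta_mx a b + delta_mx b a.
have key : delta_mx j j *m S + S *m delta_mx j j =
    ((e_ a + e_ b) j)%:~R *: S :> 'M[R[i]]_n.
  rewrite /S mulmxDr mulmxDl !mul_delta_mx_cond !ffunE.
  by case: (eqVneq j a) => [->|ja]; case: (eqVneq _ b) => [->|jb];
    rewrite ?eqxx ?(eq_sym a) ?(eq_sym b) ?(negbTE ja) ?(negbTE jb) //=
      ?scale0r ?mulr0n ?mulr1n ?addr0 ?add0r ?scale1r
      ?(scaler_nat, scalerDl) // addrC.
have -> : (- (e_ a + e_ b)) j = - ((e_ a + e_ b) j) by rewrite !ffunE.
rewrite rmorphN; apply: block_bracket key.
by apply/eqP; rewrite eq_complex /= !mul0r !mulr1 mulr0 sub0r addr0 oppr0 !eqxx.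
Qed.

End Symplectic.

(** * Weights *)

(* Entries are indexed from 0: lambda_k is [lambda`_k.-1]. *)
Definition dominant (n : nat) (lambda : n.-tuple int) : Prop :=
  forall k : nat, (k.+1 < n)%N -> lambda`_k.+1 <= lambda`_k.

(** * (g, K)-modules *)

(* The underlying vector space is the set [gk_supp], inside an ambient space on
   which the two actions are given by total functions.  Only the values at
   elements of the complexified Lie algebra, of K, and of [gk_supp] matter. *)
Record gKdata (R : realType) (n : nat) := GKData {
  gk_amb : lmodType R[i];
  gk_supp : set gk_amb;
  gk_lie : 'M[R[i]]_(n + n) -> gk_amb -> gk_amb;
  gk_cpt : 'M[R]_(n + n) -> gk_amb -> gk_amb
}.

Section GKModules.
Variables (R : realType) (n : nat).
Implicit Type M : gKdata R n.

Local Notation g_ := (LieC (@Sp R n)).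
Local Notation K := (@Kinf R n).

(* The orbit map of v on K is continuous with values in a finite-dimensional
   space. *)
Definition K_finite M (v : gk_amb M) : Prop :=
  exists (m : nat) (e : 'I_m -> gk_amb M) (c : 'I_m -> 'M[R]_(n + n) -> R[i]),
    (forall j, ccontinuous_on K (c j)) /\
    (forall k, K k -> gk_cpt k v = \sum_j c j k *: e j).

Definition subspace (V : lmodType R[i]) (W : set V) : Prop :=
  W 0 /\ forall (a : R[i]) (u v : V), W u -> W v -> W (a *: u + v).

Definition submodule M (W : set (gk_amb M)) : Prop :=
  [/\ W `<=` @gk_supp _ _ M, subspace W,
      forall X v, g_ X -> W v -> W (gk_lie X v)
    & forall k v, K k -> W v -> W (gk_cpt k v)].

Definition lie_action M : Prop :=
  let S := @gk_supp _ _ M in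
  [/\ forall X (a : R[i]) u v, g_ X -> S u -> S v ->
        gk_lie X (a *: u + v) = a *: gk_lie X u + gk_lie X v,
      forall X Y (a : R[i]) v, g_ X -> g_ Y -> S v ->
        gk_lie (a *: X + Y) v = a *: gk_lie X v + gk_lie Y v
    & forall X Y v, g_ X -> g_ Y -> S v ->
        gk_lie (bracket X Y) v =
        gk_lie X (gk_lie Y v) - gk_lie Y (gk_lie X v)].

Definition cpt_action M : Prop :=
  let S := @gk_supp _ _ M in
  [/\ forall k (a : R[i]) u v, K k -> S u -> S v ->
        gk_cpt k (a *: u + v) = a *: gk_cpt k u + gk_cpt k v,
      forall v, S v -> gk_cpt 1%:M v = v,
      forall k k' v, K k -> K k' -> S v ->
        gk_cpt (k *m k') v = gk_cpt k (gk_cpt k' v)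
    & forall v, S v -> K_finite v].

Definition gK_compatible M : Prop :=
  let S := @gk_supp _ _ M in
  (forall k X v, K k -> g_ X -> S v ->
     let kC := map_mx (real_complex R) k in
     gk_cpt k (gk_lie X v) = gk_lie (kC *m X *m invmx kC) (gk_cpt k v)) /\
  (forall X v, Lie K X -> S v ->
     is_vderive0 (fun t : R => gk_cpt (expm (t *: X)) v)
                 (gk_lie (map_mx (real_complex R) X) v)).

Definition is_gKmodule M : Prop :=
  [/\ submodule (@gk_supp _ _ M), lie_action M, cpt_action M
    & gK_compatible M].

Definition irreducible M : Prop :=
  @gk_supp _ _ M != [set 0] /\
  forall W : set (gk_amb M), submodule W ->
    W = [set 0] \/ W = @gk_supp _ _ M.

Definition highest_weight_vector M (lambda : n.-tuple int) (v : gk_amb M) :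
    Prop :=
  [/\ @gk_supp _ _ M v, v != 0,
      forall j : 'I_n, gk_lie (cartan R j) v = (tnth lambda j)%:~R *: v
    & forall alpha X, positive_root alpha -> root_space alpha X ->
        gk_lie X v = 0].

Definition generated M (v : gk_amb M) : gKdata R n :=
  @GKData R n (gk_amb M)
    [set w | forall W : set (gk_amb M), submodule W -> W v -> W w]
    (@gk_lie _ _ M) (@gk_cpt _ _ M).

(* M is a realization of L(lambda). *)
Definition is_L M (lambda : n.-tuple int) : Prop :=
  [/\ is_gKmodule M, irreducible M
    & exists v : gk_amb M, highest_weight_vector lambda v].

End GKModules.

(** * The parabolic subgroup P_{i,n} and induction *)

Section Induction.
Variables (R : realType) (n i : nat) (le_in : (i <= n)%N).

Local Notation m := (n - i)%N.

(* The stabilizer in Sp of the span of the first i basis (column) vectors. *)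
Definition Pin : set 'M[R]_(n + n) :=
  [set g | Sp g /\ forall r c : 'I_(n + n),
                     (c < i)%N -> (i <= r)%N -> g r c = 0].

Definition gl_index (k : 'I_i) : 'I_(n + n) := lshift n (widen_ord le_in k).

Definition shift_index (k : 'I_m) : 'I_n :=
  cast_ord (subnKC le_in) (rshift i k).

Definition sp_index (k : 'I_(m + m)) : 'I_(n + n) :=
  match fintype.split k with
  | inl a => lshift n (shift_index a)
  | inr b => rshift n (shift_index b)
  end.

(* The components of an element of P, or of its Lie algebra, in
   GL_i x Sp_{2(n-i)}. *)
Definition gl_part (g : 'M[R]_(n + n)) : 'M[R]_i := mxsub gl_index gl_index g.

Definition sp_part (g : 'M[R]_(n + n)) : 'M[R]_(m + m) :=
  mxsub sp_index sp_index g.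

Definition is_GL_character (mu : 'M[R]_i -> R[i]) : Prop :=
  [/\ forall a, a \in unitmx -> mu a != 0,
      forall a b, a \in unitmx -> b \in unitmx -> mu (a *m b) = mu a * mu b
    & ccontinuous_on (T := 'M[R]_i) [set a : 'M[R]_i | a \in unitmx] mu].

(* The modulus of P is |det a|^(2n - i + 1) for a the GL_i-component, since the
   unipotent radical has Hom(R^(2(n-i)), R^i) and Sym^2(R^i) as Levi
   subquotients. *)
Definition half_modulus (a : 'M[R]_i) : R :=
  `|\det a| `^ (((2 * n)%:R - i%:R + 1) / 2).

Variables (mu : 'M[R]_i -> R[i]) (V : gKdata R m).

Definition normalized (a : 'M[R]_i) : R[i] := (half_modulus a)%:C * mu a.

(* The differential of delta_P^(1/2) (mu x V) on Lie P. *)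
Definition dsigma (Y : 'M[R]_(n + n)) (v : gk_amb V) : gk_amb V :=
  cderive0 (fun t : R => normalized (expm (t *: gl_part Y))) *: v +
  gk_lie (map_mx (real_complex R) (sp_part Y)) v.

(* Sections are functions on K, extended by 0 to all matrices.  A section
   corresponds to F on G = PK with F(pk) = delta_P^(1/2) sigma(p) f(k), and G
   acts by right translation.  Writing k X k^-1 = Y + Z with Y in Lie P and Z in
   Lie K, one gets
     (X f)(k) = d/dt F(exp(t k X k^-1) k) = dsigma(Y) f(k) + d/dt f(exp(tZ) k),
   which does not depend on the choice of (Y, Z). *)
Definition ind_lie_real (X : 'M[R]_(n + n)) (f : 'M[R]_(n + n) -> gk_amb V) :
    'M[R]_(n + n) -> gk_amb V :=
  fun k => if `[< @Kinf R n k >] then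
    xget 0 [set w | exists Y Z : 'M[R]_(n + n),
      [/\ Lie Pin Y, Lie (@Kinf R n) Z, k *m X *m invmx k = Y + Z
        & w = dsigma Y (f k) + vderive0 (fun t : R => f (expm (t *: Z) *m k))]]
  else 0.

Definition ind_lie (X : 'M[R[i]]_(n + n)) (f : 'M[R]_(n + n) -> gk_amb V) :
    'M[R]_(n + n) -> gk_amb V :=
  ind_lie_real (map_mx (@complex.Re R) X) f +
  iC R *: ind_lie_real (map_mx (@complex.Im R) X) f.

Definition ind_cpt (k' : 'M[R]_(n + n)) (f : 'M[R]_(n + n) -> gk_amb V) :
    'M[R]_(n + n) -> gk_amb V :=
  fun k => f (k *m k').

Definition ind_ambient : gKdata R n :=
  @GKData R n ('M[R]_(n + n) -> gk_amb V : lmodType R[i]) setT ind_lie ind_cpt.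

Definition ind_supp : set (gk_amb ind_ambient) :=
  [set f | [/\ forall k, ~ @Kinf R n k -> f k = 0,
               forall k, @Kinf R n k -> @gk_supp _ _ V (f k),
               forall p k, Pin p -> @Kinf R n p -> @Kinf R n k ->
                 f (p *m k) =
                 normalized (gl_part p) *: gk_cpt (sp_part p) (f k)
             & @K_finite R n ind_ambient f]].

Definition Ind : gKdata R n :=
  @GKData R n (gk_amb ind_ambient) ind_supp ind_lie ind_cpt.

End Induction.

(* The character sgn^l |.|^s of R^x, composed with det. *)
Definition sgn_abs_det (R : realType) (i : nat) (l : int) (s : R)
    (a : 'M[R]_i) : R[i] :=
  (Num.sg (\det a) ^ l * `|\det a| `^ s)%:C.

Definition exponent (R : realType) (n i : nat) (l : int) : R :=
  l%:~R - n%:R + (i%:R - 1) / 2.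

(* Main.v *)
(** Evaluate sections at the element w of K which permutes the coordinates so
    that the last i of them come first.  On a vector f killed by p_-, every
    kappa(a) in k_n whose block from the last i to the first n - i coordinates
    vanishes acts on f(w) through the inducing representation: gl_(n-i) acts as
    in V and gl_i by the trace times the exponent of the character.  For a
    highest weight vector this shows that f(w) is nonzero (otherwise f would
    vanish on K, lowering operators preserving the vanishing at w) and is a
    highest weight vector of V, which determines V, the exponent and the last i
    weights; the sign of the character is read off from the torus element
    diag(-1, 1, ..., 1), which is an exponential in K.  Applied to a submodule
    of the module generated by f, the same statement shows that any highest
    weight vector in it is a multiple of f, whence irreducibility.

    For existence, the function psi(k) = det(u)^l times powers of leading
    principal minors of u, where k corresponds to u in U(n), is a highest weight
    vector of weight lambda for right translation.  Lowering psi by gl_(n-i)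
    while lowering the highest weight vector v0 of V generates the graph of a
    linear map Ev from the K-module generated by psi to V, extended by 0 on
    smaller weights of the center of gl_(n-i).  Then k |-> Ev(w^-1 k psi) is the
    required section. *)
From Pilot Require Import Defs.
From mathcomp Require Import all_boot all_order all_algebra.
From mathcomp Require Import perm complex.
From mathcomp Require Import all_classical all_reals all_analysis.
From mathcomp Require Import lra ring zify.

Set Implicit Arguments.
Unset Strict Implicit.
Unset Printing Implicit Defensive.

Import Order.TTheory GRing.Theory Num.Theory.
Import numFieldNormedType.Exports.
Import Pilot.Defs.

Local Open Scope classical_set_scope.
Local Open Scope ring_scope.

(** At the identity, kappa(B) in k differs from an element of Lie P by an element of p_- as soon as
    the block of B from the first i to the last n - i coordinates vanishes. All raising operators
    satisfy this, but not all lowering operators; conjugation by w exchanges the roles, and the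
    lowering operators are the ones needed to spread a vanishing value over K. The same
    decomposition, read at the identity, shows that the section built from Ev is killed by p_-.

    The modules carry no topology and K-finiteness grants only continuity, so the differential of K
    has to be constructed: a continuous one-parameter group of matrices is an exponential, and
    Trotter's formula makes the differential additive. Conversely, a subspace or a graph stable
    under k is stable under K by uniqueness for linear differential equations, because K is the
    image of its exponential. The action of g on sections rests on a choice of decomposition at each
    point, so that the axioms of a (g,K)-module for the induced representation are themselves
    theorems. *)

Lemma split_lshift m n (a : 'I_m) : fintype.split (lshift n a) = inl a.
Proof. exact: (unsplitK (inl a)). Qed.

Lemma split_rshift m n (a : 'I_n) : fintype.split (rshift m a) = inr a.
Proof. exact: (unsplitK (inr a)). Qed.

(** * Coordinates in finite-dimensional subspaces of an arbitrary vector space *)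

Lemma ker_factor (F : fieldType) m n p (A : 'M[F]_(m, n)) (B : 'M[F]_(m, p)) :
  (forall u : 'rV_m, u *m B = 0 -> u *m A = 0) -> exists T, A = B *m T.
Proof.
move=> kerBA; exists (pinvmx B *m A); apply/eqP; rewrite mulmxA -subr_eq0.
rewrite -[X in X - _]mul1mx -mulmxBl; apply/eqP/row_matrixP => r.
rewrite row_mul row0; apply: kerBA; rewrite -row_mul mulmxBl mul1mx.
by rewrite mulmxKpV // subrr row0.
Qed.

(** A matrix of maximal rank among those with row space inside [S] has row space exactly [S], since
    a further vector of [S] would raise the rank; [Q] is its cokernel. A subspace given only as a
    predicate thus gets linear equations. *)
Lemma subspace_ker (F : fieldType) m (S : set 'rV[F]_m) :
  S 0 -> (forall a u v, S u -> S v -> S (a *: u + v)) ->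
  exists Q : 'M[F]_m, forall x, S x <-> x *m Q = 0.
Proof.
move=> S0 Slin.
pose P k := `[< exists A : 'M[F]_(m, m), (forall x : 'rV[F]_m, (x <= A)%MS -> S x) /\ \rank A = k >].
have exP : exists k, P k.
  exists 0%N; apply/asboolP; exists 0; split; last by rewrite mxrank0.
  by move=> x; rewrite submx0 => /eqP ->.
have ubP k : P k -> (k <= m)%N by move=> /asboolP [A [_ <-]]; exact: rank_leq_col.
case: (ex_maxnP exP ubP) => _ /asboolP [A [AS <-]] maxA.
exists (cokermx A) => x; split=> [Sx|xA]; last first.
  by apply: AS; rewrite submxE xA.
apply/eqP; rewrite -submxE.
have subS (y : 'rV_m) : (y <= A + x)%MS -> S y.
  case/sub_addsmxP => -[u v] /= ->.
  rewrite addrC (mx11_scalar v) mul_scalar_mx; apply: Slin => //.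
  by apply: AS; exact: submxMl.
have le_rk : (\rank (A + x)%MS <= \rank A)%N.
  by apply: maxA; apply/asboolP; exists (A + x)%MS.
have [le_rk2 eq_rk] := mxrank_leqif_sup (addsmxSl A x).
move: eq_rk; rewrite eqn_leq le_rk2 le_rk => /esym subA.
exact: submx_trans (addsmxSr A x) subA.
Qed.

Section SpanCoordinates.
Variables (F : fieldType) (W : lmodType F).

Definition lin_indep N (b : 'I_N -> W) :=
  forall a : 'rV[F]_N, \sum_l a 0 l *: b l = 0 -> a = 0.

(** For [A] reduced to zero the matrix [Q] encodes the linear relations between the [e j]; for
    general [A] the row [x *m Q] plays the role of coordinates modulo [A]. *)
Lemma subspace_span_ker (A : set W) m (e : 'I_m -> W) :
  A 0 -> (forall a u v, A u -> A v -> A (a *: u + v)) ->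
  exists Q : 'M[F]_m, forall x : 'rV_m, A (\sum_j x 0 j *: e j) <-> x *m Q = 0.
Proof.
move=> A0 Alin; apply: (@subspace_ker F m [set x | A (\sum_j x 0 j *: e j)]).
  by rewrite /= big1 // => j _; rewrite mxE scale0r.
move=> a u v /= Au Av; suff -> : \sum_j (a *: u + v) 0 j *: e j =
    a *: (\sum_j u 0 j *: e j) + \sum_j v 0 j *: e j by exact: Alin.
rewrite scaler_sumr -big_split; apply: eq_bigr => j _.
by rewrite !mxE scalerDl scalerA.
Qed.

(** The spanning vectors [e] granted by finiteness need not lie in any subspace of interest. They
    are traded for values of [g], taken at a maximal set of points whose coefficient rows stay
    independent modulo the relations between the [e j]. The new coefficients are fixed linear
    combinations of the [c j], so they inherit continuity and differentiability. *)
Lemma orbit_basis (T : Type) (D : set T) (g : T -> W) m (e : 'I_m -> W)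
    (c : 'I_m -> T -> F) :
  (forall x, D x -> g x = \sum_j c j x *: e j) ->
  exists (N : nat) (t : 'I_N -> T) (B : 'M[F]_(m, N)),
    [/\ forall l, D (t l),
        forall x, D x -> g x = \sum_l (\sum_j c j x * B j l) *: g (t l)
      & lin_indep (fun l => g (t l))].
Proof.
move=> ge.
have [//||Q Qe] := @subspace_span_ker [set 0] m e.
  by move=> a u v /= -> ->; rewrite scaler0 addr0.
pose y x := (\row_j c j x) *m Q.
have sumE N (t : 'I_N -> T) (a : 'rV_N) : (forall l, D (t l)) ->
    \sum_l a 0 l *: g (t l) = \sum_j (\sum_l a 0 l * c j (t l)) *: e j.
  move=> Dt; under eq_bigr => l _ do rewrite ge // scaler_sumr.
  rewrite exchange_big; apply: eq_bigr => j _; rewrite scaler_suml.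
  by apply: eq_bigr => l _; rewrite scalerA.
have yE N (t : 'I_N -> T) (a : 'rV_N) :
    (\row_j \sum_l a 0 l * c j (t l)) *m Q = a *m (\matrix_l y (t l)).
  have -> : \matrix_l y (t l) = (\matrix_(l, j) c j (t l)) *m Q.
    by apply/row_matrixP => l; rewrite rowK row_mul; congr (_ *m _); apply/rowP => j; rewrite !mxE.
  rewrite mulmxA; congr (_ *m _); apply/rowP => j; rewrite !mxE.
  by apply: eq_bigr => l _; rewrite mxE.
pose P' k := `[< exists t : 'I_k -> T, (forall l, D (t l)) /\
  row_free (\matrix_l y (t l)) >].
have exP : exists k, P' k.
  exists 0%N; apply/asboolP; exists (fun l : 'I_0 => match l with Ordinal _ h => False_rect T (notF h) end); split; first by case.
  by rewrite -kermx_eq0; apply/eqP/matrixP => -[].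
have ubP k : P' k -> (k <= m)%N.
  by move=> /asboolP [t [_ /eqP <-]]; exact: rank_leq_col.
case: (ex_maxnP exP ubP) => N /asboolP [t [Dt freeY]] maxN.
pose Y := \matrix_l y (t l).
have ysub x : D x -> (y x <= Y)%MS.
  move=> Dx; apply/negPn/negP => nsub.
  suff /maxN : P' (N + 1)%N by rewrite addn1 ltnn.
  apply/asboolP; exists (fun l => match fintype.split l with inl a => t a | inr _ => x end).
  split; first by move=> l; case: fintype.split.
  have -> : \matrix_l y (match fintype.split l with inl a => t a | inr _ => x end) = col_mx Y (y x).
    apply/row_matrixP => l; rewrite rowK.
    case: (fintype.split_ordP l) => a ->.
      by rewrite rowKu rowK.
    rewrite rowKd.
    by apply/rowP => j; rewrite !mxE ord1.
  rewrite /row_free eqn_leq rank_leq_row /= -addsmxE.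
  have := mxrank_sum_cap Y (y x).
  have -> : \rank (y x) = 1%N.
    by rewrite rank_rV; case: eqP => // y0; rewrite y0 sub0mx in nsub.
  have capE : (Y :&: y x)%MS = 0.
    apply/eqP/negPn/negP => cap0; case/negP: nsub.
    have /andP [_] : (Y :&: y x == y x)%MS.
      rewrite -(geq_leqif (mxrank_leqif_eq (capmxSr Y (y x)))).
      by rewrite (leq_trans (rank_leq_row _)) // lt0n mxrank_eq0.
    by move=> /submx_trans; apply; exact: capmxSl.
  by rewrite (eqP freeY) capE mxrank0 addn0 => ->.
exists N, t, (Q *m pinvmx Y); split=> [//|x Dx|a].
  set a := (\row_j c j x) *m (Q *m pinvmx Y).
  have aE l : \sum_j c j x * (Q *m pinvmx Y) j l = a 0 l.
    by rewrite [RHS]mxE; apply: eq_bigr => j _; rewrite [in RHS]mxE.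
  rewrite (eq_bigr (fun l => a 0 l *: g (t l))); last by move=> l _; rewrite aE.
  rewrite sumE // ge //; apply/eqP; rewrite -subr_eq0; apply/eqP.
  rewrite -sumrB.
  have := (Qe (\row_j (c j x) - \row_j \sum_l a 0 l * c j (t l))).2.
  rewrite mulmxBl yE -/Y /a (mulmxA _ Q (pinvmx Y)) -/(y x) mulmxKpV ?ysub // subrr.
  move=> /(_ erefl) /= H; rewrite -[RHS]H; apply: eq_bigr => j _.
  by rewrite !mxE scalerBl.
rewrite sumE // => H.
have : (\row_j \sum_l a 0 l * c j (t l)) *m Q = 0.
  by apply/Qe; rewrite /= -[RHS]H; apply: eq_bigr => j _; rewrite mxE.
by rewrite yE => aY; apply: (row_free_inj freeY); rewrite aY mul0mx.
Qed.

(** Coordinates in an independent family depend on coordinates in any other family through one fixed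
    matrix, hence are as regular. The relations between the [b l] and the [e j] together form the
    row space of [kermx Q], and independence makes the [b] half of such a row a linear function of
    the [e] half. *)
Lemma indep_coord N (b : 'I_N -> W) m (e : 'I_m -> W) : lin_indep b ->
  exists Th : 'M[F]_(m, N), forall (a : 'rV_N) (c : 'rV_m),
    \sum_l a 0 l *: b l = \sum_j c 0 j *: e j -> a = c *m Th.
Proof.
move=> free_b.
pose h k := match fintype.split k with inl l => b l | inr j => e j end.
have [//||Q Qe] := @subspace_span_ker [set 0] (N + m) h.
  by move=> a u v /= -> ->; rewrite scaler0 addr0.
have rowE (a : 'rV_N) (c : 'rV_m) : \sum_k (row_mx a c) 0 k *: h k =
    \sum_l a 0 l *: b l + \sum_j c 0 j *: e j.
  rewrite big_split_ord /=; congr (_ + _); apply: eq_bigr => j _.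
    by rewrite row_mxEl /h split_lshift.
  by rewrite row_mxEr /h split_rshift.
pose K := kermx Q.
have [Th ThE] : exists T, lsubmx K = rsubmx K *m T.
  apply: ker_factor => u uK; apply: free_b; have := (Qe (u *m K)).2.
  rewrite -mulmxA mulmx_ker mulmx0 => /(_ erefl).
  rewrite -[u *m K]hsubmxK /= rowE => uK0; rewrite -[RHS]uK0.
  have -> : \sum_j (rsubmx (u *m K)) 0 j *: e j = 0.
    by rewrite big1 // => j _; rewrite -mulmx_rsub uK mxE scale0r.
  rewrite addr0; apply: eq_bigr => l _. by rewrite mulmx_lsub.
exists (- Th) => a c eq_ac.
have : row_mx a (- c) *m Q = 0.
  apply/Qe => /=; rewrite rowE eq_ac -big_split big1 // => j _ /=.
  by rewrite mxE scaleNr subrr.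
move=> /eqP; rewrite -sub_kermx => /submxP [u].
rewrite -[kermx Q]hsubmxK mul_mx_row => /eq_row_mx [-> ueq].
rewrite -[lsubmx _]/(lsubmx K) ThE mulmxA -[rsubmx K]/(rsubmx (kermx Q)) -ueq.
by rewrite mulmxN mulNmx.
Qed.

End SpanCoordinates.

(** * Real derivatives and uniqueness for linear differential equations *)

Section Calculus.
Variable R : realType.
Implicit Types (t x : R).

Lemma is_derive_fun_eq (f g : R -> R) x d d' :
  is_derive x (1 : R) f d -> f =1 g -> d = d' -> is_derive x (1 : R) g d'.
Proof. by move=> fd /funext <- <-. Qed.

Lemma is_derive_mul (f g : R -> R) x df dg :
  is_derive x (1 : R) f df -> is_derive x (1 : R) g dg ->
  is_derive x (1 : R) (fun t => f t * g t) (df * g x + f x * dg).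
Proof.
move=> fd gd; apply: (is_derive_fun_eq (is_deriveM fd gd)) => //.
by rewrite /GRing.scale /= addrC [g x * _]mulrC.
Qed.

Lemma is_derive_add (f g : R -> R) x df dg :
  is_derive x (1 : R) f df -> is_derive x (1 : R) g dg ->
  is_derive x (1 : R) (fun t => f t + g t) (df + dg).
Proof. by move=> fd gd; apply: (is_derive_fun_eq (is_deriveD fd gd)). Qed.

Lemma is_derive_opp (f : R -> R) x df :
  is_derive x (1 : R) f df -> is_derive x (1 : R) (fun t => - f t) (- df).
Proof. by move=> fd; apply: (is_derive_fun_eq (is_deriveN fd)). Qed.

Lemma is_derive_sub (f g : R -> R) x df dg :
  is_derive x (1 : R) f df -> is_derive x (1 : R) g dg ->
  is_derive x (1 : R) (fun t => f t - g t) (df - dg).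
Proof. by move=> fd gd; apply: is_derive_add => //; exact: is_derive_opp. Qed.

Lemma is_derive_const (a x : R) : is_derive x (1 : R) (fun=> a) 0.
Proof. exact: is_derive_cst. Qed.

Lemma is_derive_bigsum (I : Type) (r : seq I) (P : pred I) (h : I -> R -> R) (dh : I -> R) x :
  (forall i, is_derive x (1 : R) (h i) (dh i)) ->
  is_derive x (1 : R) (fun t => \sum_(i <- r | P i) h i t) (\sum_(i <- r | P i) dh i).
Proof.
move=> hd; elim: r => [|i r IH].
  apply: (is_derive_fun_eq (is_derive_const 0 x)) => [t|]; by rewrite big_nil.
case Pi: (P i); last first.
  by apply: (is_derive_fun_eq IH) => [t|]; rewrite big_cons Pi.
by apply: (is_derive_fun_eq (is_derive_add (hd i) IH)) => [t|]; rewrite big_cons Pi.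
Qed.

Lemma is_derive_affine (f : R -> R) (a b x d : R) :
  is_derive (a * x + b) (1 : R) f d -> is_derive x (1 : R) (fun t => f (a * t + b)) (a * d).
Proof.
move=> fd; rewrite mulrC.
have gd : is_derive x (1 : R) (fun t => a * t + b) a.
  apply: (is_derive_fun_eq (is_derive_add (is_derive_mul (is_derive_const a x)
    (is_derive_id x 1)) (is_derive_const b x))) => //.
  by rewrite mul0r add0r mulr1 addr0.
exact: (is_derive1_comp (f := f) (g := fun t => a * t + b)).
Qed.

Lemma is_derive_continuous (f : R -> R) x d : is_derive x (1 : R) f d -> {for x, continuous f}.
Proof. by move=> fd; apply/differentiable_continuous/derivable1_diffP; case: fd. Qed.

Lemma ode_zero_ge0 (T : finType) (y : T -> R -> R) (b : T -> T -> R) :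
  (forall t p, is_derive t (1 : R) (y p) (\sum_l b p l * y l t)) ->
  (forall p, y p 0 = 0) -> forall t p, 0 <= t -> y p t = 0.
Proof.
move=> yd y0 t p t0.
pose u t := \sum_p y p t ^+ 2.
pose K := \sum_p \sum_l `|b p l|.
pose w t := u t * expR (- (2 * K) * t + 0).
have yu p' t' : y p' t' ^+ 2 <= u t'.
  by rewrite /u (bigD1 p') //= lerDl sumr_ge0 // => l _; rewrite sqr_ge0.
pose du t := \sum_p 2 * (y p t * \sum_l b p l * y l t).
have ud t' : is_derive t' (1 : R) u (du t').
  apply: is_derive_bigsum => q; apply: (is_derive_fun_eq (is_derive_mul (yd t' q) (yd t' q))) => //.
  by rewrite mulrC -mulr2n mulr_natl.
have wd t' : is_derive t' (1 : R) w ((du t' - 2 * K * u t') * expR (- (2 * K) * t' + 0)).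
  have ed := is_derive_affine (is_derive_expR (- (2 * K) * t' + 0)).
  apply: (is_derive_fun_eq (is_derive_mul (ud t') ed)) => //; ring.
have w_le t' : (du t' - 2 * K * u t') * expR (- (2 * K) * t' + 0) <= 0.
  rewrite mulr_le0_ge0 ?expR_ge0 // subr_le0.
  have -> : 2 * K * u t' = \sum_p 2 * \sum_l `|b p l| * u t'.
    by rewrite -mulr_sumr -mulrA /K mulr_suml; congr (2 * _);
      apply: eq_bigr => q _; rewrite mulr_suml.
  apply: ler_sum => q _; rewrite ler_pM2l // mulr_sumr.
  apply: ler_sum => l _; rewrite mulrCA.
  apply: (le_trans (ler_norm _)); rewrite normrM ler_wpM2l //.
  (* A product of two coordinates is at most half the sum of their squares, hence at most [u]. *)
  have := yu q t'; have := yu l t'; rewrite normrM.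
  rewrite -(real_normK (num_real (y q t'))) -(real_normK (num_real (y l t'))).
  have := sqr_ge0 (`|y q t'| - `|y l t'|); nra.
have : w t <= w 0.
  apply: (ler0_derive1_nincry (a := 0)) => //.
  - by move=> x _; rewrite derive1E (@derive_val _ _ _ _ _ _ _ (wd x)).
  - by apply: continuous_subspaceT => x; exact: is_derive_continuous (wd x).
have -> : w 0 = 0.
  by rewrite /w /u big1 ?mul0r // => q _; rewrite y0 expr0n.
rewrite /w pmulr_lle0 ?expR_gt0 // => u0; apply/eqP; rewrite -sqrf_eq0 eq_le sqr_ge0 andbT.
exact: le_trans (yu p t) u0.
Qed.

(* Gronwall's argument: the squared norm u satisfies u' <= 2 K u. *)
Lemma ode_zero (T : finType) (y : T -> R -> R) (b : T -> T -> R) :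
  (forall t p, is_derive t (1 : R) (y p) (\sum_l b p l * y l t)) ->
  (forall p, y p 0 = 0) -> forall t p, y p t = 0.
Proof.
move=> yd y0 t p; case: (leP 0 t) => [/(ode_zero_ge0 yd y0)//|t0].
have -> : t = -1 * (- t) + 0 by rewrite mulrNN mul1r addr0.
apply: (@ode_zero_ge0 T (fun p t => y p (-1 * t + 0)) (fun p l => - b p l)).
- move=> s q; apply: (is_derive_fun_eq (is_derive_affine (yd _ q))) => //.
  by rewrite mulr_sumr; apply: eq_bigr => l _; rewrite mulrA !mulN1r.
- by move=> q; rewrite mulr0 addr0.
- by rewrite oppr_ge0 ltW.
Qed.

End Calculus.

(** * Entrywise limits of matrices *)

Section Filters.
Variables (R : realType) (T : Type) (F : set_system T).
Context {FF : Filter F}.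

Lemma cvg_bigsum (I : Type) (r : seq I) (P : pred I) (h : I -> T -> R) (l : I -> R) :
  (forall i, h i @ F --> l i) ->
  (fun t => \sum_(i <- r | P i) h i t) @ F --> \sum_(i <- r | P i) l i.
Proof.
move=> hl; elim: r => [|i r IH].
  rewrite big_nil (_ : (fun _ => _) = fun=> 0); first exact: cvg_cst.
  by apply/funext => t; rewrite big_nil.
rewrite big_cons (_ : (fun _ => _) = fun t => if P i then h i t + \sum_(i <- r | P i) h i t
  else \sum_(i <- r | P i) h i t); last by apply/funext => t; rewrite big_cons.
by case: (P i) => //; exact: cvgD.
Qed.

Lemma cvg_bigprod (I : Type) (r : seq I) (P : pred I) (h : I -> T -> R) (l : I -> R) :
  (forall i, h i @ F --> l i) ->
  (fun t => \prod_(i <- r | P i) h i t) @ F --> \prod_(i <- r | P i) l i.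
Proof.
move=> hl; elim: r => [|i r IH].
  rewrite big_nil (_ : (fun _ => _) = fun=> 1); first exact: cvg_cst.
  by apply/funext => t; rewrite big_nil.
rewrite big_cons (_ : (fun _ => _) = fun t => if P i then h i t * \prod_(i <- r | P i) h i t
  else \prod_(i <- r | P i) h i t); last by apply/funext => t; rewrite big_cons.
by case: (P i) => //; exact: cvgM.
Qed.

Lemma cvg_det n (A : T -> 'M[R]_n) (B : 'M[R]_n) :
  (forall r c, (fun t => A t r c) @ F --> B r c) -> (fun t => \det (A t)) @ F --> \det B.
Proof.
move=> AB; apply: cvg_bigsum => s; apply: cvgM; first exact: cvg_cst.
by apply: cvg_bigprod => r; exact: AB.
Qed.

Lemma cvg_mulmx m n p (A : T -> 'M[R]_(m, n)) (B : T -> 'M[R]_(n, p))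
    (A0 : 'M[R]_(m, n)) (B0 : 'M[R]_(n, p)) :
  (forall r c, (fun t => A t r c) @ F --> A0 r c) ->
  (forall r c, (fun t => B t r c) @ F --> B0 r c) ->
  forall r c, (fun t => (A t *m B t) r c) @ F --> (A0 *m B0) r c.
Proof.
move=> AA BB r c; rewrite mxE (_ : (fun _ => _) = fun t => \sum_j A t r j * B t j c).
  by apply: cvg_bigsum => j; apply: cvgM.
by apply/funext => t; rewrite mxE.
Qed.

Lemma cvg_mx m n (A : T -> 'M[R]_(m, n)) (B : 'M[R]_(m, n)) :
  (forall r c, (fun t => A t r c) @ F --> B r c) -> A @ F --> B.
Proof.
move=> AB W [P BP PW].
suff : F (fun t => forall r c, P r c (A t r c)).
  by move=> H; apply: (@filterS T F FF _ _ _ H) => t AtP; exact: PW.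
apply: (@filter_forall T _ (fun r t => forall c, P r c (A t r c)) F) => r.
apply: (@filter_forall T _ (fun c t => P r c (A t r c)) F) => c.
exact: (AB r c _ (BP r c)).
Qed.

Lemma within_cvg m n (K : set 'M[R]_(m, n)) (c : 'M[R]_(m, n) -> R) (g : T -> 'M[R]_(m, n))
    (g0 : 'M[R]_(m, n)) :
  {within K, continuous c} -> K g0 -> (forall t, K (g t)) ->
  (forall i j, (fun t => g t i j) @ F --> g0 i j) -> (fun t => c (g t)) @ F --> c g0.
Proof.
move=> /subspace_continuousP cK Kg0 Kg gcv W cW.
have := cvg_mx gcv (cK _ Kg0 _ cW).
by move=> H; apply: (@filterS T F FF _ _ _ H) => t; apply.
Qed.

End Filters.

(** * The matrix exponential *)

Section MatrixCurves.
Variable R : realType.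
Implicit Types t : R.

Definition mx_derive m n (t : R) (Y : R -> 'M[R]_(m, n)) (D : 'M[R]_(m, n)) :=
  forall r c, is_derive t (1 : R) (fun t => Y t r c) (D r c).

Lemma mx_derive_eq m n t (Y Y' : R -> 'M[R]_(m, n)) D D' :
  mx_derive t Y D -> Y =1 Y' -> D = D' -> mx_derive t Y' D'.
Proof. by move=> Yd /funext <- <-. Qed.

Lemma mx_derive_const m n t (A : 'M[R]_(m, n)) : mx_derive t (fun=> A) 0.
Proof. by move=> r c; rewrite mxE; exact: is_derive_const. Qed.

Lemma mx_derive_mul m n p t (Y : R -> 'M[R]_(m, n)) (Z : R -> 'M[R]_(n, p)) D E :
  mx_derive t Y D -> mx_derive t Z E ->
  mx_derive t (fun t => Y t *m Z t) (D *m Z t + Y t *m E).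
Proof.
move=> Yd Zd r c.
have H := @is_derive_bigsum R _ (index_enum 'I_n) xpredT _ _ _
  (fun j => is_derive_mul (Yd r j) (Zd j c)).
by apply: (is_derive_fun_eq H) => [s|]; rewrite !mxE // -big_split.
Qed.

Lemma mx_derive_mull m n p t (A : 'M[R]_(p, m)) (Y : R -> 'M[R]_(m, n)) D :
  mx_derive t Y D -> mx_derive t (fun t => A *m Y t) (A *m D).
Proof.
move=> Yd; apply: (mx_derive_eq (mx_derive_mul (mx_derive_const t A) Yd)) => //.
by rewrite mul0mx add0r.
Qed.

Lemma mx_derive_mulr m n p t (A : 'M[R]_(n, p)) (Y : R -> 'M[R]_(m, n)) D :
  mx_derive t Y D -> mx_derive t (fun t => Y t *m A) (D *m A).
Proof.
move=> Yd; apply: (mx_derive_eq (mx_derive_mul Yd (mx_derive_const t A))) => //.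
by rewrite mulmx0 addr0.
Qed.

Lemma mx_derive_tr m n t (Y : R -> 'M[R]_(m, n)) D :
  mx_derive t Y D -> mx_derive t (fun t => (Y t)^T) D^T.
Proof.
by move=> Yd r c; apply: (is_derive_fun_eq (Yd c r)) => [s|]; rewrite mxE.
Qed.

Lemma mx_derive_sub m n t (Y Z : R -> 'M[R]_(m, n)) D E :
  mx_derive t Y D -> mx_derive t Z E -> mx_derive t (fun t => Y t - Z t) (D - E).
Proof.
by move=> Yd Zd r c; apply: (is_derive_fun_eq (is_derive_sub (Yd r c) (Zd r c))) => [s|]; rewrite !mxE.
Qed.

Lemma mx_derive_affine m n (a b t : R) (Y : R -> 'M[R]_(m, n)) D :
  mx_derive (a * t + b) Y D -> mx_derive t (fun t => Y (a * t + b)) (a *: D).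
Proof.
move=> Yd r c; rewrite mxE.
exact: (is_derive_affine (f := fun t => Y t r c)).
Qed.

Lemma mx_derive_unique m n t (Y : R -> 'M[R]_(m, n)) D D' :
  mx_derive t Y D -> mx_derive t Y D' -> D = D'.
Proof.
move=> YD YD'; apply/matrixP => r c.
by rewrite -(@derive_val _ _ _ _ _ _ _ (YD r c)) -(@derive_val _ _ _ _ _ _ _ (YD' r c)).
Qed.

Lemma mx_ode_zero m n (B : 'M[R]_m) (Y : R -> 'M[R]_(m, n)) :
  (forall t, mx_derive t Y (B *m Y t)) -> Y 0 = 0 -> forall t, Y t = 0.
Proof.
move=> Yd Y0 t; apply/matrixP => r c; rewrite mxE.
apply: (@ode_zero R 'I_m (fun r t => Y t r c) (fun p l => B p l)) => [s p|p].
  by apply: (is_derive_fun_eq (Yd s p c)) => //; rewrite mxE.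
by rewrite Y0 mxE.
Qed.

Lemma mx_ode_unique m n (B : 'M[R]_m) (Y Z : R -> 'M[R]_(m, n)) :
  (forall t, mx_derive t Y (B *m Y t)) -> (forall t, mx_derive t Z (B *m Z t)) ->
  Y 0 = Z 0 -> Y =1 Z.
Proof.
move=> Yd Zd YZ0 t; apply/eqP; rewrite -subr_eq0; apply/eqP.
apply: (@mx_ode_zero _ _ B (fun t => Y t - Z t)) => [s|]; last by rewrite YZ0 subrr.
by apply: (mx_derive_eq (mx_derive_sub (Yd s) (Zd s))) => //; rewrite mulmxBr.
Qed.

Definition mnorm m n (A : 'M[R]_(m, n)) := \sum_r \sum_c `|A r c|.

Lemma mnorm_ge0 m n (A : 'M[R]_(m, n)) : 0 <= mnorm A.
Proof. by apply: sumr_ge0 => r _; apply: sumr_ge0. Qed.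

Lemma mnorm_row m n (A : 'M[R]_(m, n)) r : \sum_c `|A r c| <= mnorm A.
Proof.
by rewrite /mnorm (bigD1 r) //= lerDl sumr_ge0 // => i _; apply: sumr_ge0.
Qed.

Lemma expmx_entry_le n (A : 'M[R]_n) k r c : `|(A ^+ k) r c| <= mnorm A ^+ k.
Proof.
elim: k r c => [|k IH] r c.
  by rewrite !expr0 mxE; case: (r == c); rewrite ?normr1 ?normr0.
rewrite exprS -[_ * _]/(A *m (A ^+ k)) mxE exprS.
apply: (le_trans (ler_norm_sum _ _ _)).
apply: le_trans (ler_wpM2r (exprn_ge0 k (mnorm_ge0 A)) (mnorm_row A r)).
by rewrite mulr_suml; apply: ler_sum => j _; rewrite normrM ler_wpM2l.
Qed.

Definition expm_coeff n (X : 'M[R]_n) r c := fun k => (X ^+ k) r c / (k`!)%:R.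

(** Each entry is dominated by the exponential series at [mnorm X] times the absolute value of
    [t]. *)
Lemma expm_coeff_cvg n (X : 'M[R]_n) r c (t : R) : cvgn (pseries (expm_coeff X r c) t).
Proof.
apply: normed_cvg; apply: (series_le_cvg _ _ _ (is_cvg_series_exp_coeff (mnorm X * `|t|))).
- by move=> k /=.
- by move=> k; apply: exp_coeff_ge0; rewrite mulr_ge0 ?mnorm_ge0.
move=> k /=; rewrite /expm_coeff /exp_coeff /= !normrM normfV normrX normr_nat exprMn mulrAC.
by rewrite ler_wpM2r ?invr_ge0 // ler_wpM2r ?exprn_ge0 ?expmx_entry_le.
Qed.

Lemma expm_scaleE n (X : 'M[R]_n) (t : R) r c :
  expm (t *: X) r c = limn (pseries (expm_coeff X r c) t).
Proof.
rewrite mxE; congr (limn (series _)); apply/funext => k.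
have -> : (t *: X) ^+ k = t ^+ k *: X ^+ k.
  elim: k => [|k IH]; first by rewrite !expr0 scale1r.
  rewrite !exprS IH -[LHS]/((t *: X) *m (t ^+ k *: X ^+ k)).
  by rewrite -scalemxAl -scalemxAr scalerA.
rewrite mxE /expm_coeff. by rewrite /= -mulrA mulrC.
Qed.

Lemma pseries_diffs_expm n (X : 'M[R]_n) r c :
  pseries_diffs (expm_coeff X r c) = fun k => \sum_j X r j * expm_coeff X j c k.
Proof.
apply/funext => k; rewrite /pseries_diffs /expm_coeff exprS.
rewrite -[X * _]/(X *m (X ^+ k)) mxE factS natrM invfM.
rewrite mulrCA mulVKf; last by rewrite pnatr_eq0.
by rewrite mulr_suml; apply: eq_bigr => j _; rewrite mulrA.
Qed.

Lemma pseries_sum n (a : 'I_n -> R) (f : 'I_n -> nat -> R) (t : R) :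
  (forall j, cvgn (pseries (f j) t)) ->
  pseries (fun k => \sum_j a j * f j k) t @ \oo --> \sum_j a j * limn (pseries (f j) t).
Proof.
move=> fc.
have -> : pseries (fun k => \sum_j a j * f j k) t =
    fun N => \sum_j a j * pseries (f j) t N.
  apply/funext => N; rewrite /pseries /series /=.
  under eq_bigr => k _ do rewrite mulr_suml.
  rewrite exchange_big; apply: eq_bigr => j _; rewrite mulr_sumr.
  by apply: eq_bigr => k _; rewrite mulrA.
by apply: cvg_bigsum => j; apply: cvgM; [exact: cvg_cst|exact: fc].
Qed.

(** Each entry is a power series in t, and differentiating its coefficients amounts to multiplying
    by [X]. Termwise differentiation asks for the convergence of the series and of its first two
    derived series at a point beyond t. *)
Lemma expm_derive n (X : 'M[R]_n) t : mx_derive t (fun t => expm (t *: X)) (X *m expm (t *: X)).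
Proof.
move=> r c.
have d1 s : cvgn (pseries (pseries_diffs (expm_coeff X r c)) s).
  rewrite pseries_diffs_expm; apply/cvg_ex; eexists.
  by apply: pseries_sum => j; exact: expm_coeff_cvg.
have d2 s : cvgn (pseries (pseries_diffs (pseries_diffs (expm_coeff X r c))) s).
  rewrite pseries_diffs_expm.
  have -> : pseries_diffs (fun k => \sum_j X r j * expm_coeff X j c k) =
      fun k => \sum_j X r j * pseries_diffs (expm_coeff X j c) k.
    apply/funext => k; rewrite /pseries_diffs mulr_sumr.
    by apply: eq_bigr => j _; rewrite mulrCA.
  apply/cvg_ex; eexists; apply: pseries_sum => j.
  rewrite pseries_diffs_expm; apply/cvg_ex; eexists.
  by apply: pseries_sum => l; exact: expm_coeff_cvg.
have lt_t : `|t| < `|(`|t| + 1)| by rewrite (ger0_norm (addr_ge0 _ _)) // ltrDl.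
have H := pseries_snd_diffs (@expm_coeff_cvg _ X r c (`|t| + 1)) (d1 _) (d2 _) lt_t.
apply: (is_derive_fun_eq H).
  by move=> s; rewrite expm_scaleE.
rewrite mxE pseries_diffs_expm; apply: cvg_lim => //.
under [X in _ --> X]eq_bigr => j _ do rewrite expm_scaleE.
by apply: pseries_sum => j; exact: expm_coeff_cvg.
Qed.

Lemma expm0 n : expm (0 : 'M[R]_n) = 1%:M.
Proof.
apply/matrixP => r c; rewrite mxE; apply: cvg_lim => //.
rewrite -cvg_shiftS.
rewrite (_ : [sequence _]_n = fun=> (1%:M : 'M[R]_n) r c).
  by rewrite mxE; exact: cvg_cst.
apply/funext => k; rewrite /series /= big_nat_recl //= expr0 fact0 divr1.
by rewrite big1 ?addr0 // => j _; rewrite exprS mul0r mxE mul0r.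
Qed.

(** Uniqueness for linear equations in the form used from here on: the functional equation, the
    transpose and the intertwining of exponentials all follow by checking one equation and one
    initial value. *)
Lemma expm_flow n p (X : 'M[R]_n) (Y : R -> 'M[R]_(n, p)) :
  (forall t, mx_derive t Y (X *m Y t)) -> forall t, Y t = expm (t *: X) *m Y 0.
Proof.
move=> Yd; apply: (mx_ode_unique Yd); last by rewrite scale0r expm0 mul1mx.
by move=> t; rewrite mulmxA; apply: mx_derive_mulr; exact: expm_derive.
Qed.

Lemma expm_intertwine m n (A : 'M[R]_(m, n)) (X : 'M[R]_m) (Y : 'M[R]_n) t :
  X *m A = A *m Y -> expm (t *: X) *m A = A *m expm (t *: Y).
Proof.
move=> XA; rewrite -[RHS](_ : (fun t => A *m expm (t *: Y)) t = _) //.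
rewrite (@expm_flow _ _ X (fun t => A *m expm (t *: Y))) ?scale0r ?expm0 ?mulmx1 //.
by move=> s; rewrite mulmxA XA -mulmxA; apply: mx_derive_mull; exact: expm_derive.
Qed.

Lemma expm_comm n (X : 'M[R]_n) t : expm (t *: X) *m X = X *m expm (t *: X).
Proof. exact: expm_intertwine. Qed.

Lemma expmD n (X : 'M[R]_n) s t : expm ((s + t) *: X) = expm (s *: X) *m expm (t *: X).
Proof.
have := @expm_flow _ _ X (fun s => expm ((1 * s + t) *: X)) _ s.
rewrite mul1r mulr0 add0r; apply => u.
apply: (mx_derive_eq (mx_derive_affine (expm_derive X _))) => //.
by rewrite scale1r.
Qed.

Lemma expmN n (X : 'M[R]_n) t : expm (t *: X) *m expm (- t *: X) = 1%:M.
Proof. by rewrite -expmD subrr scale0r expm0. Qed.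

Lemma expm_unit n (X : 'M[R]_n) t : expm (t *: X) \in unitmx.
Proof. by case: (mulmx1_unit (expmN X t)). Qed.

Lemma expm_inv n (X : 'M[R]_n) t : invmx (expm (t *: X)) = expm (- t *: X).
Proof.
rewrite -[LHS]mulmx1 -(expmN X t) mulmxA mulVmx ?mul1mx //; exact: expm_unit.
Qed.

Lemma expm_tr n (X : 'M[R]_n) t : (expm (t *: X))^T = expm (t *: X^T).
Proof.
rewrite -[RHS]mulmx1 -(trmx1 R n) -(expm0 n) -(scale0r X).
apply: (@expm_flow _ _ X^T (fun t => (expm (t *: X))^T)) => s.
by rewrite -trmx_mul expm_comm; apply: mx_derive_tr; exact: expm_derive.
Qed.

Lemma expm_conj n (g X : 'M[R]_n) t : g \in unitmx ->
  expm (t *: (g *m X *m invmx g)) = g *m expm (t *: X) *m invmx g.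
Proof.
move=> gu; rewrite -(@expm_intertwine _ _ g (g *m X *m invmx g)) ?mulmxK //.
by rewrite mulmxKV.
Qed.

Lemma expm_generator n (X B : 'M[R]_n) :
  (forall t, expm (t *: X) = expm (t *: B)) -> X = B.
Proof.
move=> XB; have := expm_derive X 0; have := expm_derive B 0.
rewrite !scale0r !expm0 !mulmx1 => BD XD; apply: mx_derive_unique XD _.
exact: (mx_derive_eq BD).
Qed.

End MatrixCurves.

(** * Continuous one-parameter groups of matrices and Trotter's formula *)

Section OneParameterGroups.
Variable R : realType.
Implicit Types t : R.

Lemma antiderivative (g : R -> R) (a : R) : continuous g ->
  exists H : R -> R, forall t, a < t -> is_derive t (1 : R) H (g t).
Proof.
move=> gc; exists (fun x => \int[lebesgue_measure]_(t in [set` `[a, x]]) g t).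
move=> t at_; have tt1 : t < t + 1 by rewrite ltrDl.
have intg : lebesgue_measure.-integrable `[a, t + 1] (EFin \o g).
  apply: continuous_compact_integrable; first exact: segment_compact.
  exact: continuous_subspaceT.
have [H1 H2] := continuous_FTC1_closed tt1 intg at_ (gc t).
by split=> //; rewrite -derive1E.
Qed.

Lemma derive_zero_const (f : R -> R) (a b x : R) :
  (forall t, a < t -> is_derive t (1 : R) f 0) -> a < b -> b <= x -> f x = f b.
Proof.
move=> fd ab bx.
have le (g : R -> R) : (forall t, a < t -> is_derive t (1 : R) g 0) -> g x <= g b.
  move=> gd; apply: (ler0_derive1_nincry (a := b)) => //.
  - by move=> y; rewrite in_itv /= andbT => yb; case: (gd y (lt_trans ab yb)).
  - move=> y; rewrite in_itv /= andbT => yb.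
    by rewrite derive1E (@derive_val _ _ _ _ _ _ _ (gd y (lt_trans ab yb))).
  - apply: continuous_in_subspaceT => y; rewrite inE /= in_itv /= andbT => yb.
    exact: is_derive_continuous (gd y (lt_le_trans ab yb)).
apply/eqP; rewrite eq_le le //= -lerN2; apply: (le (fun t => - f t)) => t at_.
by apply: (is_derive_fun_eq (is_derive_opp (fd t at_))); rewrite ?oppr0.
Qed.

Lemma is_derive_quotient (f : R -> R) (d : R) : is_derive (0 : R) (1 : R) f d ->
  (fun h => h^-1 * (f h - f 0)) @ 0^' --> d.
Proof.
move=> fd; have := @ex_derive _ _ _ _ _ _ _ fd; have := @derive_val _ _ _ _ _ _ _ fd.
rewrite /derive /derivable => <- /cvgP fc.
rewrite (_ : (fun h => _) = (fun h => h^-1 *: (f (h *: (1 : R) + 0) - f 0))) //.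
by apply/funext => h; rewrite addr0 /GRing.scale /= mulr1.
Qed.

Lemma is_derive_seq (f : R -> R) (d : R) : is_derive (0 : R) (1 : R) f d ->
  (fun k => k.+1%:R * (f (k.+1%:R^-1) - f 0)) @ \oo --> d.
Proof.
move=> /is_derive_quotient fc.
have g0 : (fun k : nat => k.+1%:R^-1 : R) @ \oo --> 0^'.
  move=> A /=; rewrite /dnbhs /within /= => nA.
  have : \oo (fun k : nat => (k.+1%:R^-1 : R) != 0 -> A k.+1%:R^-1) := @cvg_harmonic R _ nA.
  by apply: filterS => k; apply; rewrite invr_eq0 pnatr_eq0.
have := cvg_comp _ _ g0 fc; apply: cvg_trans; apply: near_eq_cvg.
by near=> k; rewrite /= invrK.
Unshelve. all: end_near. Qed.

(* Averaging over a short interval: G(t) (H(d) - H(0)) = H(t + d) - H(t) for an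
   antiderivative H of G, and H(d) - H(0) is invertible for small d. *)
Lemma one_parameter_expm N (G : R -> 'M[R]_N) :
  (forall r c, continuous (fun t => G t r c)) ->
  (forall s t, G (s + t) = G s *m G t) -> G 0 = 1%:M ->
  exists B, forall t, G t = expm (t *: B).
Proof.
move=> Gc GD G0.
have /choice [H0 H0d] : forall rc : 'I_N * 'I_N, exists H : R -> R,
    forall t, -1 < t -> is_derive t (1 : R) H (G t rc.1 rc.2).
  by move=> rc; apply: antiderivative.
pose H t : 'M[R]_N := \matrix_(r, c) H0 (r, c) t.
have Hd t : -1 < t -> mx_derive t H (G t).
  move=> t1 r c; apply: (is_derive_fun_eq (H0d (r, c) t t1)) => // s.
  by rewrite mxE.
(* [H] is an antiderivative only beyond -1; keeping [t] and [s] above -1/2 keeps [s + t] in that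
   range. The difference [D] is constant in [s] because G(s + t) = G(t) G(s), and 1/4 leaves room on
   both sides of 0. *)
have key t d : - 2^-1 < t -> - 4^-1 < d -> 0 <= d + 4^-1 ->
    G t *m (H d - H 0) = H (t + d) - H t.
  move=> t2 d4 d40.
  pose D s := H (1 * s + t) - G t *m H s.
  have Dd s : - 2^-1 < s -> mx_derive s D 0.
    move=> s2; have s1 : -1 < 1 * s + t by lra.
    apply: (mx_derive_eq (mx_derive_sub (mx_derive_affine (Hd _ s1))
      (mx_derive_mull (G t) (Hd s _)))) => //; first lra.
    by rewrite scale1r mul1r (addrC s) GD subrr.
  have DE s : - 4^-1 <= s -> D s = D (- 4^-1).
    move=> s4; apply/matrixP => r c.
    apply: (@derive_zero_const (fun s => D s r c) (- 2^-1)) => //; last lra.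
    by move=> u u2; have := Dd u u2 r c; rewrite mxE.
  have : D d = D 0 by rewrite DE ?[RHS]DE //; lra.
  rewrite /D mul1r mulr0 add0r.
  rewrite mulmxBr [d + t]addrC => /eqP.
  rewrite subr_eq => /eqP ->.
  by rewrite [RHS]addrAC [H t - _]addrC addrK [RHS]addrC.
(* The difference quotient of [H] at 0 tends to G(0) = 1, so its determinant is positive near 0 and
   [H d - H 0] is invertible for some small nonzero [d]. *)
have qd : (fun h => \det (h^-1 *: (H h - H 0))) @ 0^' --> (1 : R).
  rewrite -(det1 R N) -G0; apply: cvg_det => r c.
  have := is_derive_quotient (Hd 0 _ r c); rewrite ltrN10 => /(_ isT).
  by apply: cvg_trans; apply: near_eq_cvg; near=> h; rewrite !mxE.
have [d [d0 d4 Du]] : exists d : R, [/\ d != 0, `|d| < 4^-1 & H d - H 0 \in unitmx].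
  have n1 : \forall h \near 0^', 0 < \det (h^-1 *: (H h - H 0)).
    exact: (cvgr_gt _ qd).
  have n2 : \forall h \near (0 : R)^', `|h| < 4^-1.
    by apply: dnbhs0_lt; rewrite invr_gt0.
  have n3 : \forall h \near (0 : R)^', h != 0 by exact: nbhs_dnbhs_neq.
  near (0 : R)^' => h; exists h; split.
  - by near: h.
  - by near: h.
  have h0 : h != 0 by near: h.
  have : 0 < \det (h^-1 *: (H h - H 0)) by near: h.
  rewrite detZ => det0; rewrite unitmxE unitfE; apply: contraTneq det0 => ->.
  by rewrite mulr0 ltxx.
have GE t : - 2^-1 < t -> G t = (H (1 * t + d) - H t) *m invmx (H d - H 0).
  move=> t2; rewrite mul1r -key ?mulmxK //; first by move: d4; rewrite ltr_norml => /andP [].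
  by move: d4; rewrite ltr_norml => /andP [? _]; lra.
have [B Bd] : exists B, mx_derive 0 G B.
  exists ((1 *: G (1 * 0 + d) - G 0) *m invmx (H d - H 0)) => r c.
  have d1 : -1 < 1 * 0 + d by move: d4; rewrite ltr_norml => /andP [? _]; lra.
  have := mx_derive_mulr (invmx (H d - H 0)) (mx_derive_sub
    (mx_derive_affine (Hd _ d1)) (Hd 0 (ltrN10 _))) r c.
  apply: near_eq_is_derive; near=> t; rewrite GE //.
  have : `|t| < 2^-1.
    by near: t; apply: (@nbhs0_lt R R^o); rewrite invr_gt0.
  by rewrite ltr_norml => /andP [].
(* The derivative at 0 gives the derivative at any s, since G(u) = G(u - s) G(s). *)
exists B => t; rewrite -[RHS]mulmx1 -G0; apply: expm_flow => s.
apply: (@mx_derive_eq _ _ _ _ (fun u => G (1 * u - s) *m G s)).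
- apply: mx_derive_mulr; apply: mx_derive_affine.
  by rewrite mul1r subrr; exact: Bd.
- by move=> u; rewrite -GD mul1r subrK.
- by rewrite scale1r.
Unshelve. all: end_near. Qed.

Lemma mnormD m n (A B : 'M[R]_(m, n)) : mnorm (A + B) <= mnorm A + mnorm B.
Proof.
rewrite /mnorm -big_split; apply: ler_sum => r _ /=.
by rewrite -big_split; apply: ler_sum => c _; rewrite mxE ler_normD.
Qed.

Lemma mnormM m n p (A : 'M[R]_(m, n)) (B : 'M[R]_(n, p)) : mnorm (A *m B) <= mnorm A * mnorm B.
Proof.
rewrite {1 2}/mnorm mulr_suml; apply: ler_sum => r _.
rewrite mulr_suml.
apply: (@le_trans _ _ (\sum_c \sum_j `|A r j| * `|B j c|)).
  apply: ler_sum => c _; rewrite mxE; apply: (le_trans (ler_norm_sum _ _ _)).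
  by apply: ler_sum => j _; rewrite normrM.
rewrite exchange_big; apply: ler_sum => j _.
by rewrite -mulr_sumr ler_wpM2l // mnorm_row.
Qed.

(** Telescoping: M^(k+1) - E^(k+1) = M (M^k - E^k) + (M - E) E^k. The identity has norm n for
    [mnorm], so the hypotheses bound the distance of [M] and [E] to the identity; each factor then
    costs 1 + w. *)
Lemma mnorm_expB n (M E : 'M[R]_n) (w : R) k : 0 <= w ->
  mnorm (M - 1%:M) <= w -> mnorm (E - 1%:M) <= w ->
  mnorm (M ^+ k - E ^+ k) <= k%:R * (1 + w) ^+ k * mnorm (M - E).
Proof.
move=> w0 Mw Ew.
have mulw (A B : 'M[R]_n) : mnorm (A - 1%:M) <= w -> mnorm (A *m B) <= (1 + w) * mnorm B.
  move=> Aw; rewrite -[A](subrK 1%:M) mulmxDl mul1mx addrC mulrDl mul1r.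
  apply: (le_trans (mnormD _ _)); rewrite lerD2l (le_trans (mnormM _ _)) //.
  by rewrite ler_wpM2r // mnorm_ge0.
have mulwr (A B : 'M[R]_n) : mnorm (A - 1%:M) <= w -> mnorm (B *m A) <= (1 + w) * mnorm B.
  move=> Aw; rewrite -[A](subrK 1%:M) mulmxDr mulmx1 addrC mulrDl mul1r.
  apply: (le_trans (mnormD _ _)); rewrite lerD2l (le_trans (mnormM _ _)) //.
  by rewrite mulrC ler_wpM2r // mnorm_ge0.
have w1 : 1 <= 1 + w by rewrite lerDl.
have powE (D : 'M[R]_n) j : mnorm (D *m E ^+ j) <= (1 + w) ^+ j * mnorm D.
  elim: j => [|j IH]; first by rewrite !expr0 mulmx1 mul1r.
  rewrite exprSr -[E ^+ j * E]/(E ^+ j *m E) mulmxA exprS -mulrA.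
  by apply: (le_trans (mulwr _ _ Ew)); rewrite ler_wpM2l // (le_trans ler01).
elim: k => [|k IH].
  rewrite !expr0 subrr !mul0r /mnorm big1 // => r _; rewrite big1 // => c _.
  by rewrite mxE normr0.
have -> : M ^+ k.+1 - E ^+ k.+1 = M *m (M ^+ k - E ^+ k) + (M - E) *m E ^+ k.
  by rewrite !exprS mulmxBr mulmxBl addrA subrK.
apply: (le_trans (mnormD _ _)).
have step1 := le_trans (mulw _ (M ^+ k - E ^+ k) Mw)
  (ler_wpM2l (le_trans ler01 w1) IH).
have step2 := powE (M - E) k.
rewrite exprS -natr1; set d := mnorm (M - E) in step1 step2 *.
set p := (1 + w) ^+ k in step1 step2 *.
have le2 : p * d <= (1 + w) * p * d.
  rewrite ler_wpM2r ?mnorm_ge0 // ler_peMl // exprn_ge0 //.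
  exact: le_trans ler01 w1.
have -> : (k%:R + 1) * ((1 + w) * p) * d = (1 + w) * (k%:R * p * d) + (1 + w) * p * d by ring.
exact: lerD step1 (le_trans step2 le2).
Qed.

Lemma expm_pow n (X : 'M[R]_n) t k : expm (t *: X) ^+ k = expm ((k%:R * t) *: X).
Proof.
elim: k => [|k IH]; first by rewrite expr0 mul0r scale0r expm0.
by rewrite exprS IH -[_ * _]/(_ *m _) -expmD -natr1 mulrDl mul1r addrC.
Qed.

Lemma cvg_mnorm (T : Type) (F : set_system T) (FF : Filter F) m n (A : T -> 'M[R]_(m, n)) (B : 'M[R]_(m, n)) :
  (forall r c, (fun x => A x r c) @ F --> B r c) -> (fun x => mnorm (A x)) @ F --> mnorm B.
Proof.
by move=> AB; apply: cvg_bigsum => r; apply: cvg_bigsum => c; apply: cvg_norm; exact: AB.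
Qed.

Lemma mnormZ m n (a : R) (A : 'M[R]_(m, n)) : mnorm (a *: A) = `|a| * mnorm A.
Proof.
rewrite /mnorm mulr_sumr; apply: eq_bigr => r _; rewrite mulr_sumr.
by apply: eq_bigr => c _; rewrite mxE normrM.
Qed.

(** The curves exp(tX) exp(tY) and exp(t(X + Y)) agree to first order at 0, so k times their
    difference at 1/k tends to 0. Passing to k-th powers multiplies that difference by at most k (1
    + C/k)^k, which is at most k e^C. *)
Lemma trotter n (X Y : 'M[R]_n) r c :
  (fun k => ((expm (k.+1%:R^-1 *: X) *m expm (k.+1%:R^-1 *: Y)) ^+ k.+1) r c)
    @ \oo --> expm (X + Y) r c.
Proof.
pose F t := expm (t *: X) *m expm (t *: Y).
pose E t := expm (t *: (X + Y)).
have Fd : mx_derive 0 F (X + Y).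
  apply: (mx_derive_eq (mx_derive_mul (expm_derive X 0) (expm_derive Y 0))) => //.
  by rewrite !scale0r !expm0 !mulmx1 mul1mx.
have Ed : mx_derive 0 E (X + Y).
  by apply: (mx_derive_eq (expm_derive _ 0)) => //; rewrite scale0r expm0 mulmx1.
have F0 : F 0 = 1%:M by rewrite /F !scale0r !expm0 mulmx1.
have E0 : E 0 = 1%:M by rewrite /E scale0r expm0.
pose h (k : nat) : R := k.+1%:R^-1.
have seqE (Z : R -> 'M[R]_n) D : mx_derive 0 Z D ->
    (fun k => k.+1%:R * mnorm (Z (h k) - Z 0)) @ \oo --> mnorm D.
  move=> Zd; rewrite (_ : (fun k => _) = fun k => mnorm (k.+1%:R *: (Z (h k) - Z 0))).
    apply: cvg_mnorm => i j; have := is_derive_seq (Zd i j).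
    by apply: cvg_trans; apply: near_eq_cvg; near=> k; rewrite !mxE.
  by apply/funext => k; rewrite mnormZ ger0_norm.
have FE := seqE _ _ (mx_derive_sub Fd Ed).
rewrite subrr F0 E0 subrr in FE.
have FE0 : (fun k => k.+1%:R * mnorm (F (h k) - E (h k))) @ \oo --> (0 : R).
  rewrite (_ : 0 = mnorm (0 : 'M[R]_n)); last first.
    rewrite /mnorm big1 // => i _; rewrite big1 // => j _; by rewrite mxE normr0.
  by move: FE; under [X in X @ _ --> _]funext => k do rewrite subr0.
pose C : R := mnorm (X + Y) + 1.
have Fb := cvgr_le (mnorm (X + Y)) (seqE _ _ Fd) C.
have Eb := cvgr_le (mnorm (X + Y)) (seqE _ _ Ed) C.
have EX k : E (h k) ^+ k.+1 = expm (X + Y).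
  by rewrite expm_pow /h mulfV ?scale1r // pnatr_eq0.
have C0 : 0 <= C by rewrite addr_ge0 // mnorm_ge0.
have bound : \forall k \near \oo, mnorm (F (h k) ^+ k.+1 - expm (X + Y)) <=
    expR C * (k.+1%:R * mnorm (F (h k) - E (h k))).
  have ltC : mnorm (X + Y) < C by rewrite ltrDl.
  have {}Fb := Fb _ ltC; have {}Eb := Eb _ ltC.
  near=> k.
  have k0 : (0 : R) < k.+1%:R by rewrite ltr0n.
  have w0 : 0 <= C / k.+1%:R by rewrite divr_ge0.
  have Fk : mnorm (F (h k) - 1%:M) <= C / k.+1%:R.
    by rewrite ler_pdivlMr // mulrC -F0; near: k; exact: Fb.
  have Ek : mnorm (E (h k) - 1%:M) <= C / k.+1%:R.
    by rewrite ler_pdivlMr // mulrC -E0; near: k; exact: Eb.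
  rewrite -(EX k); apply: (le_trans (mnorm_expB _ w0 Fk Ek)).
  rewrite mulrAC mulrC ler_wpM2r // ?mulr_ge0 ?mnorm_ge0 //.
  apply: (le_trans (lerXn2r _ _ _ (expR_ge1Dx _))); rewrite ?nnegrE ?expR_ge0 ?addr_ge0 //.
  by rewrite -expRM_natl mulrC divfK // pnatr_eq0.
have lim0 : (fun k => expR C * (k.+1%:R * mnorm (F (h k) - E (h k)))) @ \oo --> (0 : R).
  by rewrite -[X in _ --> X](mulr0 (expR C)); apply: cvgM => //; exact: cvg_cst.
apply/cvgrPdist_le => e e0.
have near_e := cvgr_le _ lim0 e e0; near=> k.
rewrite distrC; apply: (@le_trans _ _ (mnorm (F (h k) ^+ k.+1 - expm (X + Y)))).
  rewrite /mnorm (bigD1 r) //= (bigD1 c) //= !mxE -addrA lerDl addr_ge0 ?sumr_ge0 // => i _.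
  by rewrite sumr_ge0.
by apply: (@le_trans _ _ (expR C * (k.+1%:R * mnorm (F (h k) - E (h k))))); near: k;
  [exact: bound|exact: near_e].
Unshelve. all: end_near. Qed.

End OneParameterGroups.

(** * Derivatives of complex-valued functions *)

Section ComplexDerivatives.
Variable R : realType.
Local Notation C := R[i].
Implicit Types (c : R -> C).

Lemma cderive_eq c c' d d' : is_cderive0 c d -> c =1 c' -> d = d' -> is_cderive0 c' d'.
Proof. by move=> cd /funext <- <-. Qed.

Lemma cderive_const (a : C) : is_cderive0 (fun=> a) 0.
Proof. by split; exact: is_derive_const. Qed.

Lemma cderive_add c1 c2 d1 d2 : is_cderive0 c1 d1 -> is_cderive0 c2 d2 ->
  is_cderive0 (fun t => c1 t + c2 t) (d1 + d2).
Proof.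
case=> r1 i1 [r2 i2]; split.
- apply: (is_derive_fun_eq (is_derive_add r1 r2)) => [t|]; first by case: (c1 t); case: (c2 t).
  by case: (d1); case: (d2).
- apply: (is_derive_fun_eq (is_derive_add i1 i2)) => [t|]; first by case: (c1 t); case: (c2 t).
  by case: (d1); case: (d2).
Qed.

Lemma cderive_mul c1 c2 d1 d2 : is_cderive0 c1 d1 -> is_cderive0 c2 d2 ->
  is_cderive0 (fun t => c1 t * c2 t) (d1 * c2 0 + c1 0 * d2).
Proof.
case=> r1 i1 [r2 i2]; split.
- apply: (is_derive_fun_eq (is_derive_sub (is_derive_mul r1 r2) (is_derive_mul i1 i2))) => [t|].
    by case: (c1 t); case: (c2 t).
  by case: (d1) => ? ?; case: (d2) => ? ?; case: (c1 0) => ? ?; case: (c2 0) => ? ? /=; ring.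
- apply: (is_derive_fun_eq (is_derive_add (is_derive_mul r1 i2) (is_derive_mul i1 r2))) => [t|].
    by case: (c1 t); case: (c2 t).
  by case: (d1) => ? ?; case: (d2) => ? ?; case: (c1 0) => ? ?; case: (c2 0) => ? ? /=; ring.
Qed.

Lemma cderive_scale (a : C) c d : is_cderive0 c d -> is_cderive0 (fun t => a * c t) (a * d).
Proof.
move=> cd; apply: (cderive_eq (cderive_mul (cderive_const a) cd)) => //.
by rewrite mul0r add0r.
Qed.

Lemma cderive_sum (I : Type) (r : seq I) (P : pred I) (f : I -> R -> C) (d : I -> C) :
  (forall i, is_cderive0 (f i) (d i)) ->
  is_cderive0 (fun t => \sum_(i <- r | P i) f i t) (\sum_(i <- r | P i) d i).
Proof.
move=> fd; elim: r => [|i r IH].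
  by apply: (cderive_eq (cderive_const 0)) => [t|]; rewrite big_nil.
case Pi: (P i); last by apply: (cderive_eq IH) => [t|]; rewrite big_cons Pi.
by apply: (cderive_eq (cderive_add (fd i) IH)) => [t|]; rewrite big_cons Pi.
Qed.

Lemma cderive_prod (I : eqType) (r : seq I) (f : I -> R -> C) (d : I -> C) : uniq r ->
  (forall i, is_cderive0 (f i) (d i)) ->
  is_cderive0 (fun t => \prod_(i <- r) f i t)
    (\sum_(i <- r) d i * \prod_(j <- r | j != i) f j 0).
Proof.
move=> + fd; elim: r => [_|x r IH /= /andP [xr ur]].
  by apply: (cderive_eq (cderive_const 1)) => [t|]; rewrite big_nil.
apply: (cderive_eq (cderive_mul (fd x) (IH ur))) => [t|]; first by rewrite big_cons.
rewrite [RHS]big_cons big_cons eqxx /=; congr (_ * _ + _).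
  rewrite big_seq_cond [RHS]big_seq_cond; apply: eq_bigl => i.
  by rewrite andbT; case ir: (i \in r) => //=; rewrite (memPn xr).
rewrite mulr_sumr; apply: eq_big_seq => i ir.
by rewrite big_cons (memPnC xr _ ir) mulrCA.
Qed.

Lemma cderive_unique c d d' : is_cderive0 c d -> is_cderive0 c d' -> d = d'.
Proof.
case=> r1 i1 [r2 i2]; apply/eqP; rewrite eq_complex.
rewrite -(@derive_val _ _ _ _ _ _ _ r1) -(@derive_val _ _ _ _ _ _ _ r2).
by rewrite -(@derive_val _ _ _ _ _ _ _ i1) -(@derive_val _ _ _ _ _ _ _ i2) !eqxx.
Qed.

Lemma cderive0E c d : is_cderive0 c d -> cderive0 c = d.
Proof.
by move=> cd; apply: xget_unique => // d' cd'; exact: cderive_unique cd' cd.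
Qed.

(* Jacobi's formula. *)
Lemma cderive_det n (A : R -> 'M[C]_n) (D : 'M[C]_n) :
  (forall r q, is_cderive0 (fun t => A t r q) (D r q)) ->
  is_cderive0 (fun t => \det (A t)) (\tr (\adj (A 0) *m D)).
Proof.
move=> AD.
have H (s : 'S_n) := cderive_scale ((-1) ^+ s)
  (cderive_prod (index_enum_uniq 'I_n) (fun r => AD r (s r))).
apply: (cderive_eq (cderive_sum (index_enum _) xpredT H)) => // {H}.
(* The Leibniz rule regroups into determinants of [A 0] with row r replaced by that of [D], each
   then expanded along row r. *)
pose B r := \matrix_(p, q) if p == r then D r q else A 0 p q.
transitivity (\sum_r \det (B r)).
  under eq_bigr => s _ do rewrite mulr_sumr.
  rewrite exchange_big; apply: eq_bigr => r _; apply: eq_bigr => s _.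
  rewrite [in RHS](bigD1 r) //= mxE eqxx; congr (_ * (_ * _)).
  by apply: eq_bigr => j /negbTE jr; rewrite mxE jr.
rewrite mxtrace_mulC /mxtrace; apply: eq_bigr => r _.
rewrite (expand_det_row _ r) mxE; apply: eq_bigr => q _.
rewrite !mxE eqxx /cofactor; congr (_ * (_ * \det _)).
by apply/matrixP => a b; rewrite !mxE eq_sym (negbTE (neq_lift _ _)).
Qed.

End ComplexDerivatives.

(** * Derivatives of curves in a vector space without topology *)

Section VectorDerivatives.
Variable R : realType.
Local Notation C := R[i].
Implicit Types (V W : lmodType C).

(** The operators of a module are controlled on its support only, hence linearity relative to a
    subspace. *)
Definition linear_on V W (S : set V) (b : V -> W) :=
  forall (a : C) u v, S u -> S v -> b (a *: u + v) = a *: b u + b v.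

Lemma subspace0 V (S : set V) : subspace S -> S 0. Proof. by case. Qed.

Lemma subspaceD V (S : set V) u v : subspace S -> S u -> S v -> S (u + v).
Proof. by move=> [_ Sl] Su Sv; rewrite -[u]scale1r; exact: Sl. Qed.

Lemma subspaceZ V (S : set V) a u : subspace S -> S u -> S (a *: u).
Proof. by move=> [S0 Sl] Su; rewrite -[_ *: _]addr0; exact: Sl. Qed.

Lemma subspaceN V (S : set V) u : subspace S -> S u -> S (- u).
Proof. by move=> S0 Su; rewrite -scaleN1r; exact: subspaceZ. Qed.

Lemma subspaceB V (S : set V) u v : subspace S -> S u -> S v -> S (u - v).
Proof. by move=> sS Su Sv; apply: subspaceD => //; exact: subspaceN. Qed.

Lemma subspace_sum V (S : set V) (I : Type) (r : seq I) (P : pred I) (f : I -> V) :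
  subspace S -> (forall i, P i -> S (f i)) -> S (\sum_(i <- r | P i) f i).
Proof.
move=> sS Sf; elim/big_rec: _ => [|i x Pi Sx]; first exact: subspace0.
by apply: subspaceD => //; exact: Sf.
Qed.

Lemma subspace_setT V : subspace (@setT V). Proof. by split. Qed.

Lemma linear_on0 V W (S : set V) (b : V -> W) : subspace S -> linear_on S b -> b 0 = 0.
Proof.
move=> sS bl; have := bl (-1) 0 0 (subspace0 sS) (subspace0 sS).
by rewrite scaler0 addr0 scaleN1r addNr.
Qed.

Lemma linear_onD V W (S : set V) (b : V -> W) u v : linear_on S b -> S u -> S v -> b (u + v) = b u + b v.
Proof. by move=> bl Su Sv; rewrite -[u]scale1r bl // !scale1r. Qed.

Lemma linear_onZ V W (S : set V) (b : V -> W) a u : subspace S -> linear_on S b -> S u ->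
  b (a *: u) = a *: b u.
Proof.
move=> sS bl Su; rewrite -[a *: u]addr0 bl //; last exact: subspace0.
by rewrite (linear_on0 sS bl) addr0.
Qed.

Lemma linear_onN V W (S : set V) (b : V -> W) u : subspace S -> linear_on S b -> S u ->
  b (- u) = - b u.
Proof. by move=> sS bl Su; rewrite -scaleN1r (linear_onZ _ sS) // scaleN1r. Qed.

Lemma linear_onB V W (S : set V) (b : V -> W) u v : subspace S -> linear_on S b -> S u -> S v ->
  b (u - v) = b u - b v.
Proof.
by move=> sS bl Su Sv; rewrite (linear_onD bl) ?(linear_onN sS) //; exact: subspaceN.
Qed.

Lemma linear_on_sum V W (S : set V) (b : V -> W) (I : Type) (r : seq I) (f : I -> V) :
  subspace S -> linear_on S b -> (forall i, S (f i)) -> b (\sum_(i <- r) f i) = \sum_(i <- r) b (f i).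
Proof.
move=> sS bl Sf; elim: r => [|i r IH]; first by rewrite !big_nil (linear_on0 sS).
rewrite !big_cons (linear_onD bl) ?IH //; exact: subspace_sum.
Qed.

Lemma linear_on_comb V W (S : set V) (b : V -> W) n (a : 'I_n -> C) (x : 'I_n -> V) :
  subspace S -> linear_on S b -> (forall i, S (x i)) ->
  b (\sum_i a i *: x i) = \sum_i a i *: b (x i).
Proof.
move=> sS bl Sx; rewrite (linear_on_sum _ sS bl).
  by apply: eq_bigr => i _; rewrite (linear_onZ _ sS bl).
by move=> i; exact: subspaceZ.
Qed.

Lemma vderive_eq V (g g' : R -> V) d d' : is_vderive0 g d -> g =1 g' -> d = d' -> is_vderive0 g' d'.
Proof. by move=> gd /funext <- <-. Qed.

(** The [e j] may be dependent, so the coefficients of a vanishing curve need not vanish. The matrix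
    [Q] of relations, however, kills the coefficient row at every t, and these scalar equations can
    be differentiated. Uniqueness of derivatives rests on this. *)
Lemma vderive_zero V m (e : 'I_m -> V) (c : 'I_m -> R -> C) c' :
  (forall j, is_cderive0 (c j) (c' j)) -> (forall t, \sum_j c j t *: e j = 0) ->
  \sum_j c' j *: e j = 0.
Proof.
move=> cd c0.
have [//||Q Qe] := @subspace_span_ker _ V [set 0] m e.
  by move=> a u v /= -> ->; rewrite scaler0 addr0.
have : (\row_j c' j) *m Q = 0.
  apply/rowP => k; rewrite !mxE.
  apply: (@cderive_unique R (fun t => \sum_j c j t * Q j k)).
    apply: (cderive_eq (cderive_sum (index_enum 'I_m) xpredT
      (fun j => cderive_scale (Q j k) (cd j)))) => [t|];
      by apply: eq_bigr => j _; rewrite ?mxE mulrC.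
  apply: (cderive_eq (cderive_const 0)) => // t.
  have : (\row_j c j t) *m Q = 0.
    by apply/Qe; rewrite /= -[RHS](c0 t); apply: eq_bigr => j _; rewrite mxE.
  move=> /rowP /(_ k); rewrite !mxE => H; rewrite -[LHS]H.
  by apply: eq_bigr => j _; rewrite mxE.
move=> /Qe /= H; rewrite -[RHS]H.
by apply: eq_bigr => j _; rewrite mxE.
Qed.

Lemma vderive_scale_sum V m (e : 'I_m -> V) (c : 'I_m -> R -> C) (c' : 'I_m -> C) :
  (forall j, is_cderive0 (c j) (c' j)) ->
  is_vderive0 (fun t => \sum_j c j t *: e j) (\sum_j c' j *: e j).
Proof. by move=> cd; exists m, e, c, c'. Qed.

Lemma vderive_add V (g h : R -> V) d d' :
  is_vderive0 g d -> is_vderive0 h d' -> is_vderive0 (fun t => g t + h t) (d + d').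
Proof.
move=> [m [e [c [c' [ge cd ->]]]]] [m2 [e2 [c2 [c2' [he cd2 ->]]]]].
exists (m + m2)%N.
exists (fun k => match fintype.split k with inl a => e a | inr b => e2 b end).
exists (fun k => match fintype.split k with inl a => c a | inr b => c2 b end).
exists (fun k => match fintype.split k with inl a => c' a | inr b => c2' b end).
split.
- move=> t; rewrite ge he big_split_ord /=; congr (_ + _); apply: eq_bigr => j _.
    by rewrite split_lshift.
  by rewrite split_rshift.
- by move=> k; case: fintype.split.
- rewrite big_split_ord /=; congr (_ + _); apply: eq_bigr => j _.
    by rewrite split_lshift.
  by rewrite split_rshift.
Qed.

Lemma vderive_scale V (a : C) (g : R -> V) d : is_vderive0 g d -> is_vderive0 (fun t => a *: g t) (a *: d).
Proof.
move=> [m [e [c [c' [ge cd ->]]]]].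
exists m, e, (fun j t => a * c j t), (fun j => a * c' j); split.
- by move=> t; rewrite ge scaler_sumr; apply: eq_bigr => j _; rewrite scalerA.
- by move=> j; exact: cderive_scale.
- by rewrite scaler_sumr; apply: eq_bigr => j _; rewrite scalerA.
Qed.

Lemma vderive_unique V (g : R -> V) d d' : is_vderive0 g d -> is_vderive0 g d' -> d = d'.
Proof.
move=> gd gd'; have := vderive_add gd (vderive_scale (-1) gd').
case=> m [e [c [c' [ge cd dE]]]].
apply/eqP; rewrite -subr_eq0 -scaleN1r dE; apply/eqP.
by apply: (vderive_zero cd) => t; rewrite -ge scaleN1r subrr.
Qed.

Lemma vderive0E V (g : R -> V) d : is_vderive0 g d -> vderive0 g = d.
Proof.
by move=> gd; apply: xget_unique => // d' gd'; exact: vderive_unique gd' gd.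
Qed.

Lemma vderive_const V (v : V) : is_vderive0 (fun=> v) 0.
Proof.
apply: (vderive_eq (@vderive_scale_sum V 1 (fun=> v) (fun _ _ => 1) (fun=> 0) (fun=> cderive_const 1))).
  by move=> t; rewrite big_ord1 scale1r.
by rewrite big_ord1 scale0r.
Qed.

(** The curve and its derivative are written over values of the curve itself. A map that is linear
    only on a subspace containing these values can then be applied term by term. *)
Lemma vderive_orbit V (g : R -> V) d : is_vderive0 g d ->
  exists N (t : 'I_N -> R) (a : 'I_N -> R -> C) (a' : 'I_N -> C),
    [/\ forall s, g s = \sum_l a l s *: g (t l), forall l, is_cderive0 (a l) (a' l),
        d = \sum_l a' l *: g (t l) & lin_indep (fun l => g (t l))].
Proof.
move=> gd; have [m [e [c [c' [ge cd _]]]]] := gd.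
have [N [t [B [_ gE free]]]] := @orbit_basis _ _ _ setT g m e c (fun x _ => ge x).
exists N, t, (fun l s => \sum_j c j s * B j l), (fun l => \sum_j c' j * B j l).
have ad l : is_cderive0 (fun s => \sum_j c j s * B j l) (\sum_j c' j * B j l).
  by apply: cderive_sum => j; apply: (cderive_eq (cderive_scale (B j l) (cd j))) => [s|]; rewrite mulrC.
split=> //; first by move=> s; exact: gE.
apply: (vderive_unique gd); apply: (vderive_eq (vderive_scale_sum _ ad)) => // s.
by rewrite -gE.
Qed.

Lemma vderive_in V (S : set V) (g : R -> V) d : subspace S -> (forall t, S (g t)) ->
  is_vderive0 g d -> S d.
Proof.
move=> sS Sg /vderive_orbit [N [t [a [a' [_ _ -> _]]]]].
by apply: subspace_sum => // l _; exact: subspaceZ.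
Qed.

Lemma vderive_linear V W (S : set V) (b : V -> W) (g : R -> V) d : subspace S ->
  linear_on S b -> (forall t, S (g t)) -> is_vderive0 g d -> is_vderive0 (fun t => b (g t)) (b d).
Proof.
move=> sS bl Sg /vderive_orbit [N [t [a [a' [gE ad -> _]]]]].
apply: (vderive_eq (vderive_scale_sum (fun l => b (g (t l))) ad)) => [s|].
  by rewrite [in RHS]gE (linear_on_comb _ sS bl).
by rewrite (linear_on_comb _ sS bl).
Qed.

(** Product rule for a map that is bilinear only on [S1] and [S2]: both curves are expanded over
    their own values, which lie there. *)
Lemma vderive_bilinear V1 V2 W (S1 : set V1) (S2 : set V2) (b : V1 -> V2 -> W)
    (g1 : R -> V1) (g2 : R -> V2) d1 d2 : subspace S1 -> subspace S2 ->
  (forall v, S2 v -> linear_on S1 (b^~ v)) -> (forall u, S1 u -> linear_on S2 (b u)) ->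
  (forall t, S1 (g1 t)) -> (forall t, S2 (g2 t)) ->
  is_vderive0 g1 d1 -> is_vderive0 g2 d2 ->
  is_vderive0 (fun t => b (g1 t) (g2 t)) (b d1 (g2 0) + b (g1 0) d2).
Proof.
move=> sS1 sS2 bl1 bl2 Sg1 Sg2 /vderive_orbit [N1 [t1 [a1 [a1' [g1E ad1 d1E _]]]]].
move=> /vderive_orbit [N2 [t2 [a2 [a2' [g2E ad2 d2E _]]]]].
have bE (x : 'I_N1 -> C) (y : 'I_N2 -> C) :
    b (\sum_l x l *: g1 (t1 l)) (\sum_l y l *: g2 (t2 l)) =
    \sum_l \sum_k (x l * y k) *: b (g1 (t1 l)) (g2 (t2 k)).
  have S2y : S2 (\sum_l y l *: g2 (t2 l)).
    by apply: subspace_sum => // l _; exact: subspaceZ.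
  rewrite (linear_on_comb x sS1 (bl1 _ S2y)) //; apply: eq_bigr => l _.
  rewrite (linear_on_comb y sS2 (bl2 _ (Sg1 _))) // scaler_sumr.
  by apply: eq_bigr => k _; rewrite scalerA.
pose h (l : 'I_N1) t := \sum_k (a1 l t * a2 k t) *: b (g1 (t1 l)) (g2 (t2 k)).
have hd l : is_vderive0 (h l) (\sum_k (a1' l * a2 k 0 + a1 l 0 * a2' k) *: b (g1 (t1 l)) (g2 (t2 k))).
  by apply: vderive_scale_sum => k; exact: cderive_mul.
have sumd : forall r : seq 'I_N1, is_vderive0 (fun t => \sum_(l <- r) h l t)
    (\sum_(l <- r) \sum_k (a1' l * a2 k 0 + a1 l 0 * a2' k) *: b (g1 (t1 l)) (g2 (t2 k))).
  elim=> [|l r IH].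
    by apply: (vderive_eq (vderive_const 0)) => [s|]; rewrite big_nil.
  by apply: (vderive_eq (vderive_add (hd l) IH)) => [s|]; rewrite big_cons.
apply: (vderive_eq (sumd (index_enum _))) => [s|].
  by rewrite [in RHS]g1E [in RHS]g2E bE.
rewrite d1E d2E (g1E 0) (g2E 0) !bE -big_split; apply: eq_bigr => l _.
by rewrite -big_split; apply: eq_bigr => k _; rewrite scalerDl.
Qed.

Lemma vderive_cscale V (c : R -> C) (g : R -> V) c' d : is_cderive0 c c' -> is_vderive0 g d ->
  is_vderive0 (fun t => c t *: g t) (c' *: g 0 + c 0 *: d).
Proof.
move=> cd gd.
apply: (@vderive_bilinear C^o V V setT setT (fun a v => a *: v) c g c' d) => //.
- by move=> v _ a x y _ _; rewrite scalerDl scalerA.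
- by move=> u _ a x y _ _; rewrite scalerDr !scalerA mulrC.
apply: (vderive_eq (@vderive_scale_sum C^o 1 (fun=> 1) (fun=> c) (fun=> c') (fun=> cd))) => [t|];
  by rewrite big_ord1 /GRing.scale /= mulr1.
Qed.

End VectorDerivatives.

(** * Linear flows and the subspaces they preserve *)

Section Flows.
Variable R : realType.
Local Notation C := R[i].

Lemma cRe_sum (I : Type) (r : seq I) (f : I -> C) :
  complex.Re (\sum_(i <- r) f i) = \sum_(i <- r) complex.Re (f i).
Proof.
elim: r => [|i r IH]; first by rewrite !big_nil.
by rewrite !big_cons -IH; case: (f i); case: (\sum_(i <- r) f i).
Qed.

Lemma cIm_sum (I : Type) (r : seq I) (f : I -> C) :
  complex.Im (\sum_(i <- r) f i) = \sum_(i <- r) complex.Im (f i).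
Proof.
elim: r => [|i r IH]; first by rewrite !big_nil.
by rewrite !big_cons -IH; case: (f i); case: (\sum_(i <- r) f i).
Qed.

Lemma is_derive_unshift (f : R -> R) (t d : R) :
  is_derive (0 : R) (1 : R) (fun s => f (t + s)) d -> is_derive t (1 : R) f d.
Proof.
move=> fd; apply: (@is_derive_fun_eq R (fun u => f (t + (1 * u - t)))).
- apply: (@is_derive_affine R (fun s => f (t + s))).
  by rewrite mul1r subrr; exact: fd.
- by move=> u; rewrite mul1r addrC subrK.
- by rewrite mul1r.
Qed.

Lemma complex_ode_zero N (z : 'I_N -> R -> C) (B : 'M[C]_N) :
  (forall t p, is_cderive0 (fun s => z p (t + s)) (\sum_l z l t * B l p)) ->
  (forall p, z p 0 = 0) -> forall t p, z p t = 0.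
Proof.
move=> zd z0.
pose y (k : bool * 'I_N) t := if k.1 then complex.Im (z k.2 t) else complex.Re (z k.2 t).
pose b (k l : bool * 'I_N) := match k.1, l.1 with
  | false, false | true, true => complex.Re (B l.2 k.2)
  | false, true => - complex.Im (B l.2 k.2)
  | true, false => complex.Im (B l.2 k.2) end.
have y0 t k : y k t = 0.
  apply: (@ode_zero R _ y b) => {t k} [t k|k]; last by rewrite /y z0; case: k.1.
  have -> : \sum_l b k l * y l t = \sum_q \sum_l b k (q, l) * y (q, l) t.
    by rewrite pair_bigA; apply: eq_bigr => -[].
  rewrite big_bool -big_split /=.
  have [zr zi] := zd t k.2; rewrite /y /b; case: k.1 => /=; apply: is_derive_unshift.
    apply: (is_derive_fun_eq zi) => //; rewrite cIm_sum; apply: eq_bigr => l _.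
    by case: (z l t) => ? ?; case: (B l k.2) => ? ? /=; ring.
  apply: (is_derive_fun_eq zr) => //; rewrite cRe_sum; apply: eq_bigr => l _.
  by case: (z l t) => ? ?; case: (B l k.2) => ? ? /=; ring.
move=> t p; have := y0 t (false, p); have := y0 t (true, p).
by rewrite /y /=; case: (z p t) => ? ? /= -> ->.
Qed.

Definition flow (V : lmodType C) (S : set V) (T : R -> V -> V) (D : V -> V) :=
  [/\ subspace S, forall t x, S x -> S (T t x), forall t, linear_on S (T t),
      (forall x, S x -> T 0 x = x) /\
      (forall s t x, S x -> T (s + t) x = T s (T t x))
    & forall x, S x -> is_vderive0 (T^~ x) (D x)].

Section FlowTheory.
Variables (V : lmodType C) (S : set V) (T : R -> V -> V) (D : V -> V).
Hypothesis fl : flow S T D.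

Lemma flow_in x : S x -> S (D x).
Proof.
case: fl => sS ST _ _ Td Sx; apply: (vderive_in sS _ (Td _ Sx)) => t; exact: ST.
Qed.

Lemma flow_linear : linear_on S D.
Proof.
case: fl => sS ST Tl _ Td a u v Su Sv.
apply: (vderive_unique (Td _ (sS.2 a u v Su Sv))).
apply: (vderive_eq (vderive_add (vderive_scale a (Td _ Su)) (Td _ Sv))) => // t.
by rewrite Tl.
Qed.

(* The coordinates of T_t x modulo A satisfy a linear differential equation. *)
Lemma flow_stable (A : set V) : subspace A -> A `<=` S ->
  (forall x, A x -> A (D x)) -> forall t x, A x -> A (T t x).
Proof.
move=> sA AS AD t x Ax; have Sx := AS _ Ax.
have [sS ST Tl [T0 TD] Td] := fl.
pose g s := T s x.
have Sg s : S (g s) by exact: ST.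
have gD s u : g (u + s) = T u (g s) by rewrite /g TD.
have [N [tt [a [_ [gE _ _ free]]]]] := vderive_orbit (Td _ Sx).
have {}gE : forall s, g s = \sum_l a l s *: g (tt l) by exact: gE.
have {}free : lin_indep (fun l => g (tt l)) by exact: free.
(* The row [B l] holds the coordinates of [D (g (tt l))] in the basis of values of the orbit, so the
   span of the orbit is stable under [D]. *)
have /choice [B Bd] : forall l, exists B : 'rV[C]_N,
    (forall p, is_cderive0 (fun s => a p (s + tt l)) (B 0 p)) /\
    D (g (tt l)) = \sum_p B 0 p *: g (tt p).
  move=> l; have := Td _ (Sg (tt l)) => [[m [e [c [c' [ge cd dE]]]]]].
  have [Th ThE] := indep_coord e free.
  have aE s : \row_p a p (s + tt l) = (\row_j c j s) *m Th.
    apply: ThE; under eq_bigr => p _ do rewrite mxE.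
    by rewrite -gE gD ge; apply: eq_bigr => j _; rewrite mxE.
  have ad p : is_cderive0 (fun s => a p (s + tt l)) (((\row_j c' j) *m Th) 0 p).
    apply: (cderive_eq (cderive_sum (index_enum 'I_m) xpredT
      (fun j => cderive_scale (Th j p) (cd j)))) => [s|].
      have /rowP /(_ p) := aE s; rewrite !mxE => ->.
      by apply: eq_bigr => j _; rewrite mxE mulrC.
    by rewrite mxE; apply: eq_bigr => j _; rewrite mxE mulrC.
  exists ((\row_j c' j) *m Th); split=> //.
  apply: (vderive_unique (Td _ (Sg (tt l)))).
  apply: (vderive_eq (vderive_scale_sum (fun p => g (tt p)) ad)) => // s.
  by rewrite -gD gE.
pose BB : 'M[C]_N := \matrix_l B l.
have [Q QA] := subspace_span_ker (fun l => g (tt l)) sA.1 sA.2.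
have DE (y : 'rV[C]_N) : D (\sum_l y 0 l *: g (tt l)) = \sum_p (y *m BB) 0 p *: g (tt p).
  rewrite (linear_on_comb _ sS flow_linear) //.
  under eq_bigr => l _ do rewrite (Bd l).2 scaler_sumr.
  rewrite exchange_big; apply: eq_bigr => p _; rewrite mxE scaler_suml.
  by apply: eq_bigr => l _; rewrite scalerA mxE.
(* Rows killed by [Q] are those of vectors in [A]. As [D] preserves [A], so does [BB], and [B2] is
   the matrix it induces on the coordinates modulo [A]. *)
have [B2 B2E] : exists B2, BB *m Q = Q *m B2.
  apply: ker_factor => y /QA /AD; rewrite DE => /QA.
  by rewrite mulmxA.
have ad u p : is_cderive0 (fun s => a p (u + s)) (\sum_l a l u * BB l p).
  apply: (cderive_eq (cderive_sum (index_enum 'I_N) xpredT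
      (fun l => cderive_scale (a l u) ((Bd l).1 p)))) => [s|]; last first.
    by apply: eq_bigr => l _; rewrite mxE.
  have : \row_p a p (u + s) - \row_p \sum_l a l u * a p (s + tt l) = 0.
    apply: free; under eq_bigr => q _ do rewrite !mxE scalerBl.
    rewrite sumrB -gE (addrC u) gD gE (linear_on_comb _ sS (Tl s)) //.
    apply/eqP; rewrite subr_eq0; apply/eqP.
    under eq_bigr => l _ do rewrite -gD gE scaler_sumr.
    rewrite exchange_big; apply: eq_bigr => q _; rewrite scaler_suml.
    by apply: eq_bigr => l _; rewrite scalerA.
  by move=> /eqP; rewrite subr_eq0 => /eqP /rowP /(_ p); rewrite !mxE => <-.
pose z p t := ((\row_l a l t) *m Q) 0 p.
have z0 : forall t p, z p t = 0.
  apply: (@complex_ode_zero N z B2) => [u p|p].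
    apply: (cderive_eq (cderive_sum (index_enum 'I_N) xpredT
      (fun l => cderive_scale (Q l p) (ad u l)))) => [s|].
      by rewrite /z mxE; apply: eq_bigr => l _; rewrite mxE mulrC.
    have -> : \sum_l z l u * B2 l p = (((\row_l a l u) *m BB) *m Q) 0 p.
      rewrite -mulmxA B2E mulmxA [RHS]mxE; by apply: eq_bigr.
    rewrite [RHS]mxE; apply: eq_bigr => l _; rewrite mulrC; congr (_ * _).
    by rewrite mxE; apply: eq_bigr => k _; rewrite !mxE.
  have : (\row_l a l 0) *m Q = 0.
    apply/QA; under eq_bigr => l _ do rewrite mxE.
    by rewrite -gE /g T0.
  by rewrite /z => ->; rewrite mxE.
rewrite -[T t x]/(g t) gE.
have := (QA (\row_l a l t)).2; under eq_bigr => l _ do rewrite mxE.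
by apply; apply/rowP => p; have := z0 t p; rewrite /z => ->; rewrite mxE.
Qed.

End FlowTheory.

Lemma flow_scalar (V : lmodType C) (S : set V) (e : R -> C) (c : C) : subspace S ->
  e 0 = 1 -> (forall s t, e (s + t) = e s * e t) -> is_cderive0 e c ->
  flow S (fun t v => e t *: v) (fun v => c *: v).
Proof.
move=> sS e0 eD ed; split=> //.
- by move=> t x; exact: subspaceZ.
- by move=> t a u v _ _; rewrite scalerDr !scalerA mulrC.
- by split=> [x _|s t x _]; rewrite ?e0 ?scale1r // eD scalerA.
- move=> x _; apply: (vderive_eq (vderive_cscale ed (vderive_const x))) => //.
  by rewrite scaler0 addr0.
Qed.

(** A graph stable in the product expresses that a map intertwines two flows; with a scalar flow as
    second factor, it turns an eigenvector of the generator into an eigenvector of the group.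
    Combined with [flow_stable], both can be checked on generators. *)
Lemma flow_prod (V W : lmodType C) (S : set V) (S' : set W) T D T' D' :
  flow S T D -> flow S' T' D' ->
  flow (fun p : (V * W)%type => S p.1 /\ S' p.2) (fun t p => (T t p.1, T' t p.2))
    (fun p => (D p.1, D' p.2)).
Proof.
case=> sS ST Tl [T0 TD] Td [sS' ST' Tl' [T0' TD'] Td'].
have lin1 : linear_on (@setT V) (fun v => (v, 0) : (V * W)%type).
  by move=> a u v _ _; congr pair; rewrite /= scaler0 addr0.
have lin2 : linear_on (@setT W) (fun v => (0, v) : (V * W)%type).
  by move=> a u v _ _; congr pair; rewrite /= scaler0 addr0.
split.
- split=> [|a u v [u1 u2] [v1 v2]]; first by split; exact: subspace0.
  by split; [exact: sS.2|exact: sS'.2].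
- by move=> t x [x1 x2]; split; [exact: ST|exact: ST'].
- by move=> t a u v [u1 u2] [v1 v2]; congr pair; [exact: Tl|exact: Tl'].
- split=> [[x y] [/= Sx Sy]|s t [x y] [/= Sx Sy]].
    by rewrite T0 ?T0'.
  by rewrite TD ?TD'.
- move=> [x y] [/= Sx Sy].
  have d1 := vderive_linear (subspace_setT _) lin1 (fun _ => I) (Td _ Sx).
  have d2 := vderive_linear (subspace_setT _) lin2 (fun _ => I) (Td' _ Sy).
  apply: (vderive_eq (vderive_add d1 d2)) => [t|].
    by congr pair; rewrite ?addr0 ?add0r.
  by congr pair; rewrite ?addr0 ?add0r.
Qed.

End Flows.

(** * The stabilizer K as a unitary group *)

Section SymplecticLie.
Variable R : realType.
Local Notation C := R[i].
Local Notation iC := (iC R).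

Definition toC m n (A : 'M[R]_(m, n)) : 'M[C]_(m, n) := map_mx (real_complex R) A.
Definition mxRe m n (A : 'M[C]_(m, n)) : 'M[R]_(m, n) := map_mx (@complex.Re R) A.
Definition mxIm m n (A : 'M[C]_(m, n)) : 'M[R]_(m, n) := map_mx (@complex.Im R) A.
Definition adj m n (A : 'M[C]_(m, n)) : 'M[C]_(n, m) := map_mx conjc A^T.

Lemma iC_sqr : iC * iC = -1.
Proof. by apply/eqP; rewrite eq_complex /= !mul0r !mulr1 mulr0 sub0r addr0 oppr0 !eqxx. Qed.

Lemma mxReD m n (A B : 'M[C]_(m, n)) : mxRe (A + B) = mxRe A + mxRe B.
Proof. by apply/matrixP => r c; rewrite !mxE; case: (A r c); case: (B r c). Qed.

Lemma mxImD m n (A B : 'M[C]_(m, n)) : mxIm (A + B) = mxIm A + mxIm B.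
Proof. by apply/matrixP => r c; rewrite !mxE; case: (A r c); case: (B r c). Qed.

Lemma mxReM m n p (A : 'M[C]_(m, n)) (B : 'M[C]_(n, p)) :
  mxRe (A *m B) = mxRe A *m mxRe B - mxIm A *m mxIm B.
Proof.
apply/matrixP => r c; rewrite !mxE cRe_sum -sumrB; apply: eq_bigr => j _.
by rewrite !mxE; case: (A r j); case: (B j c).
Qed.

Lemma mxImM m n p (A : 'M[C]_(m, n)) (B : 'M[C]_(n, p)) :
  mxIm (A *m B) = mxRe A *m mxIm B + mxIm A *m mxRe B.
Proof.
apply/matrixP => r c; rewrite !mxE cIm_sum -big_split; apply: eq_bigr => j _.
by rewrite !mxE; case: (A r j); case: (B j c).
Qed.

Lemma mxReN m n (A : 'M[C]_(m, n)) : mxRe (- A) = - mxRe A.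
Proof. by apply/matrixP => r c; rewrite !mxE; case: (A r c). Qed.

Lemma mxImN m n (A : 'M[C]_(m, n)) : mxIm (- A) = - mxIm A.
Proof. by apply/matrixP => r c; rewrite !mxE; case: (A r c). Qed.

Lemma mxReZ m n (a : C) (A : 'M[C]_(m, n)) :
  mxRe (a *: A) = complex.Re a *: mxRe A - complex.Im a *: mxIm A.
Proof. by apply/matrixP => r c; rewrite !mxE; case: a; case: (A r c). Qed.

Lemma mxImZ m n (a : C) (A : 'M[C]_(m, n)) :
  mxIm (a *: A) = complex.Re a *: mxIm A + complex.Im a *: mxRe A.
Proof. by apply/matrixP => r c; rewrite !mxE; case: a; case: (A r c). Qed.

Lemma mxRe_toC m n (A : 'M[R]_(m, n)) : mxRe (toC A) = A.
Proof. by apply/matrixP => r c; rewrite !mxE. Qed.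

Lemma mxIm_toC m n (A : 'M[R]_(m, n)) : mxIm (toC A) = 0.
Proof. by apply/matrixP => r c; rewrite !mxE. Qed.

Lemma mxRe0 m n : mxRe (0 : 'M[C]_(m, n)) = 0. Proof. by apply/matrixP => r c; rewrite !mxE. Qed.
Lemma mxIm0 m n : mxIm (0 : 'M[C]_(m, n)) = 0. Proof. by apply/matrixP => r c; rewrite !mxE. Qed.

Lemma mxC_eq m n (A B : 'M[C]_(m, n)) : mxRe A = mxRe B -> mxIm A = mxIm B -> A = B.
Proof.
move=> /matrixP re /matrixP im; apply/matrixP => r c.
have := re r c; have := im r c; rewrite !mxE; case: (A r c); case: (B r c) => /= ? ? ? ? -> ->.
by [].
Qed.

Lemma mxC_split m n (A : 'M[C]_(m, n)) : A = toC (mxRe A) + iC *: toC (mxIm A).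
Proof.
by apply: mxC_eq; rewrite ?mxReD ?mxImD ?mxReZ ?mxImZ !(mxRe_toC, mxIm_toC) /= ?scale0r
  ?scale1r ?scaler0 ?subr0 ?addr0 ?add0r.
Qed.

Lemma toCM m n p (A : 'M[R]_(m, n)) (B : 'M[R]_(n, p)) : toC (A *m B) = toC A *m toC B.
Proof. exact: map_mxM. Qed.

Lemma toCD m n (A B : 'M[R]_(m, n)) : toC (A + B) = toC A + toC B.
Proof. exact: map_mxD. Qed.

Lemma toCN m n (A : 'M[R]_(m, n)) : toC (- A) = - toC A.
Proof. exact: map_mxN. Qed.

Lemma toC0 m n : toC (0 : 'M[R]_(m, n)) = 0.
Proof. exact: map_mx0. Qed.

Lemma toC1 n : toC (1%:M : 'M[R]_n) = 1%:M.
Proof. exact: map_mx1. Qed.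

Lemma toC_inj m n (A B : 'M[R]_(m, n)) : toC A = toC B -> A = B.
Proof. by move=> AB; rewrite -(mxRe_toC A) AB mxRe_toC. Qed.

Lemma toC_inv n (A : 'M[R]_n) : toC (invmx A) = invmx (toC A).
Proof. exact: map_invmx. Qed.

Lemma adjM m n p (A : 'M[C]_(m, n)) (B : 'M[C]_(n, p)) : adj (A *m B) = adj B *m adj A.
Proof. by rewrite /adj trmx_mul map_mxM. Qed.

Lemma adjK m n (A : 'M[C]_(m, n)) : adj (adj A) = A.
Proof. by apply/matrixP => r c; rewrite !mxE conjcK. Qed.

Lemma mxRe_adj m n (A : 'M[C]_(m, n)) : mxRe (adj A) = (mxRe A)^T.
Proof. by apply/matrixP => r c; rewrite !mxE; case: (A c r). Qed.

Lemma mxIm_adj m n (A : 'M[C]_(m, n)) : mxIm (adj A) = - (mxIm A)^T.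
Proof. by apply/matrixP => r c; rewrite !mxE; case: (A c r). Qed.

Section Rank.
Variable n : nat.

(** For u = A + iB this is (A, B; -B, A), under which the unitary group becomes K; [tau] is its
    inverse on the matrices commuting with J. *)
Definition phi (u : 'M[C]_n) : 'M[R]_(n + n) := block_mx (mxRe u) (mxIm u) (- mxIm u) (mxRe u).
Definition tau (k : 'M[R]_(n + n)) : 'M[C]_n := toC (ulsubmx k) - iC *: toC (dlsubmx k).
Local Notation J := (Jmx R n).

Lemma phiM u v : phi (u *m v) = phi u *m phi v.
Proof.
rewrite /phi mulmx_block mxReM mxImM !mulmxN !mulNmx.
by congr block_mx; rewrite ?opprD // addrC.
Qed.

Lemma phiD u v : phi (u + v) = phi u + phi v.
Proof. by rewrite /phi mxReD mxImD opprD add_block_mx. Qed.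

Lemma phiN u : phi (- u) = - phi u.
Proof. by rewrite /phi mxReN mxImN opp_block_mx. Qed.

Lemma phi1 : phi 1%:M = 1%:M.
Proof. by rewrite /phi -toC1 mxRe_toC mxIm_toC oppr0 -scalar_mx_block. Qed.

Lemma phi0 : phi 0 = 0.
Proof. by rewrite /phi mxRe0 mxIm0 oppr0 block_mx0. Qed.

Lemma phi_adj u : phi (adj u) = (phi u)^T.
Proof. by rewrite /phi tr_block_mx mxRe_adj mxIm_adj opprK linearN. Qed.

Lemma tau_phi u : tau (phi u) = u.
Proof.
rewrite /tau /phi block_mxKul block_mxKdl toCN scalerN opprK.
by rewrite -mxC_split.
Qed.

Lemma phi_inj : injective phi.
Proof. by move=> u v /(congr1 tau); rewrite !tau_phi. Qed.

Lemma Jmx_phi : J = phi (- iC%:M).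
Proof.
rewrite /phi mxReN mxImN.
have -> : mxRe (iC%:M : 'M[C]_n) = 0 by apply/matrixP => r c; rewrite !mxE; case: (r == c).
have -> : mxIm (iC%:M : 'M[C]_n) = 1%:M by apply/matrixP => r c; rewrite !mxE; case: (r == c).
by rewrite oppr0 opprK.
Qed.

Lemma phi_commJ u : phi u *m J = J *m phi u.
Proof. by rewrite Jmx_phi -!phiM mulmxN mulNmx mul_scalar_mx mul_mx_scalar. Qed.

Lemma commJ_phi k : k *m J = J *m k -> k = phi (tau k).
Proof.
rewrite -[k]submxK /Jmx !mulmx_block !mulmx0 !mul0mx !mulmxN !mulNmx !mulmx1 !mul1mx.
rewrite !add0r !addr0 => /eq_block_mx [ur _ dr _].
rewrite /phi /tau block_mxKul block_mxKdl mxReD mxImD mxReN mxImN mxReZ mxImZ.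
rewrite !(mxRe_toC, mxIm_toC) /= !(scale0r, scale1r, scaler0, subr0, oppr0, addr0, add0r, opprK).
by rewrite ur dr.
Qed.

Lemma Jmx_tr : J^T = - J.
Proof.
have tN : (- 1%:M : 'M[R]_n)^T = - 1%:M by rewrite raddfN /= trmx1.
by rewrite /Jmx tr_block_mx opp_block_mx !trmx0 trmx1 tN oppr0 opprK.
Qed.

Lemma Jmx_sqr : J *m J = - 1%:M.
Proof.
rewrite Jmx_phi -phiM mulNmx mulmxN opprK mul_scalar_mx scale_scalar_mx iC_sqr.
by rewrite raddfN /= phiN phi1.
Qed.

Lemma mul_iC_adj (x : 'cV[C]_n) : adj x *m x = 0 -> x = 0.
Proof.
move=> /matrixP /(_ 0 0); rewrite !mxE => x0.
have : forall r, x r 0 * (x r 0)^*%C = 0.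
  have /psumr_eq0P H : \sum_r x r 0 * (x r 0)^*%C = 0.
    by rewrite -[RHS]x0; apply: eq_bigr => r _; rewrite !mxE mulrC.
  by move=> r; apply: H => // q _; exact: mulcJ_ge0.
move=> H; apply/matrixP => r c; rewrite ord1 mxE.
by have /eqP := H r; rewrite mulf_eq0 conjc_eq0 orbb => /eqP.
Qed.

(** [invmx] leaves a singular matrix unchanged, so the fixed point equation does not directly say
    that the denominator N is invertible. If N x = 0, then g sends (ix, x) to (Mx, 0), where the
    Hermitian form defined by J vanishes; g preserves this form, and its value at (ix, x) is a
    nonzero multiple of the squared norm of x. Once N is invertible, M = iN yields commutation with
    J on comparing real and imaginary parts. *)
Lemma KinfP g : Kinf g <-> g^T *m g = 1%:M /\ g *m J = J *m g.
Proof.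
split=> [[[gu gJ] gi]|[gg gJ]].
  pose A := toC (ulsubmx g); pose B := toC (ursubmx g).
  pose c := toC (dlsubmx g); pose d := toC (drsubmx g).
  have gE : toC g = block_mx A B c d.
    by rewrite /A /B /c /d -[in LHS](submxK g) /toC map_block_mx.
  have gJC : (toC g)^T *m toC J *m toC g = toC J.
    by rewrite -[in RHS]gJ !toCM /toC map_trmx.
  have JE : toC J = block_mx 0 (- 1%:M) 1%:M 0.
    by rewrite /toC /Jmx map_block_mx map_mxN !map_mx0 map_mx1.
  pose N := iC *: c + d; pose M := iC *: A + B.
  have MN : M *m invmx N = iC%:M.
    move: gi; rewrite /moebius -/(toC g) gE block_mxKul block_mxKur block_mxKdl block_mxKdr.
    by rewrite !mul_mx_scalar.
  have Nu : N \in unitmx.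
    rewrite -unitmx_tr -row_free_unit -kermx_eq0; apply/rowV0P => y.
    move=> /sub_kermxP yN; pose x := y^T.
    have Nx : N *m x = 0 by rewrite /x -[N]trmxK -trmx_mul yN trmx0.
    pose w := col_mx (iC *: x) x.
    have gw : toC g *m w = col_mx (M *m x) 0.
      rewrite gE /w mul_block_col -[in RHS]Nx /M /N !mulmxDl -!scalemxAl -!scalemxAr.
      by [].
    have adjg : adj (toC g) = (toC g)^T.
      by apply/matrixP => r q; rewrite !mxE /= oppr0.
    have H : adj (toC g *m w) *m toC J *m (toC g *m w) = adj w *m toC J *m w.
      by rewrite adjM adjg -[in RHS]gJC !mulmxA.
    have adjcol m1 m2 (a : 'cV[C]_m1) (b : 'cV[C]_m2) : adj (col_mx a b) = row_mx (adj a) (adj b).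
      by rewrite /adj tr_col_mx map_row_mx.
    move: H; rewrite gw /w !adjcol JE !mul_row_block !mulmx0 !mulmx1 !add0r !addr0 !mulmxN mulmx1.
    rewrite !mul_row_col /adj trmx0 map_mx0 mul0mx mulmx0 addr0 -/(adj x).
    have -> : map_mx conjc (iC *: x)^T = - (iC *: adj x).
      apply/matrixP => r q; rewrite !mxE rmorphM -mulNr; congr (_ * _).
      by apply/eqP; rewrite eq_complex /= oppr0 !eqxx.
    rewrite mulmx1 opprK -scalemxAr -scalemxAl -mulr2n -scaler_nat scalerA => H.
    have : x = 0.
      apply: mul_iC_adj; move/esym/eqP: H.
      rewrite scaler_eq0 mulf_eq0 pnatr_eq0 /= => /orP [|/eqP //].
      by rewrite eq_complex /= oner_eq0 andbF.
    by rewrite /x => /(congr1 trmx); rewrite trmxK trmx0.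
  have ME : M = iC *: N by rewrite -[M](mulmxKV Nu) MN mul_scalar_mx.
  have gJc : g *m J = J *m g.
    have := congr1 (@mxRe n n) ME; have := congr1 (@mxIm n n) ME.
    rewrite /M /N scalerDr scalerA iC_sqr scaleN1r !mxReD !mxImD mxReN mxImN !mxReZ !mxImZ.
    rewrite !(mxRe_toC, mxIm_toC) /= !(scale0r, scale1r, scaler0, subr0, addr0, add0r, oppr0).
    move=> ad bc; rewrite -[g]submxK /Jmx !mulmx_block !mulmx0 !mul0mx !mulmxN !mulNmx.
    by rewrite !mulmx1 !mul1mx !add0r !addr0 ad bc.
  split=> //; have := gJ; rewrite -mulmxA -gJc mulmxA => /(congr1 (mulmx^~ J)).
  by rewrite /= -(mulmxA _ J J) Jmx_sqr mulmxN mulmx1 => /oppr_inj.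
have gphi := commJ_phi gJ; set u := tau g in gphi.
have uu : adj u *m u = 1%:M by apply: phi_inj; rewrite phiM phi_adj -gphi gg phi1.
have [_ gu] := mulmx1_unit gg.
split; first by split=> //; rewrite -mulmxA -gJ mulmxA gg mul1mx.
have gE : toC g = block_mx (toC (mxRe u)) (toC (mxIm u)) (- toC (mxIm u)) (toC (mxRe u)).
  by rewrite gphi /phi /toC map_block_mx map_mxN.
rewrite /moebius -/(toC g) gE block_mxKul block_mxKur block_mxKdl block_mxKdr.
rewrite !mul_mx_scalar.
set N := iC *: - toC (mxIm u) + toC (mxRe u).
have -> : iC *: toC (mxRe u) + toC (mxIm u) = iC *: N.
  by rewrite scalerDr scalerN scalerN scalerA iC_sqr scaleN1r opprK addrC.
have Nu : N \in unitmx.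
  have NE : N = (adj u)^T.
    apply/matrixP => r q; rewrite !mxE; case: (u r q) => a b.
    by apply/eqP; rewrite eq_complex /=; apply/andP; split; apply/eqP; ring.
  by rewrite NE unitmx_tr; case: (mulmx1_unit uu).
by rewrite -scalemxAl mulmxV // scalemx1.
Qed.

End Rank.

End SymplecticLie.

Lemma block_mx_eq (T : Type) m1 m2 n1 n2 (a a' : 'M[T]_(m1, n1)) (b b' : 'M[T]_(m1, n2))
    (c c' : 'M[T]_(m2, n1)) (d d' : 'M[T]_(m2, n2)) :
  a = a' -> b = b' -> c = c' -> d = d' -> block_mx a b c d = block_mx a' b' c' d'.
Proof. by move=> -> -> -> ->. Qed.

Section TransposeArithmetic.
Variable F : pzRingType.

Lemma trmxD m n (A B : 'M[F]_(m, n)) : (A + B)^T = A^T + B^T.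
Proof. by apply/matrixP => r q; rewrite !mxE. Qed.

Lemma trmxN m n (A : 'M[F]_(m, n)) : (- A)^T = - A^T.
Proof. by apply/matrixP => r q; rewrite !mxE. Qed.

Lemma trmxB m n (A B : 'M[F]_(m, n)) : (A - B)^T = A^T - B^T.
Proof. by rewrite trmxD trmxN. Qed.

Lemma trmxZ m n x (A : 'M[F]_(m, n)) : (x *: A)^T = x *: A^T.
Proof. by apply/matrixP => r q; rewrite !mxE. Qed.

End TransposeArithmetic.

(** * Cayley coordinates and the decomposition of g into k, p_+ and p_- *)

Section Cayley.
Variable R : realType.
Local Notation C := R[i].
Local Notation iC := (iC R).
Variable n : nat.
Implicit Types a b c d : 'M[C]_n.
Local Notation J := (Jmx R n).
Local Notation half := (real_complex R 2^-1).

(** The two block columns span the eigenspaces of J for -i and i, and [cayV] is the inverse. In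
    these coordinates k is block diagonal and p_+, p_- are the two off-diagonal blocks. *)
Definition cayW : 'M[C]_(n + n) := block_mx 1%:M 1%:M iC%:M (- iC)%:M.
Definition cayV : 'M[C]_(n + n) := half *: block_mx 1%:M (- iC)%:M 1%:M iC%:M.
Definition cay a b c d : 'M[C]_(n + n) := cayW *m block_mx a b c d *m cayV.

Lemma cay_eq a b c d a' b' c' d' : a = a' -> b = b' -> c = c' -> d = d' ->
  cay a b c d = cay a' b' c' d'.
Proof. by move=> -> -> -> ->. Qed.

Lemma half2 : half + half = 1 :> C.
Proof. by apply/eqP; rewrite eq_complex /= addr0 eqxx andbT; apply/eqP; field. Qed.

Lemma cayWV : cayW *m cayV = 1%:M.
Proof.
rewrite /cayW /cayV -scalemxAr mulmx_block !mulmx1 !mul1mx.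
rewrite -!scalar_mxM !mulNr !mulrN iC_sqr !opprK.
rewrite scale_block_mx -!(raddfD (@scalar_mx _ n)) /= !scale_scalar_mx.
by rewrite addNr subrr mulr0 mulrDr mulr1 half2 raddf0 -scalar_mx_block.
Qed.

Lemma cayVW : cayV *m cayW = 1%:M.
Proof. exact: mulmx1C cayWV. Qed.

Lemma cayM a b c d a' b' c' d' : cay a b c d *m cay a' b' c' d' =
  cay (a *m a' + b *m c') (a *m b' + b *m d') (c *m a' + d *m c') (c *m b' + d *m d').
Proof.
by rewrite /cay -mulmx_block !mulmxA -[_ *m cayV *m cayW]mulmxA cayVW mulmx1.
Qed.

Lemma cayD a b c d a' b' c' d' : cay a b c d + cay a' b' c' d' =
  cay (a + a') (b + b') (c + c') (d + d').
Proof. by rewrite /cay -mulmxDl -mulmxDr add_block_mx. Qed.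

Lemma cayN a b c d : - cay a b c d = cay (- a) (- b) (- c) (- d).
Proof. by rewrite /cay -mulNmx -mulmxN opp_block_mx. Qed.

Lemma cayZ x a b c d : x *: cay a b c d = cay (x *: a) (x *: b) (x *: c) (x *: d).
Proof. by rewrite /cay scalemxAl scalemxAr scale_block_mx. Qed.

Lemma cay_surj X : exists a b c d, X = cay a b c d.
Proof.
pose Y := cayV *m X *m cayW.
exists (ulsubmx Y), (ursubmx Y), (dlsubmx Y), (drsubmx Y).
by rewrite /cay submxK /Y !mulmxA cayWV mul1mx -mulmxA cayWV mulmx1.
Qed.

Lemma cay_inj a b c d a' b' c' d' : cay a b c d = cay a' b' c' d' ->
  [/\ a = a', b = b', c = c' & d = d'].
Proof.
move=> /(congr1 (fun X => cayV *m X *m cayW)); rewrite /cay !mulmxA cayVW !mul1mx.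
by rewrite -!mulmxA cayVW !mulmx1 => /eq_block_mx.
Qed.

Lemma cay0 : cay 0 0 0 0 = 0.
Proof. by rewrite /cay block_mx0 mulmx0 mul0mx. Qed.

Lemma cayE a b c d : cay a b c d = block_mx
  (half *: (a + c + (b + d))) ((iC * half) *: (- (a + c) + (b + d)))
  ((iC * half) *: (a - c + (b - d))) (half *: (a - c - (b - d))).
Proof.
rewrite /cay /cayW /cayV -scalemxAr !mulmx_block !mul1mx !mulmx1 scale_block_mx.
rewrite !mul_mx_scalar !mul_scalar_mx !scaleNr -!scalerBr.
apply: block_mx_eq.
- by [].
- by rewrite [iC * _]mulrC -[RHS]scalerA; apply: congr1; rewrite [RHS]scalerDr scalerN.
- by rewrite [iC * _]mulrC -[RHS]scalerA; apply: congr1; rewrite [RHS]scalerDr.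
- by apply: congr1; rewrite !scalerA iC_sqr !scaleN1r opprK.
Qed.

Lemma cay_tr a b c d : (cay a b c d)^T = cay d^T b^T c^T a^T.
Proof.
by rewrite !cayE tr_block_mx; apply: block_mx_eq; apply/matrixP => r q; rewrite !mxE; ring.
Qed.

(** With [b] and [c] symmetric this is the general element of the complexified symplectic Lie
    algebra: [a] is its component in k, identified with gl_n, [b] that in p_+ and [c] that in
    p_-. *)
Definition spx a b c := cay a b c (- a^T).
Definition kappa a := spx a 0 0.

Lemma toC_phi (u : 'M[C]_n) : toC (phi u) = cay u 0 0 (map_mx conjc u).
Proof.
rewrite cayE /phi /toC map_block_mx map_mxN.
by apply: block_mx_eq; apply/matrixP => r q; rewrite !mxE; case: (u r q) => ? ?;
  apply/eqP; rewrite eq_complex /=; apply/andP; split; apply/eqP; field.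
Qed.

Lemma toC_J : toC J = cay (- iC)%:M 0 0 iC%:M.
Proof.
have E : (- iC)%:M = - iC%:M :> 'M[C]_n by rewrite raddfN.
rewrite Jmx_phi toC_phi E; apply: cay_eq => //; apply/matrixP => r q; rewrite !mxE.
by case: (r == q); apply/eqP; rewrite eq_complex /= ?opprK ?oppr0 !eqxx.
Qed.

Lemma cartanE (j : 'I_n) : cartan R j = kappa (delta_mx j j).
Proof.
by rewrite /kappa /spx cayE /cartan trmx_delta; apply: block_mx_eq; apply/matrixP => r q; rewrite !mxE;
  case: (_ && _); apply/eqP; rewrite eq_complex /=; apply/andP; split; apply/eqP; field.
Qed.

Lemma spxD a b c a' b' c' : spx a b c + spx a' b' c' = spx (a + a') (b + b') (c + c').
Proof. by rewrite /spx cayD trmxD opprD. Qed.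

Lemma spxZ x a b c : x *: spx a b c = spx (x *: a) (x *: b) (x *: c).
Proof. by rewrite /spx cayZ trmxZ scalerN. Qed.

Lemma kappaD a b : kappa (a + b) = kappa a + kappa b.
Proof. by rewrite /kappa spxD !addr0. Qed.

Lemma kappaZ x a : kappa (x *: a) = x *: kappa a.
Proof. by rewrite /kappa spxZ !scaler0. Qed.

Lemma bracket_kappa a a' b' c' : bracket (kappa a) (spx a' b' c') =
  spx (a *m a' - a' *m a) (a *m b' + b' *m a^T) (- (a^T *m c' + c' *m a)).
Proof.
rewrite /bracket /kappa /spx !cayM cayN cayD !(mul0mx, mulmx0, addr0, add0r, mulmxN, mulNmx, opprK).
by rewrite trmxB !trmx_mul !opprB opprD addrC.
Qed.

Lemma spxN a b c : - spx a b c = spx (- a) (- b) (- c).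
Proof. by rewrite /spx cayN trmxN. Qed.

Lemma kappaN a : kappa (- a) = - kappa a.
Proof. by rewrite /kappa spxN !oppr0. Qed.

Lemma kappa0 : kappa (0 : 'M[C]_n) = 0.
Proof. by rewrite /kappa /spx trmx0 oppr0 cay0. Qed.

Lemma bracket_kappa2 a b : bracket (kappa a) (kappa b) = kappa (a *m b - b *m a).
Proof. by rewrite bracket_kappa !(mul0mx, mulmx0, addr0, oppr0). Qed.

Lemma spx_split a b c : spx a b c = kappa a + (spx 0 b 0 + spx 0 0 c).
Proof. by rewrite /kappa !spxD !(addr0, add0r). Qed.

Lemma toC_phi_skew (u : 'M[C]_n) : adj u = - u -> toC (phi u) = kappa u.
Proof.
move=> uu; rewrite toC_phi /kappa /spx; apply: cay_eq => //.
have -> : map_mx conjc u = (adj u)^T by apply/matrixP => r q; rewrite !mxE.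
by rewrite uu trmxN.
Qed.

Definition spC : set 'M[C]_(n + n) := [set X | X^T *m toC J + toC J *m X = 0].

Lemma spC_spx X : spC X <-> exists a b c, [/\ X = spx a b c, b^T = b & c^T = c].
Proof.
have key (a b c d : 'M[C]_n) : spC (cay a b c d) <-> [/\ d = - a^T, b^T = b & c^T = c].
  rewrite /spC /= cay_tr toC_J !cayM cayD !(mul0mx, mulmx0, addr0, add0r).
  rewrite !mul_scalar_mx !mul_mx_scalar -!scalerDr; split.
    rewrite -cay0 !scaleNr => /cay_inj [_ h2 h3 h4].
    have i0 : iC != 0 by rewrite eq_complex /= oner_eq0 andbF.
    split.
    - move/eqP: h4; rewrite scaler_eq0 (negbTE i0) /= addrC addr_eq0.
      by move=> /eqP.
    - by move/eqP: h2; rewrite subr_eq0 => /eqP /(scalerI i0).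
    - by move/eqP: h3; rewrite addrC subr_eq0 => /eqP /(scalerI i0).
  case=> -> hb hc; rewrite trmxN trmxK hb hc !scaleNr addNr subrr addNr scaler0 addrN scaler0.
  by rewrite oppr0 cay0.
split=> [|[a [b [c [-> bT cT]]]]]; last by apply/key.
have [a [b [c [d ->]]]] := cay_surj X.
by move=> /key [-> bT cT]; exists a, b, c.
Qed.

Lemma spC_kappa X : spC X /\ X *m toC J = toC J *m X <-> exists a, X = kappa a.
Proof.
have i0 : iC != 0 by rewrite eq_complex /= oner_eq0 andbF.
have i2 : iC + iC != 0 by rewrite eq_complex /= -[1 + 1]/(2%:R) pnatr_eq0 andbF.
split=> [[/spC_spx [a [b [c [-> bT cT]]]]]|[a ->]].
  rewrite toC_J /spx !cayM => /cay_inj [_ hb hc _]; exists a.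
  move: hb hc; rewrite !(mul0mx, mulmx0, addr0, add0r) !mul_scalar_mx !mul_mx_scalar.
  rewrite !scaleNr => /eqP; rewrite -addr_eq0 -scalerDl scaler_eq0 (negbTE i2) => /eqP b0.
  move=> /eqP; rewrite eq_sym -subr_eq0 opprK -scalerDl scaler_eq0 (negbTE i2) => /eqP c0.
  by rewrite b0 c0.
split; first by apply/spC_spx; exists a, 0, 0; rewrite trmx0.
rewrite toC_J /kappa /spx !cayM !(mul0mx, mulmx0, addr0, add0r).
by rewrite !mul_scalar_mx !mul_mx_scalar.
Qed.

End Cayley.

(** * The Lie algebras of Sp and K, and the surjectivity of the exponential onto K *)

Section LieSets.
Variable R : realType.
Local Notation C := R[i].
Variable n : nat.
Local Notation J := (Jmx R n).
Local Notation K := (@Kinf R n).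
Local Notation Sp := (@Sp R n).

Lemma Lie_expm (G : set 'M[R]_(n + n)) X t : Lie G X -> G (expm (t *: X)).
Proof. exact. Qed.

Lemma LieZ (G : set 'M[R]_(n + n)) X a : Lie G X -> Lie G (a *: X).
Proof. by move=> GX t; rewrite scalerA. Qed.

Lemma expm_derive0 p (X : 'M[R]_p) : mx_derive 0 (fun t => expm (t *: X)) X.
Proof. by have := expm_derive X 0; rewrite scale0r expm0 mulmx1. Qed.

(** Necessity comes from differentiating g^T J g = J at the identity. Conversely, the linear
    condition makes [J] intertwine [X^T] and [- X], hence their exponentials. *)
Lemma LieSpP X : Lie Sp X <-> X^T *m J + J *m X = 0.
Proof.
split=> [SpX|XJ t].
  have H := mx_derive_mul (mx_derive_mulr J (mx_derive_tr (expm_derive0 X))) (expm_derive0 X).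
  rewrite !scale0r expm0 trmx1 mulmx1 mul1mx in H.
  apply: (mx_derive_unique H); apply: (mx_derive_eq (mx_derive_const 0 J)) => // s.
  by have [_ ->] := SpX s.
split; first exact: expm_unit.
rewrite expm_tr (@expm_intertwine _ _ _ J X^T (- X)).
  rewrite -mulmxA scalerN -scaleNr; have := expmN X (- t).
  by rewrite opprK => ->; rewrite mulmx1.
by rewrite mulmxN; apply/eqP; rewrite -addr_eq0 XJ.
Qed.

Lemma LieKP X : Lie K X <-> Lie Sp X /\ X *m J = J *m X.
Proof.
split=> [KX|[SpX XJ] t].
  split; first by move=> t; have [] := KX t.
  have H1 := mx_derive_mulr J (expm_derive0 X).
  have H2 := mx_derive_mull J (expm_derive0 X).
  apply: (mx_derive_unique H1); apply: (mx_derive_eq H2) => // s.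
  by have /KinfP [_ ->] := KX s.
have [gu gJ] := SpX t; apply/KinfP.
have comm : expm (t *: X) *m J = J *m expm (t *: X) by exact: expm_intertwine.
split=> //; have /(congr1 (mulmx^~ J)) := gJ.
by rewrite /= -(mulmxA _ _ J) comm mulmxA -(mulmxA _ J J) Jmx_sqr mulmxN mulmx1 mulNmx => /oppr_inj.
Qed.

Lemma LieSpD X Y : Lie Sp X -> Lie Sp Y -> Lie Sp (X + Y).
Proof.
move=> /LieSpP HX /LieSpP HY; apply/LieSpP.
by rewrite trmxD mulmxDl mulmxDr addrACA HX HY addr0.
Qed.

Lemma LieKD X Y : Lie K X -> Lie K Y -> Lie K (X + Y).
Proof.
move=> /LieKP [HX XJ] /LieKP [HY YJ]; apply/LieKP; split; first exact: LieSpD.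
by rewrite mulmxDl mulmxDr XJ YJ.
Qed.

Lemma LieC_Sp X : LieC Sp X <-> spC X.
Proof.
rewrite /LieC /spC /= -[map_mx (@complex.Re R) X]/(mxRe X) -[map_mx (@complex.Im R) X]/(mxIm X).
have re : mxRe (X^T *m toC J + toC J *m X) = (mxRe X)^T *m J + J *m mxRe X.
  rewrite mxReD !mxReM !mxRe_toC !mxIm_toC mulmx0 mul0mx !subr0.
  by congr (_ *m _ + _); apply/matrixP => r q; rewrite !mxE.
have im : mxIm (X^T *m toC J + toC J *m X) = (mxIm X)^T *m J + J *m mxIm X.
  rewrite mxImD !mxImM !mxRe_toC !mxIm_toC mulmx0 mul0mx add0r addr0.
  by congr (_ *m _ + _); apply/matrixP => r q; rewrite !mxE.
split=> [[/LieSpP hr /LieSpP hi]|H].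
  by apply: mxC_eq; rewrite ?re ?im ?hr ?hi ?mxRe0 ?mxIm0.
by split; apply/LieSpP; rewrite -?re -?im H ?mxRe0 ?mxIm0.
Qed.

Lemma LieC_K X : LieC K X <-> spC X /\ X *m toC J = toC J *m X.
Proof.
have comm : X *m toC J = toC J *m X <-> mxRe X *m J = J *m mxRe X /\ mxIm X *m J = J *m mxIm X.
  split=> [H|[hr hi]].
    have := congr1 (@mxRe _ _ _) H; have := congr1 (@mxIm _ _ _) H.
    rewrite !mxReM !mxImM !mxRe_toC !mxIm_toC !mulmx0 !mul0mx !subr0 !add0r !addr0.
    by move=> -> ->.
  by apply: mxC_eq; rewrite ?mxReM ?mxImM !mxRe_toC !mxIm_toC !mulmx0 !mul0mx ?subr0 ?add0r ?addr0.
rewrite comm -LieC_Sp /LieC /= -[map_mx (@complex.Re R) X]/(mxRe X) -[map_mx (@complex.Im R) X]/(mxIm X).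
split=> [[/LieKP [? ?] /LieKP [? ?]] //|[[? ?] [? ?]]].
by split; apply/LieKP.
Qed.

Lemma LieC_K_kappa X : LieC K X <-> exists a, X = kappa a.
Proof. by rewrite LieC_K; exact: spC_kappa. Qed.

Lemma LieC_kappa a : LieC K (kappa a). Proof. by apply/LieC_K_kappa; exists a. Qed.

Lemma LieC_K_Sp X : LieC K X -> LieC Sp X. Proof. by move=> /LieC_K [? _]; apply/LieC_Sp. Qed.

Lemma LieC_toC (G : set 'M[R]_(n + n)) X : Lie G 0 -> Lie G X -> LieC G (toC X).
Proof.
move=> G0 GX; have re := mxRe_toC X; have im := mxIm_toC X.
by rewrite /LieC /=; move: re im; rewrite /mxRe /mxIm => -> ->.
Qed.

Lemma LieSp0 : Lie Sp 0. Proof. by apply/LieSpP; rewrite trmx0 mul0mx mulmx0 addr0. Qed.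
Lemma LieK0 : Lie K 0.
Proof. by apply/LieKP; split; [exact: LieSp0|rewrite mul0mx mulmx0]. Qed.

Lemma spC_subspace : subspace (@spC R n).
Proof.
split=> [|a X Y]; first by rewrite /spC /= trmx0 mul0mx mulmx0 addr0.
rewrite /spC /= => HX HY; rewrite trmxD trmxZ mulmxDl mulmxDr -scalemxAl -scalemxAr.
by rewrite addrACA -scalerDr HX HY scaler0 addr0.
Qed.

Lemma LieC_Sp_subspace : subspace (LieC Sp).
Proof.
have [s0 sl] := spC_subspace; split; first by apply/LieC_Sp.
by move=> a X Y /LieC_Sp HX /LieC_Sp HY; apply/LieC_Sp; exact: sl.
Qed.

Lemma LieC_K_subspace : subspace (LieC K).
Proof.
split; first by apply/LieC_K_kappa; exists 0; rewrite kappa0.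
move=> a X Y /LieC_K_kappa [x ->] /LieC_K_kappa [y ->]; apply/LieC_K_kappa.
by exists (a *: x + y); rewrite kappaD kappaZ.
Qed.

Lemma spC_bracket (X Y : 'M[C]_(n + n)) : spC X -> spC Y -> spC (bracket X Y).
Proof.
rewrite /spC /= => /eqP; rewrite addr_eq0 => /eqP HX /eqP; rewrite addr_eq0 => /eqP HY.
have key (A B : 'M[C]_(n + n)) : A^T *m toC J = - (toC J *m A) -> B^T *m toC J = - (toC J *m B) ->
    A^T *m B^T *m toC J = toC J *m A *m B.
  by move=> HA HB; rewrite -mulmxA HB mulmxN mulmxA HA mulNmx opprK.
rewrite /bracket trmxB !trmx_mul mulmxBl (key _ _ HY HX) (key _ _ HX HY) mulmxBr !mulmxA.
by rewrite addrA subrK subrr.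
Qed.

Lemma LieC_Sp_bracket X Y : LieC Sp X -> LieC Sp Y -> LieC Sp (bracket X Y).
Proof. by move=> /LieC_Sp HX /LieC_Sp HY; apply/LieC_Sp; exact: spC_bracket. Qed.

Lemma Kinf_phi u : adj u *m u = 1%:M -> K (phi u).
Proof.
by move=> uu; apply/KinfP; rewrite -phi_adj -phiM uu phi1; split=> //; exact: phi_commJ.
Qed.

Lemma Kinf_tau k : K k -> k = phi (tau k) /\ adj (tau k) *m tau k = 1%:M.
Proof.
move=> /KinfP [kk kJ]; have kE := commJ_phi kJ; split=> //.
by apply: phi_inj; rewrite phiM phi_adj -kE kk phi1.
Qed.

Lemma Kinf1 : K 1%:M.
Proof. by rewrite -phi1; apply: Kinf_phi; rewrite mulmx1 -toC1; apply/matrixP => r q; rewrite !mxE eq_sym /= oppr0. Qed.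

Lemma KinfM k l : K k -> K l -> K (k *m l).
Proof.
move=> /KinfP [kk kJ] /KinfP [ll lJ]; apply/KinfP; split.
  by rewrite trmx_mul -mulmxA (mulmxA k^T) kk mul1mx.
by rewrite -mulmxA lJ mulmxA kJ mulmxA.
Qed.

Lemma Kinf_unit k : K k -> k \in unitmx.
Proof. by move=> /KinfP [/mulmx1_unit []]. Qed.

Lemma Kinf_inv k : K k -> invmx k = k^T.
Proof.
move=> Kk; have ku := Kinf_unit Kk; have /KinfP [kk _] := Kk.
by rewrite -[LHS]mul1mx -kk mulmxK.
Qed.

Lemma KinfV k : K k -> K (invmx k).
Proof.
move=> Kk; have [kE uu] := Kinf_tau Kk; rewrite Kinf_inv // kE -phi_adj; apply: Kinf_phi.
by rewrite adjK; exact: mulmx1C.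
Qed.

Lemma Kinf_tr k : K k -> K k^T.
Proof. by move=> Kk; rewrite -Kinf_inv //; exact: KinfV. Qed.

Lemma Kinf_expm Z t : Lie K Z -> K (expm (t *: Z)). Proof. exact. Qed.

Lemma LieK_conj k Z : K k -> Lie K Z -> Lie K (k *m Z *m invmx k).
Proof.
move=> Kk KZ t; rewrite expm_conj ?Kinf_unit //.
by apply: KinfM; [apply: KinfM|exact: KinfV].
Qed.

Lemma SpM g h : Sp g -> Sp h -> Sp (g *m h).
Proof.
move=> [gu gJ] [hu hJ]; split; first by rewrite unitmx_mul gu.
by rewrite trmx_mul -!mulmxA (mulmxA J) (mulmxA g^T) (mulmxA g^T) gJ mulmxA.
Qed.

Lemma LieSp_conj k X : K k -> Lie Sp X -> Lie Sp (k *m X *m invmx k).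
Proof.
move=> Kk SX t; rewrite expm_conj ?Kinf_unit //.
have [Sk _] := Kk; have [SVk _] := KinfV Kk.
by apply: SpM => //; apply: SpM.
Qed.

Lemma toC_unit p (g : 'M[R]_p) : g \in unitmx -> toC g \in unitmx.
Proof. by rewrite map_unitmx. Qed.

Lemma mxRe_conj (k : 'M[R]_(n + n)) X :
  mxRe (toC k *m X *m invmx (toC k)) = k *m mxRe X *m invmx k.
Proof. by rewrite -toC_inv !mxReM !mxImM !mxRe_toC !mxIm_toC !mul0mx !mulmx0 !subr0. Qed.

Lemma mxIm_conj (k : 'M[R]_(n + n)) X :
  mxIm (toC k *m X *m invmx (toC k)) = k *m mxIm X *m invmx k.
Proof. by rewrite -toC_inv !mxImM !mxRe_toC !mxIm_toC !mulmx0 !mul0mx add0r addr0. Qed.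

Lemma LieC_Sp_conj k X : K k -> LieC Sp X -> LieC Sp (toC k *m X *m invmx (toC k)).
Proof.
move=> Kk [Xr Xi]; have re := mxRe_conj k X; have im := mxIm_conj k X.
by rewrite /LieC /=; move: re im; rewrite /mxRe /mxIm => -> ->; split; exact: LieSp_conj.
Qed.

Lemma LieC_K_conj k X : K k -> LieC K X -> LieC K (toC k *m X *m invmx (toC k)).
Proof.
move=> Kk [Xr Xi]; have re := mxRe_conj k X; have im := mxIm_conj k X.
by rewrite /LieC /=; move: re im; rewrite /mxRe /mxIm => -> ->; split; exact: LieK_conj.
Qed.

Lemma invmx_mul (F : fieldType) p (A B : 'M[F]_p) : A \in unitmx -> B \in unitmx ->
  invmx (A *m B) = invmx B *m invmx A.
Proof.
move=> Au Bu; have ABu : A *m B \in unitmx by rewrite unitmx_mul Au.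
by rewrite -[LHS]mulmx1 -(mulmxV Au) -[X in _ *m (X *m _)]mulmx1 -(mulmxV Bu) !mulmxA
  -(mulmxA _ A B) mulVmx // mul1mx.
Qed.

(** Conjugation by K preserves the three summands: with u = [tau k] it acts on k by u a u^-1, on p_+
    by u b u^T, and on p_- by the same formula for the conjugate of u. *)
Lemma conj_spx k a b c : K k -> toC k *m spx a b c *m invmx (toC k) =
  spx (tau k *m a *m adj (tau k)) (tau k *m b *m (tau k)^T)
      (map_mx conjc (tau k) *m c *m adj (tau k)).
Proof.
move=> Kk; have [kE uu] := Kinf_tau Kk; set u := tau k in kE uu *.
have E1 : map_mx conjc (adj u) = u^T by apply/matrixP => r q; rewrite !mxE conjcK.
have E2 : map_mx conjc u = (adj u)^T by apply/matrixP => r q; rewrite !mxE.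
rewrite -toC_inv Kinf_inv // kE -phi_adj !toC_phi /spx E1 !cayM.
rewrite !mul0mx !mulmx0 !addr0 !add0r; apply: cay_eq.
- by rewrite ?mul0mx ?addr0 ?add0r.
- by rewrite ?mul0mx ?addr0 ?add0r.
- by rewrite ?mul0mx ?addr0 ?add0r.
- by rewrite ?mul0mx ?addr0 ?add0r !trmx_mul E2 mulmxN mulNmx mulmxA.
Qed.

Lemma polar_angle (x y : R) : x ^+ 2 + y ^+ 2 = 1 -> exists t, cos t = x /\ sin t = y.
Proof.
move=> xy; have x1 : -1 <= x <= 1.
  have : x ^+ 2 <= 1 by rewrite -xy lerDl sqr_ge0.
  by rewrite -{1}[1](expr1n R 2) ler_sqr_norml || (move=> h; apply/andP; split; nra).
have s2 : sin (acos x) ^+ 2 = y ^+ 2.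
  have := cos2Dsin2 (acos x); rewrite acosK // => H.
  by apply: (@addrI _ (x ^+ 2)); rewrite H xy.
move: s2 => /eqP; rewrite eqf_sqr => /orP [] /eqP sE.
  by exists (acos x); rewrite acosK.
by exists (- acos x); rewrite cosN sinN acosK // sE opprK.
Qed.

Lemma expm_diag_phi (th : 'rV[R]_n) t :
  expm (t *: phi (diag_mx (\row_j (Complex 0 (th 0 j))))) =
  phi (diag_mx (\row_j (Complex (cos (t * th 0 j)) (sin (t * th 0 j))))).
Proof.
set Z := phi _; pose Y t := phi (diag_mx (\row_j (Complex (cos (t * th 0 j)) (sin (t * th 0 j))))).
rewrite -[RHS]/(Y t) (expm_flow (X := Z) (Y := Y)).
  rewrite /Y [diag_mx _](_ : _ = 1%:M) ?phi1 ?mulmx1 //.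
  apply/matrixP => r q; rewrite !mxE mul0r cos0 sin0.
  by case: (r == q).
move=> s; rewrite /Y /Z -phiM mulmx_diag.
have com u j : th 0 j * u + 0 = u * th 0 j by rewrite addr0 mulrC.
have dc j : is_derive s (1 : R) (fun s => cos (s * th 0 j)) (- (th 0 j * sin (s * th 0 j))).
  have := @is_derive_affine R cos (th 0 j) 0 s _ (is_derive_cos _).
  by move=> H; apply: (is_derive_fun_eq H) => [u|]; rewrite com // mulrN.
have ds j : is_derive s (1 : R) (fun s => sin (s * th 0 j)) (th 0 j * cos (s * th 0 j)).
  have := @is_derive_affine R sin (th 0 j) 0 s _ (is_derive_sin _).
  by move=> H; apply: (is_derive_fun_eq H) => [u|]; rewrite com.
have d0 (f : R -> R) : (forall u, f u = 0) -> is_derive s (1 : R) f 0.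
  by move=> f0; apply: (is_derive_fun_eq (is_derive_const 0 s)).
have dre r q : is_derive s (1 : R)
    (fun s => ((if r == q then cos (s * th 0 r) else 0) : R)) (if r == q then - (th 0 r * sin (s * th 0 r)) else 0).
  by case: (r == q); [exact: dc|exact: d0].
have dim r q : is_derive s (1 : R)
    (fun s => ((if r == q then sin (s * th 0 r) else 0) : R)) (if r == q then th 0 r * cos (s * th 0 r) else 0).
  by case: (r == q); [exact: ds|exact: d0].
move=> r q; case: (fintype.split_ordP r) => r' ->; case: (fintype.split_ordP q) => q' ->;
  rewrite ?block_mxEul ?block_mxEur ?block_mxEdl ?block_mxEdr !mxE.
- apply: (is_derive_fun_eq (dre r' q')) => [u|];
    rewrite ?block_mxEul ?mxE; case: (eqVneq r' q') => //= _; by rewrite ?mul0r ?sub0r.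
- apply: (is_derive_fun_eq (dim r' q')) => [u|];
    rewrite ?block_mxEur ?mxE; case: (eqVneq r' q') => //= _; by rewrite ?mul0r ?add0r.
- apply: (is_derive_fun_eq (is_derive_opp (dim r' q'))) => [u|];
    rewrite ?block_mxEdl ?mxE; case: (eqVneq r' q') => //= _; by rewrite ?mul0r ?add0r ?oppr0.
- apply: (is_derive_fun_eq (dre r' q')) => [u|];
    rewrite ?block_mxEdr ?mxE; case: (eqVneq r' q') => //= _; by rewrite ?mul0r ?sub0r.
Qed.

(** Links the conjugation in which the spectral theorem is stated to the one used here. *)
Lemma conjC_conjc (z : C) : Num.conj z = conjc z.
Proof.
have [->|z0] := eqVneq z 0; first by rewrite rmorph0 conjc0.
apply: (mulfI z0); rewrite -normCK normc_def.
case: z z0 => x y _ /=; rewrite -rmorphXn /= sqr_sqrtr ?addr_ge0 ?sqr_ge0 //.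
Qed.

(* Unitary matrices are diagonalizable in a unitary basis. *)
Lemma Kinf_expm_surj k : K k -> exists2 Z, Lie K Z & expm Z = k.
Proof.
move=> Kk; have [kE uu] := Kinf_tau Kk; set u := tau k in kE uu.
have adjE p q (A : 'M[C]_(p, q)) : map_mx Num.conj A^T = adj A.
  by apply/matrixP => r c; rewrite !mxE conjC_conjc.
have un : u \is normalmx by apply/normalmxP; rewrite adjE uu; exact: mulmx1C.
have /orthomx_spectralP := un; set P := spectralmx u; set D := spectral_diag u => uE.
have /unitarymxP := spectral_unitarymx u; rewrite adjE -/P => PP.
have PP' := mulmx1C PP.
have PV : invmx P = adj P.
  by have [Pu _] := mulmx1_unit PP; rewrite -[LHS]mulmx1 -PP mulmxA mulVmx ?mul1mx.
have DE : diag_mx D = P *m u *m adj P.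
  by rewrite uE PV !mulmxA PP mul1mx -mulmxA PP mulmx1.
have DD : adj (diag_mx D) *m diag_mx D = 1%:M.
  by rewrite DE !adjM adjK !mulmxA -(mulmxA _ _ P) PP' mulmx1 -(mulmxA _ _ u) uu mulmx1 PP.
(* The diagonal matrix is unitary, so its entries have modulus one and are given by angles. *)
have /choice [th thE] : forall j, exists t, D 0 j = Complex (cos t) (sin t).
  move=> j; have /matrixP /(_ j j) := DD.
  rewrite mul_mx_diag !mxE eqxx mulr1n; case: (D 0 j) => x y.
  move=> /eqP; rewrite eq_complex /= => /andP [/eqP xy _].
  have [|t [<- <-]] := @polar_angle x y; last by exists t.
  by rewrite -xy; ring.
pose Th := diag_mx (\row_j Complex 0 (th j)).
have uexp : phi (diag_mx D) = expm (1 *: phi Th).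
  have := expm_diag_phi (\row_j th j) 1.
  have -> : \row_j Complex 0 ((\row_j th j) 0 j) = \row_j Complex 0 (th j).
    by apply/rowP => j; rewrite !mxE.
  move=> ->; congr (phi (diag_mx _)); apply/rowP => j.
  by rewrite thE !mxE mul1r.
have Pphi : phi (adj P) \in unitmx by apply: Kinf_unit; apply: Kinf_phi; rewrite adjK.
have PphiV : invmx (phi (adj P)) = phi P.
  by rewrite -[LHS]mulmx1 -phi1 -PP' phiM mulmxA mulVmx ?mul1mx.
exists (phi (adj P) *m phi Th *m invmx (phi (adj P))).
  apply: LieK_conj; first by apply: Kinf_phi; rewrite adjK.
  apply/LieKP; split; last exact: phi_commJ.
  apply/LieSpP; rewrite -phi_commJ -mulmxDl -phi_adj -phiD [_ + _](_ : _ = 0) ?phi0 ?mul0mx //.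
  apply/matrixP => r c; rewrite !mxE [c == r]eq_sym; case: (eqVneq r c) => [->|_].
    by apply/eqP; rewrite eq_complex /= ?mulr1n ?oppr0 ?addr0 ?addNr !eqxx.
  by apply/eqP; rewrite eq_complex /= ?mulr0n ?oppr0 ?addr0 !eqxx.
rewrite -[X in expm X]scale1r expm_conj // -uexp PphiV -!phiM DE kE; congr phi.
by rewrite !mulmxA PP' mul1mx -mulmxA PP' mulmx1.
Qed.

End LieSets.

(** * Continuous representations of K and their differentials *)

Section ComplexContinuity.
Variables (R : realType) (T : topologicalType) (A : set T).
Local Notation C := R[i].

Lemma within_cst (a : R) : {within A, continuous (fun _ : T => a)}.
Proof. by apply/subspace_continuousP => x Ax; exact: cvg_cst. Qed.

Lemma within_add (f g : T -> R) : {within A, continuous f} -> {within A, continuous g} ->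
  {within A, continuous (fun x => f x + g x)}.
Proof.
move=> /subspace_continuousP fc /subspace_continuousP gc; apply/subspace_continuousP => x Ax.
by apply: cvgD; [exact: fc|exact: gc].
Qed.

Lemma within_opp (f : T -> R) : {within A, continuous f} ->
  {within A, continuous (fun x => - f x)}.
Proof.
move=> /subspace_continuousP fc; apply/subspace_continuousP => x Ax.
by apply: cvgN; exact: fc.
Qed.

Lemma within_mul (f g : T -> R) : {within A, continuous f} -> {within A, continuous g} ->
  {within A, continuous (fun x => f x * g x)}.
Proof.
move=> /subspace_continuousP fc /subspace_continuousP gc; apply/subspace_continuousP => x Ax.
by apply: cvgM; [exact: fc|exact: gc].
Qed.

Lemma within_eq (f g : T -> R) : {within A, continuous f} -> (forall x, A x -> f x = g x) ->
  {within A, continuous g}.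
Proof.
move=> /subspace_continuousP fc fg; apply/subspace_continuousP => x Ax.
suff : g @ within A (nbhs x) --> f x by rewrite fg.
apply: cvg_trans (fc x Ax); apply: near_eq_cvg.
by near=> y; apply: fg; near: y; exact: withinT.
Unshelve. all: end_near. Qed.

Lemma ccont_eq (f g : T -> C) : ccontinuous_on A f -> (forall x, A x -> f x = g x) ->
  ccontinuous_on A g.
Proof.
by move=> [fr fi] fg; split; [apply: (within_eq fr)|apply: (within_eq fi)] => x Ax; rewrite fg.
Qed.

Lemma ccont_cst (a : C) : ccontinuous_on A (fun _ : T => a).
Proof. by split; exact: within_cst. Qed.

Lemma ccont_add (f g : T -> C) : ccontinuous_on A f -> ccontinuous_on A g ->
  ccontinuous_on A (fun x => f x + g x).
Proof.
move=> [fr fi] [gr gi]; split.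
  by apply: (within_eq (within_add fr gr)) => x _; case: (f x); case: (g x).
by apply: (within_eq (within_add fi gi)) => x _; case: (f x); case: (g x).
Qed.

Lemma ccont_mul (f g : T -> C) : ccontinuous_on A f -> ccontinuous_on A g ->
  ccontinuous_on A (fun x => f x * g x).
Proof.
move=> [fr fi] [gr gi]; split.
  apply: (within_eq (within_add (within_mul fr gr) (within_opp (within_mul fi gi)))) => x _.
  by case: (f x); case: (g x).
apply: (within_eq (within_add (within_mul fr gi) (within_mul fi gr))) => x _.
by case: (f x) => a b; case: (g x) => c d /=.
Qed.

Lemma ccont_conj (f : T -> C) : ccontinuous_on A f -> ccontinuous_on A (fun x => conjc (f x)).
Proof.
move=> [fr fi]; split; first by apply: (within_eq fr) => x _; case: (f x).
by apply: (within_eq (within_opp fi)) => x _; case: (f x).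
Qed.

Lemma ccont_sum (I : Type) (r : seq I) (P : pred I) (f : I -> T -> C) :
  (forall i, ccontinuous_on A (f i)) -> ccontinuous_on A (fun x => \sum_(i <- r | P i) f i x).
Proof.
move=> fc; elim: r => [|i r IH].
  by apply: (ccont_eq (ccont_cst 0)) => x _; rewrite big_nil.
case Pi: (P i); last by apply: (ccont_eq IH) => x _; rewrite big_cons Pi.
by apply: (ccont_eq (ccont_add (fc i) IH)) => x _; rewrite big_cons Pi.
Qed.

End ComplexContinuity.

Section KRepresentation.
Variables (R : realType) (n : nat).
Local Notation C := R[i].
Local Notation K := (@Kinf R n).

Lemma mx_derive_cvg m p (Y : R -> 'M[R]_(m, p)) t D : mx_derive t Y D ->
  forall r c, (fun s => Y s r c) @ t --> Y t r c.
Proof. by move=> Yd r c; exact: is_derive_continuous (Yd r c). Qed.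

Lemma Kinf_exp k j : K k -> K (k ^+ j).
Proof.
move=> Kk; elim: j => [|j IH]; first by rewrite expr0; exact: Kinf1.
by rewrite exprS; exact: KinfM.
Qed.

(* Continuous homomorphisms between matrix groups are smooth: one-parameter
   subgroups go to one-parameter subgroups, and the Trotter formula makes the
   differential additive. *)
Lemma rep_differential N (rho : 'M[R]_(n + n) -> 'M[R]_N) :
  (forall r c, {within K, continuous (fun k => rho k r c)}) ->
  rho 1%:M = 1%:M -> (forall k k', K k -> K k' -> rho (k *m k') = rho k' *m rho k) ->
  exists B : 'M[R]_(n + n) -> 'M[R]_N,
    [/\ forall Z t, Lie K Z -> rho (expm (t *: Z)) = expm (t *: B Z),
        forall Z Z', Lie K Z -> Lie K Z' -> B (Z + Z') = B Z + B Z'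
      & forall Z (a : R), Lie K Z -> B (a *: Z) = a *: B Z].
Proof.
move=> rhoc rho1 rhoM.
have /choice [B Bexp] : forall Z, exists B, Lie K Z -> forall t, rho (expm (t *: Z)) = expm (t *: B).
  move=> Z; have [KZ|] := pselect (Lie K Z); last by exists 0.
  have [|s t||B BE] := @one_parameter_expm R N (fun t => rho (expm (t *: Z))).
  - move=> r c t; apply: (within_cvg (rhoc r c)); [exact: Kinf_expm|by move=> s; exact: Kinf_expm|].
    exact: mx_derive_cvg (expm_derive Z t).
  - by rewrite addrC expmD rhoM //; exact: Kinf_expm.
  - by rewrite scale0r expm0.
  - by exists B.
have rhoX k j : K k -> rho (k ^+ j) = rho k ^+ j.
  move=> Kk; elim: j => [|j IH]; first by rewrite !expr0.
  by rewrite exprS exprSr -[k * _]/(k *m _) rhoM ?IH //; exact: Kinf_exp.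
have BD Z Z' : Lie K Z -> Lie K Z' -> expm (B (Z + Z')) = expm (B Z + B Z').
  move=> KZ KZ'; have KZZ := LieKD KZ KZ'.
  (* [rho] reverses products, so it sends the powers of [x k] to the Trotter approximations of
     [B Z' + B Z]. *)
  rewrite [B Z + _]addrC -[B (Z + Z')]scale1r -Bexp // scale1r.
  pose x (k : nat) := expm (k.+1%:R^-1 *: Z) *m expm (k.+1%:R^-1 *: Z').
  have Kx k : K (x k) by apply: KinfM; exact: Kinf_expm.
  apply/matrixP => r c.
  have lim1 : (fun k => rho (x k ^+ k.+1) r c) @ \oo --> rho (expm (Z + Z')) r c.
    apply: (within_cvg (rhoc r c)).
    - by rewrite -[Z + Z']scale1r; exact: Kinf_expm.
    - by move=> k; exact: Kinf_exp.
    - by move=> i j; exact: trotter.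
  have lim2 : (fun k => rho (x k ^+ k.+1) r c) @ \oo --> expm (B Z' + B Z) r c.
    have := @trotter R N (B Z') (B Z) r c.
    rewrite (_ : (fun k => _) = (fun k => rho (x k ^+ k.+1) r c)) //.
    apply/funext => k; rewrite rhoX // /x rhoM; [|exact: Kinf_expm..].
    by rewrite !Bexp.
  exact: (cvg_unique _ lim1 lim2).
have BZ Z (a : R) : Lie K Z -> B (a *: Z) = a *: B Z.
  move=> KZ; apply: expm_generator => t.
  by rewrite -Bexp; [rewrite !scalerA Bexp|exact: LieZ].
exists B; split=> [Z t KZ|Z Z' KZ KZ'|Z a KZ]; [exact: Bexp| |exact: BZ].
(* [BD] compares exponentials only; used for all multiples [t] of [Z] and [Z'], it compares
   one-parameter groups, and these determine their generators. *)
apply: expm_generator => t; rewrite -BZ; last exact: LieKD.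
have KtZ := LieZ t KZ; have KtZ' := LieZ t KZ'.
by rewrite scalerDr (BD _ _ KtZ KtZ') (BZ _ _ KZ) (BZ _ _ KZ') -scalerDr.
Qed.

Lemma K_orbit_basis (M : gKdata R n) (v : gk_amb M) : K_finite v ->
  exists N (t : 'I_N -> 'M[R]_(n + n)) (a : 'I_N -> 'M[R]_(n + n) -> C),
    [/\ forall l, K (t l), forall l, ccontinuous_on K (a l),
        forall k, K k -> gk_cpt k v = \sum_l a l k *: gk_cpt (t l) v
      & lin_indep (fun l => gk_cpt (t l) v)].
Proof.
move=> [m [e [c [cc gE]]]].
have [N [t [B [Kt gE' free]]]] := orbit_basis gE.
exists N, t, (fun l k => \sum_j c j k * B j l); split=> // l.
by apply: ccont_sum => j; apply: ccont_mul; [exact: cc|exact: ccont_cst].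
Qed.

Lemma ccont_translate (c : 'M[R]_(n + n) -> C) k0 : K k0 -> ccontinuous_on K c ->
  ccontinuous_on K (fun k => c (k *m k0)).
Proof.
move=> K0 [cr ci].
have tr (f : 'M[R]_(n + n) -> R) : {within K, continuous f} -> {within K, continuous (fun k => f (k *m k0))}.
  move=> fc; apply/subspace_continuousP => k Kk W fW.
  have /subspace_continuousP := fc => /(_ _ (KinfM Kk K0) _ fW).
  rewrite /= /within /= => nW.
  have kcv : (fun x : 'M[R]_(n + n) => x *m k0) @ nbhs k --> k *m k0.
    apply: cvg_mx; apply: cvg_mulmx => r q; last exact: cvg_cst.
    exact: coord_continuous.
  have H : nbhs k (fun x => K (x *m k0) -> W (f (x *m k0))) := kcv _ nW.
  apply: filterS H => x xW Kx.
  by apply: xW; exact: KinfM.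
by split; [exact: (tr (fun k => complex.Re (c k)))|exact: (tr (fun k => complex.Im (c k)))].
Qed.

(** The input is the action of K alone. The span of the orbit of [v] has a basis of translates, in
    which K acts by matrices with continuous entries. Made real by [phi], they form a
    product-reversing representation to which [rep_differential] applies. *)
Lemma K_derive (M : gKdata R n) (v : gk_amb M) :
  subspace (@gk_supp _ _ M) -> (forall k u, K k -> @gk_supp _ _ M u -> @gk_supp _ _ M (gk_cpt k u)) ->
  cpt_action M -> @gk_supp _ _ M v ->
  exists D : 'M[R]_(n + n) -> gk_amb M,
    [/\ forall Z, Lie K Z -> is_vderive0 (fun t => gk_cpt (expm (t *: Z)) v) (D Z),
        forall Z Z', Lie K Z -> Lie K Z' -> D (Z + Z') = D Z + D Z'
      & forall Z (a : R), Lie K Z -> D (a *: Z) = real_complex R a *: D Z].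
Proof.
move=> sS Sk [cl c1 cM cf] Sv.
have [N [t [a [Kt ac gE free]]]] := K_orbit_basis (cf v Sv).
pose w l := gk_cpt (t l) v; have Sw l : @gk_supp _ _ M (w l) by exact: Sk.
pose rhoC k : 'M[C]_N := \matrix_(l, p) a p (k *m t l).
have wE k l : K k -> gk_cpt k (w l) = \sum_p rhoC k l p *: w p.
  move=> Kk; rewrite /w -cM // gE; last exact: KinfM.
  by apply: eq_bigr => p _; rewrite mxE.
have lin k : K k -> linear_on (@gk_supp _ _ M) (gk_cpt k) by move=> Kk b u u'; exact: cl.
have coord (x y : 'rV[C]_N) : \sum_p x 0 p *: w p = \sum_p y 0 p *: w p -> x = y.
  move=> xy; apply/eqP; rewrite -subr_eq0; apply/eqP; apply: free.
  under eq_bigr => p _ do rewrite !mxE scalerBl.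
  by rewrite sumrB xy subrr.
have rho1 : rhoC 1%:M = 1%:M.
  apply/row_matrixP => l; apply: coord.
  under eq_bigr => p _ do rewrite mxE.
  rewrite -wE ?c1 //; last exact: Kinf1.
  rewrite (bigD1 l) //= !mxE eqxx scale1r big1 ?addr0 // => p pl.
  by rewrite !mxE eq_sym (negbTE pl) scale0r.
have rhoM k k' : K k -> K k' -> rhoC (k *m k') = rhoC k' *m rhoC k.
  move=> Kk Kk'; apply/row_matrixP => l; apply: coord.
  under eq_bigr => p _ do rewrite mxE.
  under [RHS]eq_bigr => p _ do rewrite mxE.
  rewrite -wE; last exact: KinfM.
  rewrite cM // wE // (linear_on_comb _ sS (lin k Kk)) //.
  transitivity (\sum_p \sum_q (rhoC k' l p * rhoC k p q) *: w q).
    apply: eq_bigr => p _; rewrite wE // scaler_sumr.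
    by apply: eq_bigr => q _; rewrite scalerA.
  rewrite exchange_big; apply: eq_bigr => q _.
  by rewrite [(_ *m _) l q]mxE scaler_suml.
have [||k k' Kk Kk'|B [Bexp BD BZ]] := @rep_differential (N + N) (fun k => phi (rhoC k)).
- have cc l p := ccont_translate (Kt l) (ac p).
  move=> r c; case: (fintype.split_ordP r) => r' ->; case: (fintype.split_ordP c) => c' ->.
  + apply: (within_eq (cc r' c').1) => k _; by rewrite block_mxEul !mxE.
  + apply: (within_eq (cc r' c').2) => k _; by rewrite block_mxEur !mxE.
  + apply: (within_eq (within_opp (cc r' c').2)) => k _; by rewrite block_mxEdl !mxE.
  + apply: (within_eq (cc r' c').1) => k _; by rewrite block_mxEdr !mxE.
- by rewrite rho1 phi1.
- by rewrite rhoM // phiM.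
pose BC Z : 'M[C]_N := \matrix_(l, p) Complex (ulsubmx (B Z) l p) (ursubmx (B Z) l p).
have rhod Z l p : Lie K Z -> is_cderive0 (fun s => rhoC (expm (s *: Z)) l p) (BC Z l p).
  move=> KZ; have Bd := expm_derive0 (B Z).
  split.
    apply: (is_derive_fun_eq (Bd (lshift N l) (lshift N p))) => [s|]; last by rewrite !mxE.
    by rewrite -Bexp // block_mxEul mxE.
  apply: (is_derive_fun_eq (Bd (lshift N l) (rshift N p))) => [s|]; last by rewrite !mxE.
  by rewrite -Bexp // block_mxEur mxE.
have vE : v = \sum_l a l 1%:M *: w l by rewrite -gE ?c1 //; exact: Kinf1.
exists (fun Z => \sum_p (\sum_l a l 1%:M * BC Z l p) *: w p); split.
- move=> Z KZ.
  have dd p := cderive_sum (index_enum 'I_N) xpredT (fun l => cderive_scale (a l 1%:M) (rhod Z l p KZ)).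
  apply: (vderive_eq (vderive_scale_sum w dd)) => // s.
  have Ks := Kinf_expm s KZ.
  transitivity (gk_cpt (expm (s *: Z)) (\sum_l a l 1%:M *: w l)); last by rewrite -vE.
  rewrite (linear_on_comb _ sS (lin _ Ks)) //.
  transitivity (\sum_l \sum_p (a l 1%:M * rhoC (expm (s *: Z)) l p) *: w p).
    by rewrite exchange_big; apply: eq_bigr => p _; rewrite scaler_suml.
  apply: eq_bigr => l _; rewrite wE // scaler_sumr.
  by apply: eq_bigr => p _; rewrite scalerA.
- move=> Z Z' KZ KZ'; rewrite -big_split; apply: eq_bigr => p _ /=.
  rewrite -scalerDl -big_split; congr (_ *: _); apply: eq_bigr => l _ /=.
  by rewrite -mulrDr; congr (_ * _); rewrite !mxE BD // !mxE.
- move=> Z b KZ; rewrite scaler_sumr; apply: eq_bigr => p _ /=.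
  rewrite scalerA mulr_sumr; congr (_ *: _); apply: eq_bigr => l _ /=.
  rewrite mulrCA; congr (_ * _); rewrite !mxE BZ // !mxE.
  by apply/eqP; rewrite eq_complex /= !mul0r subr0 addr0 !eqxx.
Qed.

End KRepresentation.

Lemma toC_entry (R : realType) p q (A : 'M[R]_(p, q)) r c : toC A r c = real_complex R (A r c).
Proof. by rewrite mxE. Qed.

Lemma mxRe_entry (R : realType) p q (A : 'M[R[i]]_(p, q)) r c : mxRe A r c = complex.Re (A r c).
Proof. by rewrite mxE. Qed.

Lemma mxIm_entry (R : realType) p q (A : 'M[R[i]]_(p, q)) r c : mxIm A r c = complex.Im (A r c).
Proof. by rewrite mxE. Qed.

Lemma LieI (R : realType) p (G : set 'M[R]_p) X : (forall t, G (expm (t *: X))) -> Lie G X.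
Proof. by []. Qed.

Opaque Lie Kinf Sp expm mxRe mxIm toC.

Lemma LieC_split (R : realType) n (G : set 'M[R]_n) (X : 'M[R[i]]_n) :
  LieC G X -> Lie G (mxRe X) /\ Lie G (mxIm X).
Proof. exact. Qed.

Section MatrixVectorDerivative.
Variable R : realType.
Local Notation C := R[i].

Lemma vderive_sum (V : lmodType C) (I : Type) (r : seq I) (g : I -> R -> V) (d : I -> V) :
  (forall i, is_vderive0 (g i) (d i)) ->
  is_vderive0 (fun t => \sum_(i <- r) g i t) (\sum_(i <- r) d i).
Proof.
move=> gd; elim: r => [|i r IH].
  by apply: (vderive_eq (vderive_const 0)) => [t|]; rewrite big_nil.
by apply: (vderive_eq (vderive_add (gd i) IH)) => [t|]; rewrite big_cons.
Qed.

Lemma vderive_mx m n (Y : R -> 'M[C]_(m, n)) (D : 'M[C]_(m, n)) :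
  (forall r q, is_cderive0 (fun t => Y t r q) (D r q)) -> is_vderive0 Y D.
Proof.
move=> YD.
have H := vderive_sum (index_enum 'I_m) (fun r => vderive_sum (index_enum 'I_n)
  (fun q => vderive_cscale (YD r q) (vderive_const (delta_mx r q : 'M[C]_(m, n))))).
apply: (vderive_eq H) => [t|]; first by rewrite [RHS]matrix_sum_delta.
rewrite [RHS]matrix_sum_delta; apply: eq_bigr => r _; apply: eq_bigr => q _.
by rewrite scaler0 addr0.
Qed.

Definition cmx_derive m n (Y : R -> 'M[C]_(m, n)) (D : 'M[C]_(m, n)) :=
  forall r q, is_cderive0 (fun t => Y t r q) (D r q).

Lemma cmx_derive_mul m n p (Y : R -> 'M[C]_(m, n)) (Z : R -> 'M[C]_(n, p)) D E :
  cmx_derive Y D -> cmx_derive Z E -> cmx_derive (fun t => Y t *m Z t) (D *m Z 0 + Y 0 *m E).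
Proof.
move=> YD ZE r q.
have H := cderive_sum (index_enum 'I_n) xpredT (fun j => cderive_mul (YD r j) (ZE j q)).
by apply: (cderive_eq H) => [t|]; rewrite !mxE // -big_split.
Qed.

Lemma cmx_derive_const m n (A : 'M[C]_(m, n)) : cmx_derive (fun=> A) 0.
Proof. by move=> r q; rewrite mxE; exact: cderive_const. Qed.

Lemma cmx_derive_toC m n (Y : R -> 'M[R]_(m, n)) D : mx_derive 0 Y D ->
  cmx_derive (fun t => toC (Y t)) (toC D).
Proof.
move=> YD r q; split.
  by apply: (is_derive_fun_eq (YD r q)) => [t|]; rewrite mxE.
by apply: (is_derive_fun_eq (is_derive_const 0 0)) => [t|]; rewrite mxE.
Qed.

Lemma Ad_derive n (Z : 'M[R]_(n + n)) (X : 'M[C]_(n + n)) :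
  is_vderive0 (fun t => toC (expm (t *: Z)) *m X *m invmx (toC (expm (t *: Z))))
    (bracket (toC Z) X).
Proof.
have d1 := cmx_derive_toC (expm_derive0 Z).
have d2 := cmx_derive_toC (expm_derive0 (- Z)).
have H := cmx_derive_mul (cmx_derive_mul d1 (cmx_derive_const X)) d2.
apply: (vderive_eq (vderive_mx H)) => [t|].
  by rewrite -toC_inv expm_inv scaleNr scalerN.
by rewrite !scale0r expm0 toC1 mulmx0 addr0 mul1mx mulmx1 toCN mulmxN.
Qed.

End MatrixVectorDerivative.

Lemma complex_comb (F : comNzRingType) (W : lmodType F) (x y j : F) (A B A' B' : W) :
  j * j = -1 -> (x *: A + (- y) *: B + A') + j *: (x *: B + y *: A + B') =
    (x + j * y) *: (A + j *: B) + (A' + j *: B').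
Proof.
move=> jj; have E : (x + j * y) * j = - y + j * x.
  by rewrite mulrDl mulrAC jj mulN1r addrC mulrC.
rewrite [in RHS]scalerDr scalerA E !scalerDr !scalerDl !scalerA.
by rewrite addrACA [(j * x) *: B + _]addrC [X in X + _]addrACA.
Qed.

(** * Modules over K and the complexified action of k *)

Section KModules.
Variables (R : realType) (n : nat) (M : gKdata R n).
Local Notation C := R[i].
Local Notation iC := (iC R).
Local Notation K := (@Kinf R n).
Local Notation S := (@gk_supp _ _ M).
Implicit Types (v u : gk_amb M) (k Z : 'M[R]_(n + n)) (X Y : 'M[C]_(n + n)).

(** The axioms on the action of K only. They hold for sections before the Lie algebra is known to
    act on them, and for functions on K. *)
Definition is_Kmodule := [/\ subspace S, forall k v, K k -> S v -> S (gk_cpt k v) & cpt_action M].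

Hypothesis KM : is_Kmodule.

Definition Kd Z v := vderive0 (fun t : R => gk_cpt (expm (t *: Z)) v).
Definition KdC X v := Kd (mxRe X) v + iC *: Kd (mxIm X) v.

Let sS : subspace S. Proof. by case: KM. Qed.
Let Sk k v : K k -> S v -> S (gk_cpt k v). Proof. by case: KM => _ H _; exact: H. Qed.

Lemma cpt_linear k : K k -> linear_on S (gk_cpt k).
Proof. by move=> Kk a u v; case: KM => _ _ [cl _ _ _]; exact: cl. Qed.

Lemma cpt1 v : S v -> gk_cpt 1%:M v = v.
Proof. by case: KM => _ _ [_ c1 _ _]; exact: c1. Qed.

Lemma cptM k k' v : K k -> K k' -> S v -> gk_cpt (k *m k') v = gk_cpt k (gk_cpt k' v).
Proof. by case: KM => _ _ [_ _ cM _]; exact: cM. Qed.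

Lemma Kd_spec v : S v ->
  [/\ forall Z, Lie K Z -> is_vderive0 (fun t => gk_cpt (expm (t *: Z)) v) (Kd Z v),
      forall Z Z', Lie K Z -> Lie K Z' -> Kd (Z + Z') v = Kd Z v + Kd Z' v
    & forall Z (a : R), Lie K Z -> Kd (a *: Z) v = real_complex R a *: Kd Z v].
Proof.
move=> Sv; case: KM => _ _ ca.
have [D [Dd DD DZ]] := K_derive sS Sk ca Sv.
have KdE Z : Lie K Z -> Kd Z v = D Z by move=> KZ; exact: vderive0E (Dd Z KZ).
split=> [Z KZ|Z Z' KZ KZ'|Z a KZ].
- by rewrite (KdE _ KZ); exact: Dd.
- by rewrite (KdE _ KZ) (KdE _ KZ') (KdE _ (LieKD KZ KZ')) DD.
- by rewrite (KdE _ KZ) (KdE _ (LieZ a KZ)) DZ.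
Qed.

Lemma Kd_derive Z v : Lie K Z -> S v -> is_vderive0 (fun t => gk_cpt (expm (t *: Z)) v) (Kd Z v).
Proof. by move=> KZ Sv; have [H _ _] := Kd_spec Sv; exact: H. Qed.

Lemma Kd_flow Z : Lie K Z -> flow S (fun t v => gk_cpt (expm (t *: Z)) v) (Kd Z).
Proof.
move=> KZ; split=> //.
- by move=> t x Sx; apply: Sk => //; exact: Kinf_expm.
- by move=> t; apply: cpt_linear; exact: Kinf_expm.
- split=> [x Sx|s t x Sx]; first by rewrite scale0r expm0 cpt1.
  by rewrite expmD cptM //; exact: Kinf_expm.
- by move=> x Sx; exact: Kd_derive.
Qed.

Lemma Kd_in Z v : Lie K Z -> S v -> S (Kd Z v).
Proof. by move=> KZ Sv; have := flow_in (Kd_flow KZ) Sv. Qed.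

Lemma Kd_linear Z : Lie K Z -> linear_on S (Kd Z).
Proof. by move=> KZ; have := flow_linear (Kd_flow KZ). Qed.

Lemma Kd_Ad k Z v : K k -> Lie K Z -> S v ->
  gk_cpt k (Kd Z v) = Kd (k *m Z *m invmx k) (gk_cpt k v).
Proof.
move=> Kk KZ Sv; have KZ' := LieK_conj Kk KZ; have Skv := Sk Kk Sv.
apply: (vderive_unique (vderive_linear sS (cpt_linear Kk) _ (Kd_derive KZ Sv))).
  by move=> t; apply: Sk => //; exact: Kinf_expm.
apply: (vderive_eq (Kd_derive KZ' Skv)) => // t.
have Ke := Kinf_expm t KZ; have Ke' := Kinf_expm t KZ'.
rewrite -!cptM // expm_conj ?Kinf_unit //.
by rewrite mulmxKV // Kinf_unit.
Qed.

Lemma KdC_in X v : LieC K X -> S v -> S (KdC X v).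
Proof.
by move=> /LieC_split [Xr Xi] Sv; apply: subspaceD => //; [|apply: subspaceZ => //]; exact: Kd_in.
Qed.

Lemma KdC_linear X : LieC K X -> linear_on S (KdC X).
Proof.
move=> /LieC_split [Xr Xi] a u v Su Sv; rewrite /KdC !Kd_linear // !scalerDr !scalerA.
by rewrite [iC * a]mulrC addrACA.
Qed.

Lemma KdC_linear_l v : S v -> linear_on (LieC K) (KdC^~ v).
Proof.
move=> Sv [x y] X Y /LieC_split [Xr Xi] /LieC_split [Yr Yi]; rewrite /KdC mxReD mxImD mxReZ mxImZ.
have [_ D Z] := Kd_spec Sv.
rewrite -[complex.Re _ *: _ - _]/(complex.Re (x +i* y)%C *: mxRe X + - (complex.Im (x +i* y)%C *: mxIm X)).
rewrite -scaleNr /=.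
rewrite (D _ _ (LieKD (LieZ x Xr) (LieZ (- y) Xi)) Yr) (D _ _ (LieZ x Xr) (LieZ (- y) Xi)).
rewrite (D _ _ (LieKD (LieZ x Xi) (LieZ y Xr)) Yi) (D _ _ (LieZ x Xi) (LieZ y Xr)).
rewrite !(Z _ _ Xr) !(Z _ _ Xi).
set A := Kd (mxRe X) v; set B := Kd (mxIm X) v; set A' := Kd (mxRe Y) v; set B' := Kd (mxIm Y) v.
have E1 : (x +i* y)%C = real_complex R x + iC * real_complex R y.
  by apply/eqP; rewrite eq_complex /=; apply/andP; split; apply/eqP; ring.
have E2 : real_complex R (- y) = - real_complex R y by rewrite raddfN.
by rewrite E1 E2; apply: complex_comb; exact: iC_sqr.
Qed.

Lemma KdC_toC Z v : Lie K Z -> S v -> KdC (toC Z) v = Kd Z v.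
Proof.
move=> KZ Sv; have [_ _ HZ] := Kd_spec Sv; rewrite /KdC mxRe_toC mxIm_toC.
have := HZ Z 0 KZ; rewrite scale0r => ->.
by rewrite (_ : real_complex R 0 = 0) // scale0r scaler0 addr0.
Qed.

Lemma KdC_Ad k X v : K k -> LieC K X -> S v ->
  gk_cpt k (KdC X v) = KdC (toC k *m X *m invmx (toC k)) (gk_cpt k v).
Proof.
move=> Kk /LieC_split [Xr Xi] Sv; rewrite /KdC mxRe_conj mxIm_conj -!Kd_Ad //.
by rewrite (linear_onD (cpt_linear Kk)) ?(linear_onZ _ sS (cpt_linear Kk)) //;
  [exact: Kd_in|exact: Kd_in|apply: subspaceZ => //; exact: Kd_in].
Qed.

(** Differentiate the K-equivariance of [b] along exp(tZ) by the product rule, then extend from real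
    Z to complex Y. It serves for the bracket of k, with [b] the differential of K, and for the
    bracket of k with g on sections. *)
Lemma compat_bracket (L : set 'M[C]_(n + n)) (b : 'M[C]_(n + n) -> gk_amb M -> gk_amb M) :
  subspace L -> (forall k X, K k -> L X -> L (toC k *m X *m invmx (toC k))) ->
  (forall X v, L X -> S v -> S (b X v)) ->
  (forall v, S v -> linear_on L (b^~ v)) -> (forall X, L X -> linear_on S (b X)) ->
  (forall k X v, K k -> L X -> S v ->
     gk_cpt k (b X v) = b (toC k *m X *m invmx (toC k)) (gk_cpt k v)) ->
  forall Y X v, LieC K Y -> L X -> S v ->
    L (bracket Y X) /\ b (bracket Y X) v = KdC Y (b X v) - b X (KdC Y v).
Proof.
move=> sL LAd bS bl br bAd.
have real Z X v : Lie K Z -> L X -> S v -> L (bracket (toC Z) X) /\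
    b (bracket (toC Z) X) v = Kd Z (b X v) - b X (Kd Z v).
  move=> KZ LX Sv; have Ke t := Kinf_expm t KZ.
  have Ad_d := Ad_derive Z X.
  have LA t : L (toC (expm (t *: Z)) *m X *m invmx (toC (expm (t *: Z)))) by exact: LAd.
  split; first exact: vderive_in sL LA Ad_d.
  have Se t : S (gk_cpt (expm (t *: Z)) v) by exact: Sk.
  have H := vderive_bilinear sL sS bl br LA Se Ad_d (Kd_derive KZ Sv).
  have bXv := bS X v LX Sv.
  have E : Kd Z (b X v) = b (bracket (toC Z) X) v + b X (Kd Z v).
    apply: (vderive_unique (Kd_derive KZ bXv)); apply: (vderive_eq H) => [t|].
      by rewrite -bAd.
    by rewrite scale0r expm0 toC1 invmx1 mulmx1 mul1mx cpt1.
  by rewrite E addrK.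
move=> Y X v /LieC_split [Yr Yi] LX Sv.
have [LR ER] := real _ X v Yr LX Sv; have [LI EI] := real _ X v Yi LX Sv.
have BE : bracket Y X = iC *: bracket (toC (mxIm Y)) X + bracket (toC (mxRe Y)) X.
  rewrite {1}[Y]mxC_split /bracket mulmxDl mulmxDr -scalemxAl -scalemxAr scalerBr opprD addrACA.
  by rewrite addrC.
rewrite BE; split; first exact: sL.2.
rewrite (bl v Sv) // ER EI /KdC (linear_onD (br X LX)); last 2 first.
- exact: Kd_in.
- by apply: subspaceZ => //; exact: Kd_in.
rewrite (linear_onZ _ sS (br X LX)); last exact: Kd_in.
by rewrite opprD [RHS]addrACA addrC -scalerBr.
Qed.

Lemma KdC_bracket Y X v : LieC K Y -> LieC K X -> S v ->
  KdC (bracket Y X) v = KdC Y (KdC X v) - KdC X (KdC Y v).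
Proof.
move=> KY KX Sv; apply: (compat_bracket (L := LieC K) (b := KdC) _ _ _ _ _ _ KY KX Sv).2.
- exact: LieC_K_subspace.
- exact: LieC_K_conj.
- exact: KdC_in.
- exact: KdC_linear_l.
- exact: KdC_linear.
- exact: KdC_Ad.
Qed.

(* K is connected: it is the image of the exponential map. *)
Lemma K_stable (A : set (gk_amb M)) : subspace A -> A `<=` S ->
  (forall a v, A v -> A (KdC (kappa a) v)) -> forall k v, K k -> A v -> A (gk_cpt k v).
Proof.
move=> sA AS AK k v Kk Av; have [Z KZ <-] := Kinf_expm_surj Kk.
rewrite -[Z]scale1r; apply: (flow_stable (Kd_flow KZ) sA AS _ 1 Av) => x Ax.
have := LieC_toC (@LieK0 R n) KZ => /LieC_K_kappa [a Za].
by rewrite -(KdC_toC KZ (AS _ Ax)) Za; exact: AK.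
Qed.

End KModules.

(** * Block coordinates adapted to the parabolic subgroup *)

Section Selection.
Variables (F : comNzRingType) (n i : nat) (le_in : (i <= n)%N).
Local Notation m := (n - i)%N.

Definition selgl : 'M[F]_(i, n) := rowsub (widen_ord le_in) 1%:M.
Definition selsp : 'M[F]_(m, n) := rowsub (shift_index le_in) 1%:M.
Local Notation S1 := selgl.
Local Notation S2 := selsp.

Lemma mxsub_selection a b c d (f : 'I_a -> 'I_c) (g : 'I_b -> 'I_d) (A : 'M[F]_(c, d)) :
  mxsub f g A = rowsub f 1%:M *m A *m (rowsub g 1%:M)^T.
Proof.
rewrite -rowsubE; have -> : (rowsub g 1%:M : 'M[F]_(b, d))^T = colsub g 1%:M.
  by apply/matrixP => r q; rewrite !mxE eq_sym.
by rewrite mulmx_colsub mulmx1; apply/matrixP => r q; rewrite !mxE.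
Qed.

Lemma rowsub_orth a b c (f : 'I_a -> 'I_c) (g : 'I_b -> 'I_c) :
  (rowsub f 1%:M : 'M[F]_(a, c)) *m (rowsub g 1%:M)^T = \matrix_(r, q) (f r == g q)%:R.
Proof.
rewrite -[rowsub f 1%:M]mulmx1 -mxsub_selection; by apply/matrixP => r q; rewrite !mxE.
Qed.

Lemma widen_shift (a : 'I_i) (b : 'I_m) : (widen_ord le_in a == shift_index le_in b) = false.
Proof. by apply/negbTE; rewrite -val_eqE /=; have := ltn_ord a; lia. Qed.

Lemma S11 : S1 *m S1^T = 1%:M.
Proof. by rewrite rowsub_orth; apply/matrixP => r q; rewrite !mxE -!val_eqE. Qed.

Lemma S22 : S2 *m S2^T = 1%:M.
Proof. by rewrite rowsub_orth; apply/matrixP => r q; rewrite !mxE -!val_eqE /= eqn_add2l. Qed.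

Lemma S12 : S1 *m S2^T = 0.
Proof. by rewrite rowsub_orth; apply/matrixP => r q; rewrite !mxE widen_shift. Qed.

Lemma S21 : S2 *m S1^T = 0.
Proof. by apply: trmx_inj; rewrite trmx_mul trmxK S12 trmx0. Qed.

Lemma ord_cases (a : 'I_n) : (exists b, a = widen_ord le_in b) \/ (exists b, a = shift_index le_in b).
Proof.
have [lt_ai|le_ia] := ltnP a i.
  by left; exists (Ordinal lt_ai); apply: val_inj.
right; have lt : (a - i < m)%N by have := ltn_ord a; lia.
by exists (Ordinal lt); apply: val_inj => /=; lia.
Qed.

Lemma S1_rows p (A : 'M[F]_(n, p)) : S1 *m A = 0 -> S2 *m A = 0 -> A = 0.
Proof.
rewrite /S1 /S2 -!rowsubE => /matrixP A1 /matrixP A2; apply/matrixP => r q.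
case: (ord_cases r) => [[b ->]|[b ->]]; first by have := A1 b q; rewrite !mxE.
by have := A2 b q; rewrite !mxE.
Qed.

Lemma Ssum : S1^T *m S1 + S2^T *m S2 = 1%:M.
Proof.
apply/eqP; rewrite -subr_eq0; apply/eqP; apply: S1_rows; rewrite mulmxBr mulmxDr !mulmxA mulmx1.
  by rewrite S11 S12 mul1mx mul0mx addr0 subrr.
by rewrite S21 S22 mul1mx mul0mx add0r subrr.
Qed.

Lemma Ssplit p (A : 'M[F]_(n, p)) : A = S1^T *m (S1 *m A) + S2^T *m (S2 *m A).
Proof. by rewrite !mulmxA -mulmxDl Ssum mul1mx. Qed.

(** [T1] selects the first i coordinates, [T3] the dual isotropic ones paired with them by J, and
    [T2] the 2(n - i) symplectic coordinates in between. Being parabolic means preserving the image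
    of [T1^T]. *)
Definition T1 : 'M[F]_(i, n + n) := row_mx S1 0.
Definition T3 : 'M[F]_(i, n + n) := row_mx 0 S1.
Definition T2 : 'M[F]_(m + m, n + n) := block_mx S2 0 0 S2.
Definition JF : 'M[F]_(n + n) := block_mx 0 (- 1%:M) 1%:M 0.
Definition JFm : 'M[F]_(m + m) := block_mx 0 (- 1%:M) 1%:M 0.

Lemma T1tr : T1^T = col_mx S1^T 0. Proof. by rewrite /T1 tr_row_mx trmx0. Qed.
Lemma T3tr : T3^T = col_mx 0 S1^T. Proof. by rewrite /T3 tr_row_mx trmx0. Qed.
Lemma T2tr : T2^T = block_mx S2^T 0 0 S2^T. Proof. by rewrite /T2 tr_block_mx !trmx0. Qed.

Lemma T11 : T1 *m T1^T = 1%:M.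
Proof. by rewrite T1tr mul_row_col S11 mul0mx addr0. Qed.

Lemma T22 : T2 *m T2^T = 1%:M.
Proof.
by rewrite T2tr mulmx_block !mulmx0 !mul0mx !addr0 !add0r S22 -scalar_mx_block.
Qed.

Lemma T21 : T2 *m T1^T = 0.
Proof. by rewrite T1tr mul_block_col !mulmx0 !mul0mx S21 !addr0 col_mx0. Qed.

Lemma T32 : T3 *m T2^T = 0.
Proof. by rewrite T2tr mul_row_block !mulmx0 !mul0mx S12 !addr0 row_mx0. Qed.

Lemma Tsum : T1^T *m T1 + T2^T *m T2 + T3^T *m T3 = 1%:M.
Proof.
rewrite T1tr T2tr T3tr /T1 /T2 /T3 !mul_col_row mulmx_block !mulmx0 !mul0mx !add_block_mx !addr0 !add0r.
by rewrite Ssum [S2^T *m S2 + _]addrC Ssum -scalar_mx_block.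
Qed.

Lemma T1J : T1 *m JF = - T3.
Proof. by rewrite /T1 mul_row_block !mulmx0 !mul0mx !addr0 mulmxN mulmx1 /T3 opp_row_mx oppr0. Qed.

Lemma T2J : T2 *m JF = JFm *m T2.
Proof.
by rewrite /T2 /JF /JFm !mulmx_block !mulmx0 !mul0mx !addr0 !add0r !mulmxN !mulNmx !mulmx1 !mul1mx.
Qed.

Definition parabolic (g : 'M[F]_(n + n)) := g *m T1^T = T1^T *m (T1 *m g *m T1^T).

Lemma parabolicP (g : 'M[F]_(n + n)) : (forall r c : 'I_(n + n), (c < i)%N -> (i <= r)%N -> g r c = 0) <-> parabolic g.
Proof.
have e1 : T1^T *m (T1 *m g *m T1^T) = (T1^T *m T1) *m (g *m T1^T) by rewrite !mulmxA.
have gT : g *m T1^T = \matrix_(r, a) g r (gl_index le_in a).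
  rewrite T1tr -[g in g *m _]hsubmxK mul_row_col mulmx0 addr0.
  have -> : S1^T = colsub (widen_ord le_in) 1%:M by apply/matrixP => r q; rewrite !mxE eq_sym.
  by rewrite mulmx_colsub mulmx1; apply/matrixP => r q; rewrite !mxE.
have TT (r : 'I_(n + n)) p (A : 'M[F]_(n + n, p)) q : ((T1^T *m T1) *m A) r q = if (r < i)%N then A r q else 0.
  rewrite T1tr /T1 mul_col_row !mulmx0 !mul0mx.
  have SS : S1^T *m S1 = \matrix_(a, b) ((a == b) && (a < i)%N)%:R :> 'M[F]_n.
    apply/matrixP => a b; rewrite !mxE.
    case: (ord_cases a) => [[a' ->]|[a' ->]].
      rewrite (bigD1 a') //= !mxE eqxx mul1r big1 ?addr0 ?ltn_ord ?andbT //.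
      move=> c ca; rewrite !mxE (_ : (_ == _) = false) ?mul0r //.
      by apply/negbTE; apply: contraNneq ca => /(congr1 val) /= e; apply/eqP; exact: val_inj.
    rewrite big1 => [|c _].
      by rewrite /= (_ : (i + a' < i)%N = false) ?andbF //; lia.
    by rewrite !mxE widen_shift mul0r.
  have SB (B : 'M[F]_(n, p)) a : ((S1^T *m S1) *m B) a q = if (a < i)%N then B a q else 0.
    rewrite SS mxE (bigD1 a) //= mxE eqxx /= big1 ?addr0.
      by case: ifP => _; rewrite ?mul1r ?mul0r.
    by move=> c ca; rewrite !mxE eq_sym (negbTE ca) mul0r.
  rewrite -[A]vsubmxK mul_block_col !mul0mx !addr0.
  case: (fintype.split_ordP r) => a ->; first by rewrite !col_mxEu SB.
  by rewrite !col_mxEd mxE /= (_ : (n + a < i)%N = false) //; lia.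
rewrite /parabolic e1; split=> [H|/matrixP H r c ci ir].
  apply/matrixP => r a; rewrite TT gT !mxE; case: ltnP => // ir.
  by apply: H => //=; exact: ltn_ord.
have lt_cn : (c < n)%N by lia.
pose a := Ordinal ci; have cE : c = gl_index le_in a by apply: val_inj.
by have := H r a; rewrite TT gT !mxE -cE ltnNge ir.
Qed.

Lemma gl_partE (g : 'M[F]_(n + n)) : mxsub (gl_index le_in) (gl_index le_in) g = T1 *m g *m T1^T.
Proof.
rewrite mxsub_selection; have -> // : rowsub (gl_index le_in) 1%:M = T1.
apply/matrixP => r c; rewrite [LHS]mxE [LHS]mxE; case: (fintype.split_ordP c) => a ->.
  by rewrite row_mxEl !mxE -!val_eqE.
rewrite row_mxEr mxE -val_eqE /= (_ : (_ == _) = false) //.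
by apply/negbTE; have := ltn_ord r; lia.
Qed.

Lemma sp_partE (g : 'M[F]_(n + n)) : mxsub (sp_index le_in) (sp_index le_in) g = T2 *m g *m T2^T.
Proof.
rewrite mxsub_selection; have -> // : rowsub (sp_index le_in) 1%:M = T2.
apply/matrixP => r c; rewrite [LHS]mxE [LHS]mxE /sp_index.
case: (fintype.split_ordP r) => a ->; rewrite ?split_lshift ?split_rshift;
case: (fintype.split_ordP c) => b ->.
- by rewrite block_mxEul !mxE -!val_eqE.
- rewrite block_mxEur mxE -val_eqE /= (_ : (_ == _) = false) //.
  by apply/negbTE; have := ltn_ord a; lia.
- rewrite block_mxEdl mxE -val_eqE /= (_ : (_ == _) = false) //.
  by apply/negbTE; have := ltn_ord b; lia.
- by rewrite block_mxEdr !mxE -!val_eqE /= eqn_add2l.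
Qed.

Definition sp_lie (X : 'M[F]_(n + n)) := X^T *m JF + JF *m X = 0.

Lemma sp_lieP X : sp_lie X <->
  [/\ (dlsubmx X)^T = dlsubmx X, (ursubmx X)^T = ursubmx X & drsubmx X = - (ulsubmx X)^T].
Proof.
rewrite /sp_lie -{1 2}[X]submxK tr_block_mx /JF !mulmx_block !mulmx0 !mul0mx !mulmx1 !mul1mx.
rewrite !mulmxN !mulNmx !mulmx1 !mul1mx !addr0 !add0r add_block_mx -block_mx0.
split=> [/eq_block_mx [h1 h2 h3 h4]|[-> -> h]].
  split.
  - by apply/eqP; rewrite -subr_eq0 h1.
  - by apply/eqP; rewrite eq_sym -subr_eq0 addrC h4.
  - by move/eqP: h2; rewrite -opprD oppr_eq0 addrC addr_eq0 => /eqP.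
rewrite h trmxN trmxK; apply: block_mx_eq; rewrite ?subrr ?addNr ?opprK ?addrN ?subrr //.
Qed.

(** An element of k that agrees with [X] on all the blocks which vanish on Lie P: the lower left
    block is completed by its negative, the block leading out of the first i coordinates by minus
    its transpose. Then [X - Zk X] is parabolic, which is the infinitesimal form of G = PK. *)
Definition Zk (X : 'M[F]_(n + n)) : 'M[F]_(n + n) :=
  let A := S2^T *m (S2 *m ulsubmx X *m S1^T) *m S1 in
  block_mx (A - A^T) (- dlsubmx X) (dlsubmx X) (A - A^T).

Lemma Zk_sp X : sp_lie X -> sp_lie (Zk X) /\ Zk X *m JF = JF *m Zk X.
Proof.
move=> /sp_lieP [h1 h2 h3]; split.
  apply/sp_lieP; rewrite /Zk block_mxKul block_mxKur block_mxKdl block_mxKdr.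
  by rewrite trmxN h1; split=> //; rewrite trmxB trmxK opprB.
rewrite /Zk /JF !mulmx_block !mulmx0 !mul0mx !mulmxN !mulNmx !mulmx1 !mul1mx !addr0 !add0r.
by rewrite ?opprK.
Qed.

Lemma parabolicE X : parabolic X <-> S2 *m ulsubmx X *m S1^T = 0 /\ dlsubmx X *m S1^T = 0.
Proof.
rewrite /parabolic T1tr /T1 -{1 2}[X]submxK mul_block_col mul_row_block !mulmx0 !mul0mx !addr0.
rewrite mul_row_col mulmx0 addr0 mul_col_mx mul0mx; split=> [/eq_col_mx [h1 h2]|[h1 h2]].
  split=> //; rewrite -mulmxA h1 !mulmxA; by rewrite S21 !mul0mx.
congr col_mx => //; rewrite [LHS]Ssplit !mulmxA.
have -> : S2^T *m S2 *m ulsubmx X *m S1^T = S2^T *m (S2 *m ulsubmx X *m S1^T) by rewrite !mulmxA.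
by rewrite h1 mulmx0 addr0.
Qed.

Lemma Yp_parabolic X : parabolic (X - Zk X).
Proof.
have uls (A B : 'M[F]_(n + n)) : ulsubmx (A - B) = ulsubmx A - ulsubmx B.
  by apply/matrixP => r q; rewrite !mxE.
have dls (A B : 'M[F]_(n + n)) : dlsubmx (A - B) = dlsubmx A - dlsubmx B.
  by apply/matrixP => r q; rewrite !mxE.
apply/parabolicE; rewrite uls dls /Zk block_mxKul block_mxKdl subrr mul0mx; split=> //.
rewrite mulmxBr mulmxBl mulmxBr mulmxBl !trmx_mul !trmxK.
have -> : S2 *m (S1^T *m (S1 *m ((ulsubmx X)^T *m S2^T) *m S2)) *m S1^T = 0.
  by rewrite mulmxA S21 !mul0mx.
by rewrite subr0 !mulmxA S22 mul1mx -(mulmxA _ S1) S11 mulmx1 subrr.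
Qed.

(** By duality: [X] preserves the first i coordinates, hence acts on the quotient by their
    orthogonal for J through minus the transpose. *)
Lemma parabolic_T3 X : sp_lie X -> parabolic X -> T3 *m X = - (T1 *m X *m T1^T)^T *m T3.
Proof.
move=> HX PX; have -> : T3 = - (T1 *m JF) by rewrite T1J opprK.
have JX : JF *m X = - (X^T *m JF) by apply/eqP; rewrite -addr_eq0 addrC; apply/eqP.
rewrite !mulNmx mulmxN opprK -(mulmxA T1 JF X) JX mulmxN opprK.
have -> : T1 *m (X^T *m JF) = (X *m T1^T)^T *m JF by rewrite trmx_mul trmxK mulmxA.
by rewrite PX trmx_mul trmxK !mulmxA.
Qed.

Lemma sp_part_mul X Y : parabolic X -> T3 *m Y *m T2^T = 0 ->
  T2 *m (X *m Y) *m T2^T = (T2 *m X *m T2^T) *m (T2 *m Y *m T2^T).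
Proof.
move=> PX TY.
have -> : X *m Y = X *m T1^T *m (T1 *m Y) + X *m T2^T *m (T2 *m Y) + X *m T3^T *m (T3 *m Y).
  by rewrite -[in LHS](mulmx1 X) -Tsum !mulmxDr !mulmxDl !mulmxA.
rewrite !mulmxDr !mulmxDl PX.
have -> : T2 *m (T1^T *m (T1 *m X *m T1^T) *m (T1 *m Y)) = 0.
  by rewrite !mulmxA T21 !mul0mx.
have -> : T2 *m (X *m T3^T *m (T3 *m Y)) *m T2^T = T2 *m X *m T3^T *m (T3 *m Y *m T2^T).
  by rewrite !mulmxA.
by rewrite TY mulmx0 addr0 mul0mx add0r !mulmxA.
Qed.

Lemma gl_part_mul X Y : parabolic Y -> T1 *m (X *m Y) *m T1^T = (T1 *m X *m T1^T) *m (T1 *m Y *m T1^T).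
Proof. 
move=> PY; have -> : T1 *m (X *m Y) *m T1^T = T1 *m X *m (Y *m T1^T) by rewrite !mulmxA.
by rewrite PY !mulmxA.
 Qed.

Lemma sp_part_sp X : sp_lie X ->
  (T2 *m X *m T2^T)^T *m JFm + JFm *m (T2 *m X *m T2^T) = 0.
Proof.
move=> HX; rewrite !trmx_mul trmxK !mulmxA -T2J.
have JT : T2^T *m JFm = JF *m T2^T.
  apply: trmx_inj; rewrite !trmx_mul trmxK.
  have JmT : JFm^T = - JFm.
    by rewrite /JFm tr_block_mx opp_block_mx !trmx0 trmxN trmx1 oppr0 opprK.
  have JT : JF^T = - JF by rewrite /JF tr_block_mx opp_block_mx !trmx0 trmxN trmx1 oppr0 opprK.
  by rewrite JmT JT mulNmx mulmxN -T2J.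
have -> : T2 *m X^T *m T2^T *m JFm = T2 *m (X^T *m JF) *m T2^T by rewrite -mulmxA JT !mulmxA.
have -> : T2 *m JF *m X *m T2^T = T2 *m (JF *m X) *m T2^T by rewrite !mulmxA.
by rewrite -mulmxDl -mulmxDr HX mulmx0 mul0mx.
Qed.

End Selection.

(** * The Lie algebra of P and its Levi components *)

Section ParabolicLie.
Variables (R : realType) (n i : nat) (le_in : (i <= n)%N).
Local Notation C := R[i].
Local Notation m := (n - i)%N.
Local Notation K := (@Kinf R n).
Local Notation Km := (@Kinf R m).
Local Notation P := (@Pin R n i).
Local Notation T1C := (T1 C le_in).
Local Notation T2C := (T2 C le_in).
Local Notation T3C := (T3 C le_in).
Local Notation T1 := (T1 R le_in).
Local Notation T2 := (T2 R le_in).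
Local Notation T3 := (T3 R le_in).
Local Notation J := (Jmx R n).

Lemma toC_JF p : toC (Jmx R p) = JF C p.
Proof.
apply/matrixP => r c; rewrite toC_entry.
case: (fintype.split_ordP r) => a ->; case: (fintype.split_ordP c) => b ->;
  rewrite ?block_mxEul ?block_mxEur ?block_mxEdl ?block_mxEdr !mxE ?raddfN ?raddf0 //=;
  by case: (a == b); rewrite ?oppr0.
Qed.

Lemma spC_sp_lie q (X : 'M[C]_(q + q)) : spC X <-> sp_lie X.
Proof. by rewrite /spC /sp_lie -toC_JF. Qed.

Lemma toC_map p q p' q' (f : 'I_p' -> 'I_p) (g : 'I_q' -> 'I_q) (A : 'M[R]_(p, q)) :
  toC (mxsub f g A) = mxsub f g (toC A).
Proof. by apply/matrixP => r c; rewrite !(toC_entry, mxE). Qed.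

Lemma gl_partT (g : 'M[R]_(n + n)) : gl_part le_in g = T1 *m g *m T1^T.
Proof. exact: gl_partE. Qed.

Lemma sp_partT (g : 'M[R]_(n + n)) : sp_part le_in g = T2 *m g *m T2^T.
Proof. exact: sp_partE. Qed.

Lemma toC_gl_part (g : 'M[R]_(n + n)) : toC (gl_part le_in g) = T1C *m toC g *m T1C^T.
Proof. by rewrite -gl_partE -toC_map. Qed.

Lemma toC_sp_part (g : 'M[R]_(n + n)) : toC (sp_part le_in g) = T2C *m toC g *m T2C^T.
Proof. by rewrite -sp_partE -toC_map. Qed.

Lemma PinP g : P g <-> Sp g /\ parabolic le_in g.
Proof. by split=> -[Sg /(parabolicP le_in) Hg]. Qed.

Lemma LiePP X : Lie P X <-> Lie (@Sp R n) X /\ parabolic le_in X.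
Proof.
split=> [PX|[SX PX]].
  have PE t : Sp (expm (t *: X)) /\ parabolic le_in (expm (t *: X)).
    by apply/PinP; exact: Lie_expm.
  have SX : Lie (@Sp R n) X.
    by apply: LieI => t; have [] := PE t.
  split=> //.
  have H1 := mx_derive_mulr T1^T (expm_derive0 X).
  apply: (mx_derive_unique H1).
  apply: (mx_derive_eq (mx_derive_mull T1^T (mx_derive_mulr T1^T (mx_derive_mull T1 (expm_derive0 X))))) => //.
  by move=> t; have [_ ->] := PE t.
apply: LieI => t; apply/PinP; split; first exact: Lie_expm.
rewrite /parabolic (expm_intertwine t PX) -[in RHS]mulmxA (expm_intertwine t PX) (mulmxA T1).
by rewrite T11 mul1mx.
Qed.

Lemma gl_part_expm X t : Lie P X -> gl_part le_in (expm (t *: X)) = expm (t *: gl_part le_in X).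
Proof.
move=> /LiePP [_ PX]; rewrite !gl_partT -mulmxA (expm_intertwine t PX) mulmxA.
by rewrite T11 mul1mx.
Qed.

Lemma parabolic_expm_T3 X t : Lie P X -> T3 *m expm (t *: X) *m T2^T = 0.
Proof.
move=> /LiePP [/LieSpP SX PX]; have H := parabolic_T3 SX PX.
by rewrite -(expm_intertwine t (esym H)) -(mulmxA _ T3) T32 mulmx0.
Qed.

Lemma sp_part_expm X t : Lie P X -> sp_part le_in (expm (t *: X)) = expm (t *: sp_part le_in X).
Proof.
move=> PX; have [_ pX] := (LiePP X).1 PX.
have H := @expm_flow _ _ _ (sp_part le_in X) (fun t => sp_part le_in (expm (t *: X))) _ t.
rewrite {}H.
  by rewrite scale0r expm0 (sp_partT 1%:M) mulmx1 T22 mulmx1.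
move=> s; rewrite /= !sp_partT -(sp_part_mul pX) ?parabolic_expm_T3 //.
apply: (mx_derive_eq (mx_derive_mulr T2^T (mx_derive_mull T2 (expm_derive X s)))) => // u.
by rewrite sp_partT.
Qed.

Lemma parabolicD (F : comNzRingType) (X Y : 'M[F]_(n + n)) a :
  parabolic le_in X -> parabolic le_in Y -> parabolic le_in (a *: X + Y).
Proof.
rewrite /parabolic => hX hY.
by rewrite mulmxDl -scalemxAl hX hY mulmxDr mulmxDl mulmxDr -!scalemxAr -!scalemxAl -scalemxAr.
Qed.

Lemma parabolicM (F : comNzRingType) (X Y : 'M[F]_(n + n)) :
  parabolic le_in X -> parabolic le_in Y -> parabolic le_in (X *m Y).
Proof.
by move=> hX hY; rewrite /parabolic (gl_part_mul _ hY) -(mulmxA X) hY mulmxA hX !mulmxA.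
Qed.

Lemma LieP_D X Y a : Lie P X -> Lie P Y -> Lie P (a *: X + Y).
Proof.
move=> /LiePP [sX pX] /LiePP [sY pY]; apply/LiePP; split; last exact: parabolicD.
exact: (LieSpD (LieZ a sX) sY).
Qed.

Lemma sp_part_LieC X : LieC (@Sp R n) X -> LieC (@Sp R m) (T2C *m X *m T2C^T).
Proof.
by move=> /LieC_Sp /spC_sp_lie sX; apply/LieC_Sp/spC_sp_lie; exact: (sp_part_sp le_in sX).
Qed.

Lemma parabolicC X : parabolic le_in (X : 'M[C]_(n + n)) <->
  parabolic le_in (mxRe X) /\ parabolic le_in (mxIm X).
Proof.
split=> [/parabolicP H|[/parabolicP Hr /parabolicP Hi]].
  by split; apply/parabolicP => r c ci ir; rewrite ?mxRe_entry ?mxIm_entry H.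
apply/parabolicP => r c ci ir; have := Hr r c ci ir; have := Hi r c ci ir; rewrite mxRe_entry mxIm_entry.
by case: (X r c) => x y /= -> ->.
Qed.

Lemma LieC_P X : LieC P X <-> LieC (@Sp R n) X /\ parabolic le_in X.
Proof.
split=> [/LieC_split [/LiePP [sr pr] /LiePP [si pi]]|[/LieC_split [sr si] /parabolicC [pr pi]]].
  by split; [split|apply/parabolicC].
by split; apply/LiePP.
Qed.

Section Levi.
Variables (p : 'M[R]_(n + n)) (Pp : P p) (Kp : K p).
Local Notation g := (gl_part le_in p).

Let pp : p^T *m p = 1%:M. Proof. by have /KinfP [] := Kp. Qed.
Let pJ : p *m J = J *m p. Proof. by have /KinfP [] := Kp. Qed.
Let pT1 : p *m T1^T = T1^T *m g. Proof. by have /PinP [_] := Pp; rewrite gl_partT. Qed.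

Lemma gl_part_orth : g^T *m g = 1%:M.
Proof.
have -> : g^T *m g = (T1^T *m g)^T *m (T1^T *m g).
  by rewrite trmx_mul trmxK mulmxA -(mulmxA _ T1) T11 mulmx1.
by rewrite -pT1 trmx_mul trmxK mulmxA -(mulmxA T1) pp mulmx1 T11.
Qed.

Let gg : g *m g^T = 1%:M. Proof. exact: (mulmx1C gl_part_orth). Qed.

(** An orthogonal matrix preserving a subspace preserves its orthogonal complement, so an element of
    both P and K is block diagonal. *)
Lemma T1_Levi : T1 *m p = g *m T1.
Proof.
have H : p^T *m T1^T = T1^T *m g^T.
  by rewrite -[T1^T in LHS]mulmx1 -gg (mulmxA T1^T) -pT1 !mulmxA pp mul1mx.
by apply: trmx_inj; rewrite !trmx_mul.
Qed.

Lemma T3_Levi : T3 *m p = g *m T3.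
Proof.
have -> : T3 = - (T1 *m J) by rewrite T1J opprK.
by rewrite mulNmx mulmxN -mulmxA -pJ mulmxA T1_Levi mulmxA.
Qed.

Lemma Pin_inv : P p^T.
Proof.
apply/PinP; split; first by have [] := (Kinf_tr Kp).
by rewrite /parabolic -(mulmxA T1) -trmx_mul T1_Levi trmx_mul (mulmxA T1) T11 mul1mx.
Qed.

Lemma Levi_T3T2 : T3 *m p *m T2^T = 0.
Proof. by rewrite T3_Levi -mulmxA T32 mulmx0. Qed.

Lemma sp_part_J : sp_part le_in p *m Jmx R m = Jmx R m *m sp_part le_in p.
Proof.
rewrite sp_partT; have JT : T2^T *m Jmx R m = J *m T2^T.
  apply: trmx_inj; rewrite !trmx_mul trmxK !Jmx_tr mulNmx mulmxN.
  by rewrite (T2J R le_in : T2 *m J = Jmx R m *m T2).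
rewrite -(mulmxA _ T2^T) JT !mulmxA -(T2J R le_in : T2 *m J = Jmx R m *m T2).
by rewrite -(mulmxA T2 p) pJ !mulmxA.
Qed.

End Levi.

Lemma sp_part_Kinf p : P p -> K p -> Km (sp_part le_in p).
Proof.
move=> Pp Kp; apply/KinfP; split; last exact: sp_part_J.
have /KinfP [pp _] := Kp; have /PinP [_ pT] := Pin_inv Pp Kp.
rewrite {1}sp_partT !trmx_mul trmxK mulmxA sp_partT -(sp_part_mul pT) ?Levi_T3T2 //.
by rewrite pp mulmx1 T22.
Qed.

Lemma sp_part_inv p : P p -> K p -> sp_part le_in p^T = (sp_part le_in p)^T.
Proof. by move=> _ _; rewrite !sp_partT !trmx_mul trmxK mulmxA. Qed.

(** The input for the equivariance of X f: conjugation by [p] acts on the symplectic component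
    through [sp_part p], and leaves the trace of the gl_i component unchanged, which is all that the
    character sees. *)
Lemma Levi_Ad p (Y : 'M[C]_(n + n)) : P p -> K p -> parabolic le_in Y -> LieC (@Sp R n) Y ->
  let Y' := toC p *m Y *m invmx (toC p) in
  [/\ parabolic le_in Y',
      T2C *m Y' *m T2C^T = toC (sp_part le_in p) *m (T2C *m Y *m T2C^T) *m invmx (toC (sp_part le_in p))
    & \tr (T1C *m Y' *m T1C^T) = \tr (T1C *m Y *m T1C^T)].
Proof.
move=> Pp Kp pY sY Y'.
have toCp q : P q -> parabolic le_in (toC q).
  by move=> /PinP [_ H]; apply/parabolicC; rewrite mxRe_toC mxIm_toC /parabolic !mul0mx mulmx0 mul0mx mulmx0.
have Pq := Pin_inv Pp Kp; have Kq := Kinf_tr Kp.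
have pp := toCp _ Pp; have pq := toCp _ Pq.
have qE : invmx (toC p) = toC p^T by rewrite -toC_inv Kinf_inv.
have toCT3 : T3C *m toC p^T *m T2C^T = 0.
  have := congr1 (@toC R _ _) (Levi_T3T2 Pq Kq); rewrite !toCM toC0.
  have -> : toC T3 = T3C.
    apply/matrixP => r c; rewrite toC_entry /T3C /T3 /selgl.
    case: (fintype.split_ordP c) => a ->; rewrite ?row_mxEl ?row_mxEr !mxE //.
    by case: (_ == _).
  have -> // : toC T2^T = T2C^T.
  apply/matrixP => r c; rewrite toC_entry mxE [RHS]mxE /T2C /T2 /selsp.
  case: (fintype.split_ordP c) => a ->; case: (fintype.split_ordP r) => b ->;
    rewrite ?block_mxEul ?block_mxEur ?block_mxEdl ?block_mxEdr !mxE //; by case: (_ == _).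
have T3Y : T3C *m Y *m T2C^T = 0.
  rewrite (parabolic_T3 ((@spC_sp_lie n Y).1 ((LieC_Sp Y).1 sY)) pY).
  by rewrite -(mulmxA _ T3C) T32 mulmx0.
have Levi_pq : T3C *m (Y *m toC p^T) *m T2C^T = 0.
  rewrite !mulmxA (parabolic_T3 ((@spC_sp_lie n Y).1 ((LieC_Sp Y).1 sY)) pY).
  by rewrite -!mulmxA (mulmxA T3C) toCT3 mulmx0.
have YE : Y' = toC p *m (Y *m toC p^T) by rewrite /Y' qE mulmxA.
rewrite YE; split.
- exact: (parabolicM pp (parabolicM pY pq)).
- rewrite (sp_part_mul pp Levi_pq) (sp_part_mul pY toCT3) -toC_inv.
  rewrite (Kinf_inv (sp_part_Kinf Pp Kp)) -sp_part_inv // !toC_sp_part.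
  by rewrite !mulmxA.
- have trE (A B D : 'M[C]_i) : D *m A = 1%:M -> \tr (A *m (B *m D)) = \tr B.
    by move=> DA; rewrite mulmxA mxtrace_mulC mulmxA DA mul1mx.
  rewrite (gl_part_mul _ (parabolicM pY pq)) (gl_part_mul _ pq) -!toC_gl_part trE // -toCM.
  have -> : gl_part le_in p^T = (gl_part le_in p)^T by rewrite !gl_partT !trmx_mul trmxK mulmxA.
  by rewrite gl_part_orth // toC1.
Qed.

Lemma PC_bracket (X Y : 'M[C]_(n + n)) : LieC P X -> LieC P Y ->
  [/\ LieC P (bracket X Y),
      T2C *m bracket X Y *m T2C^T = bracket (T2C *m X *m T2C^T) (T2C *m Y *m T2C^T)
    & \tr (T1C *m bracket X Y *m T1C^T) = 0].
Proof.
move=> /LieC_P [sX pX] /LieC_P [sY pY].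
have T3_ Z : LieC (@Sp R n) Z -> parabolic le_in Z -> T3C *m Z *m T2C^T = 0.
  move=> sZ pZ; rewrite (parabolic_T3 ((@spC_sp_lie n Z).1 ((LieC_Sp Z).1 sZ)) pZ).
  by rewrite -(mulmxA _ T3C) T32 mulmx0.
split.
- apply/LieC_P; split; first exact: LieC_Sp_bracket.
  by rewrite /bracket addrC -scaleN1r; exact: (parabolicD (-1) (parabolicM pY pX) (parabolicM pX pY)).
- rewrite {1}/bracket mulmxBr mulmxBl (sp_part_mul pX (T3_ _ sY pY)).
  by rewrite (sp_part_mul pY (T3_ _ sX pX)).
- rewrite /bracket mulmxBr mulmxBl (gl_part_mul _ pY) (gl_part_mul _ pX) linearB /=.
  by rewrite mxtrace_mulC subrr.
Qed.

Lemma sp_decompose (X : 'M[C]_(n + n)) : LieC (@Sp R n) X ->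
  exists Y Z, [/\ X = Y + Z, LieC P Y & LieC K Z].
Proof.
move=> sX; have [h1 h2] := Zk_sp le_in ((@spC_sp_lie n X).1 ((LieC_Sp X).1 sX)).
have sZ : LieC (@Sp R n) (Zk le_in X) by apply/LieC_Sp/spC_sp_lie.
exists (X - Zk le_in X), (Zk le_in X); split; first by rewrite subrK.
- apply/LieC_P; split; last exact: Yp_parabolic.
  exact: (subspaceB (@LieC_Sp_subspace R n)).
- apply/LieC_K; split; first by apply/spC_sp_lie.
  by rewrite toC_JF.
Qed.

End ParabolicLie.

(** * K-finite vectors and the space of induced sections *)

Section KFinite.
Variables (R : realType) (n : nat) (M : gKdata R n).
Local Notation K := (@Kinf R n).

Lemma K_finite_fin (J : finType) (e : J -> gk_amb M) (c : J -> 'M[R]_(n + n) -> R[i]) (v : gk_amb M) :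
  (forall j, ccontinuous_on K (c j)) -> (forall k, K k -> gk_cpt k v = \sum_j c j k *: e j) ->
  K_finite v.
Proof.
move=> cc vE; exists #|J|, (fun j => e (enum_val j)), (fun j => c (enum_val j)); split=> // k Kk.
by rewrite vE //; exact: big_enum_val.
Qed.

Lemma K_finite_comb (a : R[i]) (u v : gk_amb M) : K_finite u -> K_finite v ->
  (forall k, K k -> gk_cpt k (a *: u + v) = a *: gk_cpt k u + gk_cpt k v) -> K_finite (a *: u + v).
Proof.
move=> [m1 [e1 [c1 [cc1 uE]]]] [m2 [e2 [c2 [cc2 vE]]]] lin.
apply: (@K_finite_fin ('I_m1 + 'I_m2)%type (fun j => match j with inl p => e1 p | inr q => e2 q end)
  (fun j k => match j with inl p => a * c1 p k | inr q => c2 q k end)).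
  by move=> [p|q]; [apply: ccont_mul => //; exact: ccont_cst|exact: cc2].
move=> k Kk; rewrite lin // uE // vE // big_sumType /= scaler_sumr; congr (_ + _).
by apply: eq_bigr => p _; rewrite scalerA.
Qed.

Lemma K_finite0 : (forall k, K k -> gk_cpt k 0 = 0 :> gk_amb M) -> K_finite (0 : gk_amb M).
Proof.
by move=> c0; exists 0%N, (fun=> 0), (fun _ _ => 0); split=> [[]//|k Kk]; rewrite big_ord0 c0.
Qed.

Lemma K_finite_cpt k0 (v : gk_amb M) : K k0 -> K_finite v ->
  (forall k, K k -> gk_cpt k (gk_cpt k0 v) = gk_cpt (k *m k0) v) -> K_finite (gk_cpt k0 v).
Proof.
move=> K0 [m [e [c [cc vE]]]] cM; exists m, e, (fun j k => c j (k *m k0)); split.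
  by move=> j; exact: ccont_translate.
by move=> k Kk; rewrite cM // vE //; exact: KinfM.
Qed.

End KFinite.

Lemma gKmodule_Kmodule (R : realType) n (V : gKdata R n) : is_gKmodule V -> is_Kmodule V.
Proof. by case=> [[_ s1 _ s3] _ ca _]; split. Qed.

Section Ind.
Variables (R : realType) (n i : nat) (le_in : (i <= n)%N).
Local Notation C := R[i].
Local Notation iC := (iC R).
Local Notation m := (n - i)%N.
Local Notation K := (@Kinf R n).
Local Notation P := (@Pin R n i).
Local Notation T1 := (T1 C le_in).
Local Notation T2 := (T2 C le_in).
Variables (mu : 'M[R]_i -> C) (V : gKdata R m).
Hypothesis VM : is_gKmodule V.
(** The character enters through [z]: the differential of delta_P^(1/2) mu on gl_i is [z] times the
    trace. This is proved further on for every continuous character, and [z] turns out to be the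
    last entry of lambda. *)
Variable z : C.
Local Notation N := (normalized n mu).
Hypothesis N1 : N 1%:M = 1.
Hypothesis Nd : forall A : 'M[R]_i,
  is_cderive0 (fun t => N (expm (t *: A))) (z * real_complex R (\tr A)).
Local Notation IV := (Ind le_in mu V).
Local Notation Sf := (@gk_supp _ _ IV).
Local Notation SV := (@gk_supp _ _ V).
Local Notation fn := (gk_amb IV).

Let VK : is_Kmodule V. Proof. exact: gKmodule_Kmodule. Qed.
Let sV : subspace SV. Proof. by case: VK. Qed.

Lemma ind_val0 (f : fn) k : Sf f -> ~ K k -> f k = 0.
Proof. by case=> + _ _ _; exact. Qed.

Lemma ind_valS (f : fn) k : Sf f -> K k -> SV (f k).
Proof. by case=> _ + _ _; exact. Qed.

Lemma ind_equi (f : fn) p k : Sf f -> P p -> K p -> K k ->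
  f (p *m k) = N (gl_part le_in p) *: gk_cpt (sp_part le_in p) (f k).
Proof. by case=> _ _ + _; exact. Qed.

Lemma ind_Kmodule : is_Kmodule IV.
Proof.
have cl k (a : C) (u v : fn) : gk_cpt k (a *: u + v) = a *: gk_cpt k u + gk_cpt k v by [].
have sS : subspace Sf.
  split.
    split=> // [k _|p k Pp Kp Kk|]; first exact: (subspace0 sV).
      rewrite (linear_on0 sV (cpt_linear VK (sp_part_Kinf le_in Pp Kp))).
      by rewrite scaler0.
    exact: (@K_finite0 _ _ (ind_ambient le_in mu V)).
  move=> a u v Su Sv; split.
  - by move=> k Kk; change (a *: u k + v k = 0); rewrite !ind_val0 // scaler0 addr0.
  - by move=> k Kk; apply: sV.2; exact: ind_valS.
  - move=> p k Pp Kp Kk; change (a *: u (p *m k) + v (p *m k) =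
      N (gl_part le_in p) *: gk_cpt (sp_part le_in p) (a *: u k + v k)).
    rewrite !ind_equi // (cpt_linear VK (sp_part_Kinf le_in Pp Kp)); [|exact: ind_valS|exact: ind_valS].
    by rewrite scalerDr !scalerA [a * _]mulrC.
  - by case: Su => _ _ _ Ku; case: Sv => _ _ _ Kv; exact: K_finite_comb.
have Sk k (v : fn) : K k -> Sf v -> Sf (gk_cpt k v).
  move=> Kk Sv; split.
  - move=> l Kl; apply: (ind_val0 Sv) => Klk; apply: Kl.
    by rewrite -[l](mulmxK (Kinf_unit Kk)); apply: KinfM => //; exact: KinfV.
  - by move=> l Kl; apply: (ind_valS Sv); exact: KinfM.
  - move=> p l Pp Kp Kl; change (v (p *m l *m k) =
      N (gl_part le_in p) *: gk_cpt (sp_part le_in p) (v (l *m k))).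
    by rewrite -mulmxA ind_equi //; exact: KinfM.
  - case: Sv => _ _ _ Kv; apply: K_finite_cpt => // l Kl.
    by apply/funext => x; change (v (x *m l *m k) = v (x *m (l *m k))); rewrite mulmxA.
split=> //; split=> //.
- by move=> v Sv; apply/funext => x; change (v (x *m 1%:M) = v x); rewrite mulmx1.
- move=> k k' v Kk Kk' Sv; apply/funext => x.
  by change (v (x *m (k *m k')) = v (x *m k *m k')); rewrite mulmxA.
- by move=> v [].
Qed.

Let KI := ind_Kmodule.
(** [dsigma] with the derivative of the character evaluated, extended complex-linearly to the
    complexified symplectic Lie algebra. *)
Definition dsC (Y : 'M[C]_(n + n)) (v : gk_amb V) : gk_amb V :=
  (z * \tr (T1 *m Y *m T1^T)) *: v + gk_lie (T2 *m Y *m T2^T) v.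

Lemma dsC_in Y v : LieC (@Sp R n) Y -> SV v -> SV (dsC Y v).
Proof.
move=> sY Sv; have [[_ _ lieV _] _ _ _] := VM.
apply: (subspaceD sV); first exact: (subspaceZ _ sV).
by apply: lieV => //; exact: sp_part_LieC.
Qed.

Lemma dsC_linear Y : LieC (@Sp R n) Y -> linear_on SV (dsC Y).
Proof.
move=> sY a u v Su Sv; have [_ [l1 _ _] _ _] := VM.
rewrite /dsC l1 //; last exact: sp_part_LieC.
by rewrite !scalerDr !scalerA [_ * a]mulrC addrACA.
Qed.

Lemma dsC_linear_l v : SV v -> linear_on (LieC (@Sp R n)) (dsC^~ v).
Proof.
move=> Sv a X Y sX sY; have [_ [_ l2 _] _ _] := VM.
rewrite /dsC; have e (p q : nat) (T : 'M[C]_(p, n + n)) : T *m (a *: X + Y) *m T^T = a *: (T *m X *m T^T) + T *m Y *m T^T.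
  by rewrite mulmxDr mulmxDl -scalemxAr -scalemxAl.
rewrite (e _ 0%N) (e _ 0%N) l2 //; try exact: sp_part_LieC.
rewrite mxtraceD mxtraceZ mulrDr scalerDl scalerDr addrACA; congr (_ + _ + _).
by rewrite scalerA mulrCA.
Qed.

Lemma toC_LieSp Y : Lie (@Sp R n) Y -> LieC (@Sp R n) (toC Y).
Proof. exact: (LieC_toC (@LieSp0 R n)). Qed.

Lemma dsigma_toC Y v : dsigma le_in mu Y v = dsC (toC Y) v.
Proof.
rewrite /dsigma /dsC (cderive0E (Nd (gl_part le_in Y))) -toC_sp_part -toC_gl_part.
congr (_ *: _ + _); congr (_ * _).
by rewrite /mxtrace raddf_sum; apply: eq_bigr => j _; rewrite toC_entry.
Qed.

(** Turns the derivative of values of [f] along K into the value at 1 of the derivative of a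
    translate of [f], to which the theory of K-modules applies. *)
Lemma Kd_val (f : fn) Z k : Sf f -> K k -> Lie K Z ->
  vderive0 (fun t : R => f (expm (t *: Z) *m k)) = (Kd Z (gk_cpt k f : fn) : fn) 1%:M.
Proof.
move=> Sg Kk KZ; have Skf : Sf (gk_cpt k f) by case: KI => _ H _; exact: H.
apply: vderive0E.
have ev_lin : linear_on (setT : set fn) (fun g : fn => g 1%:M) by [].
have := vderive_linear (conj I (fun _ _ _ _ _ => I)) ev_lin (fun=> I) (Kd_derive KI KZ Skf).
by move=> H; apply: (vderive_eq H) => // t; change (f (1%:M *m expm (t *: Z) *m k) = f (expm (t *: Z) *m k)); rewrite mul1mx.
Qed.

(* On Lie P and Lie K intersected the two terms of the action agree, by the
   equivariance of sections. *)
Lemma dsC_Kd (f : fn) E : Sf f -> Lie P E -> Lie K E -> dsC (toC E) (f 1%:M) = (Kd E f : fn) 1%:M.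
Proof.
move=> Sg PE KE.
have := Kd_val Sg (@Kinf1 R n) KE; have -> : gk_cpt 1%:M f = f by exact: (cpt1 KI Sg).
move=> <-; apply/esym/vderive0E.
have SV1 := ind_valS Sg (@Kinf1 R n).
have Ks : Lie (@Kinf R m) (sp_part le_in E).
  apply: LieI => t; rewrite -sp_part_expm //; apply: (sp_part_Kinf le_in (Lie_expm t PE) (Lie_expm t KE)).
have [_ _ _ [_ c2]] := VM.
have H := vderive_cscale (Nd (gl_part le_in E)) (c2 _ _ Ks SV1).
apply: (vderive_eq H) => [t|].
  rewrite /= (ind_equi Sg (Lie_expm t PE) (Lie_expm t KE) (@Kinf1 R n)).
  by rewrite gl_part_expm // sp_part_expm.
rewrite !scale0r !expm0 N1 scale1r (cpt1 VK SV1) -dsigma_toC /dsigma.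
by rewrite (cderive0E (Nd (gl_part le_in E))).
Qed.

Lemma cpt_val (f : fn) k l : (gk_cpt k f : fn) l = f (l *m k). Proof. by []. Qed.

Lemma cpt_val1 (f : fn) k : (gk_cpt k f : fn) 1%:M = f k. Proof. by rewrite cpt_val mul1mx. Qed.

(** Settles the choice made by [xget]: two decompositions differ by an element of both Lie P and Lie
    K, which can be moved from one term to the other by [dsC_Kd]. *)
Lemma ind_lie_realE (f : fn) X k Y Z : Sf f -> K k -> Lie P Y -> Lie K Z ->
  k *m X *m invmx k = Y + Z ->
  ind_lie_real le_in mu X f k = dsC (toC Y) (f k) + (Kd Z (gk_cpt k f : fn) : fn) 1%:M.
Proof.
move=> Sg Kk PY KZ XE; have Skf : Sf (gk_cpt k f) by case: KI => _ H _; exact: H.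
rewrite /ind_lie_real asboolT //; apply: xget_unique.
  by exists Y, Z; split=> //; rewrite dsigma_toC Kd_val.
move=> w [Y' [Z' [PY' KZ' XE' ->]]]; rewrite dsigma_toC (Kd_val Sg Kk KZ').
have EE : Y - Y' = Z' - Z.
  apply/eqP; rewrite subr_eq addrAC eq_sym subr_eq; apply/eqP.
  by rewrite -XE XE' addrC.
have PE : Lie P (Y - Y').
  by rewrite addrC -scaleN1r; exact: (LieP_D le_in (-1) PY' PY).
have KE : Lie K (Y - Y').
  by rewrite EE addrC -scaleN1r; exact: (LieKD (LieZ (-1) KZ) KZ').
have YE : toC Y = toC (Y - Y') + toC Y' by rewrite -toCD subrK.
have ZE : Z' = (Y - Y') + Z by rewrite EE subrK.
have [sY' _] := (LiePP le_in Y').1 PY'; have [sE _] := (LiePP le_in _).1 PE.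
have SVk := ind_valS Sg Kk.
rewrite YE [in LHS]ZE (linear_onD (dsC_linear_l SVk) (toC_LieSp sE) (toC_LieSp sY')).
have [_ HD _] := Kd_spec KI Skf; rewrite (HD _ _ KE KZ).
rewrite -[f k]cpt_val1 (dsC_Kd Skf PE KE).
have addv (u v : fn) : (u + v : fn) 1%:M = u 1%:M + v 1%:M by [].
by rewrite addv addrA [X in X + _ = _]addrC.
Qed.

Lemma ind_lieE (f : fn) X k Y Z : Sf f -> K k -> LieC P Y -> LieC K Z ->
  toC k *m X *m invmx (toC k) = Y + Z ->
  (gk_lie X f : fn) k = dsC Y (f k) + (KdC Z (gk_cpt k f : fn) : fn) 1%:M.
Proof.
move=> Sg Kk PY KZ XE; have [Pr Pi] := LieC_split PY; have [Kr Ki] := LieC_split KZ.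
have Er : k *m mxRe X *m invmx k = mxRe Y + mxRe Z by rewrite -mxRe_conj XE mxReD.
have Ei : k *m mxIm X *m invmx k = mxIm Y + mxIm Z by rewrite -mxIm_conj XE mxImD.
change (ind_lie_real le_in mu (mxRe X) f k + iC *: ind_lie_real le_in mu (mxIm X) f k =
  dsC Y (f k) + ((Kd (mxRe Z) (gk_cpt k f : fn) : fn) 1%:M + iC *: (Kd (mxIm Z) (gk_cpt k f : fn) : fn) 1%:M)).
rewrite (ind_lie_realE Sg Kk Pr Kr Er) (ind_lie_realE Sg Kk Pi Ki Ei).
have [sr _] := (LiePP le_in _).1 Pr; have [si _] := (LiePP le_in _).1 Pi.
have SVk := ind_valS Sg Kk.
have -> : dsC Y (f k) = dsC (toC (mxRe Y)) (f k) + iC *: dsC (toC (mxIm Y)) (f k).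
  rewrite {1}(mxC_split Y) addrC (dsC_linear_l SVk iC (toC_LieSp si) (toC_LieSp sr)).
  by rewrite addrC.
by rewrite scalerDr addrACA.
Qed.

End Ind.

Lemma dsCE (R : realType) n i (le_in : (i <= n)%N) (V : gKdata R (n - i)) z Y (v : gk_amb V) :
  dsC le_in z Y v = (z * \tr (T1 _ le_in *m Y *m (T1 _ le_in)^T)) *: v +
    gk_lie (T2 _ le_in *m Y *m (T2 _ le_in)^T) v.
Proof. by []. Qed.

Opaque dsC.

(** * The induced representation as a (g,K)-module *)

Section IndModule.
Variables (R : realType) (n i : nat) (le_in : (i <= n)%N).
Local Notation C := R[i].
Local Notation iC := (iC R).
Local Notation m := (n - i)%N.
Local Notation K := (@Kinf R n).
Local Notation P := (@Pin R n i).
Local Notation T2 := (T2 C le_in).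
Local Notation spn := (LieC (@Sp R n)).
Variables (mu : 'M[R]_i -> C) (V : gKdata R m).
Hypothesis VM : is_gKmodule V.
Variable z : C.
Local Notation N := (normalized n mu).
Hypothesis N1 : N 1%:M = 1.
Hypothesis Nd : forall A : 'M[R]_i,
  is_cderive0 (fun t => N (expm (t *: A))) (z * real_complex R (\tr A)).
Local Notation IV := (Ind le_in mu V).
Local Notation Sf := (@gk_supp _ _ IV).
Local Notation SV := (@gk_supp _ _ V).
Local Notation fn := (gk_amb IV).
Local Notation Ad k X := (toC k *m X *m invmx (toC k)).

Let VK : is_Kmodule V. Proof. exact: gKmodule_Kmodule. Qed.
Let sV : subspace SV. Proof. by case: VK. Qed.
Let KI : is_Kmodule IV. Proof. exact: ind_Kmodule. Qed.
Let sI : subspace Sf. Proof. by case: KI. Qed.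
Let Sk k (f : fn) : K k -> Sf f -> Sf (gk_cpt k f). Proof. by case: KI => _ H _; exact: H. Qed.
Let sSp : subspace spn. Proof. exact: LieC_Sp_subspace. Qed.
Let lieE := ind_lieE (le_in := le_in) VM N1 Nd.

Let fnD a (u v : fn) k : (a *: u + v : fn) k = a *: u k + v k. Proof. by []. Qed.

Lemma AdM k l X : K k -> K l -> Ad (k *m l) X = Ad k (Ad l X).
Proof.
move=> Kk Kl; rewrite toCM invmx_mul; [|exact/toC_unit/Kinf_unit|exact/toC_unit/Kinf_unit].
by rewrite !mulmxA.
Qed.

Lemma Ad1 X : Ad (1%:M : 'M[R]_(n + n)) X = X.
Proof. by rewrite toC1 invmx1 mulmx1 mul1mx. Qed.

Lemma AdD (k : 'M[R]_(n + n)) a X Y : Ad k (a *: X + Y) = a *: Ad k X + Ad k Y.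
Proof. by rewrite mulmxDr mulmxDl -scalemxAr -scalemxAl. Qed.

Lemma ind_lie_out X (f : fn) k : ~ K k -> (gk_lie X f : fn) k = 0.
Proof.
move=> Kk; change (ind_lie_real le_in mu (mxRe X) f k + iC *: ind_lie_real le_in mu (mxIm X) f k = 0).
by rewrite /ind_lie_real asboolF // scaler0 addr0.
Qed.

(** At a point l both sides use one and the same decomposition, that of the conjugate of [X] by l k.
    Questions at arbitrary points are thereby moved to the identity. *)
Lemma ind_lie_cpt k X (f : fn) : K k -> spn X -> Sf f ->
  gk_cpt k (gk_lie X f) = gk_lie (Ad k X) (gk_cpt k f) :> fn.
Proof.
move=> Kk sX Sg; apply/funext => l; rewrite cpt_val.
have [Kl|Kl] := pselect (K l); last first.
  rewrite !ind_lie_out // => Klk; apply: Kl.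
  by rewrite -[l](mulmxK (Kinf_unit Kk)); exact: (KinfM Klk (KinfV Kk)).
have Klk := KinfM Kl Kk.
have [Y [Z [XE PY KZ]]] := sp_decompose le_in (LieC_Sp_conj Klk sX).
rewrite (lieE Sg Klk PY KZ XE).
have XE' : Ad l (Ad k X) = Y + Z by rewrite -AdM.
rewrite (lieE (Sk Kk Sg) Kl PY KZ XE') (cptM KI Kl Kk Sg).
by rewrite cpt_val.
Qed.

Lemma ind_lie_at k X (f : fn) : K k -> spn X -> Sf f ->
  (gk_lie X f : fn) k = (gk_lie (Ad k X) (gk_cpt k f) : fn) 1%:M.
Proof. by move=> Kk sX Sg; rewrite -ind_lie_cpt // cpt_val1. Qed.

Lemma ind_lie1 X Y Z (f : fn) : Sf f -> LieC P Y -> LieC K Z -> X = Y + Z ->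
  (gk_lie X f : fn) 1%:M = dsC le_in z Y (f 1%:M) + (KdC Z f : fn) 1%:M.
Proof.
move=> Sg PY KZ XE; have K1 := @Kinf1 R n.
by rewrite (lieE Sg K1 PY KZ) ?Ad1 // (cpt1 KI Sg).
Qed.

Lemma ind_lie_linear X : spn X -> linear_on Sf (gk_lie X : fn -> fn).
Proof.
move=> sX a u v Su Sv; apply/funext => k.
rewrite -[RHS]/(a *: (gk_lie X u : fn) k + (gk_lie X v : fn) k).
have [Kk|Kk] := pselect (K k); last by rewrite !ind_lie_out // scaler0 addr0.
have [Y [Z [XE PY KZ]]] := sp_decompose le_in (LieC_Sp_conj Kk sX).
rewrite (lieE Su Kk PY KZ XE) (lieE Sv Kk PY KZ XE) (lieE (sI.2 a u v Su Sv) Kk PY KZ XE).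
have [sY _] := (LieC_P le_in Y).1 PY.
have -> : gk_cpt k (a *: u + v) = a *: gk_cpt k u + gk_cpt k v :> fn by [].
rewrite (KdC_linear KI KZ a (Sk Kk Su) (Sk Kk Sv)).
rewrite -[X in dsC _ _ _ X + _]/(a *: u k + v k).
rewrite (dsC_linear le_in VM z sY a (ind_valS Su Kk) (ind_valS Sv Kk)).
by rewrite fnD [in RHS]scalerDr addrACA.
Qed.

Lemma ind_lie_linear_l (f : fn) : Sf f -> linear_on spn (fun X => gk_lie X f : fn).
Proof.
move=> Sg a X X' sX sX'; apply/funext => k.
rewrite -[RHS]/(a *: (gk_lie X f : fn) k + (gk_lie X' f : fn) k).
have [Kk|Kk] := pselect (K k); last by rewrite !ind_lie_out // scaler0 addr0.
have [Y [Z [XE PY KZ]]] := sp_decompose le_in (LieC_Sp_conj Kk sX).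
have [Y' [Z' [XE' PY' KZ']]] := sp_decompose le_in (LieC_Sp_conj Kk sX').
have [sY pY] := (LieC_P le_in Y).1 PY; have [sY' pY'] := (LieC_P le_in Y').1 PY'.
have PYY : LieC P (a *: Y + Y').
  by apply/(LieC_P le_in); split; [exact: sSp.2|exact: parabolicD].
have KZZ : LieC K (a *: Z + Z') by exact: (@LieC_K_subspace R n).2.
have E : Ad k (a *: X + X') = (a *: Y + Y') + (a *: Z + Z').
  by rewrite AdD XE XE' scalerDr addrACA.
rewrite (lieE Sg Kk PY KZ XE) (lieE Sg Kk PY' KZ' XE') (lieE Sg Kk PYY KZZ E).
rewrite (dsC_linear_l le_in VM z (ind_valS Sg Kk) a sY sY').
rewrite (KdC_linear_l KI (Sk Kk Sg) a KZ KZ').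
by rewrite fnD [in RHS]scalerDr addrACA.
Qed.

(** The translate of X f by k is (Ad k X)(k f), so it lies in the span of finitely many products.
    The orbits of [X] and [f] are expanded over their own members, since linearity is available only
    on the Lie algebra and on sections. *)
Lemma ind_lie_K_finite X (f : fn) : spn X -> Sf f -> K_finite (gk_lie X f : fn).
Proof.
move=> sX Sg; have [_ _ [_ _ _ cf]] := KI.
have [N1' [t1 [a1 [Kt1 ac1 fE _]]]] := K_orbit_basis (cf f Sg).
pose e (j : 'I_(n + n) * 'I_(n + n)) : 'M[C]_(n + n) := delta_mx j.1 j.2.
pose c (j : 'I_(n + n) * 'I_(n + n)) (k : 'M[R]_(n + n)) : C := (toC k *m X *m (toC k)^T) j.1 j.2.
have cE j k : c j k = \sum_q (\sum_p real_complex R (k j.1 p) * X p q) * real_complex R (k j.2 q).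
  rewrite /c mxE; apply: eq_bigr => q _; rewrite mxE [_^T _ _]mxE toC_entry.
  by congr (_ * _); apply: eq_bigr => p _; rewrite toC_entry.
have cc j : ccontinuous_on K (c j).
  have ent p q : ccontinuous_on K (fun k : 'M[R]_(n + n) => real_complex R (k p q)).
    split.
      by apply: continuous_subspaceT => x; exact: coord_continuous.
    by apply: (within_eq (@within_cst R _ K 0)) => x _.
  have H : ccontinuous_on K (fun k : 'M[R]_(n + n) => \sum_q (\sum_p real_complex R (k j.1 p) * X p q) * real_complex R (k j.2 q)).
    apply: ccont_sum => q; apply: ccont_mul => //; apply: ccont_sum => p.
    by apply: ccont_mul => //; exact: ccont_cst.
  by apply: (ccont_eq H) => k _; rewrite cE.
have AdE k : K k -> Ad k X = \sum_j c j k *: e j.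
  move=> Kk; have -> : invmx (toC k) = (toC k)^T.
    rewrite -toC_inv (Kinf_inv Kk); apply/matrixP => r q.
    by rewrite toC_entry [RHS]mxE toC_entry mxE.
  by rewrite [LHS]matrix_sum_delta pair_bigA.
pose g := fun j : 'I_#|{: 'I_(n + n) * 'I_(n + n)}| => enum_val j.
have AdE' k : K k -> Ad k X = \sum_j c (g j) k *: e (g j).
  move=> Kk; rewrite (AdE k Kk).
  exact: (big_enum_val (A := [set: 'I_(n + n) * 'I_(n + n)]) (fun j => c j k *: e j)) || exact: big_enum_val.
have [N2 [t2 [B [Kt2 AE _]]]] := orbit_basis AdE'.
apply: (@K_finite_fin _ _ _ ('I_N2 * 'I_N1')%type
  (fun j => gk_lie (Ad (t2 j.1) X) (gk_cpt (t1 j.2) f))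
  (fun j k => (\sum_q c (g q) k * B q j.1) * a1 j.2 k)).
  move=> j; apply: ccont_mul => //; apply: ccont_sum => q; apply: ccont_mul => //; exact: ccont_cst.
move=> k Kk; rewrite (ind_lie_cpt Kk sX Sg) {1}(fE k Kk) {1}(AE k Kk).
have sA l : spn (Ad (t2 l) X) by exact: LieC_Sp_conj.
have Sf1 l : Sf (gk_cpt (t1 l) f) by exact: Sk.
have SF : Sf (\sum_l a1 l k *: gk_cpt (t1 l) f : fn).
  have Q l : true -> Sf (a1 l k *: gk_cpt (t1 l) f : fn) by move=> _; exact: (subspaceZ _ sI (Sf1 l)).
  exact: (subspace_sum (index_enum 'I_N1') sI Q).
rewrite (linear_on_comb _ sSp (ind_lie_linear_l SF) sA).
rewrite -(pair_bigA _ (fun p q => ((\sum_j c (g j) k * B j p) * a1 q k) *: (gk_lie (Ad (t2 p) X) (gk_cpt (t1 q) f) : fn))).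
apply: eq_bigr => p _; rewrite (linear_on_comb _ sI (ind_lie_linear (sA p)) Sf1) scaler_sumr.
by apply: eq_bigr => q _; rewrite scalerA.
Qed.

(** For equivariance, conjugating a decomposition at k by an element p of both P and K gives a
    decomposition at p k, and [Levi_Ad] compares the resulting terms. *)
Lemma ind_lie_in X (f : fn) : spn X -> Sf f -> Sf (gk_lie X f : fn).
Proof.
move=> sX Sg; split.
- by move=> k Kk; exact: ind_lie_out.
- move=> k Kk; have [Y [Z [XE PY KZ]]] := sp_decompose le_in (LieC_Sp_conj Kk sX).
  rewrite (lieE Sg Kk PY KZ XE); have [sY _] := (LieC_P le_in Y).1 PY.
  apply: (subspaceD sV); first exact: (dsC_in le_in VM z sY (ind_valS Sg Kk)).
  exact: (ind_valS (KdC_in KI KZ (Sk Kk Sg)) (@Kinf1 R n)).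
- move=> p k Pp Kp Kk; have [Y [Z [XE PY KZ]]] := sp_decompose le_in (LieC_Sp_conj Kk sX).
  have [sY pY] := (LieC_P le_in Y).1 PY.
  have [pY' spY' trY'] := Levi_Ad Pp Kp pY sY.
  have Kpk := KinfM Kp Kk.
  have PY' : LieC P (Ad p Y) by apply/(LieC_P le_in); split => //; exact: LieC_Sp_conj.
  have KZ' : LieC K (Ad p Z) by exact: LieC_K_conj.
  have E : Ad (p *m k) X = Ad p Y + Ad p Z.
    by rewrite AdM // XE -[Y]scale1r AdD !scale1r.
  rewrite (lieE Sg Kpk PY' KZ' E) (lieE Sg Kk PY KZ XE).
  have Kp2 := sp_part_Kinf le_in Pp Kp; have SVk := ind_valS Sg Kk.
  have SKf := KdC_in KI KZ (Sk Kk Sg).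
  have SV1 := ind_valS SKf (@Kinf1 R n).
  rewrite (cptM KI Kp Kk Sg) -(KdC_Ad KI Kp KZ (Sk Kk Sg)) cpt_val mul1mx.
  have := ind_equi SKf Pp Kp (@Kinf1 R n); rewrite mulmx1 => ->.
  rewrite (ind_equi Sg Pp Kp Kk) (linear_onD (cpt_linear VK Kp2) (dsC_in le_in VM z sY SVk) SV1).
  rewrite scalerDr; congr (_ + _).
  have Scp : SV (gk_cpt (sp_part le_in p) (f k)) by case: VK => _ H _; exact: H.
  rewrite (linear_onZ _ sV (dsC_linear le_in VM z (LieC_Sp_conj Kp sY)) Scp); congr (_ *: _).
  rewrite !dsCE trY' spY'; have [_ _ _ [c1 _]] := VM.
  have sY2 := sp_part_LieC le_in sY.
  have lieV : SV (gk_lie (T2 *m Y *m T2^T) (f k)) by have [[_ _ H _] _ _ _] := VM; exact: H.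
  rewrite (linear_onD (cpt_linear VK Kp2) (subspaceZ _ sV SVk) lieV).
  rewrite (linear_onZ _ sV (cpt_linear VK Kp2) SVk).
  by rewrite (c1 _ _ _ Kp2 sY2 SVk).
- exact: ind_lie_K_finite.
Qed.

(** On k the decomposition with zero component in Lie P is available at every point. *)
Lemma ind_lie_k Z (f : fn) : LieC K Z -> Sf f -> gk_lie Z f = KdC Z f :> fn.
Proof.
move=> KZ Sg; apply/funext => k; have SZ := KdC_in KI KZ Sg.
have [Kk|Kk] := pselect (K k); last by rewrite ind_lie_out // (ind_val0 SZ).
have KZ' := LieC_K_conj Kk KZ.
have P0 : LieC P (0 : 'M[C]_(n + n)).
  apply/(LieC_P le_in); split; first exact: (subspace0 sSp).
  by rewrite /parabolic !mul0mx mulmx0 mul0mx mulmx0.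
rewrite (lieE Sg Kk P0 KZ') ?add0r // -(KdC_Ad KI Kk KZ Sg) cpt_val1.
have -> : dsC le_in z (0 : 'M[C]_(n + n)) (f k) = 0.
  exact: (linear_on0 sSp (dsC_linear_l le_in VM z (ind_valS Sg Kk))).
by rewrite add0r.
Qed.

End IndModule.

Section IndBracket.
Variables (R : realType) (n i : nat) (le_in : (i <= n)%N).
Local Notation C := R[i].
Local Notation m := (n - i)%N.
Local Notation K := (@Kinf R n).
Local Notation P := (@Pin R n i).
Local Notation T1 := (T1 C le_in).
Local Notation T2 := (T2 C le_in).
Local Notation spn := (LieC (@Sp R n)).
Variables (mu : 'M[R]_i -> C) (V : gKdata R m).
Hypothesis VM : is_gKmodule V.
Variable z : C.
Local Notation N := (normalized n mu).
Hypothesis N1 : N 1%:M = 1.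
Hypothesis Nd : forall A : 'M[R]_i,
  is_cderive0 (fun t => N (expm (t *: A))) (z * real_complex R (\tr A)).
Local Notation IV := (Ind le_in mu V).
Local Notation Sf := (@gk_supp _ _ IV).
Local Notation SV := (@gk_supp _ _ V).
Local Notation fn := (gk_amb IV).
Local Notation Ad k X := (toC k *m X *m invmx (toC k)).

Let KI : is_Kmodule IV. Proof. exact: ind_Kmodule. Qed.
Let sI : subspace Sf. Proof. by case: KI. Qed.
Let Sk k (f : fn) : K k -> Sf f -> Sf (gk_cpt k f). Proof. by case: KI => _ H _; exact: H. Qed.
Let sSp : subspace spn. Proof. exact: LieC_Sp_subspace. Qed.
Let ind_lie_in' := @ind_lie_in R n i le_in mu V VM z N1 Nd.
Let ind_lie_linear_l' := @ind_lie_linear_l R n i le_in mu V VM z N1 Nd.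
Let ind_lie_linear' := @ind_lie_linear R n i le_in mu V VM z N1 Nd.
Let ind_lie_cpt' := @ind_lie_cpt R n i le_in mu V VM z N1 Nd.
Let ind_lie_k' := @ind_lie_k R n i le_in mu V VM z N1 Nd.
Let ind_lie_at' := @ind_lie_at R n i le_in mu V VM z N1 Nd.
Let ind_lie1' := @ind_lie1 R n i le_in mu V VM z N1 Nd.
Let ind_lie_out' := @ind_lie_out R n i le_in mu V.

Let zmod_regroup (W : zmodType) (a b c d e g : W) :
  a - b + (c - d + (e - g)) = a + c + e - (b + d + g).
Proof. by rewrite opprD (opprD b d) (addrACA (a + c) e) (addrACA a c) !addrA. Qed.

Let zmod_cancel (W : zmodType) (p q r s t : W) :
  s - t = p + q + (r + s) - (p + r + (q + t)).
Proof. by rewrite !addrA (addrAC p r q) opprD addrACA subrr add0r. Qed.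

Lemma dsC_bracket Y1 Y2 v : LieC P Y1 -> LieC P Y2 -> SV v ->
  dsC le_in z (bracket Y1 Y2) v = dsC le_in z Y1 (dsC le_in z Y2 v) - dsC le_in z Y2 (dsC le_in z Y1 v).
Proof.
move=> PY1 PY2 Sv; have [PB spB trB] := PC_bracket le_in PY1 PY2.
have [sY1 _] := (LieC_P le_in Y1).1 PY1; have [sY2 _] := (LieC_P le_in Y2).1 PY2.
have [[_ _ lieV _] [l1 _ l3] _ _] := VM.
have sp1 := sp_part_LieC le_in sY1; have sp2 := sp_part_LieC le_in sY2.
rewrite !(dsCE le_in z) trB mulr0 scale0r add0r spB {trB spB}.
move: sp1 sp2; set A1 := T2 *m Y1 *m T2^T; set A2 := T2 *m Y2 *m T2^T.
set c1 := z * \tr (T1 *m Y1 *m T1^T); set c2 := z * \tr (T1 *m Y2 *m T1^T) => sp1 sp2.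
clearbody A1 A2 c1 c2.
rewrite (l3 A1 A2 v sp1 sp2 Sv).
rewrite (l1 A1 c2 v _ sp1 Sv (lieV _ _ sp2 Sv)) (l1 A2 c1 v _ sp2 Sv (lieV _ _ sp1 Sv)).
rewrite (scalerDr c1) (scalerDr c2) !scalerA [c2 * c1]mulrC.
exact: zmod_cancel.
Qed.

Lemma bracketC_ (X Y : 'M[C]_(n + n)) : bracket X Y = (-1) *: bracket Y X + 0.
Proof. by rewrite addr0 scaleN1r /bracket opprB. Qed.

Lemma bracketDl (X X' Y : 'M[C]_(n + n)) : bracket (X + X') Y = bracket X Y + bracket X' Y.
Proof. by rewrite /bracket mulmxDl mulmxDr opprD addrACA. Qed.

Lemma bracketDr (X Y Y' : 'M[C]_(n + n)) : bracket X (Y + Y') = bracket X Y + bracket X Y'.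
Proof. by rewrite /bracket mulmxDl mulmxDr opprD addrACA. Qed.

(** By translation it suffices to compare values at 1. Split both elements into parts in Lie P and
    k: brackets with an element of k come from K-equivariance, and on Lie P the action at 1 is
    [dsC], a representation because the trace kills brackets. *)
Lemma ind_lie_bracket X Y (f : fn) : spn X -> spn Y -> Sf f ->
  gk_lie (bracket X Y) f = gk_lie X (gk_lie Y f) - gk_lie Y (gk_lie X f) :> fn.
Proof.
move=> sX sY Sg.
have kK Z : LieC K Z -> spn Z by exact: LieC_K_Sp.
have brk Z W g : LieC K Z -> spn W -> Sf g ->
    gk_lie (bracket Z W) g = gk_lie Z (gk_lie W g) - gk_lie W (gk_lie Z g) :> fn.
  move=> KZ sW Sg'.
  have [_ E] := compat_bracket KI (L := spn) (b := fun X (f : fn) => gk_lie X f : fn) sSp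
    (fun k X => @LieC_Sp_conj R n k X) ind_lie_in' ind_lie_linear_l' ind_lie_linear' ind_lie_cpt' KZ sW Sg'.
  by rewrite E -(ind_lie_k' KZ (ind_lie_in' sW Sg')) -(ind_lie_k' KZ Sg').
have DX A B g : spn A -> spn B -> Sf g -> gk_lie (A + B) g = gk_lie A g + gk_lie B g :> fn.
  by move=> sA sB Sg'; exact: (linear_onD (ind_lie_linear_l' Sg') sA sB).
have Df A g h : spn A -> Sf g -> Sf h -> gk_lie A (g + h) = gk_lie A g + gk_lie A h :> fn.
  by move=> sA Sg1 Sg2; exact: (linear_onD (ind_lie_linear' sA) Sg1 Sg2).
have at1 A B g : spn A -> spn B -> Sf g ->
    (gk_lie (bracket A B) g : fn) 1%:M = (gk_lie A (gk_lie B g) - gk_lie B (gk_lie A g) : fn) 1%:M.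
  move=> sA sB Sg'.
  have [Y1 [Z1 [AE PY1 KZ1]]] := sp_decompose le_in sA.
  have [Y2 [Z2 [BE PY2 KZ2]]] := sp_decompose le_in sB.
  have [sY1 _] := (LieC_P le_in Y1).1 PY1; have [sY2 _] := (LieC_P le_in Y2).1 PY2.
  have sZ1 := kK _ KZ1; have sZ2 := kK _ KZ2.
  have sub D : spn D -> forall W, LieC K W ->
      gk_lie (bracket D W) g = gk_lie D (gk_lie W g) - gk_lie W (gk_lie D g) :> fn.
    move=> sD W KW; have sW := kK _ KW.
    rewrite bracketC_ (ind_lie_linear_l' Sg' (-1) (LieC_Sp_bracket sW sD) (subspace0 sSp)).
    rewrite (linear_on0 sSp (ind_lie_linear_l' Sg')) addr0 (brk W D g KW sD Sg').
    by rewrite scaleN1r opprB.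
  have YY : (gk_lie (bracket Y1 Y2) g : fn) 1%:M =
      (gk_lie Y1 (gk_lie Y2 g) - gk_lie Y2 (gk_lie Y1 g) : fn) 1%:M.
    have [PB _ _] := PC_bracket le_in PY1 PY2.
    have p1 D h : LieC P D -> Sf h -> (gk_lie D h : fn) 1%:M = dsC le_in z D (h 1%:M).
      move=> PD Sh; have K0 : LieC K (0 : 'M[C]_(n + n)) by exact: (subspace0 (@LieC_K_subspace R n)).
      rewrite (ind_lie1' Sh PD K0) ?addr0 // (linear_on0 (@LieC_K_subspace R n) (KdC_linear_l KI Sh)).
      by rewrite addr0.
    rewrite -[RHS]/((gk_lie Y1 (gk_lie Y2 g) : fn) 1%:M - (gk_lie Y2 (gk_lie Y1 g) : fn) 1%:M).
    rewrite (p1 _ _ PB Sg') (p1 _ _ PY1 (ind_lie_in' sY2 Sg')) (p1 _ _ PY2 (ind_lie_in' sY1 Sg')).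
    rewrite (p1 _ _ PY1 Sg') (p1 _ _ PY2 Sg').
    exact: (dsC_bracket PY1 PY2 (ind_valS Sg' (@Kinf1 R n))).
  have E1 : (gk_lie (bracket A B) g : fn) = gk_lie (bracket Y1 Y2) g +
      (gk_lie (bracket Y1 Z2) g + gk_lie (bracket Z1 B) g).
    rewrite AE bracketDl {1}BE bracketDr.
    have b1 := LieC_Sp_bracket sY1 sY2; have b2 := LieC_Sp_bracket sY1 sZ2.
    have b3 := LieC_Sp_bracket sZ1 sB.
    rewrite (DX _ _ _ (subspaceD sSp b1 b2) b3 Sg') (DX _ _ _ b1 b2 Sg').
    exact/esym/addrA.
  rewrite E1 (sub Y1 sY1 Z2 KZ2) (brk Z1 B g KZ1 sB Sg').
  have -> : gk_lie A (gk_lie B g) = gk_lie Y1 (gk_lie Y2 g) + gk_lie Y1 (gk_lie Z2 g) + gk_lie Z1 (gk_lie B g) :> fn.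
    rewrite AE (DX _ _ _ sY1 sZ1 (ind_lie_in' sB Sg')); congr (_ + _).
    by rewrite BE (DX _ _ _ sY2 sZ2 Sg') (Df _ _ _ sY1 (ind_lie_in' sY2 Sg') (ind_lie_in' sZ2 Sg')).
  have -> : gk_lie B (gk_lie A g) = gk_lie Y2 (gk_lie Y1 g) + gk_lie Z2 (gk_lie Y1 g) + gk_lie B (gk_lie Z1 g) :> fn.
    rewrite [in LHS]AE (DX _ _ _ sY1 sZ1 Sg') (Df _ _ _ sB (ind_lie_in' sY1 Sg') (ind_lie_in' sZ1 Sg')); congr (_ + _).
    by rewrite BE (DX _ _ _ sY2 sZ2 (ind_lie_in' sY1 Sg')).
  have fD (u v : fn) : (u + v : fn) 1%:M = u 1%:M + v 1%:M by [].
  by rewrite fD YY -fD zmod_regroup.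
apply/funext => k; rewrite -[RHS]/((gk_lie X (gk_lie Y f) : fn) k - (gk_lie Y (gk_lie X f) : fn) k).
have [Kk|Kk] := pselect (K k); last by rewrite !ind_lie_out' // subrr.
rewrite (ind_lie_at' Kk (LieC_Sp_bracket sX sY) Sg).
rewrite (ind_lie_at' Kk sX (ind_lie_in' sY Sg)) (ind_lie_at' Kk sY (ind_lie_in' sX Sg)).
rewrite (ind_lie_cpt' Kk sY Sg) (ind_lie_cpt' Kk sX Sg).
have -> : Ad k (bracket X Y) = bracket (Ad k X) (Ad k Y).
  have ku : toC k \in unitmx by exact/toC_unit/Kinf_unit.
  by rewrite /bracket mulmxBr mulmxBl !mulmxA !(mulmxKV ku).
exact: (at1 _ _ _ (LieC_Sp_conj Kk sX) (LieC_Sp_conj Kk sY) (Sk Kk Sg)).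
Qed.

Lemma ind_gKmodule : is_gKmodule IV.
Proof.
have [_ _ ca] := KI; have sS := sI; split=> //.
- by split.
- split.
  + by move=> X a u v sX Su Sv; exact: (ind_lie_linear' sX).
  + by move=> X Y a v sX sY Sv; exact: (ind_lie_linear_l' Sv).
  + by move=> X Y v sX sY Sv; exact: ind_lie_bracket.
- split.
  + by move=> k X v Kk sX Sv; exact: ind_lie_cpt'.
  + move=> X v KX Sv; have KX' := LieC_toC (@LieK0 R n) KX.
    have E : gk_lie (toC X) v = Kd X v :> fn by rewrite (ind_lie_k' KX' Sv) (KdC_toC KI KX Sv).
    exact: (vderive_eq (Kd_derive KI KX Sv) (fun=> erefl) (esym E)).
Qed.

End IndBracket.

(** * Characters of GL_i and of the multiplicative group *)

Section BlockCharacters.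
Variables (F : fieldType) (D : fieldType).

Definition unip (p : nat) (b : 'rV[F]_p) : 'M[F]_(1 + p) := block_mx 1%:M b 0 1%:M.
Definition unil (p : nat) (b : 'cV[F]_p) : 'M[F]_(1 + p) := block_mx 1%:M 0 b 1%:M.
Definition diag1 (p : nat) (x : F) (d : 'M[F]_p) : 'M[F]_(1 + p) := block_mx x%:M 0 0 d.

Lemma diag1M p x y (d e : 'M[F]_p) : diag1 x d *m diag1 y e = diag1 (x * y) (d *m e).
Proof. by rewrite /diag1 mulmx_block !mulmx0 !mul0mx !addr0 add0r scalar_mxM. Qed.

Lemma diag1_det p x (d : 'M[F]_p) : \det (diag1 x d) = x * \det d.
Proof. by rewrite /diag1 det_ublock det_scalar1. Qed.

Lemma diag1_00 p x (d : 'M[F]_p) : diag1 x d 0 0 = x.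
Proof.
have -> : 0 = lshift p 0 :> 'I_(1 + p) by exact: val_inj.
by rewrite /diag1 block_mxEul mxE eqxx mulr1n.
Qed.

Lemma unipM p (b c : 'rV[F]_p) : unip b *m unip c = unip (b + c).
Proof. by rewrite /unip mulmx_block !mulmx0 !mul0mx !mul1mx !mulmx1 !addr0 !add0r addrC. Qed.

Lemma unilM p (b c : 'cV[F]_p) : unil b *m unil c = unil (b + c).
Proof. by rewrite /unil mulmx_block !mulmx0 !mul0mx !mul1mx !mulmx1 !addr0 !add0r. Qed.

Lemma unip_det p (b : 'rV[F]_p) : \det (unip b) = 1.
Proof. by rewrite /unip det_ublock !det1 mulr1. Qed.

Lemma unil_det p (b : 'cV[F]_p) : \det (unil b) = 1.
Proof. by rewrite /unil det_lblock !det1 mulr1. Qed.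

Lemma diag1_unip p (b : 'rV[F]_p) x : diag1 x 1%:M *m unip b = unip (x *: b) *m diag1 x 1%:M.
Proof.
by rewrite /diag1 /unip !mulmx_block !mulmx0 !mul0mx !mul1mx !mulmx1 !addr0 !add0r mul_scalar_mx.
Qed.

Lemma diag1_unil p (b : 'cV[F]_p) x : diag1 x 1%:M *m unil (x *: b) = unil b *m diag1 x 1%:M.
Proof.
by rewrite /diag1 /unil !mulmx_block !mulmx0 !mul0mx !mul1mx !mulmx1 !addr0 !add0r mul_mx_scalar.
Qed.

Lemma block_decomp p (x : F) (b : 'rV[F]_p) (c : 'cV[F]_p) (d : 'M[F]_p) : x != 0 ->
  block_mx x%:M b c d = unil (x^-1 *: c) *m diag1 x (d - x^-1 *: (c *m b)) *m unip (x^-1 *: b).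
Proof.
move=> x0; rewrite /unil /diag1 /unip !mulmx_block !mulmx0 !mul0mx !mul1mx !mulmx1 !addr0 !add0r.
have xb : x%:M *m (x^-1 *: b) = b by rewrite mul_scalar_mx scalerA divff // scale1r.
have cx : x^-1 *: c *m x%:M = c by rewrite mul_mx_scalar scalerA divff // scale1r.
by rewrite cx xb -scalemxAr addrC subrK.
Qed.

(* In dimension one more than p: matrices with nonzero corner are handled by
   block elimination, and unipotent factors u(b) lie in the kernel since
   diag(2, 1) conjugates u(b) to u(b)^2. *)
Lemma char_factors_det p (mu : 'M[F]_(1 + p) -> D) : (2 : F) != 0 ->
  (forall a, a \in unitmx -> mu a != 0) ->
  (forall a b, a \in unitmx -> b \in unitmx -> mu (a *m b) = mu a * mu b) ->
  forall a, a \in unitmx -> mu a = mu (diag1 (\det a) 1%:M).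
Proof.
move=> n2; elim: p mu => [|p IH] mu mu0 muM a ua.
  congr mu; rewrite [LHS](@mx11_scalar F a) [RHS](@mx11_scalar F); congr _%:M.
  by rewrite diag1_00 (det_mx11 a).
have unitE q (b : 'M[F]_q) : (b \in unitmx) = (\det b != 0) by rewrite unitmxE unitfE.
have u1 : (diag1 2 1%:M : 'M[F]_(1 + p.+1)) \in unitmx by rewrite unitE diag1_det det1 mulr1.
have uu b : unip b \in unitmx by rewrite unitE unip_det oner_eq0.
have ul b : unil b \in unitmx by rewrite unitE unil_det oner_eq0.
have idem (x : D) : x != 0 -> x = x * x -> x = 1.
  by move=> x0 xx; apply: (mulfI x0); rewrite mulr1.
have mu_u (b : 'rV[F]_p.+1) : mu (unip b) = 1.
  apply: (idem _ (mu0 _ (uu _ b))).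
  rewrite -(muM _ _ (uu _ b) (uu _ b)) unipM -mulr2n -scaler_nat; apply: (mulIf (mu0 _ u1)).
  by rewrite -(muM _ _ (uu _ (2 *: b)) u1) -diag1_unip (muM _ _ u1 (uu _ b)) mulrC.
have mu_l (b : 'cV[F]_p.+1) : mu (unil b) = 1.
  apply: (idem _ (mu0 _ (ul _ b))).
  rewrite -(muM _ _ (ul _ b) (ul _ b)) unilM -mulr2n -scaler_nat; apply: (mulIf (mu0 _ u1)).
  by rewrite -(muM _ _ (ul _ b) u1) -diag1_unil (muM _ _ u1 (ul _ (2 *: b))) mulrC.
have mu_d (d : 'M[F]_(1 + p)) : d \in unitmx -> mu (diag1 1 d) = mu (diag1 (\det d) 1%:M).
  move=> ud; pose nu d := mu (diag1 1 d).
  have un (e : 'M[F]_(1 + p)) : e \in unitmx -> (diag1 1 e : 'M[F]_(1 + p.+1)) \in unitmx.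
    by rewrite !unitE diag1_det mul1r.
  rewrite -[LHS]/(nu d) (IH nu) //.
  - rewrite /nu; set x := \det d.
    have x0 : x != 0 by rewrite -unitE.
    have sD q (y w : F) : y%:M + w%:M = (y + w)%:M :> 'M[F]_q.
      by apply/matrixP => r k; rewrite !mxE mulrnDl.
    have sN q (w : F) : - w%:M = (- w)%:M :> 'M[F]_q.
      by apply/matrixP => r k; rewrite !mxE mulNrn.
    (* The entry x is moved from the second diagonal place to the first: (1, b; c, 1) with b c = 1 -
       x factors both with a unipotent lower factor on the left and diagonal (1, x, 1, ..., 1), and
       with a unipotent upper factor on the left and diagonal (x, 1, ..., 1). *)
    pose b : 'rV[F]_(1 + p) := row_mx (1 - x)%:M 0.
    pose c : 'cV[F]_(1 + p) := col_mx 1%:M 0.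
    have cb : 1%:M - c *m b = diag1 x 1%:M.
      rewrite /c /b mul_col_row !mulmx0 !mul0mx mul1mx [X in X - _]scalar_mx_block /diag1.
      by rewrite opp_block_mx add_block_mx !subr0 sN sD opprB addrC subrK.
    have bc : b *m c = (1 - x)%:M by rewrite mul_row_col mulmx1 mulmx0 addr0.
    have e1 : block_mx 1%:M b c 1%:M = unip b *m diag1 x 1%:M *m unil c.
      rewrite /unil /diag1 /unip !mulmx_block !mulmx0 !mul0mx !mul1mx !mulmx1 !addr0 !add0r.
      by rewrite bc sD addrC subrK mul1mx.
    have e2 : block_mx 1%:M b c 1%:M = unil c *m diag1 1 (diag1 x 1%:M) *m unip b.
      by rewrite (@block_decomp _ 1 b c 1%:M) ?oner_neq0 // invr1 !scale1r cb.
    have u2 : (diag1 x 1%:M : 'M[F]_(1 + (1 + p))) \in unitmx by rewrite unitE diag1_det det1 mulr1.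
    have u3 : (diag1 1 (diag1 x 1%:M) : 'M[F]_(1 + (1 + p))) \in unitmx.
      by rewrite unitE !diag1_det det1 mul1r mulr1.
    have := congr1 mu e1; rewrite e2.
    rewrite muM ?unitmx_mul ?uu ?ul ?u3 // (muM _ _ (ul _ c) u3) mu_l mul1r mu_u mulr1 => ->.
    by rewrite muM ?unitmx_mul ?uu ?ul ?u2 // (muM _ _ (uu _ b) u2) mu_l mulr1 mu_u mul1r.
  - by move=> e ue; exact/mu0/un.
  - by move=> e f ue uf; rewrite /nu -muM ?un // diag1M mulr1.
have corner (b : 'M[F]_(1 + p.+1)) : b \in unitmx -> b 0 0 != 0 -> mu b = mu (diag1 (\det b) 1%:M).
  move=> ub b0.
  have bE : b = unil ((b 0 0)^-1 *: dlsubmx b) *m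
      diag1 (b 0 0) (drsubmx b - (b 0 0)^-1 *: (dlsubmx b *m ursubmx b)) *m unip ((b 0 0)^-1 *: ursubmx b).
    rewrite -block_decomp // -[LHS]submxK; congr block_mx.
    rewrite [LHS]mx11_scalar; congr _%:M; rewrite !mxE; congr (b _ _); exact: val_inj.
  set s := drsubmx b - _ in bE.
  have dE : \det b = b 0 0 * \det s by rewrite {1}bE !det_mulmx unil_det unip_det diag1_det mul1r mulr1.
  have us : s \in unitmx by move: ub; rewrite !unitE dE mulf_eq0 negb_or => /andP [].
  have ud : diag1 (b 0 0) s \in unitmx by rewrite unitE diag1_det -dE -unitE.
  have ux y : y != 0 -> (diag1 y 1%:M : 'M[F]_(1 + p.+1)) \in unitmx by rewrite unitE diag1_det det1 mulr1.
  have u1s : (diag1 1 s : 'M[F]_(1 + p.+1)) \in unitmx by rewrite unitE diag1_det mul1r -unitE.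
  rewrite {1}bE !muM ?unitmx_mul ?uu ?ul // mu_u mu_l mul1r mulr1 dE.
  have -> : diag1 (b 0 0) s = diag1 (b 0 0) 1%:M *m diag1 1 s by rewrite diag1M mulr1 mul1mx.
  rewrite muM ?ux // mu_d // -muM ?ux // -?unitE //.
  by rewrite diag1M mulmx1.
have [a0|] := eqVneq (a 0 0) 0; last exact: corner.
have [r ar] : exists r : 'I_p.+1, a (rshift 1 r) 0 != 0.
  apply: contrapT => H; have := ua; rewrite unitE => /eqP; apply.
  rewrite (expand_det_col a 0) big1 // => k _.
  case: (fintype.split_ordP k) => k' ->.
    by rewrite ord1 (_ : lshift _ 0 = 0) ?a0 ?mul0r //; exact: val_inj.
  have -> : a (rshift 1 k') 0 = 0 by apply: contrapT => h; apply: H; exists k'; apply/eqP.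
  by rewrite mul0r.
have ga : mu a = mu (unip (delta_mx 0 r) *m a) by rewrite muM // mu_u mul1r.
have da : \det (unip (delta_mx 0 r) *m a) = \det a by rewrite det_mulmx unip_det mul1r.
rewrite ga -da; apply: corner; first by rewrite unitmx_mul uu.
rewrite -[a]submxK /unip mulmx_block (_ : (0 : 'I_(1 + p.+1)) = lshift p.+1 0); last exact: val_inj.
rewrite block_mxEul mul1mx mxE.
have l0 : lshift p.+1 (0 : 'I_1) = 0 :> 'I_(1 + p.+1) by exact: val_inj.
have -> : ulsubmx a 0 0 = 0 by rewrite !mxE l0.
rewrite add0r mxE (bigD1 r) //= [delta_mx _ _ _ _]mxE !eqxx mul1r big1 ?addr0; last first.
  by move=> k kr; rewrite mxE eqxx (negbTE kr) mul0r.
by rewrite !mxE l0.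
Qed.

End BlockCharacters.

Section OneParameterCharacters.
Variable R : realType.
Local Notation C := R[i].
Implicit Types (e : R -> C) (s t x : R).

Lemma cderive_affine e (a : R) d : is_cderive0 e d -> is_cderive0 (fun t => e (a * t)) (real_complex R a * d).
Proof.
case=> er ei; have e0 : a * 0 + 0 = 0 by rewrite mulr0 addr0.
split.
  apply: (is_derive_fun_eq (@is_derive_affine R (fun t => complex.Re (e t)) a 0 0 (complex.Re d) _)).
  - by rewrite e0.
  - by move=> t; rewrite addr0.
  - by case: d {er ei} => x y /=; rewrite mul0r subr0.
apply: (is_derive_fun_eq (@is_derive_affine R (fun t => complex.Im (e t)) a 0 0 (complex.Im d) _)).
- by rewrite e0.
- by move=> t; rewrite addr0.
- by case: d {er ei} => x y /=; rewrite mul0r addr0.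
Qed.

Lemma cderive_real (f : R -> R) d : is_derive (0 : R) (1 : R) f d ->
  is_cderive0 (fun t => real_complex R (f t)) (real_complex R d).
Proof. by move=> fd; split; [exact: fd|exact: is_derive_const]. Qed.

Lemma cderive_expR s : is_cderive0 (fun t => real_complex R (expR (s * t))) (real_complex R s).
Proof.
apply: cderive_real.
have H : is_derive (s * 0 + 0) (1 : R) expR (expR (s * 0 + 0)) by exact: is_derive_expR.
apply: (is_derive_fun_eq (is_derive_affine H)) => [t|]; first by rewrite addr0.
by rewrite mulr0 addr0 expR0 mulr1.
Qed.

Lemma character_expR e s : (forall t u, e (t + u) = e t * e u) -> e 0 = 1 ->
  is_cderive0 e (real_complex R s) -> forall t, e t = real_complex R (expR (s * t)).
Proof.
move=> eD e0 ed t; apply/eqP; rewrite -subr_eq0; apply/eqP.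
pose w (_ : 'I_1) t := e t - real_complex R (expR (s * t)).
apply: (@complex_ode_zero R 1 w (real_complex R s)%:M _ _ t 0) => [u p|p]; last first.
  by rewrite /w e0 mulr0 expR0 subrr.
rewrite big_ord1 mxE (ord1 p) eqxx mulr1n.
have H1 := cderive_scale (e u) ed.
have H2 := cderive_scale (- real_complex R (expR (s * u))) (cderive_expR s).
apply: (cderive_eq (cderive_add H1 H2)) => [v|].
  by rewrite /w eD mulrDr expRD rmorphM mulNr.
by rewrite /w mulrBl mulNr.
Qed.

Lemma det_expm p (A : 'M[R]_p) t : \det (expm (t *: A)) = expR (\tr A * t).
Proof.
apply: (fmorph_inj (real_complex R)).
apply: (@character_expR (fun t => real_complex R (\det (expm (t *: A))))).
- by move=> u v; rewrite expmD det_mulmx rmorphM.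
- by rewrite scale0r expm0 det1.
have H : forall r q, is_cderive0 (fun t => toC (expm (t *: A)) r q) (toC A r q).
  by move=> r q; exact: cmx_derive_toC (expm_derive0 A) r q.
apply: (cderive_eq (cderive_det H)) => [u|]; first by rewrite det_map_mx.
rewrite scale0r expm0 toC1 adj1 mul1mx /mxtrace raddf_sum.
by apply: eq_bigr => r _; rewrite mxE.
Qed.

(** Through [phi], a complex-valued one-parameter group is a one-parameter group of real 2 by 2
    matrices, hence an exponential. *)
Lemma character_derive e : (forall t u, e (t + u) = e t * e u) -> e 0 = 1 ->
  continuous (fun t => complex.Re (e t)) -> continuous (fun t => complex.Im (e t)) ->
  exists c, is_cderive0 e c.
Proof.
move=> eD e0 cr ci.
pose G t : 'M[R]_(1 + 1) := phi (e t)%:M.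
have [|||B GB] := @one_parameter_expm R (1 + 1) G.
- have ext (f g : R -> R) : continuous f -> f =1 g -> continuous g by move=> fc /funext <-.
  have cNi : continuous (fun t => - complex.Im (e t)) by move=> t; apply: cvgN; exact: ci.
  move=> r c; case: (fintype.split_ordP r) => r' ->; case: (fintype.split_ordP c) => c' ->.
  + by apply: (ext _ _ cr) => u; rewrite /G /phi block_mxEul !mxE !ord1 eqxx mulr1n.
  + by apply: (ext _ _ ci) => u; rewrite /G /phi block_mxEur !mxE !ord1 eqxx mulr1n.
  + by apply: (ext _ _ cNi) => u; rewrite /G /phi block_mxEdl !mxE !ord1 eqxx mulr1n.
  + by apply: (ext _ _ cr) => u; rewrite /G /phi block_mxEdr !mxE !ord1 eqxx mulr1n.
- by move=> s t; rewrite /G eD scalar_mxM phiM.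
- by rewrite /G e0 phi1.
have Gd := expm_derive0 B.
pose c00 := lshift 1 (0 : 'I_1); pose c01 := rshift 1 (0 : 'I_1).
exists (B c00 c00 +i* B c00 c01)%C; split.
  apply: (is_derive_fun_eq (Gd c00 c00)) => // t.
  by rewrite -GB /G /phi block_mxEul !mxE eqxx mulr1n.
apply: (is_derive_fun_eq (Gd c00 c01)) => // t.
by rewrite -GB /G /phi block_mxEur !mxE eqxx mulr1n.
Qed.

End OneParameterCharacters.

Section GLCharacters.
Variables (R : realType) (n i : nat).
Local Notation C := R[i].
Local Notation rho := (((2 * n)%:R - i%:R + 1) / 2 : R).

Lemma GL_character_det (mu : 'M[R]_i -> C) : (0 < i)%N -> is_GL_character mu ->
  exists chi : R -> C,
    [/\ forall a, a \in unitmx -> mu a = chi (\det a), forall x, x != 0 -> chi x != 0,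
        forall x y, x != 0 -> y != 0 -> chi (x * y) = chi x * chi y
      & exists c, is_cderive0 (fun t => chi (expR t)) c].
Proof.
case: i mu => [//|p] mu _ [mu0 muM [cr ci]].
pose chi x := mu (diag1 x 1%:M : 'M[R]_(1 + p)).
have ud x : x != 0 -> (diag1 x 1%:M : 'M[R]_(1 + p)) \in unitmx.
  by rewrite unitmxE unitfE diag1_det det1 mulr1.
have ux t : (diag1 (expR t) 1%:M : 'M[R]_(1 + p)) \in unitmx by apply: ud; rewrite gt_eqF ?expR_gt0.
have chiM x y : x != 0 -> y != 0 -> chi (x * y) = chi x * chi y.
  by move=> x0 y0; rewrite /chi -(muM _ _ (ud _ x0) (ud _ y0)) diag1M mulmx1.
have chi0 x : x != 0 -> chi x != 0 by move=> x0; exact/mu0/ud.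
have e0 t : expR t != 0 :> R by rewrite gt_eqF ?expR_gt0.
exists chi; split=> //.
  by move=> a ua; apply: (@char_factors_det R C p mu) => //; rewrite pnatr_eq0.
have cvg t r q : (fun s => (diag1 (expR s) 1%:M : 'M[R]_(1 + p)) r q) @ t --> (diag1 (expR t) 1%:M : 'M[R]_(1 + p)) r q.
  rewrite /diag1; case: (fintype.split_ordP r) => r' ->; case: (fintype.split_ordP q) => q' ->.
  - rewrite block_mxEul !mxE !ord1 eqxx mulr1n.
    rewrite (_ : (fun s => _) = expR); first exact: continuous_expR.
    by apply/funext => s; rewrite block_mxEul !mxE eqxx mulr1n.
  - rewrite block_mxEur mxE (_ : (fun s => _) = fun=> 0); first exact: cvg_cst.
    by apply/funext => s; rewrite block_mxEur mxE.
  - rewrite block_mxEdl mxE (_ : (fun s => _) = fun=> 0); first exact: cvg_cst.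
    by apply/funext => s; rewrite block_mxEdl mxE.
  - rewrite block_mxEdr (_ : (fun s => _) = fun=> (1%:M : 'M[R]_p) r' q'); first exact: cvg_cst.
    by apply/funext => s; rewrite block_mxEdr.
apply: (@character_derive R (fun t => chi (expR t))).
- by move=> t u; rewrite expRD chiM.
- rewrite expR0; apply: (mulfI (chi0 1 (oner_neq0 _))).
  by rewrite -chiM ?oner_neq0 // !mulr1.
- by move=> t; exact: (within_cvg cr (ux t) ux (cvg t)).
- by move=> t; exact: (within_cvg ci (ux t) ux (cvg t)).
Qed.

Lemma half_modulus_expm (A : 'M[R]_i) t :
  half_modulus n (expm (t *: A)) = expR (rho * (\tr A * t)).
Proof. by rewrite /half_modulus det_expm gtr0_norm ?expR_gt0 // -expRM mulrC. Qed.

Lemma normalized_derive (mu : 'M[R]_i -> C) (chi : R -> C) c :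
  (forall a, a \in unitmx -> mu a = chi (\det a)) -> chi 1 = 1 ->
  is_cderive0 (fun t => chi (expR t)) c ->
  normalized n mu 1%:M = 1 /\
  forall A, is_cderive0 (fun t => normalized n mu (expm (t *: A)))
    ((real_complex R rho + c) * real_complex R (\tr A)).
Proof.
move=> muE chi1 cd; split.
  rewrite /normalized muE ?unitmx1 // det1 chi1 mulr1 -[1%:M](expm0 R i) -(scale0r (0 : 'M[R]_i)).
  by rewrite half_modulus_expm mulr0 mulr0 expR0.
move=> A; have H := cderive_mul (cderive_expR rho) cd.
apply: (cderive_eq (cderive_affine (\tr A) H)) => [t|].
  by rewrite /normalized half_modulus_expm muE ?expm_unit // det_expm.
by rewrite mulr0 expR0 chi1 mulr1 mul1r mulrC.
Qed.

(** Here (2n - i + 1)/2 from the half modulus and l - n + (i - 1)/2 from [exponent] add up to l: the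
    shift in the exponent is there to undo the normalization. *)
Lemma sgn_abs_det_derive (l : int) : let mu := @sgn_abs_det R i l (exponent R n i l) in
  normalized n mu 1%:M = 1 /\
  forall A, is_cderive0 (fun t => normalized n mu (expm (t *: A)))
    (l%:~R * real_complex R (\tr A)).
Proof.
pose chi (x : R) : C := real_complex R (Num.sg x ^ l * `|x| `^ exponent R n i l).
have chiE t : chi (expR t) = real_complex R (expR (exponent R n i l * t)).
  rewrite /chi gtr0_sg ?expR_gt0 // exp1rz mul1r gtr0_norm ?expR_gt0 //.
  by rewrite -expRM mulrC.
have cd : is_cderive0 (fun t => chi (expR t)) (real_complex R (exponent R n i l)).
  by apply: (cderive_eq (cderive_expR (exponent R n i l))) => // t; rewrite chiE.
have chi1 : chi 1 = 1 by rewrite -expR0 chiE mulr0 expR0.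
have [|N1 Nd] := @normalized_derive (sgn_abs_det l (exponent R n i l)) chi _ _ chi1 cd.
  by [].
split=> // A; apply: (cderive_eq (Nd A)) => //; congr (_ * _).
rewrite -rmorphD -(rmorph_int (real_complex R)); congr (real_complex R _).
by rewrite /exponent natrM; field.
Qed.

(** Positive reals are values of the exponential, where the derivative decides; the value at -1
    decides the sign. *)
Lemma character_sgn_abs (chi : R -> C) (l : int) :
  (forall x y, x != 0 -> y != 0 -> chi (x * y) = chi x * chi y) -> chi 1 = 1 ->
  is_cderive0 (fun t => chi (expR t)) (l%:~R - real_complex R rho) -> chi (- 1) = (- 1) ^ l ->
  forall x, x != 0 -> chi x = real_complex R (Num.sg x ^ l * `|x| `^ exponent R n i l).
Proof.
move=> chiM chi1 cd chiN.
have sE : l%:~R - real_complex R rho = real_complex R (exponent R n i l).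
  rewrite -(rmorph_int (real_complex R)) -rmorphB; congr (real_complex R _).
  by rewrite /exponent natrM; field.
have e0 t : expR t != 0 :> R by rewrite gt_eqF ?expR_gt0.
have E : forall t, chi (expR t) = real_complex R (expR (exponent R n i l * t)).
  apply: (@character_expR R (fun t => chi (expR t))).
  - by move=> t u; rewrite expRD chiM.
  - by rewrite expR0.
  - by rewrite -sE.
have pos x : 0 < x -> chi x = real_complex R (`|x| `^ exponent R n i l).
  by move=> x0; rewrite -{1}(lnK x0) E mulrC expRM lnK // gtr0_norm.
move=> x; rewrite neq_lt => /orP [x0|x0]; last by rewrite gtr0_sg // exp1rz mul1r pos.
have nx : 0 < - x by rewrite oppr_gt0.
rewrite -[in LHS](opprK x) -mulN1r chiM ?oppr_eq0 ?oner_neq0 ?lt_eqF // chiN (pos _ nx) normrN.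
have -> : (- 1) ^ l = real_complex R ((- 1) ^ l).
  by case: (l) => k; rewrite /exprz ?fmorphV rmorphXn rmorphN1.
by rewrite ltr0_sg // [RHS]rmorphM.
Qed.

End GLCharacters.

(** * Weight vectors and their levels *)

Section Weights.
Variables (R : realType) (n : nat) (V : lmodType R[i]) (S : set V) (cart : 'I_n -> V -> V).
Local Notation C := R[i].
Local Notation weight := {ffun 'I_n -> int}.
Hypotheses (sS : subspace S) (cart_lin : forall j, linear_on S (cart j))
  (cart_in : forall j x, S x -> S (cart j x)).
Implicit Types (chi alpha : weight) (x y z : V) (P Q : weight -> Prop) (T : V -> V) (A : set V).

Definition wtv chi x := S x /\ forall j, cart j x = (chi j)%:~R *: x.

(* Positive on the positive roots. *)
Definition lev chi : int := - \sum_(j < n) (j.+1)%:Z * chi j.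

Definition op_wt T alpha := [/\ forall x, S x -> S (T x), linear_on S T &
  forall x j, S x -> cart j (T x) = T (cart j x) + (alpha j)%:~R *: T x].

(** Sums of k weight vectors with weights in [P]. Weights may repeat, so that sums are added by
    concatenation. *)
Fixpoint WSn P k x : Prop := if k is k'.+1 then
  exists chi y x', [/\ x = y + x', wtv chi y, P chi & WSn P k' x'] else x = 0.

Definition WS P x := exists k, WSn P k x.

Definition cart_stable A := forall j x, A x -> A (cart j x).

Definition Gen (Neg : set (V -> V)) v : set V := [set x | forall W : set V, subspace W -> W v ->
  (forall T y, Neg T -> W y -> W (T y)) -> W x].

Lemma levD chi chi' : lev (chi + chi') = lev chi + lev chi'.
Proof.
by rewrite /lev -opprD -big_split /=; congr (- _); apply: eq_bigr => j _; rewrite !ffunE mulrDr.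
Qed.

Lemma wtvS chi x : wtv chi x -> S x. Proof. by case. Qed.

Lemma wtvZ chi x a : wtv chi x -> wtv chi (a *: x).
Proof.
case=> Sx xE; split=> [|j]; first exact: (subspaceZ _ sS).
by rewrite (linear_onZ _ sS (cart_lin j) Sx) xE !scalerA mulrC.
Qed.

Lemma wtvD chi x y : wtv chi x -> wtv chi y -> wtv chi (x + y).
Proof.
case=> Sx xE [Sy yE]; split=> [|j]; first exact: (subspaceD sS).
by rewrite (linear_onD (cart_lin j) Sx Sy) xE yE scalerDr.
Qed.

Lemma op_wtv T alpha chi x : op_wt T alpha -> wtv chi x -> wtv (chi + alpha) (T x).
Proof.
case=> TS Tl TE [Sx xE]; split=> [|j]; first exact: TS.
by rewrite TE // xE (linear_onZ _ sS Tl Sx) ffunE rmorphD scalerDl.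
Qed.

Lemma WSn_in P k x : WSn P k x -> S x.
Proof.
elim: k x => [x ->|k IH x [chi [y [x' [-> [Sy _] _ /IH Sx]]]]]; first exact: (subspace0 sS).
exact: (subspaceD sS).
Qed.

Lemma WSnZ P k x a : WSn P k x -> WSn P k (a *: x).
Proof.
elim: k x => [x ->|k IH x [chi [y [x' [-> wy Py /IH wx]]]]]; first exact: scaler0.
by exists chi, (a *: y), (a *: x'); split=> //; [rewrite scalerDr|exact: wtvZ].
Qed.

Lemma WSnD P k l x y : WSn P k x -> WSn P l y -> WSn P (k + l) (x + y).
Proof.
elim: k x => [x ->|k IH x [chi [u [x' [-> wu Pu /IH H]]]]] wy; first by rewrite add0r.
by exists chi, u, (x' + y); split=> //; [rewrite addrA|exact: H].
Qed.

Lemma WS_subspace P : subspace (WS P).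
Proof.
split; first by exists 0%N.
by move=> a u v [k wu] [l wv]; exists (k + l)%N; apply: WSnD => //; exact: WSnZ.
Qed.

Lemma WS_wtv P chi x : wtv chi x -> P chi -> WS P x.
Proof. by move=> wx Px; exists 1%N, chi, x, 0; split=> //; rewrite addr0. Qed.

Lemma WS_op P Q T alpha x : op_wt T alpha -> (forall chi, P chi -> Q (chi + alpha)) ->
  WS P x -> WS Q (T x).
Proof.
move=> To PQ [k]; elim: k x => [x ->|k IH x [chi [y [x' [-> wy Py wx]]]]].
  by have [_ Tl _] := To; rewrite (linear_on0 sS Tl); exists 0%N.
have [_ Tl _] := To; rewrite (linear_onD Tl (wtvS wy) (WSn_in wx)).
apply: (subspaceD (WS_subspace Q)); last exact: IH.
by apply: (WS_wtv (op_wtv To wy)); exact: PQ.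
Qed.

Lemma WSn_shift P k x j (a : C) : WSn P k x -> WSn P k (cart j x - a *: x).
Proof.
elim: k x => [x ->|k IH x [chi [y [x' [-> wy Py wx]]]]].
  by rewrite /= (linear_on0 sS (cart_lin j)) scaler0 subr0.
have [Sy yE] := wy.
exists chi, (cart j y - a *: y), (cart j x' - a *: x'); split=> //; last exact: IH.
  by rewrite (linear_onD (cart_lin j) Sy (WSn_in wx)) scalerDr opprD addrACA.
by rewrite yE -scalerBl; exact: wtvZ.
Qed.

Lemma weight_neq chi chi' : chi <> chi' -> exists j, chi j - chi' j != 0.
Proof.
move=> ne; apply: contrapT => H; apply: ne; apply/ffunP => j; apply/eqP.
by rewrite -subr_eq0; apply: contrapT => h; apply: H; exists j; apply/negP.
Qed.

(* Apply T_j - chi0(j), which kills the weight chi0, to remove one summand. *)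
Lemma weight_separation A P chi y z : subspace A -> cart_stable A -> wtv chi y -> ~ P chi ->
  WS P z -> A (y + z) -> A y.
Proof.
move=> sA cA wy nP [k]; elim: k y z wy => [y z _ ->|k IH y z wy [chi0 [y0 [z' [-> wy0 P0 wz]]]] Ayz].
  by rewrite addr0.
have [j dj] : exists j, chi j - chi0 j != 0 by apply: weight_neq => e; apply: nP; rewrite e.
have [Sy yE] := wy; have [Sy0 y0E] := wy0; have Sz := WSn_in wz.
have d0 : ((chi j - chi0 j)%:~R : C) != 0 by rewrite intr_eq0.
have {}Ayz : A ((chi j - chi0 j)%:~R *: y + (cart j z' - (chi0 j)%:~R *: z')).
  have := subspaceB sA (cA j _ Ayz) (subspaceZ (chi0 j)%:~R sA Ayz).
  rewrite (linear_onD (cart_lin j) Sy (subspaceD sS Sy0 Sz)) (linear_onD (cart_lin j) Sy0 Sz) yE y0E.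
  rewrite rmorphB scalerBl; congr (A _).
  by rewrite !scalerDr !opprD addrACA; congr (_ + _); rewrite addrACA subrr add0r.
have := IH _ _ (wtvZ _ wy) (WSn_shift j _ wz) Ayz.
by move=> /(subspaceZ ((chi j - chi0 j)%:~R^-1) sA); rewrite scalerA mulVf // scale1r.
Qed.

Lemma zero_subspace : subspace ([set 0] : set V).
Proof. by split=> // a u v -> ->; rewrite scaler0 addr0. Qed.

Lemma wtv_WS_eq0 P chi y : wtv chi y -> ~ P chi -> WS P y -> y = 0.
Proof.
move=> wy nP Wy; apply: (@weight_separation [set 0] P chi y (- y)) => //.
- exact: zero_subspace.
- by move=> j x ->; exact: (linear_on0 sS (cart_lin j)).
- exact: (subspaceN (WS_subspace P)).
- by rewrite subrr.
Qed.

(** Unless x already has the weight chi of its first summand, some operator cart_j - chi_j sends it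
    to a nonzero vector of [A] with fewer summands. *)
Lemma weight_component A P x : subspace A -> cart_stable A -> A x -> x != 0 -> WS P x ->
  exists chi y, [/\ P chi, wtv chi y, y != 0 & A y].
Proof.
move=> sA cA Ax x0 [k]; elim: k x Ax x0 => [x _ /eqP x0 /x0//|k IH x Ax x0 Wx].
have [chi [y [x' [xE wy Py wx]]]] := Wx.
have Sx := WSn_in Wx.
have [[j dj]|H] := pselect (exists j, cart j x - (chi j)%:~R *: x != 0).
  apply: (IH _ _ dj).
    by apply: (subspaceB sA); [exact: cA|exact: (subspaceZ _ sA)].
  have -> : cart j x - (chi j)%:~R *: x = cart j x' - (chi j)%:~R *: x'.
    have [Sy yE] := wy; rewrite xE (linear_onD (cart_lin j) Sy (WSn_in wx)) yE.
    by rewrite scalerDr opprD addrACA subrr add0r.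
  exact: WSn_shift.
exists chi, x; split=> //; split=> // j; apply/eqP; rewrite -subr_eq0.
by apply: contrapT => h; apply: H; exists j; apply/negP.
Qed.

(** Starting from a weight vector in [A], apply positive operators as long as one does not kill it.
    Each raises the level, and levels in [A] are bounded by [L], so the process stops. *)
Lemma highest_component A (Pos : set (V -> V)) (L : int) x : subspace A -> cart_stable A ->
  (forall y, A y -> WS (fun chi => lev chi <= L) y) ->
  (forall T, Pos T -> exists2 alpha, 0 < lev alpha & op_wt T alpha) ->
  (forall T y, Pos T -> A y -> A (T y)) -> A x -> x != 0 ->
  exists chi y, [/\ wtv chi y, y != 0, A y & forall T, Pos T -> T y = 0].
Proof.
move=> sA cA AL Po PA Ax x0.
have [chi [y [lc wy y0 Ay]]] := weight_component sA cA Ax x0 (AL x Ax).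
move: {2}(absz (L - lev chi)) (leqnn (absz (L - lev chi))) => N.
elim: N chi y lc wy y0 Ay => [|N IH] chi y lc wy y0 Ay dN.
all: have [H|H] := pselect (forall T, Pos T -> T y = 0); first by exists chi, y.
all: have [T [PT Ty]] : exists T, Pos T /\ T y != 0.
  all: try (by apply: contrapT => h; apply: H => T PT; apply: contrapT => Ty; apply: h; exists T; split=> //; apply/eqP).
all: have [alpha al To] := Po T PT.
all: have wTy := op_wtv To wy; have ATy := PA T y PT Ay.
all: have lT : lev (chi + alpha) <= L by
  (apply: contrapT => h; move/eqP: Ty; apply; exact: (wtv_WS_eq0 (P := fun chi => lev chi <= L) wTy h (AL _ ATy))).
  by exfalso; move: lT; rewrite levD; lia.
by apply: (IH _ _ lT wTy Ty ATy); rewrite levD; move: lT; rewrite levD; lia.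
Qed.

Lemma Gen_base (Neg : set (V -> V)) v : Gen Neg v v.
Proof. by move=> W _ Wv _. Qed.

Lemma Gen_subspace (Neg : set (V -> V)) v : subspace (Gen Neg v).
Proof.
split; first by move=> W sW _ _; exact: (subspace0 sW).
by move=> a x y Gx Gy W sW Wv WN; apply: sW.2; [exact: Gx|exact: Gy].
Qed.

Lemma Gen_op (Neg : set (V -> V)) v T x : Neg T -> Gen Neg v x -> Gen Neg v (T x).
Proof. by move=> NT Gx W sW Wv WN; exact: (WN T x NT (Gx W sW Wv WN)). Qed.

(** Lowering strictly decreases the level, so only multiples of [v] remain at the level of lambda.
    This triangularity makes the top weight space one-dimensional in [Gen_top]. *)
Lemma Gen_decomp (Neg : set (V -> V)) v lambda x : wtv lambda v ->
  (forall T, Neg T -> exists2 alpha, lev alpha < 0 & op_wt T alpha) -> Gen Neg v x ->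
  exists (c : C) z, x = c *: v + z /\ WS (fun chi => lev chi < lev lambda) z.
Proof.
move=> wv NT; set Q := fun chi => _; have sQ := WS_subspace Q => Gx.
apply: (Gx [set x | exists (c : C) z, x = c *: v + z /\ WS Q z]).
- split; first by exists 0, 0; rewrite scale0r addr0; split=> //; exact: (subspace0 sQ).
  move=> a u w [c [z [-> Wz]]] [c' [z' [-> Wz']]]; exists (a * c + c'), (a *: z + z').
  by rewrite scalerDr scalerA scalerDl addrACA; split=> //; exact: sQ.2.
- by exists 1, 0; rewrite scale1r addr0; split=> //; exact: (subspace0 sQ).
move=> T y HT [c [z [-> Wz]]]; have [alpha al To] := NT T HT; have [_ Tl _] := To.
exists 0, (T (c *: v + z)); rewrite scale0r add0r; split=> //.
have Sz : S z by case: Wz => k; exact: WSn_in.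
rewrite (Tl c v z (wtvS wv) Sz); apply: sQ.2.
  by apply: (WS_wtv (op_wtv To wv)); rewrite /Q levD gtrDl.
by apply: (WS_op To _ Wz) => chi; rewrite /Q levD => h; lia.
Qed.

Lemma Gen_WS (Neg : set (V -> V)) v lambda x : wtv lambda v ->
  (forall T, Neg T -> exists2 alpha, lev alpha < 0 & op_wt T alpha) -> Gen Neg v x ->
  WS (fun chi => lev chi <= lev lambda) x.
Proof.
move=> wv NT Gx; have [c [z [-> Wz]]] := Gen_decomp wv NT Gx.
apply: (subspaceD (WS_subspace _)); first by apply: (WS_wtv (wtvZ _ wv)).
case: Wz => k; elim: k z => [z ->|k IH z [chi [y [z' [-> wy ly /IH H]]]]].
  exact: (subspace0 (WS_subspace _)).
apply: (subspaceD (WS_subspace _)); last exact: H.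
by apply: (WS_wtv wy); exact: ltW.
Qed.

Lemma Gen_top (Neg : set (V -> V)) v lambda chi x : wtv lambda v ->
  (forall T, Neg T -> exists2 alpha, lev alpha < 0 & op_wt T alpha) -> Gen Neg v x ->
  wtv chi x -> x != 0 -> lev lambda <= lev chi -> chi = lambda /\ exists c, x = c *: v.
Proof.
move=> wv NT Gx wx x0 lc; have [c [z [xE Wz]]] := Gen_decomp wv NT Gx.
have nlt : ~ (lev chi < lev lambda) by move=> h; move: lc; rewrite leNgt h.
have chiE : chi = lambda.
  apply: contrapT => ne; move/eqP: x0; apply.
  apply: (wtv_WS_eq0 (P := fun mu => mu = lambda \/ lev mu < lev lambda) wx); first by case.
  rewrite xE; apply: (subspaceD (WS_subspace _)); first by apply: (WS_wtv (wtvZ c wv)); left.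
  case: Wz => k; elim: k {xE} z => [z ->|k IH z [mu [y [z' [-> wy ly /IH H]]]]].
    exact: (subspace0 (WS_subspace _)).
  apply: (subspaceD (WS_subspace _)); last exact: H.
  by apply: (WS_wtv wy); right.
split=> //; exists c; apply/eqP; rewrite -subr_eq0; apply/eqP.
have zE : x - c *: v = z by rewrite xE addrC addKr.
rewrite chiE in wx nlt.
have wz : wtv lambda (x - c *: v) by rewrite -scaleNr; apply: wtvD => //; exact: wtvZ.
by apply: (wtv_WS_eq0 (P := fun chi => lev chi < lev lambda) wz nlt); rewrite zE.
Qed.

End Weights.

Opaque cay.

(** The vectors of [Gen] that all of [Ops] sends into [Gen] are stable under lowering, because X T =
    T X + [X, T] with the commutator again in [Ops]. Only the action of [Ops] on [v] has to be
    examined. *)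
Lemma Gen_stable (R : realType) (V : lmodType R[i]) (S : set V) (Neg Ops : set (V -> V)) v :
  subspace S -> S v -> (forall T, Neg T -> forall x, S x -> S (T x)) ->
  (forall X, Ops X -> linear_on S X) -> (forall X, Ops X -> Gen Neg v (X v)) ->
  (forall X T, Ops X -> Neg T -> exists2 Y, Ops Y & forall x, S x -> X (T x) = T (X x) + Y x) ->
  forall X x, Ops X -> Gen Neg v x -> Gen Neg v (X x).
Proof.
move=> sS Sv TS Xl Xv br X x OX Gx; have sG := Gen_subspace Neg v.
suff [] : [set x | [/\ S x, Gen Neg v x & forall X, Ops X -> Gen Neg v (X x)]] x by move=> _ _; apply.
apply: (Gx [set x | [/\ S x, Gen Neg v x & forall X, Ops X -> Gen Neg v (X x)]]).
- split.
    split; [exact: (subspace0 sS)|exact: (subspace0 sG)|move=> Y OY].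
    by rewrite (linear_on0 sS (Xl Y OY)); exact: (subspace0 sG).
  move=> a u w [Su Gu uX] [Sw Gw wX]; split; [exact: sS.2|exact: sG.2|move=> Y OY].
  by rewrite (Xl Y OY a u w Su Sw); apply: sG.2; [exact: uX|exact: wX].
- by split=> //; exact: Gen_base.
move=> T y NT [Sy Gy yX]; split; [exact: (TS T NT)|exact: Gen_op|move=> Y OY].
have [Z OZ E] := br Y T OY NT; rewrite (E y Sy).
by apply: (subspaceD sG); [apply: Gen_op => //; exact: yX|exact: yX].
Qed.

(** * Root vectors in Cayley coordinates *)

Section Roots.
Variables (R : realType) (n : nat).
Local Notation C := R[i].
Local Notation spn := (LieC (@Sp R n)).
Local Notation half := (real_complex R 2^-1).
Implicit Types (a b c : 'M[C]_n) (r q j : 'I_n).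

Definition pplus r q : 'M[C]_(n + n) := spx 0 (delta_mx r q + delta_mx q r) 0.
Definition pmin r q : 'M[C]_(n + n) := spx 0 0 (delta_mx r q + delta_mx q r).

Lemma spx_Sp a b c : b^T = b -> c^T = c -> spn (spx a b c).
Proof. by move=> bT cT; apply/LieC_Sp/spC_spx; exists a, b, c. Qed.

Lemma kappa_Sp a : spn (kappa a).
Proof. by apply: spx_Sp; rewrite trmx0. Qed.

Lemma delta_sym r q : (delta_mx r q + delta_mx q r : 'M[C]_n)^T = delta_mx r q + delta_mx q r.
Proof. by rewrite trmxD !trmx_delta addrC. Qed.

Lemma pplus_Sp r q : spn (pplus r q).
Proof. by apply: spx_Sp; [exact: delta_sym|rewrite trmx0]. Qed.

Lemma pmin_Sp r q : spn (pmin r q).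
Proof. by apply: spx_Sp; [rewrite trmx0|exact: delta_sym]. Qed.

Lemma pminC r q : pmin r q = pmin q r.
Proof. by rewrite /pmin addrC. Qed.

(** The double sum counts every matrix delta_rq + delta_qr for both orders, and doubles the diagonal
    ones, hence the factor one half. *)
Lemma sym_sum b : b^T = b -> b = \sum_r \sum_q (half * b r q) *: (delta_mx r q + delta_mx q r).
Proof.
move=> bT; have E1 : half *: b = \sum_r \sum_q (half * b r q) *: delta_mx r q.
  rewrite {1}(matrix_sum_delta b) scaler_sumr; apply: eq_bigr => r _.
  by rewrite scaler_sumr; apply: eq_bigr => q _; rewrite scalerA.
have E2 : half *: b = \sum_r \sum_q (half * b r q) *: delta_mx q r.
  rewrite -[in LHS]bT -trmxZ E1 (big_morph trmx (@trmxD _ _ _) (trmx0 _ _ _)).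
  apply: eq_bigr => r _; rewrite (big_morph trmx (@trmxD _ _ _) (trmx0 _ _ _)).
  by apply: eq_bigr => q _; rewrite trmxZ trmx_delta.
rewrite -[LHS]scale1r -half2 scalerDl {1}E1 E2 -big_split; apply: eq_bigr => r _.
by rewrite -big_split; apply: eq_bigr => q _; rewrite scalerDr.
Qed.

(** Reduces a linear condition on the Lie algebra to the root vectors that actually occur; the
    restriction to nonzero entries allows triangular matrices to be treated. *)
Lemma spx_span (L : set 'M[C]_(n + n)) a b c : subspace L -> b^T = b -> c^T = c ->
  (forall r q, a r q != 0 -> L (kappa (delta_mx r q))) ->
  (forall r q, b r q != 0 -> L (pplus r q)) -> (forall r q, c r q != 0 -> L (pmin r q)) ->
  L (spx a b c).
Proof.
move=> sL bT cT La Lb Lc.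
have Lsum (f : 'M[C]_n -> 'M[C]_(n + n)) (co : 'I_n -> 'I_n -> C) (g : 'I_n -> 'I_n -> 'M[C]_n) :
    (forall x y, f (x + y) = f x + f y) -> f 0 = 0 -> (forall x y, f (x *: y) = x *: f y) ->
    (forall r q, co r q != 0 -> L (f (g r q))) -> L (f (\sum_r \sum_q co r q *: g r q)).
  move=> fD f0 fZ H; rewrite (big_morph f fD f0); apply: (subspace_sum _ sL) => r _.
  rewrite (big_morph f fD f0); apply: (subspace_sum _ sL) => q _; rewrite fZ.
  have [->|co0] := eqVneq (co r q) 0; first by rewrite scale0r; exact: (subspace0 sL).
  by apply: (subspaceZ _ sL); exact: H.
rewrite spx_split; apply: (subspaceD sL); [|apply: (subspaceD sL)].
- rewrite [a]matrix_sum_delta; apply: (Lsum (@kappa R n)) => //; [exact: kappaD|exact: kappa0|exact: kappaZ].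
- rewrite (sym_sum bT); apply: (Lsum (fun b => spx 0 b 0)).
  + by move=> x y; rewrite spxD !addr0.
  + by rewrite -[spx 0 0 0]/(kappa 0) kappa0.
  + by move=> x y; rewrite spxZ !scaler0.
  + by move=> r q; rewrite mulf_eq0 negb_or => /andP [_ /Lb].
- rewrite (sym_sum cT); apply: (Lsum (fun c => spx 0 0 c)).
  + by move=> x y; rewrite spxD !addr0.
  + by rewrite -[spx 0 0 0]/(kappa 0) kappa0.
  + by move=> x y; rewrite spxZ !scaler0.
  + by move=> r q; rewrite mulf_eq0 negb_or => /andP [_ /Lc].
Qed.

Lemma spx_eq a b c a' b' c' : a = a' -> b = b' -> c = c' -> spx a b c = spx a' b' c'.
Proof. by move=> -> -> ->. Qed.

Lemma spx_inj a b c a' b' c' : spx a b c = spx a' b' c' -> [/\ a = a', b = b' & c = c'].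
Proof. by move=> /cay_inj [-> -> ->]. Qed.

Lemma deltaM_l j a r q : (delta_mx j j *m a) r q = (r == j)%:R * a r q.
Proof.
rewrite mxE (bigD1 j) //= mxE eqxx andbT big1 ?addr0 => [|k /negbTE kj].
  by case: eqVneq => [->|] //=; rewrite !mul0r.
by rewrite mxE kj andbF mul0r.
Qed.

Lemma deltaM_r j a r q : (a *m delta_mx j j) r q = a r q * (q == j)%:R.
Proof.
rewrite mxE (bigD1 j) //= mxE eqxx big1 ?addr0 => [|k /negbTE kj].
  by case: eqVneq => [->|] //=; rewrite !mulr0.
by rewrite mxE kj mulr0.
Qed.

Lemma bracket_cartan j a b c : bracket (cartan R j) (spx a b c) =
  spx (\matrix_(r, q) (((r == j)%:R - (q == j)%:R) * a r q))
      (\matrix_(r, q) (((r == j)%:R + (q == j)%:R) * b r q))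
      (- \matrix_(r, q) (((r == j)%:R + (q == j)%:R) * c r q)).
Proof.
rewrite cartanE bracket_kappa trmx_delta; apply: spx_eq; [| |congr (- _)]; apply/matrixP => r q.
- rewrite [LHS]mxE [RHS]mxE [X in _ + X]mxE deltaM_l deltaM_r.
  by rewrite mulrBl [a r q * _]mulrC.
- by rewrite [LHS]mxE [RHS]mxE deltaM_l deltaM_r mulrDl [b r q * _]mulrC.
- by rewrite [LHS]mxE [RHS]mxE deltaM_l deltaM_r mulrDl [c r q * _]mulrC.
Qed.

Let sym_entry j x y r q : ((x == j)%:R + (y == j)%:R) *
    (((x == r) && (y == q))%:R + ((x == q) && (y == r))%:R) =
  ((r == j)%:R + (q == j)%:R) * (((x == r) && (y == q))%:R + ((x == q) && (y == r))%:R) :> C.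
Proof.
rewrite !mulrDr; congr (_ + _).
  by case: (x =P r) => [->|_]; case: (y =P q) => [->|_]; rewrite /= ?mulr0.
by case: (x =P q) => [->|_]; case: (y =P r) => [->|_]; rewrite /= ?mulr0 // addrC.
Qed.

Lemma root_kappa r q : root_space (e_ r - e_ q) (kappa (delta_mx r q) : 'M[C]_(n + n)).
Proof.
split; first exact: kappa_Sp.
move=> j; rewrite -[kappa _]/(spx _ 0 0) bracket_cartan spxZ; apply: spx_eq.
- apply/matrixP => x y; rewrite !mxE !ffunE rmorphB /=.
  by case: (eqVneq x r) => [->|]; case: (eqVneq y q) => [->|] //=; rewrite ?mulr0 // ![_ == j]eq_sym !mulr1;
    congr (_ - _); case: eqP.
- by apply/matrixP => x y; rewrite !mxE !mulr0.
- by apply/matrixP => x y; rewrite !mxE !mulr0 oppr0.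
Qed.

Lemma root_pplus r q : root_space (e_ r + e_ q) (pplus r q).
Proof.
split; first exact: pplus_Sp.
move=> j; rewrite /pplus bracket_cartan spxZ.
have -> : ((e_ r + e_ q) j)%:~R = (r == j)%:R + (q == j)%:R :> C.
  by rewrite !ffunE rmorphD /= ![j == _]eq_sym.
apply: spx_eq; apply/matrixP => x y; rewrite !mxE ?mulr0 ?oppr0 //; exact: sym_entry.
Qed.

Lemma root_pmin r q : root_space (- (e_ r + e_ q)) (pmin r q).
Proof.
split; first exact: pmin_Sp.
move=> j; rewrite /pmin bracket_cartan spxZ.
have -> : ((- (e_ r + e_ q)) j)%:~R = - ((r == j)%:R + (q == j)%:R) :> C.
  by rewrite !ffunE rmorphN rmorphD /= ![j == _]eq_sym.
apply: spx_eq; apply/matrixP => x y; rewrite !mxE ?mulr0 ?oppr0 // mulNr; congr (- _); exact: sym_entry.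
Qed.

Lemma lev_e r : lev (e_ r) = - (r.+1)%:Z.
Proof.
rewrite /lev; congr (- _); rewrite (bigD1 r) //= ffunE eqxx mulr1 big1 ?addr0 // => j /negbTE jr.
by rewrite ffunE jr mulr0.
Qed.

Lemma levN (chi : {ffun 'I_n -> int}) : lev (- chi) = - lev chi.
Proof.
rewrite /lev; congr (- _); rewrite -sumrN; apply: eq_bigr => j _.
by rewrite ffunE mulrN.
Qed.

Lemma lev_positive (alpha : {ffun 'I_n -> int}) : positive_root alpha -> 0 < lev alpha.
Proof.
by case=> [[a [b [_ ->]]]|[a [b [ab ->]]]]; rewrite ?levN !levD ?levN !lev_e; lia.
Qed.

(** Highest weight vectors are defined by arbitrary root vectors. Comparing eigenvalues entry by
    entry, a nonzero b_rq forces the root e_r + e_q, of negative level, and a nonzero a_rq forces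
    e_r - e_q, of positive level only when r < q. *)
Lemma positive_root_space alpha X : 0 < lev alpha -> root_space alpha X ->
  exists a c, [/\ X = spx a 0 c, c^T = c & forall r q, a r q != 0 -> (r < q)%N].
Proof.
move=> la [/LieC_Sp /spC_spx [a [b [c [-> bT cT]]]] H].
have ea j r q : ((r == j)%:R - (q == j)%:R) * a r q = (alpha j)%:~R * a r q.
  by have := H j; rewrite bracket_cartan spxZ => /spx_inj [/matrixP /(_ r q)]; rewrite !mxE.
have eb j r q : ((r == j)%:R + (q == j)%:R) * b r q = (alpha j)%:~R * b r q.
  by have := H j; rewrite bracket_cartan spxZ => /spx_inj [_ /matrixP /(_ r q)]; rewrite !mxE.
have intR (x : bool) : (x%:R : C) = (x%:Z)%:~R by [].
have b0 : b = 0.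
  apply/matrixP => r q; rewrite mxE; apply/eqP; apply: contraT => brq.
  suff E : alpha = e_ r + e_ q by move: la; rewrite E levD !lev_e; lia.
  apply/ffunP => j; rewrite !ffunE.
  have /eqP := mulIf brq (eb j r q); rewrite !intR -intrD eqr_int => /eqP <-.
  by rewrite ![_ == j]eq_sym.
rewrite b0; exists a, c; split; [by []|exact: cT|].
move=> r q arq; suff E : alpha = e_ r - e_ q by move: la; rewrite E levD levN !lev_e; lia.
apply/ffunP => j; rewrite !ffunE.
have /eqP := mulIf arq (ea j r q); rewrite !intR -intrB eqr_int => /eqP <-.
by rewrite ![_ == j]eq_sym.
Qed.

End Roots.

Opaque spx.

(** * Highest weight vectors in (g,K)-modules *)

Section HighestWeight.
Variables (R : realType) (n : nat) (M : gKdata R n).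
Local Notation C := R[i].
Local Notation iC := (iC R).
Local Notation spn := (LieC (@Sp R n)).
Local Notation K := (@Kinf R n).
Local Notation S := (@gk_supp _ _ M).
Local Notation V := (gk_amb M).
Local Notation E r q := (kappa (delta_mx r q)).
Hypothesis MM : is_gKmodule M.
Implicit Types (v w x y : V) (X Y : 'M[C]_(n + n)).

Let KM : is_Kmodule M. Proof. exact: gKmodule_Kmodule. Qed.
Let sS : subspace S. Proof. by case: KM. Qed.
Let sSp : subspace spn. Proof. exact: LieC_Sp_subspace. Qed.
Let cart (j : 'I_n) : V -> V := gk_lie (cartan R j).

Lemma lie_in X v : spn X -> S v -> S (gk_lie X v).
Proof. by have [[_ _ H _] _ _ _] := MM; exact: H. Qed.

Lemma lie_linear X : spn X -> linear_on S (gk_lie X : V -> V).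
Proof. by have [_ [H _ _] _ _] := MM; move=> sX a u v; exact: H. Qed.

Lemma lie_linear_l v : S v -> linear_on spn (fun X => gk_lie X v).
Proof. by have [_ [_ H _] _ _] := MM; move=> Sv a X Y sX sY; exact: H. Qed.

Lemma lie_bracket X Y v : spn X -> spn Y -> S v ->
  gk_lie X (gk_lie Y v) = gk_lie Y (gk_lie X v) + gk_lie (bracket X Y) v.
Proof. by have [_ [_ _ H] _ _] := MM; move=> sX sY Sv; rewrite H // addrC subrK. Qed.

Lemma lie_KdC X v : LieC K X -> S v -> gk_lie X v = KdC X v.
Proof.
move=> KX Sv; have [_ _ _ [_ c2]] := MM; have [Xr Xi] := LieC_split KX.
have real Z : Lie K Z -> gk_lie (toC Z) v = Kd Z v.
  by move=> KZ; exact: (vderive_unique (c2 _ _ KZ Sv) (Kd_derive KM KZ Sv)).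
have sp Z : Lie K Z -> spn (toC Z) by move=> KZ; apply/LieC_K_Sp; exact: LieC_toC (@LieK0 R n) KZ.
rewrite {1}(mxC_split X) addrC (lie_linear_l Sv iC (sp _ Xi) (sp _ Xr)) (real _ Xr) (real _ Xi).
by rewrite addrC.
Qed.

Lemma cartan_Sp j : spn (cartan R j).
Proof. by rewrite cartanE; exact: kappa_Sp. Qed.

Let cart_lin j : linear_on S (cart j). Proof. exact: (lie_linear (cartan_Sp j)). Qed.
Lemma root_op_wt alpha X : root_space alpha X -> op_wt S cart (gk_lie X) alpha.
Proof.
move=> [sX H]; split; [by move=> x; exact: lie_in|exact: lie_linear|move=> x j Sx].
rewrite /cart (lie_bracket (cartan_Sp j) sX Sx) H.
rewrite -[_ *: X]addr0 (lie_linear_l Sx _ sX (subspace0 sSp)).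
by rewrite (linear_on0 sSp (lie_linear_l Sx)) addr0.
Qed.

Definition wt_of (lambda : n.-tuple int) : {ffun 'I_n -> int} := [ffun j => tnth lambda j].

Lemma wt_of_inj : injective wt_of.
Proof.
by move=> l l' /ffunP e; apply: eq_from_tnth => j; have := e j; rewrite !ffunE.
Qed.

Lemma hwv_wt lambda v : highest_weight_vector lambda v -> wtv S cart (wt_of lambda) v.
Proof. by case=> Sv _ H _; split=> // j; rewrite ffunE; exact: H. Qed.

Lemma hwv_killed lambda v : highest_weight_vector lambda v ->
  (forall r q : 'I_n, (r < q)%N -> gk_lie (E r q) v = 0) /\
  (forall r q : 'I_n, gk_lie (pmin R r q) v = 0).
Proof.
case=> _ _ _ H; split=> [r q rq|].
  by apply: (H (e_ r - e_ q)); [right; exists r, q|exact: root_kappa].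
suff le (r q : 'I_n) : (r <= q)%N -> gk_lie (pmin R r q) v = 0.
  by move=> r q; case/orP: (leq_total r q) => [|/le <-]; [exact: le|rewrite pminC].
by move=> rq; apply: (H (- (e_ r + e_ q))); [left; exists r, q|exact: root_pmin].
Qed.

Lemma lie_sub (W : set V) v : subspace W -> S v -> subspace [set X | spn X /\ W (gk_lie X v)].
Proof.
move=> sW Sv; split.
  by split; [exact: (subspace0 sSp)|rewrite (linear_on0 sSp (lie_linear_l Sv)); exact: (subspace0 sW)].
move=> a X Y [sX WX] [sY WY]; split; first exact: sSp.2.
by rewrite (lie_linear_l Sv a sX sY); exact: sW.2.
Qed.

Lemma killed_hwv lambda v : S v -> v != 0 ->
  (forall j, gk_lie (cartan R j) v = (tnth lambda j)%:~R *: v) ->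
  (forall r q : 'I_n, (r < q)%N -> gk_lie (E r q) v = 0) ->
  (forall r q : 'I_n, gk_lie (pmin R r q) v = 0) -> highest_weight_vector lambda v.
Proof.
move=> Sv v0 cv Ev pv; split=> // alpha X pa rX.
have [a [c [-> cT ar]]] := positive_root_space (lev_positive pa) rX.
have /(@spx_span R n) H := lie_sub (@zero_subspace R V) Sv.
have [||||//] := H a 0 c _ cT; rewrite ?trmx0 //.
- by move=> r q arq; split; [exact: kappa_Sp|exact: (Ev _ _ (ar r q arq))].
- by move=> r q; rewrite mxE eqxx.
- by move=> r q _; split; [exact: pmin_Sp|exact: pv].
Qed.

Definition NegL : set (V -> V) := [set T | exists alpha X,
  [/\ positive_root (- alpha), root_space alpha X & T = gk_lie X]].
Definition PosL : set (V -> V) := [set T | exists alpha X,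
  [/\ positive_root alpha, root_space alpha X & T = gk_lie X]].

Let Neg_wt T : NegL T -> exists2 alpha, lev alpha < 0 & op_wt S cart T alpha.
Proof.
case=> alpha [X [pa rX ->]]; exists alpha; last exact: root_op_wt.
by have := lev_positive pa; rewrite levN oppr_gt0.
Qed.

Let Pos_wt T : PosL T -> exists2 alpha, 0 < lev alpha & op_wt S cart T alpha.
Proof.
by case=> alpha [X [pa rX ->]]; exists alpha; [exact: lev_positive|exact: root_op_wt].
Qed.

(** By [Gen_stable] it suffices to act on [v]: positive root vectors kill it, the Cartan subalgebra
    scales it, and negative root vectors are among the generators. *)
Lemma Gen_lie lambda v : highest_weight_vector lambda v ->
  forall X x, spn X -> Gen NegL v x -> Gen NegL v (gk_lie X x).
Proof.
move=> hv X x sX Gx; have [Sv _ cv _] := hv; have [Ev pv] := hwv_killed hv.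
have sG := Gen_subspace NegL v.
apply: (@Gen_stable R V S NegL [set T | exists X, spn X /\ T = gk_lie X] v sS Sv) => //.
- by move=> T [alpha [Y [_ [sY _] ->]]] y; exact: lie_in.
- by move=> _ [Y [sY ->]]; exact: lie_linear.
- move=> _ [Y [sY ->]]; have /LieC_Sp /spC_spx [a [b [c [-> bT cT]]]] := sY.
  have /(@spx_span R n) H := lie_sub sG Sv.
  have [|||//] := H a b c bT cT.
  + move=> r q _; split; first exact: kappa_Sp.
    have [rq|qr|rq] := ltngtP r q.
    * by rewrite Ev //; exact: (subspace0 sG).
    * apply: Gen_op; last exact: Gen_base.
      exists (e_ r - e_ q), (E r q); split=> //; last exact: root_kappa.
      by right; exists q, r; rewrite opprB.
    * have <- : r = q by exact: val_inj.
      by rewrite -cartanE cv; apply: (subspaceZ _ sG); exact: Gen_base.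
  + move=> r q _; split; first exact: pplus_Sp.
    apply: Gen_op; last exact: Gen_base.
    exists (e_ r + e_ q), (pplus R r q); split=> //; last exact: root_pplus.
    by left; case/orP: (leq_total r q) => h; [exists r, q|exists q, r; rewrite addrC].
  + by move=> r q _; split; [exact: pmin_Sp|rewrite pv; exact: (subspace0 sG)].
- move=> _ T [Y [sY ->]] [alpha [Z [_ [sZ _] ->]]]; exists (gk_lie (bracket Y Z)).
    by exists (bracket Y Z); split=> //; exact: LieC_Sp_bracket.
  by move=> y Sy; exact: lie_bracket.
- by exists X.
Qed.

Lemma Gen_sub lambda v : highest_weight_vector lambda v -> Gen NegL v `<=` S.
Proof.
case=> Sv _ _ _ x Gx; apply: (Gx S) => // T y [alpha [X [_ [sX _] ->]]]; exact: lie_in.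
Qed.

(** Stability under K follows from stability under k by [K_stable]. *)
Lemma Gen_submodule lambda v : highest_weight_vector lambda v -> submodule (Gen NegL v).
Proof.
move=> hv; have GS := Gen_sub hv; have sG := Gen_subspace NegL v; split=> //.
  by move=> X x sX; exact: (Gen_lie hv sX).
apply: (K_stable KM) => // a x Gx.
rewrite -(lie_KdC (LieC_kappa a) (GS _ Gx)); exact: (Gen_lie hv (kappa_Sp a) Gx).
Qed.

Lemma irreducible_Gen lambda v : irreducible M -> highest_weight_vector lambda v -> Gen NegL v = S.
Proof.
move=> [_ irr] hv; have [E|//] := irr _ (Gen_submodule hv).
have := @Gen_base R V NegL v; rewrite E => v0; have [_ /eqP] := hv; by case.
Qed.

(** Each of the two vectors generates the whole module, so neither weight can lie below the other in
    level; then [Gen_top] makes them equal and the vectors proportional. *)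
Lemma hwv_unique lambda nu v w : irreducible M -> highest_weight_vector lambda v ->
  highest_weight_vector nu w -> nu = lambda /\ exists c, w = c *: v.
Proof.
move=> irr hv hw; have [Sv v0 _ _] := hv; have [Sw w0 _ _] := hw.
have Gw : Gen NegL v w by rewrite (irreducible_Gen irr hv).
have Gv : Gen NegL w v by rewrite (irreducible_Gen irr hw).
have wv := hwv_wt hv; have ww := hwv_wt hw.
have top := Gen_top sS cart_lin.
have [l|l] := leP (lev (wt_of lambda)) (lev (wt_of nu)).
  by have [/wt_of_inj e c] := top _ _ _ _ _ wv Neg_wt Gw ww w0 l.
have [/wt_of_inj e _] := top _ _ _ _ _ ww Neg_wt Gv wv v0 (ltW l).
by move: l; rewrite e ltxx.
Qed.

(** Levels in the space generated by [v] are at most that of lambda, so a vector of maximal level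
    can be reached inside [W]. *)
Lemma submodule_hwv lambda v (W : set V) x : highest_weight_vector lambda v ->
  submodule W -> W `<=` Gen NegL v -> W x -> x != 0 ->
  exists nu w, highest_weight_vector nu w /\ W w.
Proof.
move=> hv [WS sW WX _] WG Wx x0.
have [chi [w [[Sw wc] w0 Ww pw]]] : exists chi y, [/\ wtv S cart chi y, y != 0, W y & forall T, PosL T -> T y = 0].
  apply: (highest_component sS cart_lin sW (L := lev (wt_of lambda)) _ _ Pos_wt _ Wx x0).
  - by move=> j y; exact: (WX _ _ (cartan_Sp j)).
  - move=> y Wy; apply: (Gen_WS sS cart_lin (hwv_wt hv) Neg_wt); exact: WG.
  - by move=> T y [alpha [X [_ [sX _] ->]]]; exact: WX.
exists [tuple chi j | j < n], w; split=> //; split=> //.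
  by move=> j; rewrite tnth_mktuple; exact: wc.
by move=> alpha X pa rX; apply: (pw (gk_lie X)); exists alpha, X.
Qed.

End HighestWeight.

(** * Highest weight theory for K alone *)

Section KHighestWeight.
Variables (R : realType) (n : nat) (M : gKdata R n).
Local Notation C := R[i].
Local Notation K := (@Kinf R n).
Local Notation S := (@gk_supp _ _ M).
Local Notation V := (gk_amb M).
Local Notation E r q := (kappa (delta_mx r q : 'M[C]_n)).
Hypothesis KM : is_Kmodule M.
Let sS : subspace S. Proof. by case: KM. Qed.

Definition kcart (j : 'I_n) : V -> V := KdC (cartan R j).

Definition kNeg : set (V -> V) := [set T | exists r q : 'I_n, (q < r)%N /\ T = KdC (E r q)].

Lemma kappa_bracket_KdC a b (x : V) : S x ->
  KdC (kappa a) (KdC (kappa b) x) = KdC (kappa b) (KdC (kappa a) x) + KdC (kappa (a *m b - b *m a)) x.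
Proof.
move=> Sx; rewrite -bracket_kappa2 (KdC_bracket KM (LieC_kappa a) (LieC_kappa b) Sx).
by rewrite addrC subrK.
Qed.

Lemma kcart_lin j : linear_on S (kcart j).
Proof. by apply: (KdC_linear KM); rewrite cartanE; exact: LieC_kappa. Qed.

Lemma kappa_op_wt r q : op_wt S kcart (KdC (E r q)) (e_ r - e_ q).
Proof.
split; [by move=> x; apply: (KdC_in KM); exact: LieC_kappa|by apply: (KdC_linear KM); exact: LieC_kappa|].
move=> x j Sx; rewrite /kcart cartanE kappa_bracket_KdC // -bracket_kappa2 -cartanE.
have [_ ->] := root_kappa R r q; congr (_ + _).
have sK := @LieC_K_subspace R n.
rewrite -[_ *: E r q]addr0 (KdC_linear_l KM Sx _ (LieC_kappa _) (subspace0 sK)).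
by rewrite (linear_on0 sK (KdC_linear_l KM Sx)) addr0.
Qed.

Lemma kappa_span (W : set V) x (a : 'M[C]_n) : subspace W -> S x ->
  (forall r q : 'I_n, a r q != 0 -> W (KdC (E r q) x)) -> W (KdC (kappa a) x).
Proof.
move=> sW Sx H; have sK := @LieC_K_subspace R n.
have sL : subspace [set X | LieC K X /\ W (KdC X x)].
  split.
    by split; [exact: (subspace0 sK)|rewrite (linear_on0 sK (KdC_linear_l KM Sx)); exact: (subspace0 sW)].
  move=> b X Y [sX WX] [sY WY]; split; first exact: sK.2.
  by rewrite (KdC_linear_l KM Sx b sX sY); exact: sW.2.
have [|||||//] := spx_span (a := a) (b := 0) (c := 0) sL; rewrite ?trmx0 //.
- by move=> r q arq; split; [exact: LieC_kappa|exact: H].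
- by move=> r q; rewrite mxE eqxx.
- by move=> r q; rewrite mxE eqxx.
Qed.

Lemma kGen_sub v : S v -> Gen kNeg v `<=` S.
Proof.
move=> Sv x Gx; apply: (Gx S) => // T y [r [q [_ ->]]]; apply: (KdC_in KM); exact: LieC_kappa.
Qed.

Lemma kGen_stable lambda v : wtv S kcart lambda v ->
  (forall r q : 'I_n, (r < q)%N -> KdC (E r q) v = 0) ->
  forall a x, Gen kNeg v x -> Gen kNeg v (KdC (kappa a) x).
Proof.
move=> [Sv cv] Ev a x Gx; have sG := Gen_subspace kNeg v.
apply: (@Gen_stable R V S kNeg [set T | exists b, T = KdC (kappa b)] v sS Sv) => //.
- by move=> T [r [q [_ ->]]] y; apply: (KdC_in KM); exact: LieC_kappa.
- by move=> _ [b ->]; apply: (KdC_linear KM); exact: LieC_kappa.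
- move=> _ [b ->]; apply: (kappa_span sG Sv) => r q _.
  have [rq|qr|rq] := ltngtP r q.
  + by rewrite Ev //; exact: (subspace0 sG).
  + by apply: Gen_op; [exists r, q|exact: Gen_base].
  + have <- : r = q by exact: val_inj.
    by rewrite -cartanE -[KdC _ v]/(kcart r v) cv; apply: (subspaceZ _ sG); exact: Gen_base.
- move=> _ T [b ->] [r [q [_ ->]]]; exists (KdC (kappa (b *m delta_mx r q - delta_mx r q *m b))).
    by eexists.
  by move=> y Sy; exact: kappa_bracket_KdC.
- by exists a.
Qed.

End KHighestWeight.

Lemma KdCE (R : realType) n (M : gKdata R n) X (v : gk_amb M) : KdC X v = Kd (mxRe X) v + iC R *: Kd (mxIm X) v.
Proof. by []. Qed.

Opaque KdC.

(** * The element w and the Levi blocks in Cayley coordinates *)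

Section Sandwich.
Variables (F : comNzRingType) (n i : nat) (le_in : (i <= n)%N).
Local Notation S1 := (selgl F le_in).
Local Notation S2 := (selsp F le_in).
Implicit Types A B D E : 'M[F]_n.

Lemma T1_block A B D E : T1 F le_in *m block_mx A B D E *m (T1 F le_in)^T = S1 *m A *m S1^T.
Proof. by rewrite T1tr /T1 mul_row_block !mul0mx !addr0 mul_row_col mulmx0 addr0. Qed.

Lemma T2_block A B D E : T2 F le_in *m block_mx A B D E *m (T2 F le_in)^T =
  block_mx (S2 *m A *m S2^T) (S2 *m B *m S2^T) (S2 *m D *m S2^T) (S2 *m E *m S2^T).
Proof. by rewrite T2tr /T2 !mulmx_block !mulmx0 !mul0mx !addr0 !add0r. Qed.

End Sandwich.

Section Rotation.
Variables (R : realType) (n i : nat) (le_in : (i <= n)%N).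
Local Notation C := R[i].
Local Notation m := (n - i)%N.
Local Notation S1 := (selgl C le_in).
Local Notation S2 := (selsp C le_in).
Implicit Types (a b c B : 'M[C]_n).

Definition lo_index (k : 'I_m) : 'I_n := widen_ord (leq_subr i n) k.
Definition hi_index (k : 'I_i) : 'I_n := cast_ord (subnK le_in) (rshift m k).

Definition rotJ1 : 'M[C]_(m, n) := rowsub lo_index 1%:M.
Definition rotJ2 : 'M[C]_(i, n) := rowsub hi_index 1%:M.
Local Notation J1 := rotJ1.
Local Notation J2 := rotJ2.

(* The permutation moving the first n - i coordinates to the end, where the
   factor Sp_(2(n-i)) of the Levi subgroup acts. *)
Definition rotW : 'M[C]_n := S2^T *m J1 + S1^T *m J2.
Local Notation W := rotW.

Lemma J11 : J1 *m J1^T = 1%:M.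
Proof. by rewrite rowsub_orth; apply/matrixP => r q; rewrite !mxE -!val_eqE. Qed.

Lemma J22 : J2 *m J2^T = 1%:M.
Proof. by rewrite rowsub_orth; apply/matrixP => r q; rewrite !mxE -!val_eqE /= eqn_add2l. Qed.

Lemma J12 : J1 *m J2^T = 0.
Proof.
rewrite rowsub_orth; apply/matrixP => r q; rewrite !mxE -val_eqE /= (_ : (_ == _) = false) //.
by apply/negbTE; have := ltn_ord r; lia.
Qed.

Lemma J21 : J2 *m J1^T = 0.
Proof. by apply: trmx_inj; rewrite trmx_mul trmxK J12 trmx0. Qed.

Lemma S1W : S1 *m W = J2.
Proof. by rewrite /rotW mulmxDr !mulmxA S11 S12 mul0mx mul1mx add0r. Qed.

Lemma S2W : S2 *m W = J1.
Proof. by rewrite /rotW mulmxDr !mulmxA S22 S21 mul0mx mul1mx addr0. Qed.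

Lemma WTS1 : W^T *m S1^T = J2^T. Proof. by rewrite -trmx_mul S1W. Qed.
Lemma WTS2 : W^T *m S2^T = J1^T. Proof. by rewrite -trmx_mul S2W. Qed.

Lemma rotWT : W *m W^T = 1%:M.
Proof.
have -> : W^T = J1^T *m S2 + J2^T *m S1 by rewrite /rotW trmxD !trmx_mul !trmxK.
rewrite mulmxDr !mulmxA /rotW !mulmxDl -!(mulmxA _ J1) -!(mulmxA _ J2).
by rewrite J11 J22 J12 J21 !mulmx0 !mul0mx !mulmx1 addr0 add0r addrC Ssum.
Qed.

Lemma rotTW : W^T *m W = 1%:M. Proof. exact: (mulmx1C rotWT). Qed.

Lemma rotW_real : map_mx conjc W = W.
Proof.
have real p q (f : 'I_p -> 'I_q) : map_mx conjc (rowsub f 1%:M : 'M[C]_(p, q)) = rowsub f 1%:M.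
  by apply/matrixP => r k; rewrite !mxE; case: (_ == _); apply/eqP; rewrite eq_complex /= oppr0 !eqxx.
by rewrite /rotW map_mxD !map_mxM -!map_trmx !real.
Qed.

Lemma adj_rotW : adj W = W^T.
Proof. by rewrite /adj -map_trmx rotW_real. Qed.

Definition krot : 'M[R]_(n + n) := phi W.

Lemma rot_K : Kinf krot.
Proof. by apply: Kinf_phi; rewrite adj_rotW rotTW. Qed.

Lemma rot_Ad a b c : toC krot *m spx a b c *m invmx (toC krot) =
  spx (W *m a *m W^T) (W *m b *m W^T) (W *m c *m W^T).
Proof. by rewrite (conj_spx _ _ _ rot_K) /krot tau_phi adj_rotW rotW_real. Qed.

Lemma rot_Ad_S B : toC krot *m kappa (W^T *m B *m W) *m invmx (toC krot) = kappa B.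
Proof.
rewrite -[kappa _]/(spx _ 0 0) rot_Ad !mulmx0 !mul0mx; congr (spx _ 0 0).
by rewrite !mulmxA rotWT mul1mx -mulmxA rotWT mulmx1.
Qed.

Lemma rowsub_delta p q (f : 'I_p -> 'I_q) (r k : 'I_p) :
  (rowsub f 1%:M : 'M[C]_(p, q))^T *m delta_mx r k *m rowsub f 1%:M = delta_mx (f r) (f k).
Proof.
have colE (l : 'I_p) : delta_mx 0 l *m rowsub f 1%:M = delta_mx 0 (f l) :> 'rV[C]_q.
  by rewrite -rowE; apply/rowP => j; rewrite !mxE eqxx /= eq_sym.
have rowE' : (rowsub f 1%:M : 'M[C]_(p, q))^T *m delta_mx r 0 = delta_mx (f r) 0 :> 'cV[C]_q.
  by apply: trmx_inj; rewrite trmx_mul trmxK !trmx_delta colE.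
rewrite -(@mul_delta_mx C p 1 p 0 r k) mulmxA -mulmxA colE rowE'.
by rewrite mul_delta_mx.
Qed.

Lemma J12_delta (r q : 'I_n) : (q <= r)%N -> J1 *m delta_mx r q *m J2^T = 0.
Proof.
move=> qr; rewrite -mxsub_selection; apply/matrixP => x y; rewrite !mxE.
case: (lo_index x =P r) => //= ex; case: (hi_index y =P q) => //= ey.
by exfalso; move: qr; rewrite -ex -ey /= leqNgt => /negP; apply; have := ltn_ord x; lia.
Qed.

Lemma T1_spx a b c : T1 C le_in *m spx a b c *m (T1 C le_in)^T =
  real_complex R 2^-1 *: (S1 *m (a + c + (b - a^T)) *m S1^T).
Proof.
Transparent spx. rewrite /spx. Opaque spx.
by rewrite cayE T1_block -scalemxAr -scalemxAl.
Qed.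

Lemma T2_cay a b c (d : 'M[C]_n) : T2 C le_in *m cay a b c d *m (T2 C le_in)^T =
  cay (S2 *m a *m S2^T) (S2 *m b *m S2^T) (S2 *m c *m S2^T) (S2 *m d *m S2^T).
Proof.
have sD x y : S2 *m (x + y) *m S2^T = S2 *m x *m S2^T + S2 *m y *m S2^T.
  by rewrite mulmxDr mulmxDl.
have sN x : S2 *m (- x) *m S2^T = - (S2 *m x *m S2^T) by rewrite mulmxN mulNmx.
have sZ h x : S2 *m (h *: x) *m S2^T = h *: (S2 *m x *m S2^T) by rewrite -scalemxAr -scalemxAl.
rewrite cayE [RHS]cayE T2_block.
by apply: block_mx_eq; rewrite sZ !sD ?sN ?sD ?sN.
Qed.

Lemma T2_spx a b c : T2 C le_in *m spx a b c *m (T2 C le_in)^T =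
  spx (S2 *m a *m S2^T) (S2 *m b *m S2^T) (S2 *m c *m S2^T).
Proof.
Transparent spx. rewrite /spx. Opaque spx.
by rewrite T2_cay mulmxN mulNmx !trmx_mul trmxK !mulmxA.
Qed.

Lemma spx_parabolic a b c : parabolic le_in (spx a b c) <->
  S2 *m (a + c + (b - a^T)) *m S1^T = 0 /\ (a - c + (b + a^T)) *m S1^T = 0.
Proof.
Transparent spx. rewrite parabolicE /spx. Opaque spx.
rewrite cayE block_mxKul block_mxKdl opprK -scalemxAr -scalemxAl -scalemxAl.
have h0 : real_complex R 2^-1 != 0 by rewrite fmorph_eq0 invr_eq0 pnatr_eq0.
have i0 : iC R != 0 by rewrite eq_complex /= oner_eq0 andbF.
split=> [[/eqP + /eqP +]|[-> ->]]; last by rewrite !scaler0.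
by rewrite !scaler_eq0 mulf_eq0 (negbTE h0) (negbTE i0) /= => /eqP -> /eqP ->.
Qed.

End Rotation.

Lemma lie_Ad (R : realType) q (M : gKdata R q) k X (v : gk_amb M) : is_gKmodule M ->
  Kinf k -> LieC (@Sp R q) X -> @gk_supp _ _ M v ->
  gk_cpt k (gk_lie X v) = gk_lie (toC k *m X *m invmx (toC k)) (gk_cpt k v).
Proof. by case=> _ _ _ [c1 _] Kk sX Sv; exact: c1. Qed.

(** * Values at the identity of sections killed by p_- *)

Section AtOne.
Variables (R : realType) (n i : nat) (le_in : (i <= n)%N).
Local Notation C := R[i].
Local Notation m := (n - i)%N.
Local Notation K := (@Kinf R n).
Local Notation P := (@Pin R n i).
Local Notation spn := (LieC (@Sp R n)).
Local Notation S1 := (selgl C le_in).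
Local Notation S2 := (selsp C le_in).
Variables (mu : 'M[R]_i -> C) (V : gKdata R m).
Hypothesis VM : is_gKmodule V.
Variable z : C.
Local Notation N := (normalized n mu).
Hypothesis N1 : N 1%:M = 1.
Hypothesis Nd : forall A : 'M[R]_i,
  is_cderive0 (fun t => N (expm (t *: A))) (z * real_complex R (\tr A)).
Local Notation IV := (Ind le_in mu V).
Local Notation Sf := (@gk_supp _ _ IV).
Local Notation SV := (@gk_supp _ _ V).
Local Notation fn := (gk_amb IV).

Let IM : is_gKmodule IV := ind_gKmodule le_in VM N1 Nd.
Let KI : is_Kmodule IV := gKmodule_Kmodule IM.
Let sI : subspace Sf. Proof. by case: KI. Qed.
(** Annihilation by the whole of p_-, a condition that passes to the translate by w and to images
    under k, since k normalizes p_-. *)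
Definition pkilled q (M : gKdata R q) (x : gk_amb M) :=
  forall c : 'M[C]_q, c^T = c -> gk_lie (spx 0 0 c) x = 0.

Lemma lie_parabolic1 Y (x : fn) : Sf x -> spn Y -> parabolic le_in Y ->
  (gk_lie Y x : fn) 1%:M = dsC le_in z Y (x 1%:M).
Proof.
move=> Sx sY pY; have K0 : LieC K (0 : 'M[C]_(n + n)) := subspace0 (@LieC_K_subspace R n).
have PY : LieC P Y by apply/(LieC_P le_in).
rewrite (ind_lie1 VM N1 Nd Sx PY K0) ?addr0 //.
by rewrite (linear_on0 (@LieC_K_subspace R n) (KdC_linear_l KI Sx)) addr0.
Qed.

(** The p_- of the smaller symplectic group, placed in the last n - i coordinates, lies in Lie P
    with zero gl_i component. *)
Lemma ev_pkilled (x : fn) : Sf x -> pkilled x -> pkilled (x 1%:M : gk_amb V).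
Proof.
move=> Sx px c cT; pose c' := S2^T *m c *m S2.
have cT' : c'^T = c' by rewrite /c' !trmx_mul trmxK cT mulmxA.
have S21' : S2 *m S1^T = 0 := S21 C le_in.
have cS : c' *m S1^T = 0 by rewrite /c' -!mulmxA S21' !mulmx0.
have sY : spn (spx 0 0 c') by apply: spx_Sp; rewrite ?trmx0.
have pY : parabolic le_in (spx 0 0 c').
  by apply/spx_parabolic; rewrite trmx0 !sub0r !add0r subr0 addr0 -mulmxA cS mulmx0 mulNmx cS oppr0.
have := lie_parabolic1 Sx sY pY; rewrite (px _ cT') dsCE T1_spx T2_spx.
rewrite trmx0 subr0 add0r addr0 -mulmxA cS mulmx0 scaler0 linear0 mulr0 scale0r add0r.
rewrite !mulmx0 !mul0mx /c' !mulmxA S22 mul1mx -mulmxA S22 mulmx1 => H.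
by rewrite -[LHS]H.
Qed.

(** Write kappa(B) as spx(B, 0, B + B^T) - spx(0, 0, B + B^T). The second term lies in p_- and kills
    [x]; the first lies in Lie P because of the vanishing block. Its symplectic component again
    differs from kappa(S2 B S2^T) by an element of p_-, which kills the value at 1. *)
Lemma ev_kappa (x : fn) (B : 'M[C]_n) : Sf x -> pkilled x -> S2 *m B *m S1^T = 0 ->
  (KdC (kappa B) x : fn) 1%:M = (z * \tr (S1 *m B *m S1^T)) *: x 1%:M +
    gk_lie (kappa (S2 *m B *m S2^T)) (x 1%:M).
Proof.
move=> Sx px B0; rewrite -(lie_KdC IM (LieC_kappa B) Sx).
have symB q (A : 'M[C]_q) : (A + A^T)^T = A + A^T by rewrite trmxD trmxK addrC.
have Y0 : kappa B = spx B 0 (B + B^T) + spx 0 0 (- (B + B^T)).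
  by rewrite spxD !addr0 subrr.
have sY : spn (spx B 0 (B + B^T)) by apply: spx_Sp; rewrite ?trmx0.
have sZ : spn (spx 0 0 (- (B + B^T))) by apply: spx_Sp; rewrite ?trmx0 // trmxN symB.
have e1 : B + (B + B^T) + (0 - B^T) = B + B by rewrite sub0r addrA addrK.
have pY : parabolic le_in (spx B 0 (B + B^T)).
  apply/spx_parabolic; rewrite e1 mulmxDr mulmxDl B0 addr0; split=> //.
  by rewrite add0r opprD addrA subrr sub0r addNr mul0mx.
rewrite Y0 (linear_onD (lie_linear_l IM Sx) sY sZ) (px _); last by rewrite trmxN symB.
rewrite addr0 (lie_parabolic1 Sx sY pY) dsCE T1_spx T2_spx e1; congr (_ + _).
  congr ((_ * _) *: _); rewrite mulmxDr mulmxDl scalerDr -scalerDl half2 scale1r //.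
have Sx1 : SV (x 1%:M) := ind_valS Sx (@Kinf1 R n).
have px1 := ev_pkilled Sx px.
set B2 := S2 *m B *m S2^T.
have -> : S2 *m (B + B^T) *m S2^T = B2 + B2^T.
  by rewrite mulmxDr mulmxDl /B2 !trmx_mul trmxK !mulmxA.
have -> : spx B2 (S2 *m 0 *m S2^T) (B2 + B2^T) = kappa B2 + spx 0 0 (B2 + B2^T).
  by rewrite spxD mulmx0 mul0mx !addr0 add0r.
have sk : LieC (@Sp R m) (kappa B2) by exact: kappa_Sp.
have sp : LieC (@Sp R m) (spx 0 0 (B2 + B2^T)) by apply: spx_Sp; rewrite ?trmx0.
by rewrite (linear_onD (lie_linear_l VM Sx1) sk sp) (px1 _ (symB _ _)) addr0.
Qed.

Lemma pkilled_kappa q (M : gKdata R q) (MM : is_gKmodule M) a (x : gk_amb M) :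
  @gk_supp _ _ M x -> pkilled x -> pkilled (gk_lie (kappa a) x).
Proof.
move=> Sx px c cT; have ks : LieC (@Sp R q) (kappa a) := kappa_Sp a.
have cs : LieC (@Sp R q) (spx 0 0 c) by apply: spx_Sp; rewrite ?trmx0.
have := lie_bracket MM ks cs Sx; rewrite (px c cT) bracket_kappa !mulmx0 !mul0mx subrr addr0.
have sM : subspace (@gk_supp _ _ M) by case: (gKmodule_Kmodule MM).
rewrite ?(linear_on0 sM (lie_linear MM ks)) (px (- _)); last first.
  by rewrite trmxN trmxD !trmx_mul trmxK cT addrC.
by rewrite addr0 => <-.
Qed.

Lemma hwv_pkilled q (M : gKdata R q) (MM : is_gKmodule M) lambda (v : gk_amb M) :
  highest_weight_vector lambda v -> pkilled v.
Proof.
move=> hv c cT; have [_ pv] := hwv_killed hv; have [Sv _ _ _] := hv.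
have /(@spx_span R q) H := lie_sub MM (@zero_subspace R (gk_amb M)) Sv.
have [||||//] := H 0 0 c _ cT; rewrite ?trmx0 //.
- by move=> r k; rewrite mxE eqxx.
- by move=> r k; rewrite mxE eqxx.
- by move=> r k _; split; [exact: pmin_Sp|exact: pv].
Qed.

Lemma pkilled_pmin q (M : gKdata R q) (v : gk_amb M) (r k : 'I_q) : pkilled v -> gk_lie (pmin R r k) v = 0.
Proof. by move=> pv; apply: pv; exact: delta_sym. Qed.

Lemma pkilled_rot (x : fn) : Sf x -> pkilled x -> pkilled (gk_cpt (krot R le_in) x : fn).
Proof.
move=> Sx px c cT; set W := rotW R le_in.
have cT' : (W^T *m c *m W)^T = W^T *m c *m W by rewrite !trmx_mul trmxK cT mulmxA.
have cs : spn (spx 0 0 (W^T *m c *m W)) by apply: spx_Sp; rewrite ?trmx0.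
have := lie_Ad IM (rot_K R le_in) cs Sx; rewrite rot_Ad -/W (px _ cT').
rewrite (linear_on0 sI (cpt_linear KI (rot_K R le_in))) !mulmx0 !mul0mx !mulmxA rotWT mul1mx.
by rewrite -mulmxA rotWT mulmx1 => <-.
Qed.

Lemma kappa_rot (x : fn) B : Sf x -> KdC (kappa B) (gk_cpt (krot R le_in) x : fn) =
  gk_cpt (krot R le_in) (KdC (kappa ((rotW R le_in)^T *m B *m rotW R le_in)) x).
Proof.
move=> Sx; rewrite (KdC_Ad KI (rot_K R le_in) (LieC_kappa _) Sx).
by rewrite rot_Ad_S.
Qed.

End AtOne.

Section Circle.
Variable R : realType.
Local Notation C := R[i].
Local Notation iC := (iC R).

(** The function e^(ilt), whose value at pi carries the sign (-1)^l. *)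
Definition circle (l : int) (t : R) : C := (cos (l%:~R * t) +i* sin (l%:~R * t))%C.

Lemma circle0 l : circle l 0 = 1.
Proof. by rewrite /circle mulr0 cos0 sin0. Qed.

Lemma circleD l s t : circle l (s + t) = circle l s * circle l t.
Proof.
rewrite /circle mulrDr cosD sinD; apply/eqP; rewrite eq_complex /=.
by apply/andP; split; apply/eqP; ring.
Qed.

Lemma circle_derive l : is_cderive0 (circle l) (iC * l%:~R).
Proof.
rewrite -(rmorph_int (real_complex R)); set s : R := l%:~R.
have dc : is_derive (s * 0 + 0) (1 : R) cos (- sin (s * 0 + 0)) by exact: is_derive_cos.
have ds : is_derive (s * 0 + 0) (1 : R) sin (cos (s * 0 + 0)) by exact: is_derive_sin.
split.
  apply: (is_derive_fun_eq (is_derive_affine dc)) => [t|]; first by rewrite addr0.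
  by rewrite mulr0 addr0 sin0 oppr0 mulr0 /= mulr0 mul0r subrr.
apply: (is_derive_fun_eq (is_derive_affine ds)) => [t|]; first by rewrite addr0.
by rewrite mulr0 addr0 cos0 mulr1 /=; ring.
Qed.

Lemma circle_pi l : circle l pi = (- 1) ^ l.
Proof.
have nat_case (k : nat) : cos (k%:R * pi) = (- 1) ^+ k :> R /\ sin (k%:R * pi) = 0 :> R.
  elim: k => [|k [IHc IHs]]; first by rewrite mul0r cos0 sin0 expr0.
  rewrite -[in cos _]addn1 -[in sin _]addn1 natrD mulrDl mul1r exprSr.
  by split; [rewrite cosD IHc IHs cospi mul0r subr0|rewrite sinD IHs sinpi mul0r mulr0 addr0].
have sgnC (k : nat) : real_complex R ((- 1) ^+ k) = (- 1) ^+ k by rewrite rmorphXn rmorphN1.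
rewrite /circle; case: l => k.
  have [c s] := nat_case k; rewrite -[(Posz k)%:~R]/(k%:R) c s.
  by rewrite -[((_ +i* 0)%C)]/(real_complex R _) sgnC.
have [c s] := nat_case k.+1; rewrite NegzE mulrNz mulNr cosN sinN -[(Posz k.+1)%:~R]/(k.+1%:R) c s oppr0.
rewrite -[((_ +i* 0)%C)]/(real_complex R _) sgnC -[RHS]/(((- 1) ^+ k.+1)^-1).
by rewrite -exprVn invrN1.
Qed.

End Circle.

(** * Values at w of a highest weight vector *)

Section Evaluation.
Variables (R : realType) (n i : nat) (le_in : (i <= n)%N).
Local Notation C := R[i].
Local Notation iC := (iC R).
Local Notation m := (n - i)%N.
Local Notation K := (@Kinf R n).
Local Notation P := (@Pin R n i).
Local Notation spn := (LieC (@Sp R n)).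
Local Notation S1 := (selgl C le_in).
Local Notation J1 := (rotJ1 R n i).
Local Notation J2 := (rotJ2 R le_in).
Local Notation W := (rotW R le_in).
Local Notation w := (krot R le_in).
Local Notation hi := (hi_index le_in).
Variables (mu : 'M[R]_i -> C) (V : gKdata R m).
Hypothesis VM : is_gKmodule V.
Variable z : C.
Local Notation N := (normalized n mu).
Hypothesis N1 : N 1%:M = 1.
Hypothesis Nd : forall A : 'M[R]_i,
  is_cderive0 (fun t => N (expm (t *: A))) (z * real_complex R (\tr A)).
Local Notation IV := (Ind le_in mu V).
Local Notation Sf := (@gk_supp _ _ IV).
Local Notation SV := (@gk_supp _ _ V).
Local Notation fn := (gk_amb IV).
Local Notation E r q := (kappa (delta_mx r q)).

Let IM : is_gKmodule IV := ind_gKmodule le_in VM N1 Nd.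
Let KI : is_Kmodule IV := gKmodule_Kmodule IM.
Let sI : subspace Sf. Proof. by case: KI. Qed.
Let sV : subspace SV. Proof. by case: (gKmodule_Kmodule VM). Qed.

(** [ev_kappa] for the translate of [x] by w: conjugation by w turns the condition on the lower left
    block into one on the upper right block, which all lowering operators satisfy. *)
Lemma ev_rot (x : fn) (a : 'M[C]_n) : Sf x -> pkilled x -> J1 *m a *m J2^T = 0 ->
  (KdC (kappa a) x : fn) w = (z * \tr (J2 *m a *m J2^T)) *: (x : fn) w +
    gk_lie (kappa (J1 *m a *m J1^T)) ((x : fn) w).
Proof.
move=> Sx px a0; pose B := W *m a *m W^T; have Kw := rot_K R le_in.
have aE : a = W^T *m B *m W by rewrite /B !mulmxA rotTW mul1mx -mulmxA rotTW mulmx1.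
have Swx : Sf (gk_cpt w x : fn) by case: KI => _ H _; exact: H.
rewrite -cpt_val1 {1}aE -(kappa_rot VM N1 Nd B Sx).
have S1B (p : nat) (A : 'M[C]_(p, n)) : A *m B = A *m W *m a *m W^T by rewrite /B !mulmxA.
rewrite (ev_kappa VM N1 Nd Swx (pkilled_rot VM N1 Nd Sx px)) ?S1B.
  rewrite S1W S2W -!(mulmxA _ W^T) WTS1 WTS2 cpt_val1 //.
by rewrite S2W -(mulmxA _ W^T) WTS1.
Qed.

Section HighestWeightVector.
Variables (lambda : n.-tuple int) (f : fn).
Hypothesis hf : highest_weight_vector lambda f.

Let Sg : Sf f. Proof. by case: hf. Qed.
Let pf : pkilled f. Proof. exact: (hwv_pkilled IM hf). Qed.

Let kcartf (j : 'I_n) : KdC (E j j) f = (tnth lambda j)%:~R *: f.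
Proof.
have [_ _ cf _] := hf.
by rewrite -cf cartanE (lie_KdC IM (LieC_kappa _) Sg).
Qed.

Let kposf (r q : 'I_n) : (r < q)%N -> KdC (E r q) f = 0.
Proof.
by move=> rq; have [Ef _] := hwv_killed hf; rewrite -(lie_KdC IM (LieC_kappa _) Sg) Ef.
Qed.

(* If f vanishes at w then so does everything generated from f by lowering
   operators of k, hence every translate of f. *)
Lemma hwv_ev_neq0 : f w != 0.
Proof.
apply/eqP => fw0; have [_ /eqP f0 _ _] := hf; apply: f0.
have wf : wtv Sf (@kcart R n IV) (wt_of lambda) f.
  by split=> // j; rewrite /kcart cartanE kcartf ffunE.
have sG := Gen_subspace (@kNeg R n IV) f.
have GA : Gen (@kNeg R n IV) f `<=` [set x : fn | [/\ Sf x, pkilled x & x w = 0]].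
  move=> x Gx; apply: (Gx [set x : fn | [/\ Sf x, pkilled x & x w = 0]]); [|by split|].
    split.
      split=> //; first exact: (subspace0 sI).
      by move=> c cT; apply: (linear_on0 sI (lie_linear IM _)); apply: spx_Sp; rewrite ?trmx0.
    move=> a u v [Su pu u0] [Sv pv v0]; split; first exact: sI.2.
      move=> c cT; have cs : spn (spx 0 0 c) by apply: spx_Sp; rewrite ?trmx0.
      by rewrite (lie_linear IM cs a Su Sv) (pu c cT) (pv c cT) scaler0 addr0.
    by rewrite -[LHS]/(a *: u w + v w) u0 v0 scaler0 addr0.
  move=> T y [r [q [qr ->]]] [Sy py y0]; split; first exact: (KdC_in KI (LieC_kappa _) Sy).
    by rewrite -(lie_KdC IM (LieC_kappa _) Sy); exact: (pkilled_kappa IM).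
  rewrite (ev_rot Sy py (J12_delta R le_in (ltnW qr))) y0 scaler0 add0r.
  exact: (linear_on0 sV (lie_linear VM (kappa_Sp _))).
have GK := K_stable KI sG (fun x Gx => (let: And3 Sx _ _ := GA x Gx in Sx)) (kGen_stable KI wf kposf).
apply/funext => k; have [Kk|Kk] := pselect (K k); last exact: (ind_val0 Sg).
have Kw := rot_K R le_in.
(* The value of [f] at k is the value at w of its translate by w^-1 k. *)
have /GA [_ _] := GK _ _ (KinfM (KinfV Kw) Kk) (@Gen_base R fn (@kNeg R n IV) f).
by rewrite cpt_val mulmxA mulmxV ?mul1mx // Kinf_unit.
Qed.

Let lo_lambda : m.-tuple int := [tuple lambda`_k | k < m].

(** An element of gl_(n-i) acts on the value at w as its embedding in the first n - i coordinates
    acts on [f]; the gl_i component of this embedding is zero, so no trace term appears. The first n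
    - i weights survive. *)
Lemma hwv_ev : highest_weight_vector lo_lambda (f w : gk_amb V).
Proof.
have Kw := rot_K R le_in.
have SVw : SV (f w) := ind_valS Sg Kw.
have J21' : J2 *m J1^T = 0 := J21 R le_in.
have ev (a : 'M[C]_m) : gk_lie (kappa a) (f w) = (KdC (kappa (J1^T *m a *m J1)) f : fn) w.
  have a0 : J1 *m (J1^T *m a *m J1) *m J2^T = 0.
    by rewrite -!mulmxA (J12 R le_in) !mulmx0.
  rewrite (ev_rot Sg pf a0) !mulmxA J21' !mul0mx mxtrace0 mulr0 scale0r add0r.
  by rewrite J11 mul1mx -mulmxA J11 mulmx1.
apply: (killed_hwv VM SVw hwv_ev_neq0).
- move=> j; rewrite cartanE ev rowsub_delta kcartf tnth_mktuple (tnth_nth 0) //.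
- move=> r q rq; rewrite ev rowsub_delta kposf //.
- move=> r q; apply: pkilled_pmin.
  have Swf : Sf (gk_cpt w f : fn) by case: KI => _ H _; exact: H.
  by rewrite -cpt_val1; exact: (ev_pkilled VM N1 Nd Swf (pkilled_rot VM N1 Nd Sg pf)).
Qed.

(** A diagonal unit in the last i coordinates has zero component in gl_(n-i) and trace one in gl_i,
    so it acts on the nonzero value at w by [z], and on [f] by an entry of lambda. *)
Lemma hwv_ev_z (j : 'I_i) : z = (tnth lambda (hi j))%:~R.
Proof.
have J12' : J1 *m J2^T = 0 := J12 R le_in.
have a0 : J1 *m (J2^T *m delta_mx j j *m J2) *m J2^T = 0 by rewrite !mulmxA J12' !mul0mx.
have := ev_rot Sg pf a0; rewrite {1}rowsub_delta kcartf !mulmxA J12' !mul0mx.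
rewrite -[kappa 0]/(kappa (0 : 'M[C]_m)) kappa0.
rewrite (linear_on0 (@LieC_Sp_subspace R m) (lie_linear_l VM (ind_valS Sg (rot_K R le_in)))) addr0.
rewrite J22 mul1mx -mulmxA J22 mulmx1.
have -> : \tr (delta_mx j j : 'M[C]_i) = 1.
  rewrite /mxtrace (bigD1 j) //= mxE !eqxx big1 ?addr0 // => k /negbTE kj.
  by rewrite mxE kj.
rewrite mulr1 => e; apply/eqP; rewrite -subr_eq0; apply/negPn/negP => ne.
have := hwv_ev_neq0; apply/negP/negPn/eqP; apply: (scalerI ne); rewrite scaler0 scalerBl.
by rewrite -e -[X in _ - X]/(_ *: f w) subrr.
Qed.

(* The element diag(-1, 1, ..., 1) of GL_i is the value at pi of a one-parameter
   group in the torus of K, which acts on f by the last entries of lambda. *)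
Lemma hwv_ev_sign (j : 'I_i) :
  N (1%:M - 2 *: delta_mx j j) = (- 1) ^ (tnth lambda (hi j)).
Proof.
set l := tnth lambda (hi j).
pose a : 'M[C]_n := iC *: delta_mx (hi j) (hi j).
have [KZ _] := LieC_split (LieC_kappa a).
pose th : 'rV[R]_n := delta_mx 0 (hi j).
have aE : diag_mx (\row_k (Complex 0 (th 0 k))) = a.
  apply/matrixP => r q; rewrite !mxE eqxx /=.
  have [->|rq] := eqVneq r q; last first.
    rewrite mulr0n; case: eqVneq => [e|_] /=; last by rewrite mulr0.
    by rewrite -e eq_sym (negbTE rq) mulr0.
  rewrite mulr1n andbb; case: eqVneq => _; apply/eqP; rewrite eq_complex /=;
    by apply/andP; split; apply/eqP => /=; ring.
have skew : adj a = - a.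
  apply/matrixP => r q; rewrite !mxE andbC; case: (_ && _) => /=;
  by apply/eqP; rewrite eq_complex /=; apply/andP; split; apply/eqP => /=; ring.
have toCa := toC_phi_skew skew.
have ZE : mxRe (kappa a) = phi a by rewrite -toCa mxRe_toC.
rewrite ZE in KZ.
have KdZ : Kd (phi a) f = (iC * l%:~R) *: f.
  rewrite -(KdC_toC KI KZ Sg) toCa /a kappaZ.
  have sK := @LieC_K_subspace R n.
  rewrite (linear_onZ _ sK (KdC_linear_l KI Sg) (LieC_kappa _)) kcartf.
  by rewrite scalerA.
have sT : subspace (setT : set C^o) by [].
(* The pairs (c f, c) form a subspace stable under the product with the flow e^(ilt), which
   integrates the eigenvalue of the generator. *)
have fl := flow_prod (Kd_flow KI KZ) (flow_scalar sT (circle0 R l) (@circleD R l) (circle_derive R l)).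
have := flow_stable fl (A := [set p : (fn * C^o)%type | p.1 = p.2 *: f]).
have sA : subspace [set p : (fn * C^o)%type | p.1 = p.2 *: f].
  split; first by rewrite /= scale0r.
  by move=> b u v /= -> ->; rewrite scalerDl scalerA.
move=> /(_ sA) H.
have exp_f t : gk_cpt (expm (t *: phi a)) f = circle l t *: f.
  have := H _ _ t (f, 1 : C^o); rewrite /= -[circle l t *: (1 : C^o)]/(circle l t * 1) mulr1; apply.
  - by move=> [x y] /= ->; split=> //; exact: (subspaceZ _ sI).
  - move=> [x y] /= ->; rewrite (linear_onZ _ sI (Kd_linear KI KZ) Sg) KdZ !scalerA.
    by congr (_ *: _); rewrite mulrC.
  - by rewrite scale1r.
(* The reflection in coordinate j of the GL_i block; [p] is its image in K. It lies in P, with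
   trivial component in the smaller symplectic group. *)
pose d0 : 'M[R]_n := 1%:M - 2 *: ((selgl R le_in)^T *m delta_mx j j *m selgl R le_in).
have d0T : d0^T = d0 by rewrite /d0 trmxB trmx1 trmxZ !trmx_mul trmxK trmx_delta mulmxA.
have d0q : d0 *m d0 = 1%:M.
  have invol (D : 'M[R]_n) : D *m D = D -> (1%:M - 2 *: D) *m (1%:M - 2 *: D) = 1%:M.
    move=> DD; rewrite mulmxBr !mulmxBl !mulmx1 !mul1mx -scalemxAl -!scalemxAr DD.
    by apply/matrixP => r q; rewrite !mxE; ring.
  apply: invol; rewrite !mulmxA -(mulmxA _ (selgl R le_in)) S11 mulmx1.
  by rewrite -(mulmxA (selgl R le_in)^T (delta_mx j j) (delta_mx j j)) mul_delta_mx.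
pose p := phi (toC d0).
have adjd : adj (toC d0) = toC d0.
  apply: mxC_eq; first by rewrite mxRe_adj mxRe_toC d0T.
  by rewrite mxIm_adj mxIm_toC trmx0 oppr0.
have Kp : K p by apply: Kinf_phi; rewrite adjd -toCM d0q toC1.
have pE : p = block_mx d0 0 0 d0 by rewrite /p /phi mxRe_toC mxIm_toC oppr0.
have Pp : P p.
  apply/(PinP le_in); split; first by case: Kp.
  apply/parabolicE; rewrite pE block_mxKul block_mxKdl mul0mx; split=> //.
  rewrite /d0 mulmxBr mulmx1 mulmxBl S21 -scalemxAr -scalemxAl !mulmxA S21 !mul0mx.
  by rewrite scaler0 subrr.
have glp : gl_part le_in p = 1%:M - 2 *: delta_mx j j.
  rewrite gl_partT pE T1_block /d0 mulmxBr mulmxBl mulmx1 S11 -scalemxAr -scalemxAl.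
  by rewrite !mulmxA S11 mul1mx -mulmxA S11 mulmx1.
have spp : sp_part le_in p = 1%:M.
  rewrite sp_partT pE T2_block !mulmx0 !mul0mx.
  have -> : selsp R le_in *m d0 *m (selsp R le_in)^T = 1%:M.
    by rewrite /d0 mulmxBr mulmxBl mulmx1 S22 -scalemxAr -scalemxAl !mulmxA S21 !mul0mx scaler0 subr0.
  by rewrite -scalar_mx_block.
have Kw := rot_K R le_in; have SVw := ind_valS Sg Kw.
have := ind_equi Sg Pp Kp Kw; rewrite glp spp (cpt1 (gKmodule_Kmodule VM) SVw).
(* At pi the torus element is -1 in coordinate [hi j] and 1 elsewhere; w carries that coordinate to
   the j-th of GL_i. *)
have pw : p *m w = w *m expm (pi *: phi a).
  rewrite -aE expm_diag_phi /p /krot -!phiM; congr phi.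
  have -> : diag_mx (\row_k (Complex (cos (pi * th 0 k)) (sin (pi * th 0 k)))) =
      1%:M - 2 *: delta_mx (hi j) (hi j) :> 'M[C]_n.
    apply/matrixP => r q; rewrite !mxE eqxx /=.
    have [->|rq] := eqVneq r q; last first.
      rewrite !mulr0n; case: eqVneq => [e|_] /=; last by rewrite mulr0 subr0.
      by rewrite -e eq_sym (negbTE rq) mulr0 subr0.
    rewrite !mulr1n andbb; case: eqVneq => _; apply/eqP; rewrite eq_complex /=.
      by rewrite mulr1 cospi sinpi; apply/andP; split; apply/eqP => /=; ring.
    by rewrite mulr0 cos0 sin0; apply/andP; split; apply/eqP => /=; ring.
  have -> : toC d0 = 1%:M - 2 *: (S1^T *m delta_mx j j *m S1) :> 'M[C]_n.
    have toC_rowsub q q' (g : 'I_q -> 'I_q') : toC (rowsub g 1%:M : 'M[R]_(q, q')) = rowsub g 1%:M.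
      by apply/matrixP => r k; rewrite toC_entry !mxE; case: (_ == _).
    rewrite /d0 toCD toCN toC1; congr (_ - _).
    have toCZ2 (A : 'M[R]_n) : toC (2 *: A) = 2 *: toC A by rewrite !scaler_nat !mulr2n toCD.
    have eS : toC (selgl R le_in) = S1 by exact: toC_rowsub.
    have eST : toC (selgl R le_in)^T = S1^T.
      by rewrite -eS; apply/matrixP => r k; rewrite toC_entry [RHS]mxE toC_entry mxE.
    have eD : toC (delta_mx j j : 'M[R]_i) = delta_mx j j.
      by apply/matrixP => r k; rewrite toC_entry [in LHS]mxE [RHS]mxE; case: (_ && _).
    by rewrite toCZ2 !toCM eS eST eD.
  rewrite mulmxBl mulmxBr mul1mx mulmx1 -scalemxAl -scalemxAr; congr (_ - _ *: _).
  have W1 : W *m J2^T = S1^T by rewrite -WTS1 mulmxA rotWT mul1mx.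
  have <- : J2^T *m delta_mx j j *m J2 = delta_mx (hi j) (hi j) by exact: rowsub_delta.
  by rewrite !mulmxA W1 -(mulmxA _ S1) S1W.
rewrite pw -cpt_val exp_f circle_pi => e.
apply/eqP; rewrite -subr_eq0; apply/negPn/negP => ne.
have := hwv_ev_neq0; apply/negP/negPn/eqP; apply: (scalerI ne); rewrite scaler0 scalerBl -e.
by rewrite -[X in X - _]/(_ *: f w) subrr.
Qed.

End HighestWeightVector.

End Evaluation.

Lemma det_reflection (F : comNzRingType) p (j : 'I_p) : \det (1%:M - 2 *: delta_mx j j : 'M[F]_p) = - 1.
Proof.
have -> : 1%:M - 2 *: delta_mx j j = diag_mx (\row_k if k == j then - 1 else 1) :> 'M[F]_p.
  apply/matrixP => r q; rewrite !mxE; have [<-|rq] := eqVneq r q.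
    by rewrite andbb !mulr1n; case: eqP => _ /=; ring.
  rewrite !mulr0n; case: eqVneq => [e|_] /=; last by ring.
  by rewrite -e eq_sym (negbTE rq) /=; ring.
rewrite det_diag (bigD1 j) //= mxE eqxx big1 ?mulr1 // => k /negbTE kj.
by rewrite mxE kj.
Qed.

(** * The module generated by a highest weight vector, and the determination of the inducing data *)

Section Submodules.
Variables (R : realType) (n : nat) (M : gKdata R n).
Hypothesis MM : is_gKmodule M.
Local Notation S := (@gk_supp _ _ M).

Lemma submodule_gKmodule (W : set (gk_amb M)) : submodule W ->
  is_gKmodule (@GKData R n (gk_amb M) W (@gk_lie _ _ M) (@gk_cpt _ _ M)).
Proof.
move=> [WS sW WX Wk]; have [_ [l1 l2 l3] [c1 c2 c3 c4] [k1 k2]] := MM; split.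
- by split.
- split.
  + by move=> X a u v sX Wu Wv; apply: l1 => //; exact: WS.
  + by move=> X Y a v sX sY Wv; apply: l2 => //; exact: WS.
  + by move=> X Y v sX sY Wv; apply: l3 => //; exact: WS.
- split.
  + by move=> k a u v Kk Wu Wv; apply: c1 => //; exact: WS.
  + by move=> v Wv; apply: c2; exact: WS.
  + by move=> k k' v Kk Kk' Wv; apply: c3 => //; exact: WS.
  + by move=> v Wv; apply: c4; exact: WS.
- split.
  + by move=> k X v Kk sX Wv; apply: k1 => //; exact: WS.
  + by move=> X v KX Wv; apply: k2 => //; exact: WS.
Qed.

Lemma generated_submodule (v : gk_amb M) : S v -> @submodule R n M (@gk_supp _ _ (@generated R n M v)).
Proof.
have [sub _ _ _] := MM; have [_ sS lS kS] := sub.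
move=> Sv; have cap (x : gk_amb M) : @gk_supp _ _ (@generated R n M v) x ->
  forall W : set (gk_amb M), submodule W -> W v -> W x by [].
split.
- by move=> x gx; apply: (gx S).
- split; first by move=> W [_ sW _ _] _; exact: (subspace0 sW).
  move=> a x y gx gy W sub' Wv; have [_ sW _ _] := sub'.
  by apply: sW.2; [exact: (gx W)|exact: (gy W)].
- move=> X x sX gx W sub' Wv; have [_ _ WX _] := sub'.
  by apply: WX => //; exact: (gx W).
- move=> k x Kk gx W sub' Wv; have [_ _ _ Wk] := sub'.
  by apply: Wk => //; exact: (gx W).
Qed.

Lemma generated_base (v : gk_amb M) : @gk_supp _ _ (@generated R n M v) v.
Proof. by move=> W _ Wv. Qed.

End Submodules.

Section Main.
Variables (R : realType) (n i : nat) (le_in : (i <= n)%N).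
Local Notation C := R[i].
Local Notation m := (n - i)%N.
Local Notation w := (krot R le_in).
Local Notation hi := (hi_index le_in).
Variables (V : gKdata R m).
Local Notation lo_tuple lambda := [tuple (lambda : n.-tuple int)`_k | k < m].

Lemma lo_hi_eq (lambda nu : n.-tuple int) : lo_tuple nu = lo_tuple lambda ->
  (forall j : 'I_i, tnth nu (hi j) = tnth lambda (hi j)) -> nu = lambda.
Proof.
move=> e h; apply: eq_from_tnth => k; have [km|mk] := ltnP k m.
  have := congr1 (fun t : m.-tuple int => tnth t (Ordinal km)) e.
  by rewrite !tnth_mktuple /= !(tnth_nth 0).
have ki : (k - m < i)%N by have := ltn_ord k; lia.
have -> : k = hi (Ordinal ki) by apply: val_inj => /=; lia.
exact: h.
Qed.

Lemma induced_generated (mu : 'M[R]_i -> C) (z : C) (omega : m.-tuple int) (lambda : n.-tuple int)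
    (f : gk_amb (Ind le_in mu V)) : is_L V omega ->
  normalized n mu 1%:M = 1 ->
  (forall A : 'M[R]_i, is_cderive0 (fun t => normalized n mu (expm (t *: A))) (z * real_complex R (\tr A))) ->
  highest_weight_vector lambda f -> is_L (generated f) lambda.
Proof.
move=> [VM irr _] N1 Nd hf; have IM := ind_gKmodule le_in VM N1 Nd.
have [Sg f0 cf pf] := hf; have Gsub := generated_submodule IM Sg.
have sI : subspace (@gk_supp _ _ (Ind le_in mu V)) by case: (gKmodule_Kmodule IM).
split.
- exact: (submodule_gKmodule IM Gsub).
- split.
    apply/eqP => E; have := @generated_base R n (Ind le_in mu V) f; rewrite E => /eqP.
    by rewrite (negbTE f0).
  move=> W WM; have [WG sW WX Wk] := WM; have [GS _ _ _] := Gsub.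
  have WM' : @submodule _ _ (Ind le_in mu V) W by split=> // x Wx; apply: GS; exact: WG.
  have [[x [Wx x0]]|H] := pselect (exists x, W x /\ x != 0); last first.
    left; apply/seteqP; split=> [x Wx|x ->]; last exact: (subspace0 sW).
    by apply: contrapT => x0; apply: H; exists x; split=> //; apply/eqP.
  right; have WGen : W `<=` Gen (@NegL _ _ (Ind le_in mu V)) f.
    by move=> y Wy; apply: (WG y Wy); [exact: (Gen_submodule IM hf)|exact: Gen_base].
  have [nu [g [hg Wg]]] := submodule_hwv IM hf WM' WGen Wx x0.
  have ef := hwv_ev VM N1 Nd hf; have eg := hwv_ev VM N1 Nd hg.
  have [lo_e [c gE]] := hwv_unique VM irr ef eg.
  (* The first n - i entries are compared in V, and the last i entries of both weights equal [z]. *)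
  have nuE : nu = lambda.
    apply: (lo_hi_eq lo_e) => j; apply: (intr_inj (R := C)).
    by rewrite -(hwv_ev_z VM N1 Nd hf j) -(hwv_ev_z VM N1 Nd hg j).
  (* Otherwise [g - c *: f] is a highest weight vector of weight lambda vanishing at w, against
     [hwv_ev_neq0]. *)
  have gf : g = c *: f.
    apply: contrapT => ne; have [Sh g0 cg pg] := hg.
    have h0 : g - c *: f != 0 by rewrite subr_eq0; apply/eqP.
    have Sd : @gk_supp _ _ (Ind le_in mu V) (g - c *: f).
      by apply: (subspaceB sI) => //; exact: (subspaceZ _ sI).
    have lin X : LieC (@Sp R n) X -> gk_lie X (g - c *: f) =
        gk_lie X g - c *: gk_lie X f :> gk_amb (Ind le_in mu V).
      move=> sX; have ll := lie_linear IM sX.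
      by rewrite (linear_onB sI ll Sh (subspaceZ c sI Sg)) (linear_onZ c sI ll Sg).
    have hd : highest_weight_vector lambda (g - c *: f : gk_amb (Ind le_in mu V)).
      split=> //.
        move=> j; rewrite (lin _ (cartan_Sp R j)) cf cg nuE scalerBr !scalerA.
        by rewrite [c * _]mulrC.
      move=> alpha X pa rX; have [sX _] := rX.
      by rewrite (lin _ sX) (pf _ _ pa rX) (pg _ _ pa rX) scaler0 subrr.
    have /eqP := hwv_ev_neq0 VM N1 Nd hd; apply.
    by rewrite -[LHS]/((g : 'M[R]_(n + n) -> gk_amb V) w - c *: (f : 'M[R]_(n + n) -> gk_amb V) w) gE subrr.
  have [Sh g0 cg pg] := hg.
  have c0 : c != 0 by apply: contraNneq g0 => c0; rewrite gf c0 scale0r.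
  have Wf : W f by rewrite -[f](scalerK c0) -gf; exact: (subspaceZ _ sW).
  by apply/seteqP; split=> // y Gy; exact: (Gy W WM' Wf).
- exists f; split=> //; exact: (@generated_base R n (Ind le_in mu V) f).
Qed.

Lemma induced_weights (i_gt0 : (0 < i)%N) (mu : 'M[R]_i -> C) (omega : m.-tuple int)
    (lambda : n.-tuple int) (f : gk_amb (Ind le_in mu V)) : is_GL_character mu -> is_L V omega ->
  highest_weight_vector lambda f ->
  [/\ forall k : nat, (n - i <= k < n)%N -> lambda`_k = lambda`_n.-1,
      forall a : 'M[R]_i, a \in unitmx ->
        mu a = sgn_abs_det lambda`_n.-1 (exponent R n i lambda`_n.-1) a
    & omega = lo_tuple lambda].
Proof.
move=> mu_char [VM irr [v hv]] hf.
have [chi [muE chi0 chiM [c cd]]] := GL_character_det i_gt0 mu_char.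
have chi1 : chi 1 = 1.
  by apply: (mulfI (chi0 1 (oner_neq0 _))); rewrite -chiM ?oner_neq0 // !mulr1.
have [N1 Nd] := normalized_derive n muE chi1 cd.
set z := real_complex R _ + c in Nd.
(* All the last i entries of lambda equal the one number [z], hence each other; [z] in turn fixes
   the exponent of the character. *)
have zE := hwv_ev_z VM N1 Nd hf.
have last_lt : (i.-1 < i)%N by rewrite prednK.
pose jl : 'I_i := Ordinal last_lt.
have lE : tnth lambda (hi jl) = lambda`_n.-1.
  by rewrite (tnth_nth 0) /=; congr (_`_ _); lia.
have zl : z = (lambda`_n.-1)%:~R by rewrite -lE; exact: zE.
split.
- move=> k /andP [mk kn]; have ki : (k - m < i)%N by lia.
  apply: (intr_inj (R := C)); rewrite -zl (zE (Ordinal ki)) (tnth_nth 0) /=.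
  by congr ((_`_ _)%:~R); lia.
- have cE : c = (lambda`_n.-1)%:~R - real_complex R (((2 * n)%:R - i%:R + 1) / 2).
    by rewrite -zl /z addrC addKr.
  (* The reflection has determinant -1, so its half modulus is 1 and [hwv_ev_sign] gives the value
     of [chi] itself. *)
  have chiN : chi (- 1) = (- 1) ^ lambda`_n.-1.
    have := hwv_ev_sign VM N1 Nd hf jl; rewrite lE => <-.
    rewrite /normalized /half_modulus muE; last first.
      by rewrite unitmxE det_reflection unitrN1.
    by rewrite det_reflection normrN1 powR1 mul1r.
  move=> a ua; rewrite muE //; rewrite cE in cd.
  apply: (character_sgn_abs chiM chi1 cd chiN).
  by move: ua; rewrite unitmxE unitfE.
- by have [] := hwv_unique VM irr (hwv_ev VM N1 Nd hf) hv.
Qed.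

End Main.

Opaque Kd.

(** * Matrix coefficients on K and their derivatives *)

Section SkewLie.
Variables (R : realType) (n : nat).
Local Notation C := R[i].
Local Notation K := (@Kinf R n).

Lemma LieK_phi (u : 'M[C]_n) : adj u = - u -> Lie K (phi u).
Proof.
move=> uu; have [H _] := LieC_split (LieC_kappa u).
by rewrite -(toC_phi_skew uu) mxRe_toC in H.
Qed.

Lemma LieK_skew Z : Lie K Z -> exists2 u : 'M[C]_n, adj u = - u & Z = phi u.
Proof.
move=> /LieKP [/LieSpP SZ ZJ]; have ZE := commJ_phi ZJ; exists (tau Z) => //.
apply: phi_inj; rewrite phi_adj phiN -ZE; apply/eqP; rewrite -addr_eq0; apply/eqP.
have H : (Z^T + Z) *m Jmx R n = 0 by rewrite mulmxDl ZJ SZ.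
have := congr1 (fun A => A *m Jmx R n) H; rewrite /= -mulmxA Jmx_sqr mul0mx mulmxN mulmx1 => /eqP.
by rewrite oppr_eq0 => /eqP.
Qed.

Lemma tauM x k : K x -> K k -> tau (x *m k) = tau x *m tau k.
Proof.
move=> /Kinf_tau [xE _] /Kinf_tau [kE _].
by rewrite {1}xE {1}kE -phiM tau_phi.
Qed.

Lemma tau_entry (x : 'M[R]_(n + n)) r q : tau x r q =
  real_complex R (x (lshift n r) (lshift n q)) - iC R * real_complex R (x (rshift n r) (lshift n q)).
Proof. by rewrite /tau !mxE. Qed.

Lemma tau_expm (u : 'M[C]_n) : adj u = - u -> cmx_derive (fun t => tau (expm (t *: phi u))) u.
Proof.
move=> uu r q; have H := expm_derive0 (phi u).
have H1 := cmx_derive_toC H (lshift n r) (lshift n q).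
have H2 := cderive_scale (- iC R) (cmx_derive_toC H (rshift n r) (lshift n q)).
apply: (cderive_eq (cderive_add H1 H2)) => [t|]; rewrite ?tau_entry !toC_entry mulNr //.
by rewrite -tau_entry tau_phi.
Qed.

End SkewLie.

Section FunctionsOnK.
Variables (R : realType) (n : nat).
Local Notation C := R[i].
Local Notation K := (@Kinf R n).
Implicit Types (x k : 'M[R]_(n + n)) (h : 'M[R]_(n + n) -> C) (u a : 'M[C]_n).

(** Functions on K under right translation, with full support so that K-finiteness can be expressed
    before the K-finite functions are singled out. The Lie algebra k acts on them by differentiating
    translation. *)
Definition Kfun_ambient : gKdata R n := @GKData R n ('M[R]_(n + n) -> C^o : lmodType C) setT
  (fun _ => id) (fun k phi x => phi (x *m k)).

Definition Kfun : gKdata R n := @GKData R n (gk_amb Kfun_ambient)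
  [set phi | (forall k, ~ K k -> phi k = 0) /\ @K_finite R n Kfun_ambient phi]
  (fun _ => id) (fun k phi x => phi (x *m k)).

Lemma Kfun_Kmodule : is_Kmodule Kfun.
Proof.
have cl k (a : C) (u v : gk_amb Kfun) : gk_cpt k (a *: u + v) = a *: gk_cpt k u + gk_cpt k v by [].
split.
- split; first by split=> //; exact: (@K_finite0 _ _ Kfun_ambient).
  move=> a u v [u0 Ku] [v0 Kv]; split; last exact: (@K_finite_comb _ _ Kfun_ambient).
  by move=> k Kk; change (a *: u k + v k = 0); rewrite u0 // v0 // scaler0 addr0.
- move=> k v Kk [v0 Kv]; split.
    move=> l Kl; apply: v0 => Klk; apply: Kl.
    by rewrite -[l](mulmxK (Kinf_unit Kk)); apply: (KinfM Klk (KinfV Kk)).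
  apply: (@K_finite_cpt _ _ Kfun_ambient) => // l Kl.
  by apply/funext => x; change (v (x *m l *m k) = v (x *m (l *m k))); rewrite mulmxA.
split=> //.
- by move=> v Sv; apply/funext => x; change (v (x *m 1%:M) = v x); rewrite mulmx1.
- move=> k k' v Kk Kk' Sv; apply/funext => x.
  by change (v (x *m (k *m k')) = v (x *m k *m k')); rewrite mulmxA.
- by move=> v [].
Qed.

Let KF := Kfun_Kmodule.

Definition extK h : gk_amb Kfun := fun x => if `[< K x >] then h x else 0.

Lemma extKE h x : K x -> extK h x = h x.
Proof. by move=> Kx; rewrite /extK asboolT. Qed.

(** Right translates stay in a finite span with continuous coefficients. In this form closure under
    sums and products is direct, and [mat_coef_supp] turns such functions into elements of
    [Kfun]. *)
Definition mat_coef h := exists (J : finType) (e c : J -> 'M[R]_(n + n) -> C),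
  (forall j, ccontinuous_on K (c j)) /\
  forall x k, K x -> K k -> h (x *m k) = \sum_j c j k * e j x.

Lemma mat_coef_const (b : C) : mat_coef (fun=> b).
Proof.
exists unit, (fun _ _ => b), (fun _ _ => 1); split=> [j|x k _ _]; first exact: ccont_cst.
by rewrite big_const card_unit /= mul1r addr0.
Qed.

Lemma mat_coef_add h1 h2 : mat_coef h1 -> mat_coef h2 -> mat_coef (fun x => h1 x + h2 x).
Proof.
move=> [J1 [e1 [c1 [cc1 E1]]]] [J2 [e2 [c2 [cc2 E2]]]].
exists (J1 + J2)%type, (fun j => match j with inl p => e1 p | inr q => e2 q end),
  (fun j => match j with inl p => c1 p | inr q => c2 q end); split; first by case.
by move=> x k Kx Kk; rewrite E1 // E2 // big_sumType.
Qed.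

Lemma mat_coef_mul h1 h2 : mat_coef h1 -> mat_coef h2 -> mat_coef (fun x => h1 x * h2 x).
Proof.
move=> [J1 [e1 [c1 [cc1 E1]]]] [J2 [e2 [c2 [cc2 E2]]]].
exists (J1 * J2)%type, (fun j x => e1 j.1 x * e2 j.2 x), (fun j x => c1 j.1 x * c2 j.2 x); split.
  by move=> j; exact: ccont_mul.
move=> x k Kx Kk; rewrite E1 // E2 // big_distrl /=.
rewrite -(pair_bigA _ (fun p q => c1 p k * c2 q k * (e1 p x * e2 q x))); apply: eq_bigr => p _.
by rewrite big_distrr; apply: eq_bigr => q _ /=; rewrite mulrACA.
Qed.

Lemma mat_coef_sum (I : Type) (s : seq I) (F : I -> 'M[R]_(n + n) -> C) :
  (forall j, mat_coef (F j)) -> mat_coef (fun x => \sum_(j <- s) F j x).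
Proof.
move=> Fm; elim: s => [|j s IH].
  by rewrite (_ : (fun _ => _) = fun=> 0); [exact: mat_coef_const|apply/funext => x; rewrite big_nil].
rewrite (_ : (fun _ => _) = fun x => F j x + \sum_(j <- s) F j x); first exact: mat_coef_add.
by apply/funext => x; rewrite big_cons.
Qed.

Lemma mat_coef_prod (I : Type) (s : seq I) (F : I -> 'M[R]_(n + n) -> C) :
  (forall j, mat_coef (F j)) -> mat_coef (fun x => \prod_(j <- s) F j x).
Proof.
move=> Fm; elim: s => [|j s IH].
  by rewrite (_ : (fun _ => _) = fun=> 1); [exact: mat_coef_const|apply/funext => x; rewrite big_nil].
rewrite (_ : (fun _ => _) = fun x => F j x * \prod_(j <- s) F j x); first exact: mat_coef_mul.
by apply/funext => x; rewrite big_cons.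
Qed.

Lemma mat_coef_exp h d : mat_coef h -> mat_coef (fun x => h x ^+ d).
Proof.
move=> hm; elim: d => [|d IH]; first exact: mat_coef_const.
rewrite (_ : (fun _ => _) = fun x => h x * h x ^+ d); first exact: mat_coef_mul.
by apply/funext => x; rewrite exprS.
Qed.

Lemma mat_coef_conj h : mat_coef h -> mat_coef (fun x => conjc (h x)).
Proof.
move=> [J [e [c [cc E]]]]; exists J, (fun j x => conjc (e j x)), (fun j k => conjc (c j k)); split.
  by move=> j; exact: ccont_conj.
move=> x k Kx Kk; rewrite E // raddf_sum; apply: eq_bigr => j _.
by rewrite /= rmorphM.
Qed.

Lemma ccont_entry r q : ccontinuous_on K (fun x => tau x r q).
Proof.
have ent p s : ccontinuous_on K (fun x => real_complex R (x p s)).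
  split; first by apply: continuous_subspaceT => x; exact: coord_continuous.
  by apply: (within_eq (@within_cst R _ K 0)) => x _.
apply: (ccont_eq (ccont_add (ent (lshift n r) (lshift n q))
  (ccont_mul (ccont_cst K (- iC R)) (ent (rshift n r) (lshift n q))))) => x _.
by rewrite tau_entry mulNr.
Qed.

Lemma mat_coef_entry r q : mat_coef (fun x => tau x r q).
Proof.
exists 'I_n, (fun p x => tau x r p), (fun p k => tau k p q); split=> [p|x k Kx Kk].
  exact: ccont_entry.
by rewrite tauM // mxE; apply: eq_bigr => p _; rewrite mulrC.
Qed.

Lemma mat_coef_det p (Q : 'M[C]_(n, p)) : mat_coef (fun x => \det (Q^T *m tau x *m Q)).
Proof.
have ent r q : mat_coef (fun x => (Q^T *m tau x *m Q) r q).
  rewrite (_ : (fun _ => _) = fun x => \sum_k (\sum_l Q^T r l * tau x l k) * Q k q).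
    apply: mat_coef_sum => k; apply: mat_coef_mul; last exact: mat_coef_const.
    by apply: mat_coef_sum => l; apply: mat_coef_mul; [exact: mat_coef_const|exact: mat_coef_entry].
  by apply/funext => x; rewrite mxE; apply: eq_bigr => k _; rewrite mxE.
rewrite /determinant; apply: mat_coef_sum => s; apply: mat_coef_mul; first exact: mat_coef_const.
exact: mat_coef_prod.
Qed.

Lemma mat_coef_supp h : mat_coef h -> @gk_supp _ _ Kfun (extK h).
Proof.
move=> [J [e [c [cc E]]]]; split; first by move=> k Kk; rewrite /extK asboolF.
apply: (@K_finite_fin R n Kfun_ambient J (fun j => extK (e j)) c) => // k Kk; apply/funext => x.
have sE (r : seq J) : (\sum_(j <- r) c j k *: extK (e j) : gk_amb Kfun) x = \sum_(j <- r) c j k * extK (e j) x.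
  elim: r => [|j r IH]; first by rewrite !big_nil.
  by rewrite !big_cons -IH.
rewrite sE; change (extK h (x *m k) = \sum_j c j k * extK (e j) x).
have [Kx|Kx] := pselect (K x).
  by rewrite extKE ?E //; [apply: eq_bigr => j _; rewrite extKE|exact: KinfM].
rewrite /extK asboolF; last first.
  by move=> Kxk; apply: Kx; rewrite -[x](mulmxK (Kinf_unit Kk)); exact: (KinfM Kxk (KinfV Kk)).
by rewrite big1 // => j _; rewrite asboolF // mulr0.
Qed.

(** [D x u] is the derivative at x along a skew-Hermitian [u], extended complex-linearly to gl_n.
    The property [eig] below then expresses an eigenfunction of a complex element of k, and
    eigenvalues add under products by the Leibniz rule. *)
Definition has_diff h (D : 'M[R]_(n + n) -> 'M[C]_n -> C) :=
  (forall x u, K x -> adj u = - u -> is_cderive0 (fun t => h (x *m expm (t *: phi u))) (D x u)) /\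
  (forall x (b : C) u v, D x (b *: u + v) = b * D x u + D x v).

Definition eig h a (c : C) := exists2 D, has_diff h D & forall x, K x -> D x a = c * h x.

Lemma eig_one a : eig (fun=> 1) a 0.
Proof.
exists (fun _ _ => 0) => [|x _]; last by rewrite mul0r.
by split=> [x u _ _|x b u v]; [exact: cderive_const|rewrite mulr0 addr0].
Qed.

Lemma eig_mul h1 h2 a c1 c2 : eig h1 a c1 -> eig h2 a c2 -> eig (fun x => h1 x * h2 x) a (c1 + c2).
Proof.
move=> [D1 [d1 l1] e1] [D2 [d2 l2] e2].
exists (fun x u => D1 x u * h2 x + h1 x * D2 x u) => [|x Kx].
  split=> [x u Kx uu|x b u v].
    apply: (cderive_eq (cderive_mul (d1 x u Kx uu) (d2 x u Kx uu))) => //.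
    by rewrite scale0r expm0 mulmx1.
  by rewrite l1 l2; ring.
by rewrite e1 // e2 //; ring.
Qed.

Lemma eig_exp h a c d : eig h a c -> eig (fun x => h x ^+ d) a (d%:R * c).
Proof.
move=> hc; elim: d => [|d IH].
  by rewrite mul0r; exact: eig_one.
rewrite (_ : (fun _ => _) = fun x => h x * h x ^+ d); last by apply/funext => x; rewrite exprS.
by rewrite -addn1 natrD mulrDl mul1r addrC; exact: eig_mul.
Qed.

Lemma eig_prod (I : Type) (s : seq I) (F : I -> 'M[R]_(n + n) -> C) a (c : I -> C) :
  (forall j, eig (F j) a (c j)) -> eig (fun x => \prod_(j <- s) F j x) a (\sum_(j <- s) c j).
Proof.
move=> Fe; elim: s => [|j s IH].
  by rewrite big_nil (_ : (fun _ => _) = fun=> 1); [exact: eig_one|apply/funext => x; rewrite big_nil].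
rewrite big_cons (_ : (fun _ => _) = fun x => F j x * \prod_(j <- s) F j x); first exact: eig_mul.
by apply/funext => x; rewrite big_cons.
Qed.

(** When [a] preserves the column space of [Q], Jacobi's formula reads tr(adj(B) B a') = det(B)
    tr(a'), where B is the matrix under the determinant. *)
Lemma eig_det p (Q : 'M[C]_(n, p)) a (a' : 'M[C]_p) : a *m Q = Q *m a' ->
  eig (fun x => \det (Q^T *m tau x *m Q)) a (\tr a').
Proof.
move=> aQ; exists (fun x u => \tr (\adj (Q^T *m tau x *m Q) *m (Q^T *m tau x *m u *m Q))).
  split=> [x u Kx uu|x b u v]; last first.
    move: (Q^T *m tau x) => B; rewrite mulmxDr mulmxDl -scalemxAr -scalemxAl mulmxDr -scalemxAr.
    by rewrite mxtraceD mxtraceZ.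
  have Ke t := Kinf_expm t (LieK_phi uu).
  have d := cmx_derive_mul (cmx_derive_mul (cmx_derive_const (Q^T *m tau x)) (tau_expm uu)) (cmx_derive_const Q).
  apply: (cderive_eq (cderive_det d)) => [t|]; first by rewrite (tauM Kx (Ke t)) !mulmxA.
  rewrite scale0r expm0 -phi1 tau_phi mul0mx add0r mulmx0 addr0 mulmx1 //.
move=> x Kx; rewrite -(mulmxA _ a) aQ.
have -> : \adj (Q^T *m tau x *m Q) *m (Q^T *m tau x *m (Q *m a')) =
    (\adj (Q^T *m tau x *m Q) *m (Q^T *m tau x *m Q)) *m a' by rewrite !mulmxA.
by rewrite mul_adj_mx mul_scalar_mx mxtraceZ mulrC.
Qed.

(** The determinant has modulus one on K, so negative powers are powers of the conjugate, which
    keeps them among matrix coefficients. *)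
Definition det_power (l : int) x : C := if l is Posz d then \det (tau x) ^+ d else conjc (\det (tau x)) ^+ `|l|.

Lemma eig_det_power l a : eig (det_power l) a (l%:~R * \tr a).
Proof.
have det1 : eig (fun x => \det (tau x)) a (\tr a).
  have := @eig_det n 1%:M a a; rewrite mulmx1 mul1mx => /(_ erefl).
  by rewrite (_ : (fun _ => _) = fun x => \det (tau x)) //; apply/funext => x; rewrite trmx1 mul1mx mulmx1.
case: l => d; first exact: (eig_exp d det1).
have conj1 : eig (fun x => conjc (\det (tau x))) a (- \tr a).
  exists (fun x u => - \tr u * conjc (\det (tau x))) => [|//].
  split=> [x u Kx uu|x b u v]; last by rewrite mxtraceD mxtraceZ; ring.
  have Ke t := Kinf_expm t (LieK_phi uu).
  have d1 := cmx_derive_mul (cmx_derive_const (tau x)) (tau_expm uu).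
  have dd := cderive_det d1.
  have cconj (c : R -> C) e : is_cderive0 c e -> is_cderive0 (fun t => conjc (c t)) (conjc e).
    case=> cr ci; split.
      by apply: (is_derive_fun_eq cr) => [t|]; [case: (c t)|case: (e)].
    by apply: (is_derive_fun_eq (is_derive_opp ci)) => [t|]; [case: (c t)|case: (e)].
  apply: (cderive_eq (cconj _ _ dd)) => [t|]; first by rewrite (tauM Kx (Ke t)).
  rewrite scale0r expm0 -phi1 tau_phi mul0mx add0r mulmx1 mulmxA mul_adj_mx mul_scalar_mx mxtraceZ.
  have tru : conjc (\tr u) = - \tr u.
    have := congr1 mxtrace uu; rewrite raddfN => <-; rewrite /mxtrace raddf_sum.
    by apply: eq_bigr => r _; rewrite !mxE.
  have conjM (p q : C) : conjc (p * q) = conjc p * conjc q by exact: rmorphM.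
  by rewrite conjM tru mulrC.
have := eig_exp d.+1 conj1; rewrite mulrN -mulNr.
by rewrite NegzE rmorphN.
Qed.

Lemma vderive_regular (g : R -> C^o) d : is_vderive0 g d -> is_cderive0 g d.
Proof.
move=> [p [e [c [c' [gE cd ->]]]]].
apply: (cderive_eq (cderive_sum (index_enum 'I_p) xpredT (fun j => cderive_scale (e j) (cd j)))) => [t|].
  by rewrite gE; apply: eq_bigr => j _; rewrite mulrC.
by apply: eq_bigr => j _; rewrite mulrC.
Qed.

(** A complex matrix is u1 + i u2 with both parts skew-Hermitian, so the complexified action is read
    from real derivatives along K. *)
Lemma KdC_eig h a c : mat_coef h -> eig h a c ->
  KdC (kappa a) (extK h) = c *: extK h :> gk_amb Kfun.
Proof.
move=> hm [D [Dd Dl] De]; have Sh := mat_coef_supp hm.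
have [Kr Ki] := LieC_split (LieC_kappa a).
have [u1 s1 E1] := LieK_skew Kr; have [u2 s2 E2] := LieK_skew Ki.
have aE : a = iC R *: u2 + u1.
  have := mxC_split (kappa a); rewrite E1 E2 (toC_phi_skew s1) (toC_phi_skew s2) -kappaZ -kappaD.
  by move=> /spx_inj [-> _ _]; rewrite addrC.
have [sF _ _] := KF.
apply/funext => x; rewrite -[RHS]/(c * extK h x).
have SK : @gk_supp _ _ Kfun (KdC (kappa a) (extK h)) by exact: (KdC_in KF (LieC_kappa a) Sh).
have [Kx|Kx] := pselect (K x); last first.
  by case: SK => H _; rewrite (H x Kx) /extK asboolF // mulr0.
have KdE u : adj u = - u -> (Kd (phi u) (extK h) : gk_amb Kfun) x = D x u.
  move=> uu; have KZ := LieK_phi uu.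
  have ev_lin : linear_on (setT : set (gk_amb Kfun)) (fun g : gk_amb Kfun => g x : C^o) by [].
  have := vderive_linear (conj I (fun _ _ _ _ _ => I)) ev_lin (fun=> I) (Kd_derive KF KZ Sh).
  move=> /vderive_regular H; apply: (cderive_unique H); apply: (cderive_eq (Dd x u Kx uu)) => // t.
  change (h (x *m expm (t *: phi u)) = extK h (x *m expm (t *: phi u))).
  by rewrite extKE //; apply: (KinfM Kx); exact: Kinf_expm.
have -> : KdC (kappa a) (extK h) = Kd (phi u1) (extK h) + iC R *: Kd (phi u2) (extK h) :> gk_amb Kfun.
  by rewrite -E1 -E2 -KdCE.
rewrite -[LHS]/((Kd (phi u1) (extK h) : gk_amb Kfun) x + iC R * (Kd (phi u2) (extK h) : gk_amb Kfun) x).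
by rewrite (KdE _ s1) (KdE _ s2) addrC -Dl -aE (De x Kx) extKE.
Qed.

End FunctionsOnK.

(** * The highest weight function on K *)

Section HighestWeightFunction.
Variables (R : realType) (n i : nat) (i_gt0 : (0 < i)%N) (le_in : (i <= n)%N).
Local Notation C := R[i].
Local Notation m := (n - i)%N.
Local Notation J2 := (rotJ2 R le_in).
Local Notation E r q := (kappa (delta_mx r q : 'M[C]_n)).
Variables (lambda : n.-tuple int) (dom : dominant lambda).
Hypothesis flat : forall k : nat, (m <= k < n)%N -> lambda`_k = lambda`_n.-1.

Definition flag (j : nat) : 'M[C]_(n, j.+1) := \matrix_(r, k) (r == k :> nat)%:R.

Definition gap (j : nat) : nat := absz (lambda`_j - lambda`_j.+1)%R.

(** The determinant under [flag j] is the leading principal minor of size j + 1, and the exponents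
    are the gaps of lambda, so that weights telescope. Minors of sizes n - i + 1 to n - 1 would
    carry the exponent 0, as the last i entries of lambda agree; size n is the determinant
    factor. *)
Definition hw_fun (x : 'M[R]_(n + n)) : C :=
  det_power lambda`_n.-1 x * \prod_(j < m) \det ((flag j)^T *m tau x *m flag j) ^+ gap j.

Lemma flag_mul p (A : 'M[C]_(p, n)) j r (k : 'I_j.+1) (kn : (k < n)%N) :
  (A *m flag j) r k = A r (Ordinal kn).
Proof.
rewrite mxE (bigD1 (Ordinal kn)) //= mxE eqxx mulr1 big1 ?addr0 // => l lk.
rewrite mxE (_ : (l == k :> nat) = false) ?mulr0 //.
by apply/negbTE; apply: contraNneq lk => e; apply/eqP; apply: val_inj.
Qed.

Lemma flag_stable (a : 'M[C]_n) j : (j < n)%N ->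
  (forall r q : 'I_n, (q <= j)%N -> (j < r)%N -> a r q = 0) ->
  a *m flag j = flag j *m ((flag j)^T *m a *m flag j).
Proof.
move=> jn a0; apply/matrixP => r k.
have kn : (k < n)%N by have := ltn_ord k; lia.
rewrite (flag_mul a r kn) -mulmxA mulmxA.
have FF (B : 'M[C]_(n, j.+1)) : (flag j *m (flag j)^T *m B) r k = if (r <= j)%N then B r k else 0.
  rewrite -mulmxA mxE; have [rj|jr] := leqP r j; last first.
    rewrite big1 // => l _; rewrite mxE (_ : (r == l :> nat) = false) ?mul0r //.
    by apply/negbTE; have := ltn_ord l; lia.
  have rj1 : (r < j.+1)%N by [].
  rewrite (bigD1 (Ordinal rj1)) //= mxE eqxx mul1r big1 ?addr0 => [|l lr].
    rewrite mxE (bigD1 r) //= 2!mxE eqxx mul1r big1 ?addr0 // => l lr.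
    by rewrite 2!mxE (_ : (l == r :> nat) = false) ?mul0r //; exact/negbTE/lr.
  rewrite mxE (_ : (r == l :> nat) = false) ?mul0r //.
  by apply/negbTE; apply: contraNneq lr => e; apply/eqP; apply: val_inj.
rewrite FF (flag_mul a r kn); case: leqP => // jr; apply: a0 => //=.
by have := ltn_ord k; lia.
Qed.

Lemma flag_trace (a : 'M[C]_n) j : (j < n)%N ->
  \tr ((flag j)^T *m a *m flag j) = \sum_(k < n | (k <= j)%N) a k k.
Proof.
move=> jn; rewrite mxtrace_mulC mulmxA.
have FF : flag j *m (flag j)^T = diag_mx (\row_k (k <= j)%:R) :> 'M[C]_n.
  apply/matrixP => r q; rewrite !mxE; have [rj|jr] := leqP r j; last first.
    rewrite mul0rn big1 // => l _; rewrite mxE (_ : (r == l :> nat) = false) ?mul0r //.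
    by apply/negbTE; have := ltn_ord l; lia.
  have rj1 : (r < j.+1)%N by [].
  rewrite (bigD1 (Ordinal rj1)) //= 3!mxE eqxx mul1r big1 ?addr0 => [|l lr]; first by rewrite eq_sym.
  rewrite mxE (_ : (r == l :> nat) = false) ?mul0r //.
  by apply/negbTE; apply: contraNneq lr => e; apply/eqP; apply: val_inj.
rewrite FF /mxtrace [RHS]big_mkcond; apply: eq_bigr => k _.
by rewrite mul_diag_mx mxE mxE; case: leqP => _; rewrite ?mul1r ?mul0r.
Qed.

(** The hypothesis says that [a] preserves the first n - i steps of the standard flag. It covers
    upper triangular matrices and also all of gl_i placed in the last i coordinates, which therefore
    acts through l times the trace. *)
Lemma eig_hw_fun (a : 'M[C]_n) : (forall (j : nat) (r q : 'I_n), (j < m)%N -> (q <= j)%N -> (j < r)%N -> a r q = 0) ->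
  eig hw_fun a ((lambda`_n.-1)%:~R * \tr a + \sum_(j < m) (gap j)%:R * \sum_(k < n | (k <= j)%N) a k k).
Proof.
move=> a0; apply: eig_mul; first exact: eig_det_power.
apply: eig_prod => j; apply: eig_exp.
have jn : (j < n)%N by have := ltn_ord j; lia.
rewrite -(flag_trace a jn); apply: eig_det; apply: (flag_stable jn) => r q qj jr.
exact: (a0 j r q (ltn_ord j)).
Qed.

Lemma mat_coef_hw_fun : mat_coef hw_fun.
Proof.
have d : mat_coef (fun x : 'M[R]_(n + n) => \det (tau x)).
  have := @mat_coef_det R n n 1%:M.
  by rewrite (_ : (fun _ => _) = (fun x : 'M[R]_(n + n) => \det (tau x))) //; apply/funext => x; rewrite trmx1 mul1mx mulmx1.
apply: mat_coef_mul; last by apply: mat_coef_prod => j; apply: mat_coef_exp; exact: mat_coef_det.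
by rewrite /det_power; case: (lambda`_n.-1) => k; apply: mat_coef_exp => //; exact: mat_coef_conj.
Qed.

Lemma hw_fun1 : hw_fun 1%:M = 1.
Proof.
have t1 : tau (1%:M : 'M[R]_(n + n)) = 1%:M by rewrite -phi1 tau_phi.
rewrite /hw_fun /det_power t1 det1 big1 ?mulr1 => [|j _].
  by case: (lambda`_n.-1) => k; rewrite ?rmorph1 expr1n.
have jn : (j < n)%N by have := ltn_ord j; lia.
rewrite mulmx1 (_ : (flag j)^T *m flag j = 1%:M) ?det1 ?expr1n //.
apply/matrixP => r k; have kn : (k < n)%N by have := ltn_ord k; lia.
by rewrite (flag_mul _ r kn) !mxE /= eq_sym -val_eqE.
Qed.

Lemma gap_sum (r : 'I_n) :
  \sum_(j < m | (r <= j)%N) (gap j)%:Z = if (r < m)%N then lambda`_r - lambda`_n.-1 else 0.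
Proof.
have gE (j : nat) : (j < m)%N -> (gap j)%:Z = lambda`_j - lambda`_j.+1.
  by move=> jm; rewrite /gap gez0_abs // subr_ge0; apply: dom; lia.
have [rm|mr] := ltnP r m; last first.
  by rewrite big_pred0 // => j; apply/negbTE; have := ltn_ord j; lia.
have -> : \sum_(j < m | (r <= j)%N) (gap j)%:Z = \sum_(r <= j < m) (gap j)%:Z.
  rewrite -(@big_mkord _ _ _ m (fun j => (r <= j)%N) (fun j => (gap j)%:Z)).
  rewrite (@big_cat_nat _ _ _ r 0 m) //=; last exact: ltnW.
  rewrite big_nat_cond big_pred0 ?add0r => [|j]; last by lia.
  by rewrite big_nat_cond [RHS]big_nat_cond; apply: eq_bigl => j; lia.
rewrite (eq_big_nat _ _ (F2 := fun j => lambda`_j - lambda`_j.+1)); last first.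
  by move=> j /andP [_ jm]; exact: gE.
rewrite (eq_bigr (fun j => - (lambda`_j.+1 - lambda`_j))); last by move=> j _; rewrite opprB.
rewrite sumrN (telescope_sumr (fun j => lambda`_j) (ltnW rm)) opprB.
by rewrite (flat (k := m)) //; lia.
Qed.

Lemma exists_hw_fun : exists psi : gk_amb (Kfun R n),
  [/\ @gk_supp _ _ (Kfun R n) psi, psi != 0,
      forall r, KdC (E r r) psi = (tnth lambda r)%:~R *: psi,
      forall r q : 'I_n, (r < q)%N -> KdC (E r q) psi = 0
    & forall A : 'M[C]_i, KdC (kappa (J2^T *m A *m J2)) psi = ((lambda`_n.-1)%:~R * \tr A) *: psi].
Proof.
have hm := mat_coef_hw_fun; exists (extK hw_fun); split.
- exact: mat_coef_supp.
- apply/eqP => /(congr1 (fun g : gk_amb (Kfun R n) => g 1%:M)).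
  rewrite extKE ?hw_fun1; last exact: Kinf1.
  by move/eqP; rewrite -[X in _ == X]/(0 : C) oner_eq0.
- move=> r; have [|D dD e] := eig_hw_fun (a := delta_mx r r).
    move=> j p q jm qj jp; rewrite mxE; case: eqVneq => [pr|//]; case: eqVneq => [qr|//].
    by exfalso; move: qj jp; rewrite pr qr; lia.
  rewrite (KdC_eig hm (ex_intro2 _ _ D dD e)); congr (_ *: _).
  have tr1 : \tr (delta_mx r r : 'M[C]_n) = 1.
    rewrite /mxtrace (bigD1 r) //= mxE !eqxx big1 ?addr0 // => k /negbTE kr.
    by rewrite mxE kr.
  rewrite tr1 mulr1 (tnth_nth 0).
  have -> : \sum_(j < m) (gap j)%:R * (\sum_(k < n | (k <= j)%N) (delta_mx r r : 'M[C]_n) k k) =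
      (\sum_(j < m | (r <= j)%N) (gap j)%:Z)%:~R.
    rewrite rmorph_sum [RHS]big_mkcond; apply: eq_bigr => j _.
    have [rj|jr] := leqP r j.
      rewrite (bigD1 r) //= mxE !eqxx big1 ?addr0 ?mulr1 // => k /andP [_ /negbTE kr].
      by rewrite mxE kr.
    rewrite big1 ?mulr0 // => k kj; rewrite mxE andbb; case: eqVneq => // kr.
    by exfalso; move: kj jr; rewrite kr; lia.
  rewrite gap_sum -rmorphD /=; congr (_%:~R); case: ltnP => rm; first by rewrite addrC subrK.
  by rewrite addr0 (flat (k := r)) // rm ltn_ord.
- move=> r q rq; have [|D dD e] := eig_hw_fun (a := delta_mx r q).
    move=> j p s jm sj jp; rewrite mxE; case: eqVneq => [pr|//]; case: eqVneq => [qr|//].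
    by exfalso; move: sj jp; rewrite pr qr; lia.
  rewrite (KdC_eig hm (ex_intro2 _ _ D dD e)).
  have diag0 (k : 'I_n) : (delta_mx r q : 'M[C]_n) k k = 0.
    rewrite mxE; case: eqVneq => [->|//]; case: eqVneq => // rq'.
    by move: rq; rewrite rq' ltnn.
  rewrite /mxtrace big1 ?mulr0 ?add0r => [|k _]; last exact: diag0.
  by rewrite big1 ?scale0r // => j _; rewrite big1 ?mulr0 // => k _; exact: diag0.
- move=> A; have col0 (r q : 'I_n) : (q < m)%N -> (J2^T *m A *m J2) r q = 0.
    move=> qm; rewrite mxE big1 // => l _; rewrite [X in _ * X]mxE [X in _ * X]mxE -val_eqE /=.
    by rewrite (_ : (_ == _) = false) ?mulr0 //; apply/negbTE; lia.
  have [|D dD e] := eig_hw_fun (a := J2^T *m A *m J2).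
    by move=> j r q jm qj jr; apply: col0; lia.
  rewrite (KdC_eig hm (ex_intro2 _ _ D dD e)).
  rewrite -mulmxA mxtrace_mulC -mulmxA J22 mulmx1 mulmxA.
  rewrite [\sum_(j < m) _]big1 ?addr0 // => j _; rewrite big1 ?mulr0 // => k kj; apply: col0.
  by have := ltn_ord j; lia.
Qed.

End HighestWeightFunction.

(** * The graph of Ev on the K-module generated by the highest weight function *)

Section WeightSpaces.
Variables (R : realType) (n : nat) (V : lmodType R[i]) (S : set V) (cart : 'I_n -> V -> V).
Hypotheses (sS : subspace S) (cart_lin : forall j, linear_on S (cart j)).
Implicit Types (chi : {ffun 'I_n -> int}) (P Q : {ffun 'I_n -> int} -> Prop).

Lemma WS_disjoint P Q x : (forall chi, P chi -> ~ Q chi) -> WS S cart P x -> WS S cart Q x -> x = 0.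
Proof.
move=> PQ Px Qx; apply/eqP/negPn/negP => x0.
have cQ : cart_stable cart (WS S cart Q).
  move=> j y [k Wy]; exists k; rewrite -[cart j y]subr0 -(scale0r y).
  exact: (WSn_shift sS cart_lin j 0 Wy).
have [chi [y [Pc wy y0 Qy]]] := weight_component sS cart_lin (WS_subspace sS cart_lin Q) cQ Qx x0 Px.
by move/eqP: y0; apply; exact: (wtv_WS_eq0 sS cart_lin wy (PQ _ Pc) Qy).
Qed.

End WeightSpaces.

Section RotatedBlocks.
Variables (R : realType) (n i : nat) (le_in : (i <= n)%N).
Local Notation C := R[i].
Local Notation m := (n - i)%N.
Local Notation J1 := (rotJ1 R n i).
Local Notation J2 := (rotJ2 R le_in).

Lemma J1_col p (A : 'M[C]_(p, m)) r (q : 'I_n) : (m <= q)%N -> (A *m J1) r q = 0.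
Proof.
move=> mq; rewrite mxE big1 // => l _; rewrite [X in _ * X]mxE [X in _ * X]mxE -val_eqE /=.
by rewrite (_ : (_ == _) = false) ?mulr0 //; apply/negbTE; have := ltn_ord l; lia.
Qed.

Lemma J2_col p (A : 'M[C]_(p, i)) r (q : 'I_n) : (q < m)%N -> (A *m J2) r q = 0.
Proof.
move=> qm; rewrite mxE big1 // => l _; rewrite [X in _ * X]mxE [X in _ * X]mxE -val_eqE /=.
by rewrite (_ : (_ == _) = false) ?mulr0 //; apply/negbTE; lia.
Qed.

Lemma J2_row p (A : 'M[C]_(i, p)) (r : 'I_n) q : (r < m)%N -> (J2^T *m A) r q = 0.
Proof. by move=> mr; rewrite -[J2^T *m A]trmxK trmx_mul trmxK mxE J2_col. Qed.

End RotatedBlocks.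

Section Graph.
Variables (R : realType) (n i : nat) (le_in : (i <= n)%N).
Local Notation C := R[i].
Local Notation m := (n - i)%N.
Local Notation J1 := (rotJ1 R n i).
Local Notation J2 := (rotJ2 R le_in).
Local Notation lo := (@lo_index n i).
Local Notation F := (Kfun R n).
Local Notation E r q := (kappa (delta_mx r q)).
Variables (V : gKdata R m) (lambda : n.-tuple int) (psi : gk_amb F) (v0 : gk_amb V).
Local Notation l := (lambda`_n.-1).
Local Notation eta := [tuple lambda`_k | k < m].
Local Notation SF := (@gk_supp _ _ F).
Local Notation SV := (@gk_supp _ _ V).
Hypotheses (VM : is_gKmodule V) (irr : irreducible V) (hv : highest_weight_vector eta v0).
Hypotheses (Spsi : SF psi) (psi0 : psi != 0)
  (psiH : forall r, KdC (E r r : 'M[C]_(n + n)) psi = (tnth lambda r)%:~R *: psi)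
  (psiE : forall r q : 'I_n, (r < q)%N -> KdC (E r q) psi = 0)
  (psiJ2 : forall A : 'M[C]_i, KdC (kappa (J2^T *m A *m J2)) psi = (l%:~R * \tr A) *: psi).

Let KF : is_Kmodule F := Kfun_Kmodule R n.
Let sF : subspace SF. Proof. by case: KF. Qed.
Let sV : subspace SV. Proof. by case: (gKmodule_Kmodule VM). Qed.
Let wpsi : wtv SF (@kcart R n F) (wt_of lambda) psi.
Proof. by split=> // j; rewrite /kcart cartanE psiH ffunE. Qed.
Let wsF := WS_subspace sF (kcart_lin KF).

Definition hwU := Gen (@kNeg R n F) psi.
Local Notation U := hwU.

Lemma hwU_subspace : subspace U. Proof. exact: Gen_subspace. Qed.

Lemma hwU_sub : U `<=` SF. Proof. exact: (kGen_sub KF Spsi). Qed.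

Lemma hwU_stable a x : U x -> U (KdC (kappa a) x).
Proof. exact: (kGen_stable KF wpsi psiE). Qed.

(* The eigenvalue of the center of gl_m, embedded in the first m coordinates. *)
Definition deg (chi : {ffun 'I_n -> int}) : int := \sum_(j < n | (j < m)%N) chi j.
Local Notation d0 := (deg (wt_of lambda)).
Local Notation ws P := (WS SF (@kcart R n F) P).

Lemma degD_root chi r q : deg (chi + (e_ r - e_ q)) = deg chi + (r < m)%:Z - (q < m)%:Z.
Proof.
have degE (k : 'I_n) : \sum_(j < n | (j < m)%N) (j == k)%:Z = (k < m)%:Z.
  have [km|mk] := boolP (k < m)%N.
    rewrite (bigD1 k) //= eqxx big1 ?addr0 // => j /andP [_ /negbTE jk]; by rewrite jk.
  by rewrite big1 // => j jm; rewrite (_ : (j == k) = false) //; apply: contraNF mk => /eqP <-.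
rewrite /deg -!degE -big_split -sumrB /=.
by apply: eq_bigr => j _; rewrite !ffunE addrA.
Qed.

Lemma ws_op (P Q : int -> Prop) (r q : 'I_n) x : (forall d, P d -> Q (d + (r < m)%:Z - (q < m)%:Z)) ->
  ws (P \o deg) x -> ws (Q \o deg) (KdC (E r q) x).
Proof.
move=> PQ; apply: (WS_op sF (kcart_lin KF) (kappa_op_wt KF r q)) => chi Pc.
by rewrite /= degD_root; exact: PQ.
Qed.

Lemma hwU_ws x : U x -> ws ((fun d => d <= d0) \o deg) x.
Proof.
move=> Ux; apply: (Ux (ws ((fun d => d <= d0) \o deg))); first exact: wsF.
  by apply: (WS_wtv wpsi); exact: lexx.
move=> T y [r [q [qr ->]]]; apply: (ws_op (P := fun d => d <= d0) (Q := fun d => d <= d0)) => d dd.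
by case: (ltnP r m); case: (ltnP q m) => /=; lia.
Qed.

(** The part of [U] on which Ev is to vanish: degrees strictly below that of [psi]. *)
Definition hwN : set (gk_amb F) := [set x | U x /\ ws ((fun d => d < d0) \o deg) x].
Local Notation N := hwN.

Lemma hwN_subspace : subspace N.
Proof.
have sU := hwU_subspace; have sW := wsF ((fun d => d < d0) \o deg); split.
  by split; [exact: (subspace0 sU)|exact: (subspace0 sW)].
by move=> a u v [Uu Wu] [Uv Wv]; split; [exact: sU.2|exact: sW.2].
Qed.

(** Only matrix units with row among the first n - i and column among the last i coordinates raise
    the degree, and the hypothesis excludes them. *)
Lemma hwN_stable a x : J1 *m a *m J2^T = 0 -> N x -> N (KdC (kappa a) x).
Proof.
move=> a0 Nx; have [Ux Wx] := Nx; apply: (kappa_span KF hwN_subspace (hwU_sub Ux)) => r q arq.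
split; first exact: hwU_stable.
apply: (ws_op (P := fun d => d < d0) (Q := fun d => d < d0) _ Wx) => d dd; have [rm|mr] := ltnP r m; last by case: (ltnP q m) => /=; lia.
have [qm|mq] := ltnP q m => /=; first by lia.
exfalso; move/eqP: arq; apply; have ki : (q - m < i)%N by have := ltn_ord q; lia.
have /matrixP /(_ (Ordinal rm) (Ordinal ki)) := a0; rewrite -mxsub_selection !mxE => <-.
by congr (a _ _); apply: val_inj => //=; rewrite subnKC.
Qed.

(** Units leading from the first n - i coordinates to the last i lower the degree by one, which puts
    all of [U] into [N]. *)
Lemma hwN_lower (A : 'M[C]_(i, m)) x : U x -> N (KdC (kappa (J2^T *m A *m J1)) x).
Proof.
move=> Ux; apply: (kappa_span KF hwN_subspace (hwU_sub Ux)) => r q arq.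
have mr : (m <= r)%N by rewrite leqNgt; apply/negP => rm; move/eqP: arq; apply; rewrite -mulmxA J2_row.
have qm : (q < m)%N by rewrite ltnNge; apply/negP => mq; move/eqP: arq; apply; rewrite J1_col.
split; first exact: hwU_stable.
apply: (ws_op (P := fun d => d <= d0) (Q := fun d => d < d0) _ (hwU_ws Ux)) => d dd.
by case: (ltnP r m); case: (ltnP q m) => /=; lia.
Qed.

Local Notation PV := (gk_amb F * gk_amb V)%type.
Definition pairS : set PV := [set p | SF p.1 /\ SV p.2].
(** The diagonal action of gl_(n-i) on pairs: on functions through its place in the first n - i
    coordinates, on V through k of the smaller group. *)
Definition pairop (B : 'M[C]_m) (p : PV) : PV :=
  (KdC (kappa (J1^T *m B *m J1)) p.1, gk_lie (kappa B) p.2).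
Definition paircart (j : 'I_m) := pairop (delta_mx j j).
Definition pairNeg : set (PV -> PV) := [set T | exists r q : 'I_m, (q < r)%N /\ T = pairop (delta_mx r q)].
Definition pairPos : set (PV -> PV) := [set T | exists r q : 'I_m, (r < q)%N /\ T = pairop (delta_mx r q)].
Local Notation S := pairS.
Local Notation op := pairop.

Lemma pairS_subspace : subspace S.
Proof.
split; first by split; [exact: (subspace0 sF)|exact: (subspace0 sV)].
by move=> a u v [Su Su'] [Sv Sv']; split; [exact: sF.2|exact: sV.2].
Qed.

Lemma pairop_in B p : S p -> S (op B p).
Proof.
by case=> S1 S2; split; [exact: (KdC_in KF (LieC_kappa _) S1)|exact: (lie_in VM (kappa_Sp B) S2)].
Qed.

Lemma pairop_linear B : linear_on S (op B).
Proof.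
move=> a u v [Su Su'] [Sv Sv']; rewrite /op /= (KdC_linear KF (LieC_kappa _) a Su Sv).
by rewrite (lie_linear VM (kappa_Sp B) a Su' Sv').
Qed.

Lemma pairop_linear_l p : S p -> linear_on setT (fun B => op B p).
Proof.
case=> S1 S2 a B B' _ _; rewrite /op.
have -> : J1^T *m (a *: B + B') *m J1 = a *: (J1^T *m B *m J1) + J1^T *m B' *m J1.
  by rewrite mulmxDr mulmxDl -scalemxAr -scalemxAl.
rewrite !kappaD !kappaZ (KdC_linear_l KF S1) ?(lie_linear_l VM S2) //;
  by [exact: kappa_Sp|exact: LieC_kappa].
Qed.

Lemma pairop_comm B B' p : S p -> op B (op B' p) = op B' (op B p) + op (B *m B' - B' *m B) p.
Proof.
case=> S1 S2; have JJ (A A' : 'M[C]_m) : J1^T *m A *m J1 *m (J1^T *m A' *m J1) = J1^T *m (A *m A') *m J1.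
  by rewrite !mulmxA -(mulmxA _ J1) J11 mulmx1.
have J11B : J1^T *m (B *m B' - B' *m B) *m J1 =
    J1^T *m B *m J1 *m (J1^T *m B' *m J1) - J1^T *m B' *m J1 *m (J1^T *m B *m J1).
  by rewrite !JJ mulmxBr mulmxBl.
have e1 := kappa_bracket_KdC KF (J1^T *m B *m J1) (J1^T *m B' *m J1) S1.
have e2 := lie_bracket VM (kappa_Sp B) (kappa_Sp B') S2.
rewrite bracket_kappa2 in e2; rewrite -J11B in e1.
exact: (congr2 pair e1 e2).
Qed.

Lemma pairop_span (W : set PV) B p : subspace W -> S p ->
  (forall r q, W (op (delta_mx r q) p)) -> W (op B p).
Proof.
move=> sW Sp H; have sL : subspace [set B | W (op B p)].
  split; first by rewrite /= (linear_on0 _ (pairop_linear_l Sp)) //; exact: (subspace0 sW).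
  by move=> a B1 B2 W1 W2; rewrite /= pairop_linear_l //; exact: sW.2.
rewrite (matrix_sum_delta B); apply: (subspace_sum _ sL) => r _; apply: (subspace_sum _ sL) => q _.
by apply: (subspaceZ _ sL); exact: H.
Qed.

Lemma pairop_wt r q : op_wt S paircart (op (delta_mx r q)) (e_ r - e_ q).
Proof.
split; [by move=> x; exact: pairop_in|exact: pairop_linear|move=> x j Sx].
rewrite /paircart pairop_comm //; congr (_ + _).
have [_ /(_ j)] := root_kappa R r q; rewrite cartanE bracket_kappa2 -kappaZ => /spx_inj [-> _ _].
by rewrite (linear_onZ _ _ (pairop_linear_l Sx)).
Qed.

Let sS := pairS_subspace.
Let cart_lin (j : 'I_m) : linear_on S (paircart j) := @pairop_linear _.

Lemma pairNeg_wt T : pairNeg T -> exists2 alpha, lev alpha < 0 & op_wt S paircart T alpha.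
Proof.
case=> r [q [qr ->]]; exists (e_ r - e_ q); last exact: pairop_wt.
by rewrite levD levN !lev_e; lia.
Qed.

Lemma pairPos_wt T : pairPos T -> exists2 alpha, 0 < lev alpha & op_wt S paircart T alpha.
Proof.
case=> r [q [qr ->]]; exists (e_ r - e_ q); last exact: pairop_wt.
by rewrite levD levN !lev_e; lia.
Qed.

Let p0 : PV := (psi, v0).
Let Sp0 : S p0. Proof. by split=> //; case: hv. Qed.
Let cv (r : 'I_m) : gk_lie (E r r) v0 = (tnth lambda (lo r))%:~R *: v0.
Proof. by have [_ _ H _] := hv; rewrite -cartanE H tnth_mktuple (tnth_nth 0). Qed.

Definition hwG0 := Gen pairNeg p0.
Local Notation G0 := hwG0.
Let sG0 : subspace G0. Proof. exact: Gen_subspace. Qed.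

Lemma hwG0_stable B p : G0 p -> G0 (op B p).
Proof.
move=> Gp; apply: (@Gen_stable R PV S pairNeg [set T | exists B, T = op B] p0 sS Sp0) => //.
- by move=> T [r [q [_ ->]]] y; exact: pairop_in.
- by move=> _ [B' ->]; exact: pairop_linear.
- move=> _ [B' ->]; apply: (pairop_span _ sG0 Sp0) => r q.
  have [rq|qr|rq] := ltngtP r q.
  + have [Ev _] := hwv_killed hv.
    by rewrite /op /= rowsub_delta psiE // Ev //; exact: (subspace0 sG0).
  + by apply: Gen_op; [exists r, q|exact: Gen_base].
  + have <- : r = q by exact: val_inj.
    rewrite /op /= rowsub_delta psiH cv -[(_ *: _, _)]/((tnth lambda (lo r))%:~R *: p0).
    by apply: (subspaceZ _ sG0); exact: Gen_base.
- move=> _ T [B' ->] [r [q [_ ->]]]; exists (op (B' *m delta_mx r q - delta_mx r q *m B')).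
    by eexists.
  by move=> y Sy; exact: pairop_comm.
- by exists B.
Qed.

(** All these properties hold at (psi, v0) and survive lowering by gl_(n-i), which keeps the degree,
    normalizes p_- in V, and commutes with gl_i. *)
Lemma hwG0_sub p : G0 p -> [/\ U p.1, ws ((fun d => d = d0) \o deg) p.1, SV p.2, pkilled p.2 &
  forall A : 'M[C]_i, KdC (kappa (J2^T *m A *m J2)) p.1 = (l%:~R * \tr A) *: p.1].
Proof.
pose W : set PV := [set p | [/\ U p.1, ws ((fun d => d = d0) \o deg) p.1, SV p.2, pkilled p.2 &
  forall A : 'M[C]_i, KdC (kappa (J2^T *m A *m J2)) p.1 = (l%:~R * \tr A) *: p.1]].
have sU := hwU_subspace; have sD := wsF ((fun d => d = d0) \o deg).
have csp (c : 'M[C]_m) : c^T = c -> LieC (@Sp R m) (spx 0 0 c) by move=> cT; apply: spx_Sp; rewrite ?trmx0.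
move=> Gp; apply: (Gp W).
- split.
    split; [exact: (subspace0 sU)|exact: (subspace0 sD)|exact: (subspace0 sV)| |].
      by move=> c cT; exact: (linear_on0 sV (lie_linear VM (csp c cT))).
    by move=> A; rewrite (linear_on0 sF (KdC_linear KF (LieC_kappa _))) scaler0.
  move=> a u v [Uu Du Su ku Au] [Uv Dv Sv kv Av]; split; [exact: sU.2|exact: sD.2|exact: sV.2| |].
    by move=> c cT; rewrite /= (lie_linear VM (csp c cT) a Su Sv) (ku c cT) (kv c cT) scaler0 addr0.
  move=> A; rewrite /= (KdC_linear KF (LieC_kappa _) a (hwU_sub Uu) (hwU_sub Uv)) Au Av.
  by rewrite scalerDr !scalerA [a * _]mulrC.
- split; [exact: Gen_base|exact: (WS_wtv wpsi)|by case: hv|exact: (hwv_pkilled VM hv)|exact: psiJ2].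
- move=> T y [r [q [qr ->]]] [Uy Dy Sy ky Ay]; split.
  + exact: hwU_stable.
  + rewrite /= rowsub_delta; apply: (ws_op _ Dy) => d ->.
    by have := ltn_ord r; have := ltn_ord q; rewrite /lo_index /= => -> ->; lia.
  + exact: (lie_in VM (kappa_Sp _) Sy).
  + exact: (pkilled_kappa VM).
  + move=> A; rewrite /= (kappa_bracket_KdC KF _ _ (hwU_sub Uy)) Ay.
    have J12' : J1 *m J2^T = 0 := J12 R le_in.
    have J21' : J2 *m J1^T = 0 := J21 R le_in.
    have -> : J2^T *m A *m J2 *m (J1^T *m delta_mx r q *m J1) - J1^T *m delta_mx r q *m J1 *m (J2^T *m A *m J2) = 0.
      by rewrite !mulmxA -(mulmxA _ J2) J21' -(mulmxA _ J1 J2^T) J12' !mulmx0 !mul0mx subr0.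
    rewrite kappa0 (linear_on0 (@LieC_K_subspace R n) (KdC_linear_l KF (hwU_sub Uy))) addr0.
    by rewrite (linear_onZ _ sF (KdC_linear KF (LieC_kappa _)) (hwU_sub Uy)).
Qed.

Lemma paircart_p0 (a b : C) : wtv S paircart (wt_of eta) ((a *: psi, b *: v0) : PV).
Proof.
have [Sv _ _ _] := hv; split; first by split; [exact: (subspaceZ _ sF)|exact: (subspaceZ _ sV)].
move=> j; rewrite /paircart /op /= rowsub_delta.
rewrite (linear_onZ _ sF (KdC_linear KF (LieC_kappa _)) Spsi) psiH.
rewrite (linear_onZ _ sV (lie_linear VM (kappa_Sp _)) Sv) cv !scalerA ffunE tnth_mktuple (tnth_nth 0).
by rewrite -[RHS]/(_ *: (a *: psi), _ *: (b *: v0)) !scalerA [a * _]mulrC [b * _]mulrC.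
Qed.

(* A nonzero y would produce a highest weight vector of V, hence (0, v0) in G0;
   but the only vectors of top weight in G0 are the multiples of (psi, v0). *)
Lemma hwG0_inj y : G0 ((0, y) : PV) -> y = 0.
Proof.
move=> Gy; apply/eqP/negPn/negP => y0.
have wp0 : wtv S paircart (wt_of eta) p0 by have := paircart_p0 1 1; rewrite !scale1r.
have op0 B (p : PV) : p.1 = 0 -> (op B p).1 = 0.
  by move=> /= ->; exact: (linear_on0 sF (KdC_linear KF (LieC_kappa _))).
have [chi [[x y1] [wy p1 [Gy1 /= x0] kill]]] : exists chi p, [/\ wtv S paircart chi p, p != 0,
    [set p | G0 p /\ p.1 = 0] p & forall T, pairPos T -> T p = 0].
  apply: (highest_component sS cart_lin (L := lev (wt_of eta)) (x := (0, y) : PV)) => //.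
  - split; first by split=> //; exact: (subspace0 sG0).
    by move=> a u v [Gu u0] [Gv v0']; split; [exact: sG0.2|rewrite /= u0 v0' scaler0 addr0].
  - by move=> j p [Gp p10]; split; [exact: hwG0_stable|exact: op0].
  - by move=> p [Gp _]; exact: (Gen_WS sS cart_lin wp0 pairNeg_wt Gp).
  - exact: pairPos_wt.
  - by move=> T p [r [q [_ ->]]] [Gp p10]; split; [exact: hwG0_stable|exact: op0].
  - by apply: contraNneq y0 => -[->].
rewrite {x}x0 in wy p1 Gy1 kill.
have [_ _ Sy1 ky1 _] := hwG0_sub Gy1.
have y10 : y1 != 0 by apply: contraNneq p1 => ->.
have hy : highest_weight_vector [tuple chi j | j < m] y1.
  apply: (killed_hwv VM Sy1 y10).
  - move=> j; rewrite tnth_mktuple cartanE; have [_ /(_ j) /(congr1 snd)] := wy; exact.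
  - move=> r q rq; have /(congr1 snd) := kill (op (delta_mx r q)) (ex_intro _ r (ex_intro _ q (conj rq erefl))).
    exact.
  - by move=> r q; exact: pkilled_pmin.
have [_ [c y1E]] := hwv_unique VM irr hv hy.
have c0 : c != 0 by apply: contraNneq y10 => c0; rewrite y1E c0 scale0r.
have Gv : G0 ((0, v0) : PV).
  have := subspaceZ c^-1 sG0 Gy1; rewrite y1E -[_ *: (_, _)]/(c^-1 *: 0, c^-1 *: (c *: v0)).
  by rewrite scaler0 scalerA mulVf // scale1r.
(* [z] has the top weight but is a sum of weight vectors of lower level, so it vanishes. Its
   components then give b = 0 and v0 = 0. *)
have [b [z [zE Wz]]] := Gen_decomp sS cart_lin wp0 pairNeg_wt Gv.
have zE' : z = (- b *: psi, (1 - b) *: v0).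
  have -> : z = ((0, v0) : PV) - b *: p0 by rewrite zE addrC addKr.
  by rewrite -[LHS]/(0 - b *: psi, v0 - b *: v0) sub0r scaleNr scalerBl scale1r.
have z0 : z = 0.
  apply: (wtv_WS_eq0 sS cart_lin _ _ Wz); first by rewrite zE'; exact: paircart_p0.
  by rewrite ltxx.
move: z0; rewrite zE' => -[/eqP]; rewrite scaler_eq0 (negbTE psi0) orbF oppr_eq0 => /eqP ->.
by rewrite subr0 scale1r => v00; have [_ /eqP] := hv.
Qed.

(** Lowering by gl_(n-i) reaches only vectors of top degree. Adding [N] paired with 0 extends the
    map by zero to lower degrees, and makes the graph total on [U]. *)
Definition hwG : set PV := [set p | exists x u, [/\ G0 ((x, p.2) : PV), N u & p.1 = x + u]].
Local Notation G := hwG.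

Lemma hwG_subspace : subspace G.
Proof.
have sN := hwN_subspace; split.
  by exists 0, 0; split; [exact: (subspace0 sG0)|exact: (subspace0 sN)|rewrite addr0].
move=> a p p' [x [u [Gx Nu pE]]] [x' [u' [Gx' Nu' pE']]]; exists (a *: x + x'), (a *: u + u').
split; [exact: (sG0.2 a _ _ Gx Gx')|exact: sN.2|].
by rewrite /= pE pE' scalerDr addrACA.
Qed.

Lemma hwG_sub p : G p -> [/\ U p.1, SV p.2 & pkilled p.2].
Proof.
case=> x [u [/hwG0_sub [/= Ux _ Sy ky _] [Uu _] ->]]; split=> //.
exact: (subspaceD hwU_subspace).
Qed.

Lemma hwG_base : G ((psi, v0) : PV).
Proof.
exists psi, 0; split; [exact: Gen_base|exact: (subspace0 hwN_subspace)|by rewrite addr0].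
Qed.

(** If x + u = 0 with x of top degree and u of lower degree, both vanish, which leads back to
    [hwG0_inj]. *)
Lemma hwG_inj y : G ((0, y) : PV) -> y = 0.
Proof.
case=> x [u [/= Gx [Uu Wu] xu]]; have [_ Wx _ _ _] := hwG0_sub Gx.
suff x0 : x = 0 by apply: hwG0_inj; rewrite -x0.
apply: (WS_disjoint sF (kcart_lin KF) _ Wx (Q := (fun d => d < d0) \o deg)).
  by move=> chi /= ->; rewrite ltxx.
have -> : x = - u by apply/eqP; rewrite -addr_eq0 -xu.
exact: (subspaceN (wsF _)).
Qed.

Lemma hwG_N u : N u -> G ((u, 0) : PV).
Proof. by move=> Nu; exists 0, u; split; [exact: (subspace0 sG0)| |rewrite add0r]. Qed.

Lemma hwG_lo B x y : G ((x, y) : PV) -> G ((KdC (kappa (J1^T *m B *m J1)) x, gk_lie (kappa B) y) : PV).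
Proof.
case=> x' [u [/= Gx Nu ->]]; have [Ux' _ _ _ _] := hwG0_sub Gx; have [Uu _] := Nu.
exists (KdC (kappa (J1^T *m B *m J1)) x'), (KdC (kappa (J1^T *m B *m J1)) u).
split; first exact: (hwG0_stable B Gx).
  apply: (hwN_stable _ Nu); have J12' : J1 *m J2^T = 0 := J12 R le_in.
  by rewrite -!mulmxA J12' !mulmx0.
by rewrite /= (linear_onD (KdC_linear KF (LieC_kappa _)) (hwU_sub Ux') (hwU_sub Uu)).
Qed.

Lemma hwG_hi (A : 'M[C]_i) x y : G ((x, y) : PV) ->
  G ((KdC (kappa (J2^T *m A *m J2)) x, (l%:~R * \tr A) *: y) : PV).
Proof.
case=> x' [u [/= Gx Nu ->]]; have [Ux' _ _ _ Ax'] := hwG0_sub Gx; have [Uu _] := Nu.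
exists ((l%:~R * \tr A) *: x'), (KdC (kappa (J2^T *m A *m J2)) u); split.
- exact: (subspaceZ _ sG0 Gx).
- apply: (hwN_stable _ Nu); have J12' : J1 *m J2^T = 0 := J12 R le_in.
  by rewrite !mulmxA J12' !mul0mx.
- by rewrite /= (linear_onD (KdC_linear KF (LieC_kappa _)) (hwU_sub Ux') (hwU_sub Uu)) -Ax'.
Qed.

Lemma hwG_lower (A : 'M[C]_(i, m)) x : U x -> G ((KdC (kappa (J2^T *m A *m J1)) x, 0) : PV).
Proof. by move=> Ux; apply: hwG_N; exact: hwN_lower. Qed.

(** A lowering unit is of one of three kinds: inside gl_(n-i), where the graph is stable; inside
    gl_i, which acts on V by a scalar; or from the first block to the last, with image in [N]. *)
Lemma hwG_total x : U x -> exists y, G ((x, y) : PV).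
Proof.
have sG := hwG_subspace; move=> Ux; apply: (Ux [set x | exists y, G ((x, y) : PV)]).
- split; first by exists 0; exact: (subspace0 sG).
  move=> a u v [y Gu] [y' Gv]; exists (a *: y + y'); exact: (sG.2 a _ _ Gu Gv).
- by exists v0; exact: hwG_base.
- move=> T x' [r [q [qr ->]]] [y Gxy]; have [Ux' _ _] := hwG_sub Gxy.
  have [rm|mr] := ltnP r m.
    have qm : (q < m)%N by apply: ltn_trans qr rm.
    exists (gk_lie (E (Ordinal rm) (Ordinal qm)) y).
    have lr : lo (Ordinal rm) = r by apply: val_inj.
    have lq : lo (Ordinal qm) = q by apply: val_inj.
    by have H := hwG_lo (delta_mx (Ordinal rm) (Ordinal qm)) Gxy; rewrite rowsub_delta lr lq in H; exact: H.
  have hiE (k : 'I_n) (mk : (m <= k)%N) : exists k', hi_index le_in k' = k.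
    have ki : (k - m < i)%N by have := ltn_ord k; lia.
    by exists (Ordinal ki); apply: val_inj; rewrite /= subnKC.
  have [r' rE] := hiE r mr; have [qm|mq] := ltnP q m.
    exists 0; apply: hwG_N; have := hwN_lower (J2 *m delta_mx r q *m J1^T) Ux'.
    rewrite (_ : J2^T *m _ *m J1 = delta_mx r q) //.
    have -> : J2^T *m (J2 *m delta_mx r q *m J1^T) *m J1 = (J2^T *m J2) *m delta_mx r q *m (J1^T *m J1).
      by rewrite !mulmxA.
    have qE : q = lo (Ordinal qm) by exact: val_inj.
    have eL (k : 'I_i) : J2^T *m J2 *m delta_mx (hi_index le_in k) q = delta_mx (hi_index le_in k) q.
      rewrite -(mul_delta_mx (hi_index le_in k)) mulmxA; congr (_ *m _).
      by rewrite -rowsub_delta !mulmxA -(mulmxA J2^T J2) J22 mulmx1.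
    rewrite -rE eL qE.
    rewrite -(mul_delta_mx (lo (Ordinal qm)) (hi_index le_in r')) -!mulmxA; congr (_ *m _).
    by rewrite -rowsub_delta -!mulmxA (mulmxA J1 J1^T) J11 mul1mx.
  have [q' qE] := hiE q mq; exists ((l%:~R * \tr (delta_mx r' q' : 'M[C]_i)) *: y).
  by have H := hwG_hi (delta_mx r' q') Gxy; rewrite rowsub_delta rE qE in H; exact: H.
Qed.

End Graph.

(** * The section built from the graph and its annihilation by p_- *)

Section Embedding.
Variables (R : realType) (p q : nat) (A : 'M[R]_(p, q)).
Hypothesis AA : A *m A^T = 1%:M.

(** The embedded generator acts as [Z] on the image of [A^T] and as 0 on its complement, where the
    exponential is therefore the identity. *)
Lemma expm_embed (Z : 'M[R]_p) t :
  expm (t *: (A^T *m Z *m A)) = A^T *m expm (t *: Z) *m A + (1%:M - A^T *m A).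
Proof.
have H := @expm_flow R q q (A^T *m Z *m A) (fun t => A^T *m expm (t *: Z) *m A + (1%:M - A^T *m A)).
rewrite H => [|s].
  by rewrite scale0r expm0 mulmx1 addrC subrK mulmx1.
have -> : A^T *m Z *m A *m (A^T *m expm (s *: Z) *m A + (1%:M - A^T *m A)) = A^T *m (Z *m expm (s *: Z)) *m A.
  rewrite mulmxDr mulmxBr mulmx1 !mulmxA -(mulmxA _ A A^T) AA mulmx1.
  by rewrite subrr addr0.
have d := mx_derive_mulr A (mx_derive_mull A^T (expm_derive Z s)).
apply: (mx_derive_eq (mx_derive_sub d (mx_derive_const s (A^T *m A - 1%:M)))) => [u|].
  by rewrite opprB.
by rewrite subr0.
Qed.

End Embedding.

Section Existence.
Variables (R : realType) (n i : nat) (le_in : (i <= n)%N).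
Local Notation C := R[i].
Local Notation m := (n - i)%N.
Local Notation K := (@Kinf R n).
Local Notation P := (@Pin R n i).
Local Notation spn := (LieC (@Sp R n)).
Local Notation J1 := (rotJ1 R n i).
Local Notation J2 := (rotJ2 R le_in).
Local Notation S1 := (selgl C le_in).
Local Notation S2 := (selsp C le_in).
Local Notation W := (rotW R le_in).
Local Notation w := (krot R le_in).

(* Real forms of J1 and J2, and their doubles acting on R^(2n). *)
Let j1 : 'M[R]_(m, n) := rowsub (@lo_index n i) 1%:M.
Let j2 : 'M[R]_(i, n) := rowsub (hi_index le_in) 1%:M.
Let dbl p (a : 'M[R]_(p, n)) : 'M[R]_(p + p, n + n) := block_mx a 0 0 a.
Local Notation A1 := (dbl j1).
Local Notation A2 := (dbl j2).

Let toC_j1 : toC j1 = J1. Proof. by rewrite /j1 toC_map toC1. Qed.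
Let toC_j2 : toC j2 = J2. Proof. by rewrite /j2 toC_map toC1. Qed.

Let toC_tr p q (a : 'M[R]_(p, q)) : toC a^T = (toC a)^T.
Proof. by apply/matrixP => r k; rewrite toC_entry mxE [RHS]mxE toC_entry. Qed.

Let adj_toC p q (a : 'M[R]_(p, q)) : adj (toC a) = (toC a)^T.
Proof.
have ra : map_mx conjc (toC a) = toC a by apply/matrixP => r k; rewrite mxE toC_entry /= oppr0.
by rewrite /adj -map_trmx ra.
Qed.

Let real_Im (X : 'M[C]_n) : map_mx conjc X = X -> mxIm X = 0.
Proof.
move=> XX; apply/matrixP => r q; rewrite mxIm_entry [RHS]mxE.
have := congr1 (fun Y : 'M[C]_n => complex.Im (Y r q)) XX; rewrite /= mxE.
by case: (X r q) => a b /= e; lra.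
Qed.

Let tr_dbl p (a : 'M[R]_(p, n)) : (dbl a)^T = block_mx a^T 0 0 a^T.
Proof. by rewrite /dbl tr_block_mx !trmx0. Qed.

Let dblV p (a : 'M[R]_(p, n)) : a *m a^T = 1%:M -> dbl a *m (dbl a)^T = 1%:M.
Proof.
by move=> aa; rewrite tr_dbl mulmx_block !mulmx0 !mul0mx !addr0 !add0r aa -scalar_mx_block.
Qed.

Let dblT p (a : 'M[R]_(p, n)) : (dbl a)^T *m dbl a = block_mx (a^T *m a) 0 0 (a^T *m a).
Proof. by rewrite tr_dbl mulmx_block !mulmx0 !mul0mx !addr0 !add0r. Qed.

Let j11 : j1 *m j1^T = 1%:M.
Proof. by apply: toC_inj; rewrite toCM toC_tr toC1 toC_j1 J11. Qed.
Let j22 : j2 *m j2^T = 1%:M.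
Proof. by apply: toC_inj; rewrite toCM toC_tr toC1 toC_j2 J22. Qed.
Let j12 : j1 *m j2^T = 0.
Proof. by apply: toC_inj; rewrite toCM toC_tr toC0 toC_j1 toC_j2 J12. Qed.

Let jsum : j1^T *m j1 + j2^T *m j2 = 1%:M.
Proof.
apply: toC_inj; rewrite toCD !toCM !toC_tr toC1 toC_j1 toC_j2 -(S1W R le_in) -(S2W R le_in).
have key (X : 'M[C]_n) : (S2 *m X)^T *m (S2 *m X) + (S1 *m X)^T *m (S1 *m X) =
    X^T *m (S1^T *m S1 + S2^T *m S2) *m X.
  by rewrite !trmx_mul mulmxDr mulmxDl !mulmxA addrC.
by rewrite key (Ssum C le_in) mulmx1 rotTW.
Qed.

Let Asum : 1%:M - A1^T *m A1 = A2^T *m A2.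
Proof.
have -> : (1%:M : 'M[R]_(n + n)) = block_mx 1%:M 0 0 1%:M by rewrite scalar_mx_block.
rewrite !dblT -jsum opp_block_mx add_block_mx oppr0 addr0.
by apply: block_mx_eq => //; rewrite addrC addKr.
Qed.

Let phi_dbl p (a : 'M[R]_(p, n)) (u : 'M[C]_p) :
  (dbl a)^T *m phi u *m dbl a = phi ((toC a)^T *m u *m toC a).
Proof.
have re : mxRe ((toC a)^T *m u *m toC a) = a^T *m mxRe u *m a.
  by rewrite -toC_tr !(mxReM, mxImM) !mxRe_toC !mxIm_toC !(mul0mx, mulmx0, subr0, addr0, add0r).
have im : mxIm ((toC a)^T *m u *m toC a) = a^T *m mxIm u *m a.
  by rewrite -toC_tr !(mxReM, mxImM) !mxRe_toC !mxIm_toC !(mul0mx, mulmx0, subr0, addr0, add0r).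
rewrite tr_dbl /phi re im !mulmx_block !mulmx0 !mul0mx !addr0 !add0r.
by rewrite !mulmxN !mulNmx.
Qed.

Let embed_skew p (a : 'M[R]_(p, n)) (u : 'M[C]_p) : adj u = - u ->
  let u' := (toC a)^T *m u *m toC a in adj u' = - u'.
Proof.
move=> uu; have ta := adj_toC a; have tta : adj (toC a)^T = toC a by rewrite -ta adjK.
by rewrite /= !adjM ta tta uu mulNmx mulmxN mulmxA.
Qed.

Variables (V : gKdata R m) (VM : is_gKmodule V) (irr : irreducible V).
Variables (lambda : n.-tuple int) (v0 : gk_amb V).
Local Notation l := (lambda`_n.-1).
Hypothesis hv : highest_weight_vector [tuple lambda`_k | k < m] v0.
Variables (mu : 'M[R]_i -> C).
Local Notation N := (normalized n mu).
Hypothesis N1 : N 1%:M = 1.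
Hypothesis Nd : forall A : 'M[R]_i,
  is_cderive0 (fun t => N (expm (t *: A))) (l%:~R * real_complex R (\tr A)).
Hypothesis Northo : forall g : 'M[R]_i, g^T *m g = 1%:M -> N g = det_power l (phi (toC g)).
Local Notation IV := (Ind le_in mu V).
Local Notation Sf := (@gk_supp _ _ IV).
Local Notation SV := (@gk_supp _ _ V).
Local Notation fn := (gk_amb IV).
Local Notation F := (Kfun R n).
Local Notation SF := (@gk_supp _ _ F).
Local Notation PV := (gk_amb F * gk_amb V)%type.

Variable psi : gk_amb F.
Hypotheses (Spsi : SF psi) (psi0 : psi != 0)
  (psiH : forall r, KdC (kappa (delta_mx r r : 'M[C]_n)) psi = (tnth lambda r)%:~R *: psi)
  (psiE : forall r q : 'I_n, (r < q)%N -> KdC (kappa (delta_mx r q : 'M[C]_n)) psi = 0)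
  (psiJ2 : forall A : 'M[C]_i, KdC (kappa (J2^T *m A *m J2)) psi = (l%:~R * \tr A) *: psi).

Let KF : is_Kmodule F := Kfun_Kmodule R n.
Let IM : is_gKmodule IV := ind_gKmodule le_in VM N1 Nd.
Let KI : is_Kmodule IV := gKmodule_Kmodule IM.
Let sV : subspace SV. Proof. by case: (gKmodule_Kmodule VM). Qed.
Let VK : is_Kmodule V := gKmodule_Kmodule VM.
Local Notation U := (hwU psi).
Local Notation G := (@hwG R n i V lambda psi v0).

Let sU : subspace U := hwU_subspace psi.
Let sG : subspace G := hwG_subspace lambda psi v0.
Let US x : U x -> SF x. Proof. exact: (hwU_sub Spsi). Qed.
Let Glo := @hwG_lo R n i le_in V lambda psi v0 VM hv Spsi psi0 psiH psiE psiJ2.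
Let Ghi := @hwG_hi R n i le_in V lambda psi v0 VM hv Spsi psi0 psiH psiE psiJ2.
Let Glower := @hwG_lower R n i le_in V lambda psi v0 Spsi psi0 psiH psiE.
Let Ginj := @hwG_inj R n i le_in V lambda psi v0 VM irr hv Spsi psi0 psiH psiE psiJ2.
Let Gtotal := @hwG_total R n i le_in V lambda psi v0 VM hv Spsi psi0 psiH psiE psiJ2.
Let Gsub p : G p -> [/\ U p.1, SV p.2 & pkilled p.2].
Proof. exact: (@hwG_sub R n i le_in V lambda psi v0 VM hv Spsi psi0 psiH psiE psiJ2). Qed.

Let Uk k x : K k -> U x -> U (gk_cpt k x).
Proof. move=> Kk Ux; apply: (K_stable KF sU US) => // a y; exact: (hwU_stable Spsi psiH psiE). Qed.

(** Stability of the graph under gl_(n-i) integrates along the product flow, and every element of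
    the smaller maximal compact group is an exponential. *)
Lemma hwG_Sp k x y : Kinf k -> G ((x, y) : PV) ->
  G ((gk_cpt (A1^T *m k *m A1 + A2^T *m A2) x, gk_cpt k y) : PV).
Proof.
move=> Kk Gxy; have [Z KZ ZE] := Kinf_expm_surj Kk; have [u uu uE] := LieK_skew KZ.
pose Z' := A1^T *m Z *m A1.
have Z'E : Z' = phi (J1^T *m u *m J1) by rewrite /Z' uE phi_dbl toC_j1.
have skew' : adj (J1^T *m u *m J1) = - (J1^T *m u *m J1) by have := embed_skew j1 uu; rewrite toC_j1.
have KZ' : Lie K Z' by rewrite Z'E; exact: LieK_phi.
have fl := flow_prod (Kd_flow KF KZ') (Kd_flow VK KZ).
have kE : A1^T *m k *m A1 + A2^T *m A2 = expm (1 *: Z').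
  by rewrite (expm_embed (dblV j11)) scale1r ZE Asum.
rewrite kE -ZE -[Z]scale1r.
apply: (flow_stable fl sG _ _ 1 Gxy).
  by move=> p /Gsub [Up Sp _]; split=> //; exact: US.
move=> [x' y'] Gp; have [/= Ux' Sy' _] := Gsub Gp.
have e1 : Kd Z' x' = KdC (kappa (J1^T *m u *m J1)) x'.
  by rewrite -(KdC_toC KF KZ' (US Ux')) Z'E (toC_phi_skew skew').
have e2 : Kd Z y' = gk_lie (kappa u) y'.
  by rewrite -(KdC_toC VK KZ Sy') uE (toC_phi_skew uu) (lie_KdC VM (LieC_kappa u) Sy').
rewrite -[X in G X]/((Kd Z' x', Kd Z y') : PV) e1 e2.
exact: (Glo u Gp).
Qed.

Let det_power_expm (u : 'M[C]_i) : adj u = - u ->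
  [/\ det_power l (expm (0 *: phi u)) = 1,
      forall s t, det_power l (expm ((s + t) *: phi u)) = det_power l (expm (s *: phi u)) * det_power l (expm (t *: phi u))
    & is_cderive0 (fun t => det_power l (expm (t *: phi u))) (l%:~R * \tr u)].
Proof.
move=> uu; have t1 : tau (1%:M : 'M[R]_(i + i)) = 1%:M by rewrite -phi1 tau_phi.
have Ke t := Kinf_expm t (LieK_phi uu).
have dp1 : det_power l (1%:M : 'M[R]_(i + i)) = 1.
  by rewrite /det_power t1 det1; case: (l) => d; rewrite ?rmorph1 expr1n.
split.
- by rewrite scale0r expm0.
- move=> s t; rewrite expmD /det_power (tauM (Ke s) (Ke t)) det_mulmx.
  by case: (l) => d; rewrite ?rmorphM exprMn.
- have [D [Dd Dl] De] := @eig_det_power R i l u.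
  have K1 := @Kinf1 R i.
  apply: (cderive_eq (Dd _ u K1 uu)) => [t|]; first by rewrite mul1mx.
  by rewrite (De _ K1) dp1 mulr1.
Qed.

(** The same integration for the unitary group in the last i coordinates, the flow on V being
    multiplication by the l-th power of the determinant. *)
Lemma hwG_GL k x y : Kinf k -> G ((x, y) : PV) ->
  G ((gk_cpt (A2^T *m k *m A2 + A1^T *m A1) x, det_power l k *: y) : PV).
Proof.
move=> Kk Gxy; have [Z KZ ZE] := Kinf_expm_surj Kk; have [u uu uE] := LieK_skew KZ.
pose Z' := A2^T *m Z *m A2.
have Z'E : Z' = phi (J2^T *m u *m J2) by rewrite /Z' uE phi_dbl toC_j2.
have skew' : adj (J2^T *m u *m J2) = - (J2^T *m u *m J2) by have := embed_skew j2 uu; rewrite toC_j2.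
have KZ' : Lie K Z' by rewrite Z'E; exact: LieK_phi.
have [e0 eD ed] := det_power_expm uu.
have fl := flow_prod (Kd_flow KF KZ') (flow_scalar sV e0 eD ed).
have kE : A2^T *m k *m A2 + A1^T *m A1 = expm (1 *: Z').
  by rewrite (expm_embed (dblV j22)) scale1r ZE; congr (_ + _); rewrite -Asum opprB addrC subrK.
rewrite kE -ZE -[Z]scale1r uE.
apply: (flow_stable fl sG _ _ 1 Gxy).
  by move=> p /Gsub [Up Sp _]; split=> //; exact: US.
move=> [x' y'] Gp; have [/= Ux' Sy' _] := Gsub Gp.
have e1 : Kd Z' x' = KdC (kappa (J2^T *m u *m J2)) x'.
  by rewrite -(KdC_toC KF KZ' (US Ux')) Z'E (toC_phi_skew skew').
rewrite -[X in G X]/((Kd Z' x', (l%:~R * \tr u) *: y') : PV) e1.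
exact: (Ghi u Gp).
Qed.

(** On [U] the graph is total and single-valued, so the choice is forced there. *)
Definition hwEv (x : gk_amb F) : gk_amb V := xget 0 [set y | G ((x, y) : PV)].
Local Notation Ev := hwEv.

Lemma hwEvE x y : G ((x, y) : PV) -> Ev x = y.
Proof.
move=> Gxy; have GE : G ((x, Ev x) : PV) by rewrite /Ev; case: xgetP => [z _|/(_ y)].
apply/eqP; rewrite -subr_eq0; apply/eqP.
apply: Ginj.
have H := subspaceB sG GE Gxy; rewrite -[_ - _]/((x - x, Ev x - y) : PV) subrr in H; exact: H.
Qed.

Lemma hwEvP x : U x -> G ((x, Ev x) : PV).
Proof.
move=> Ux; have [y Gxy] := Gtotal Ux.
by rewrite (hwEvE Gxy).
Qed.

Lemma hwEv_linear : linear_on U Ev.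
Proof. by move=> a x x' Ux Ux'; apply: hwEvE; exact: (sG.2 a _ _ (hwEvP Ux) (hwEvP Ux')). Qed.

Definition hwT (x : gk_amb F) : fn := fun k => if `[< K k >] then Ev (gk_cpt (w^T *m k) x) else 0.
Local Notation T := hwT.

Let Kw : K w := rot_K R le_in.
Let Kwt : K w^T := Kinf_tr Kw.

Let TE x k : K k -> T x k = Ev (gk_cpt (w^T *m k) x).
Proof. by move=> Kk; rewrite /T asboolT. Qed.

Let T_linear : linear_on U T.
Proof.
move=> a x x' Ux Ux'; apply/funext => k; rewrite -[RHS]/(a *: T x k + T x' k).
have [Kk|Kk] := pselect (K k); last by rewrite /T asboolF // scaler0 addr0.
have Kwk := KinfM Kwt Kk.
rewrite !TE // (cpt_linear KF Kwk a (US Ux) (US Ux')).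
by rewrite (hwEv_linear a (Uk Kwk Ux) (Uk Kwk Ux')).
Qed.

Let T_cpt k x : K k -> U x -> gk_cpt k (T x) = T (gk_cpt k x) :> fn.
Proof.
move=> Kk Ux; apply/funext => k'; rewrite cpt_val.
have [Kk'|Kk'] := pselect (K k'); last first.
  rewrite /T !asboolF // => Kkk; apply: Kk'.
  by rewrite -[k'](mulmxK (Kinf_unit Kk)); exact: (KinfM Kkk (KinfV Kk)).
rewrite !TE //; last exact: KinfM.
by have [_ _ [_ _ cM _]] := KF; rewrite mulmxA (cM _ _ _ (KinfM Kwt Kk') Kk (US Ux)).
Qed.

Let rot_Levi p : P p -> K p ->
  w^T *m p *m w = A1^T *m sp_part le_in p *m A1 + A2^T *m phi (toC (gl_part le_in p)) *m A2.
Proof.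
move=> Pp Kp.
have W0 : mxIm W = 0 := real_Im (rotW_real R le_in).
have WE : w = dbl (mxRe W).
  by rewrite /krot /phi W0 oppr0.
have WC : toC (mxRe W) = W by apply: mxC_eq; rewrite ?mxRe_toC ?mxIm_toC ?W0.
have toC_sel p' (f : 'I_p' -> 'I_n) : toC (rowsub f 1%:M : 'M[R]_(p', n)) = rowsub f 1%:M.
  by rewrite toC_map toC1.
have S1w : selgl R le_in *m mxRe W = j2.
  by apply: toC_inj; rewrite toCM WC toC_j2 -(S1W R le_in) toC_sel.
have S2w : selsp R le_in *m mxRe W = j1.
  by apply: toC_inj; rewrite toCM WC toC_j1 -(S2W R le_in) toC_sel.
have T2w : T2 R le_in *m w = A1.
  by rewrite WE /T2 /dbl mulmx_block !mulmx0 !mul0mx !addr0 !add0r S2w.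
have T1w : T1 R le_in *m w = row_mx j2 0.
  by rewrite WE /T1 /dbl mul_row_block !mulmx0 !mul0mx !addr0 S1w.
have T3w : T3 R le_in *m w = row_mx 0 j2.
  by rewrite WE /T3 /dbl mul_row_block !mulmx0 !mul0mx !add0r S1w.
set g := gl_part le_in p; set s := sp_part le_in p.
have pE : p = (T1 R le_in)^T *m g *m T1 R le_in + (T2 R le_in)^T *m s *m T2 R le_in + (T3 R le_in)^T *m g *m T3 R le_in.
  have T2p : T2 R le_in *m p = s *m T2 R le_in.
    rewrite /s sp_partT -[LHS]mulmx1 -(Tsum R le_in) !mulmxDr !mulmxA.
    have [_ pT] := (PinP le_in p).1 Pp.
    have -> : T2 R le_in *m p *m (T1 R le_in)^T = 0.
      by rewrite -mulmxA pT mulmxA (T21 R le_in) mul0mx.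
    have -> : T2 R le_in *m p *m (T3 R le_in)^T = 0.
      have H := T3_Levi le_in (Pin_inv le_in Pp Kp) (Kinf_tr Kp).
      apply: trmx_inj; rewrite trmx0 !trmx_mul trmxK mulmxA H -(mulmxA _ (T3 R le_in)).
      by rewrite (T32 R le_in) mulmx0.
    by rewrite !mul0mx add0r addr0.
  rewrite -[LHS]mul1mx -(Tsum R le_in) !mulmxDl -!(mulmxA _ _ p) T2p.
  by rewrite (T1_Levi le_in Pp Kp) (T3_Levi le_in Pp Kp) !mulmxA.
have tw (a b : nat) (X : 'M[R]_(a, n + n)) (Y : 'M[R]_(b, n + n)) (h : 'M[R]_(a, b)) :
  w^T *m (X^T *m h *m Y) *m w = (X *m w)^T *m h *m (Y *m w) by rewrite trmx_mul !mulmxA.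
rewrite {1}pE !mulmxDr !mulmxDl !tw T1w T2w T3w addrAC addrC; congr (_ + _).
have -> : phi (toC g) = block_mx g 0 0 g by rewrite /phi mxRe_toC mxIm_toC oppr0.
rewrite tr_dbl /dbl !mulmx_block !mulmx0 !mul0mx !addr0 !add0r !tr_row_mx !trmx0 !mul_col_mx !mul0mx.
by rewrite !mul_mx_row !mulmx0 add_col_mx addr0 add0r.
Qed.

Let Ev_Levi p x : P p -> K p -> U x ->
  Ev (gk_cpt (w^T *m p *m w) x) = N (gl_part le_in p) *: gk_cpt (sp_part le_in p) (Ev x).
Proof.
move=> Pp Kp Ux; set g := gl_part le_in p; set s := sp_part le_in p.
have Ks : Kinf s := sp_part_Kinf le_in Pp Kp.
have gg : g^T *m g = 1%:M := gl_part_orth le_in Pp Kp.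
have Kg : Kinf (phi (toC g)).
  by apply: Kinf_phi; rewrite adj_toC -toC_tr -toCM gg toC1.
have H := hwG_GL Kg (hwG_Sp Ks (hwEvP Ux)); rewrite (Northo gg); apply: hwEvE.
set k1 := A1^T *m s *m A1 + A2^T *m A2 in H; set k2 := A2^T *m phi (toC g) *m A2 + A1^T *m A1 in H.
have A12 : A1 *m A2^T = 0.
  by rewrite tr_dbl /dbl mulmx_block !mulmx0 !mul0mx !addr0 !add0r j12 block_mx0.
have A21 : A2 *m A1^T = 0 by apply: trmx_inj; rewrite trmx_mul trmxK A12 trmx0.
have kk : k2 *m k1 = w^T *m p *m w.
  rewrite (rot_Levi Pp Kp) /k1 /k2 mulmxDl !mulmxDr !mulmxA.
  rewrite -!(mulmxA _ A1 A1^T) -!(mulmxA _ A2 A2^T) -!(mulmxA _ A1 A2^T) -!(mulmxA _ A2 A1^T).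
  rewrite A12 A21 (dblV j11) (dblV j22) !mulmx1 !mulmx0 !mul0mx addr0 add0r.
  by rewrite addrC.
have Kk1 : K k1.
  have [Z KZ ZE] := Kinf_expm_surj Ks; have [u uu uE] := LieK_skew KZ.
  have -> : k1 = expm (1 *: (A1^T *m Z *m A1)) by rewrite (expm_embed (dblV j11)) scale1r ZE Asum.
  apply: Kinf_expm; rewrite uE phi_dbl; apply: LieK_phi; exact: embed_skew.
have Kk2 : K k2.
  have [Z KZ ZE] := Kinf_expm_surj Kg; have [u uu uE] := LieK_skew KZ.
  have -> : k2 = expm (1 *: (A2^T *m Z *m A2)).
    by rewrite (expm_embed (dblV j22)) scale1r ZE; congr (_ + _); rewrite -Asum opprB addrC subrK.
  apply: Kinf_expm; rewrite uE phi_dbl; apply: LieK_phi; exact: embed_skew.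
by rewrite -kk; have [_ _ [_ _ cM _]] := KF; rewrite (cM _ _ _ Kk2 Kk1 (US Ux)).
Qed.

Lemma hwT_supp x : U x -> Sf (T x).
Proof.
move=> Ux; have Ukx k : K k -> U (gk_cpt (w^T *m k) x) by move=> Kk; apply: Uk => //; exact: KinfM.
have [_ _ [_ _ cM cf]] := KF; split.
- by move=> k Kk; rewrite /T asboolF.
- by move=> k Kk; rewrite TE //; have [_ ] := Gsub (hwEvP (Ukx k Kk)).
- move=> p k Pp Kp Kk; rewrite !TE //; last exact: KinfM.
  have Kp' : K (w^T *m p *m w) by exact: (KinfM (KinfM Kwt Kp) Kw).
  have ww : w *m w^T = 1%:M by have /KinfP [+ _] := Kw; exact: mulmx1C.
  have -> : w^T *m (p *m k) = w^T *m p *m w *m (w^T *m k) by rewrite !mulmxA -(mulmxA _ w) ww mulmx1.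
  rewrite (cM _ _ _ Kp' (KinfM Kwt Kk) (US Ux)); exact: (Ev_Levi Pp Kp (Ukx k Kk)).
- have [M [t [a [Kt ac xE _]]]] := K_orbit_basis (cf x (US Ux)).
  exists M, (fun j => T (gk_cpt (t j) x)), a; split=> // k Kk.
  rewrite -[LHS]/(gk_cpt k (T x) : fn) (T_cpt Kk Ux) xE //.
  by apply: (linear_on_comb _ sU T_linear) => j; exact: Uk.
Qed.

(** [T] commutes with right translation by K, hence with its derivative. *)
Lemma hwT_KdC a x : U x -> KdC (kappa a) (T x) = T (KdC (kappa a) x) :> fn.
Proof.
move=> Ux; have [Kr Ki] := LieC_split (LieC_kappa a).
have UKd Z : Lie K Z -> U (Kd Z x).
  move=> KZ; have [u uu ->] := LieK_skew KZ.
  rewrite -(KdC_toC KF (LieK_phi uu) (US Ux)) (toC_phi_skew uu).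
  exact: (hwU_stable Spsi psiH psiE).
have KdT Z : Lie K Z -> Kd Z (T x) = T (Kd Z x) :> fn.
  move=> KZ; have Ut t : U (gk_cpt (expm (t *: Z)) x) by apply: Uk => //; exact: Kinf_expm.
  have H := vderive_linear sU T_linear Ut (Kd_derive KF KZ (US Ux)).
  apply: (vderive_unique (Kd_derive KI KZ (hwT_supp Ux))).
  apply: (vderive_eq H) => // t; apply/esym; apply: T_cpt => //; exact: Kinf_expm.
rewrite !KdCE (KdT _ Kr) (KdT _ Ki) addrC [in RHS]addrC.
by rewrite T_linear //; exact: UKd.
Qed.

Let symmetric_split (c : 'M[C]_n) : c^T = c ->
  exists B, B + B^T = c /\ S2 *m B *m S1^T = 0.
Proof.
move=> cT; pose P1 := S1^T *m S1; pose P2 := S2^T *m S2.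
have P1T : P1^T = P1 by rewrite /P1 trmx_mul trmxK.
have P2T : P2^T = P2 by rewrite /P2 trmx_mul trmxK.
have Psum : P1 + P2 = 1%:M := Ssum C le_in.
have h1 : S2 *m P1 = 0 by rewrite /P1 mulmxA (S21 C le_in) mul0mx.
have h2 : P2 *m S1^T = 0 by rewrite /P2 -mulmxA (S21 C le_in) mulmx0.
clearbody P1 P2.
have cE : c = P1 *m c *m P1 + P1 *m c *m P2 + (P2 *m c *m P1 + P2 *m c *m P2).
  by rewrite -[LHS]mul1mx -[LHS]mulmx1 -Psum !mulmxDl !mulmxDr.
exists (2^-1 *: (P1 *m c *m P1) + 2^-1 *: (P2 *m c *m P2) + P1 *m c *m P2); split.
  rewrite [RHS]cE !trmxD !trmxZ !trmx_mul P1T P2T cT !mulmxA.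
  move: (P1 *m _ *m P1) (P1 *m _ *m P2) (P2 *m _ *m P1) (P2 *m _ *m P2) => a b d e.
  by apply/matrixP => r q; rewrite !mxE; field.
rewrite !mulmxDr !mulmxDl -!scalemxAr -!scalemxAl !mulmxA h1 !mul0mx -!(mulmxA _ P2 S1^T) h2.
by rewrite !mulmx0 !scaler0 !addr0.
Qed.

(* At the identity, an element of p_- is the sum of an element of Lie P and of
   an element -kappa B of k; both act through the graph. *)
Lemma hwT_pkilled1 x (c : 'M[C]_n) : U x -> c^T = c -> (gk_lie (spx 0 0 c) (T x) : fn) 1%:M = 0.
Proof.
move=> Ux cT; have [B [Bc B0]] := symmetric_split cT.
have bT : (0 : 'M[C]_n)^T = 0 by exact: trmx0.
have sY : spn (spx B 0 c) by exact: spx_Sp.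
have cE : B + c - B^T = B + B by rewrite -Bc addrA addrK.
have pY : parabolic le_in (spx B 0 c).
  apply/(spx_parabolic le_in); split.
    by rewrite add0r cE mulmxDr mulmxDl B0 addr0.
  by rewrite add0r addrAC Bc subrr mul0mx.
have XE : spx 0 0 c = spx B 0 c + kappa (- B) by rewrite /kappa spxD subrr !addr0.
have PY : LieC P (spx B 0 c) by apply/(LieC_P le_in).
rewrite (ind_lie1 VM N1 Nd (hwT_supp Ux) PY (LieC_kappa _) XE) hwT_KdC //.
have K1 := @Kinf1 R n; have Uwx := Uk Kwt Ux.
rewrite !TE // !mulmx1 (KdC_Ad KF Kwt (LieC_kappa _) (US Ux)).
set x' := gk_cpt w^T x in Uwx *; set y := Ev x'.
have Gxy : G ((x', y) : PV) := hwEvP Uwx; have [_ Sy ky] := Gsub Gxy.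
have tauw : tau w^T = W^T by rewrite /krot -phi_adj tau_phi adj_rotW.
have adjW : adj W^T = W by rewrite -adj_rotW adjK.
have -> : toC w^T *m kappa (- B) *m invmx (toC w^T) = kappa (- (W^T *m B *m W)).
  by rewrite (conj_spx _ _ _ Kwt) tauw adjW !mulmx0 !mul0mx mulmxN mulNmx.
(* Of the four rotated blocks, the one raising the degree is absent because S2 B S1^T = 0; the other
   three are those for which the graph is known to be stable. *)
have WB : - (W^T *m B *m W) = J1^T *m (- (S2 *m B *m S2^T)) *m J1 + J2^T *m (- (S1 *m B *m S1^T)) *m J2 +
    J2^T *m (- (S1 *m B *m S2^T)) *m J1.
  have WTE : W^T = J1^T *m S2 + J2^T *m S1 by rewrite /rotW trmxD !trmx_mul !trmxK.
  have z : J1^T *m (S2 *m B *m S1^T) *m J2 = 0 by rewrite B0 mulmx0 mul0mx.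
  rewrite !mulmxN !mulNmx -!opprD; congr (- _); rewrite WTE [in LHS]/rotW.
  by rewrite !mulmxDl !mulmxDr !mulmxA; rewrite !mulmxA in z; rewrite z addr0 addrA addrAC.
rewrite WB kappaD kappaD.
have lin := KdC_linear_l KF (US Uwx).
rewrite (linear_onD lin) ?(linear_onD lin); [|exact: LieC_kappa|exact: LieC_kappa| |exact: LieC_kappa]; last first.
  by rewrite -kappaD; exact: LieC_kappa.
have g1 := Glo (- (S2 *m B *m S2^T)) Gxy.
have g2 := Ghi (- (S1 *m B *m S1^T)) Gxy.
have g3 := Glower (- (S1 *m B *m S2^T)) Uwx.
have add x1 y1 x2 y2 : G ((x1, y1) : PV) -> G ((x2, y2) : PV) -> G ((x1 + x2, y1 + y2) : PV).
  by move=> G1 G2; exact: (subspaceD sG G1 G2).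
have /hwEvE -> := add _ _ _ _ (add _ _ _ _ g1 g2) g3.
(* The Lie P term acts on y by l tr(S1 B S1^T) and kappa(S2 B S2^T); the term from k has just been
   found to be the opposite. *)
rewrite dsCE T1_spx T2_spx.
have trE : \tr (real_complex R 2^-1 *: (S1 *m (B + c + (0 - B^T)) *m S1^T)) = \tr (S1 *m B *m S1^T).
  rewrite add0r cE mulmxDr mulmxDl mxtraceZ mxtraceD fmorphV rmorph_nat.
  by move: (\tr (S1 *m B *m S1^T)) => t; field.
have cS : (S2 *m c *m S2^T)^T = S2 *m c *m S2^T by rewrite !trmx_mul trmxK cT mulmxA.
rewrite trE mulmx0 mul0mx.
have -> : spx (S2 *m B *m S2^T) 0 (S2 *m c *m S2^T) = kappa (S2 *m B *m S2^T) + spx 0 0 (S2 *m c *m S2^T).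
  by rewrite /kappa spxD !addr0 !add0r.
have linV := lie_linear_l VM Sy.
have sc : LieC (@Sp R m) (spx 0 0 (S2 *m c *m S2^T)) by apply: spx_Sp; rewrite ?trmx0.
rewrite (linear_onD linV (kappa_Sp _) sc) (ky _ cS) addr0.
rewrite kappaN (linear_onN (@LieC_Sp_subspace R m) linV (kappa_Sp _)).
have -> : \tr (- (S1 *m B *m S1^T)) = - \tr (S1 *m B *m S1^T) by rewrite raddfN.
rewrite mulrN scaleNr addr0.
move: (_ *: y) (gk_lie (kappa _) y) => u v'.
by rewrite addrA addrK subrr.
Qed.

Lemma hwT_hwv : highest_weight_vector lambda (T psi : gk_amb IV).
Proof.
have Upsi : U psi by exact: Gen_base.
have Sg := hwT_supp Upsi.
have T0 : T 0 = 0 :> fn by exact: (linear_on0 sU T_linear).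
apply: (killed_hwv IM Sg).
(* At w the translation is by w^T w = 1, so the value there is Ev psi = v0. *)
- apply/eqP => /(congr1 (fun h : fn => h w)); rewrite TE //.
  have /KinfP [ww _] := Kw; rewrite ww.
  have [_ _ [_ c1 _ _]] := KF; rewrite (c1 _ Spsi) (hwEvE (hwG_base lambda psi v0)).
  by have [_ /eqP] := hv.
- move=> j; rewrite cartanE (lie_KdC IM (LieC_kappa _) Sg) hwT_KdC // psiH.
  exact: (linear_onZ _ sU T_linear Upsi).
- by move=> r q rq; rewrite (lie_KdC IM (LieC_kappa _) Sg) hwT_KdC // psiE.
(* Translation moves the point k to 1 and replaces [c] by another symmetric matrix; the vanishing at
   1 is known for every vector of [U], hence for the translate of [psi]. *)
- move=> r q; apply: pkilled_pmin => c cT; apply/funext => k.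
  have sc : spn (spx 0 0 c) by apply: spx_Sp; rewrite ?trmx0.
  have [Kk|Kk] := pselect (K k); last by rewrite (ind_lie_out _ _ Kk).
  rewrite (ind_lie_at VM N1 Nd Kk sc Sg) (T_cpt Kk Upsi) (conj_spx _ _ _ Kk) !mulmx0 !mul0mx.
  apply: hwT_pkilled1; first exact: Uk.
  have adjT (A : 'M[C]_n) : (adj A)^T = map_mx conjc A by rewrite /adj map_trmx trmxK.
  by rewrite !trmx_mul cT adjT -(adjT (tau k)) trmxK mulmxA.
Qed.

End Existence.

(** The determinant of an orthogonal matrix is 1 or -1: powers of its absolute value are 1, it
    equals its sign, and it is its own inverse. *)
Lemma sgn_abs_det_orth (R : realType) n i (l : int) (g : 'M[R]_i) : g^T *m g = 1%:M ->
  normalized n (@sgn_abs_det R i l (exponent R n i l)) g = det_power l (phi (toC g)).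
Proof.
move=> gg.
have dC : \det (tau (phi (toC g))) = real_complex R (\det g).
  rewrite tau_phi.
  Transparent toC. rewrite /toC. Opaque toC.
  by rewrite det_map_mx.
have dd : \det g ^+ 2 = 1 by have := congr1 determinant gg; rewrite det_mulmx det_tr det1 expr2.
have d1 : `|\det g| = 1.
  by move/eqP: dd; rewrite sqrf_eq1 => /orP [] /eqP ->; rewrite ?normrN normr1.
have dsg : Num.sg (\det g) = \det g.
  by move/eqP: dd; rewrite sqrf_eq1 => /orP [] /eqP ->; rewrite ?sgrN sgr1.
have dV : (\det g)^-1 = \det g.
  by move/eqP: dd; rewrite sqrf_eq1 => /orP [] /eqP ->; rewrite ?invrN invr1.
have hm : half_modulus n g = 1 by rewrite /half_modulus d1 powR1.
have sg : @sgn_abs_det R i l (exponent R n i l) g = real_complex R (\det g ^ l).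
  by rewrite /sgn_abs_det d1 powR1 dsg mulr1.
rewrite /normalized hm sg mul1r /det_power dC; move: (\det g) dV => d dV.
case: l {sg} => k; first by rewrite -[d ^ Posz k]/(d ^+ k) -rmorphXn.
rewrite -[d ^ Negz k]/((d ^+ k.+1)^-1) -exprVn dV rmorphXn /=.
by rewrite (_ : (d -i* 0)%C = (d +i* 0)%C) //; congr (_ +i* _)%C; rewrite oppr0.
Qed.

Theorem theorem1p1 (R : realType) (n i : nat) (i_gt0 : (0 < i)%N)
    (le_in : (i <= n)%N) (lambda : n.-tuple int) (dom : dominant lambda) :
  ((forall k : nat, (n - i <= k < n)%N -> lambda`_k = lambda`_n.-1) ->
   forall V : gKdata R (n - i),
     is_L V [tuple lambda`_k | k < n - i] ->
     let I := Ind le_in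
                (sgn_abs_det lambda`_n.-1 (exponent R n i lambda`_n.-1)) V in
     (exists f : gk_amb I, highest_weight_vector lambda f) /\
     (forall f : gk_amb I, highest_weight_vector lambda f ->
        is_L (generated f) lambda))
  /\
  (forall (mu : 'M[R]_i -> R[i]) (omega : (n - i).-tuple int)
      (V : gKdata R (n - i)),
     is_GL_character mu -> dominant omega -> is_L V omega ->
     (exists f : gk_amb (Ind le_in mu V), highest_weight_vector lambda f) ->
     [/\ forall k : nat, (n - i <= k < n)%N -> lambda`_k = lambda`_n.-1,
         forall a : 'M[R]_i, a \in unitmx ->
           mu a = sgn_abs_det lambda`_n.-1 (exponent R n i lambda`_n.-1) a
       & omega = [tuple lambda`_k | k < n - i]]).
Proof.
split=> [flat V LV I|mu omega V mu_char _ LV [f hf]]; last exact: (induced_weights i_gt0 mu_char LV hf).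
have [N1 Nd] := sgn_abs_det_derive R n i lambda`_n.-1.
split=> [|f hf]; last exact: (induced_generated LV N1 Nd hf).
have [VM irr [v0 hv]] := LV.
have [psi [Spsi psi0 psiH psiE psiJ2]] := exists_hw_fun R i_gt0 le_in dom flat.
eexists; apply: (hwT_hwv VM irr hv N1 Nd _ Spsi psi0 psiH psiE psiJ2) => g.
exact: sgn_abs_det_orth.
Qed.
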